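(* Let $\alpha\in[0,d)$ and let $f$ be an SGF on $\mathbb{R}^d$ or $\mathbb{Z}^d$ with spectral measure $\mu$. Suppose that (1) $\displaystyle\lim_{\delta\to0}\frac{\log\mu[B(\delta)]}{\log\delta}=\alpha$; (2) $\mu_{a.c.}\neq0$ and $\mu_{s.c.}=0$; (3) for every $\epsilon>0$, $\mathrm{Cap}_f(B(T+T^{1-\epsilon}))\sim\mathrm{Cap}_f(B(T))$ as $T\to\infty$; (4) (doubling) there is $c>0$ such that $\mu[B(2\delta)]\le c\,\mu[B(\delta)]$ for all $\delta>0$; (5) (origin dominance) there is $c>0$ such that $\sup_u\mu[u+B(\delta)]\le c\,\mu[B(\delta)]$ for all $\delta>0$. Let $m=\|\mu_{a.c.}\|$. Then for every $\eta\in\mathcal{T}$, as $T\to\infty$, $$\left|\frac{\langle\tilde f_T,\eta_T\rangle}{\sqrt{2m(d-\alpha)\log T}}-\langle h_T,\eta_T\rangle\right|\to0\quad\text{in probability}.$$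
   Context: An SGF on $\mathbb{R}^d$ or $\mathbb{Z}^d$ is a continuous (in the case of $\mathbb{R}^d$), centred, non-degenerate, stationary Gaussian field $f$. Its covariance kernel is $K(x)=\mathbb{E}[f(0)f(x)]$; its spectral measure $\mu$ is the unique non-negative, finite, symmetric measure with $K=\mathcal{F}[\mu]$, where $\mathcal{F}[\mu](x)=\int e^{-2\pi i\langle\lambda,x\rangle}d\mu(\lambda)$. It lives on $\mathbb{R}^d$ for fields on $\mathbb{R}^d$, and on the torus $\mathbb{R}^d/\mathbb{Z}^d$ for fields on $\mathbb{Z}^d$. Write $\mu=\mu_{a.c.}+\mu_d+\mu_{s.c.}$ for the decomposition into absolutely continuous, discrete, and singular continuous parts, and $\|\cdot\|$ for total mass. $B(r)$ is the closed Euclidean ball of radius $r$ about the origin; for fields on $\mathbb{Z}^d$, a spatial domain $B(T)$ is understood as $B(T)\cap\mathbb{Z}^d$. Capacity and equilibrium potential: for compact $D$, $$\mathrm{Cap}_f(D)=\min\{\|h\|_H^2:h\in H,\ h\ge1\text{ on }D\}=\Big(\min_{\nu\in\mathcal{P}(D)}\int_D\int_DK(x-y)\,d\nu(x)\,d\nu(y)\Big)^{-1}$$ (the two expressions coincide), where $\mathcal{P}(D)$ is the set of Borel probability measures on $D$ and $H=\{\mathcal{F}[g\,d\mu]:g\in L^2_\mu\}$ ($g$ Hermitian), $\|\mathcal{F}[g\,d\mu]\|_H=\|g\|_{L^2_\mu}$. When $\mathrm{Cap}_f(D)<\infty$, the equilibrium potential $h_f(D)$ is the unique minimiser $h$ of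 the first expression; equivalently $h_f(D)=\mathrm{Cap}_f(D)\,(K*\nu_f)$ for any minimiser $\nu_f$ of the second. Write $h_T=h_f(B(T))$, a function on all of $\mathbb{R}^d$ or $\mathbb{Z}^d$. Conditioned field: $\tilde f_T$ is the field $f$ conditioned on the event $\{f(x)\ge0\text{ for all }x\in B(T)\}$. Test functions: $\mathcal{T}$ is the set of signed measures on $\mathbb{R}^d$ of the form $\xi\mathbf{1}_D\,dx$ where $\xi\in C^0(\mathbb{R}^d)$ is Lipschitz, $D$ is a compact domain with piecewise smooth boundary, and $dx$ is Lebesgue measure. For $\eta\in\mathcal{T}$, $\eta_T=T^{-d}\eta(\cdot/T)$ is the rescaled signed measure of identical total mass, i.e. the measure with density $T^{-d}\xi(x/T)\mathbf{1}_D(x/T)$. $\langle g,\eta\rangle=\int g\,d\eta$, the integral against the density being interpreted as a sum over $\mathbb{Z}^d$ if $g$ is defined on $\mathbb{Z}^d$. $a(T)\sim b(T)$ means $a(T)/b(T)\to1$. *)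

(* Defs.v *)
From HB Require Import structures.
From mathcomp Require Import all_boot all_order all_algebra.
From mathcomp Require Import all_classical all_reals all_analysis.
From mathcomp Require Import complex.

Set Implicit Arguments.
Unset Strict Implicit.
Unset Printing Implicit Defensive.

Import Order.TTheory GRing.Theory Num.Theory.
Import numFieldNormedType.Exports.

Local Open Scope classical_set_scope.
Local Open Scope ring_scope.
Local Open Scope complex_scope.

(* The norm `|x| of the library on 'rV[R]_d is the sup norm. *)
Definition enorm (R : realType) (d : nat) (x : 'rV[R]_d) : R :=
  Num.sqrt (\sum_i x 0 i ^+ 2).

Definition edot (R : realType) (d : nat) (x y : 'rV[R]_d) : R :=
  \sum_i x 0 i * y 0 i.

(* The sigma-algebra generated by the coordinate projections, which is the
   Borel sigma-algebra of R^d because R is second countable. *)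
Section measurable_rV.
Context (R : realType) (d : nat).

Let coords (i : 'I_d) (x : 'rV[R]_d) : measurableTypeR R := x 0 i.

Let rV_set0 : g_sigma_preimage coords set0.
Proof. exact: sigma_algebra0. Qed.

Let rV_setC A : g_sigma_preimage coords A -> g_sigma_preimage coords (~` A).
Proof. exact: sigma_algebraC. Qed.

Let rV_bigcup (F : _^nat) : (forall i, g_sigma_preimage coords (F i)) ->
  g_sigma_preimage coords (\bigcup_i (F i)).
Proof. exact: sigma_algebra_bigcup. Qed.

HB.instance Definition _ := @isMeasurable.Build default_measure_display
  'rV[R]_d (g_sigma_preimage coords) rV_set0 rV_setC rV_bigcup.

Lemma measurable_coord (i : 'I_d) :
  measurable_fun setT (fun x : 'rV[R]_d => x 0 i : measurableTypeR R).
Proof.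
move=> _ Y mY; rewrite setTI; apply: sub_sigma_algebra => /=.
rewrite -bigcup_seq/=; exists i => /=; first by rewrite mem_index_enum.
by exists Y => //; rewrite setTI.
Qed.

Lemma measurable_fun_rV d' (T : measurableType d') (f : T -> 'rV[R]_d) :
  (forall i, measurable_fun setT (fun t => f t 0 i : measurableTypeR R)) ->
  measurable_fun setT f.
Proof.
move=> mf _ A mA; rewrite setTI.
suff : preimage_set_system setT f (g_sigma_preimage coords) `<=` measurable.
  by apply; exists A => //; rewrite setTI.
rewrite -g_sigma_preimageE.
apply: smallest_sub; first exact: sigma_algebra_measurable.
move=> _ [B + <-].
rewrite -bigcup_seq/= => -[i _ [C mC <-]].
rewrite !setTI; have := mf i measurableT _ mC.
by rewrite setTI.
Qed.

End measurable_rV.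

(* Lebesgue measure on R^d, by induction on d as a product measure. *)
Section lebesgue_rV.
Context (R : realType).

Definition rV_cons (d : nat) (p : 'rV[R]_d * measurableTypeR R) : 'rV[R]_d.+1 :=
  \row_i oapp (p.1 0) p.2 (unlift ord0 i).

Lemma measurable_rV_cons d : measurable_fun setT (@rV_cons d).
Proof.
apply: measurable_fun_rV => i; rewrite /rV_cons.
under eq_fun do rewrite mxE.
case: (unlift ord0 i) => [j|] /=; last exact: measurable_snd.
by apply: (measurableT_comp (measurable_coord j)); exact: measurable_fst.
Qed.

Section step.
Context (d : nat) (m : {measure set 'rV[R]_d -> \bar R}).

Definition lebesgue_step : set 'rV[R]_d.+1 -> \bar R :=
  pushforward (m \x @lebesgue_measure R)%E (@rV_cons d).

Let step0 : lebesgue_step set0 = 0%E.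
Proof. by rewrite /lebesgue_step /pushforward preimage_set0 measure0. Qed.

Let step_ge0 A : (0 <= lebesgue_step A)%E.
Proof. exact: (measure_ge0 (m \x @lebesgue_measure R)%E). Qed.

Let step_sigma_additive : semi_sigma_additive lebesgue_step.
Proof.
move=> F mF tF mUF; rewrite /lebesgue_step /pushforward preimage_bigcup.
have mpre A : measurable A -> measurable (@rV_cons d @^-1` A).
  by move=> mA; rewrite -[X in measurable X]setTI; exact: measurable_rV_cons.
apply: measure_semi_sigma_additive => [n||].
- exact: mpre.
- apply/trivIsetP => i j _ _ ij; rewrite -preimage_setI.
  by move/trivIsetP : tF => /(_ _ _ _ _ ij) ->//; rewrite preimage_set0.
- by rewrite -preimage_bigcup; exact: mpre.
Qed.

HB.instance Definition _ := isMeasure.Build _ _ _ lebesgue_step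
  step0 step_ge0 step_sigma_additive.

End step.

Fixpoint lebesgue_rV (d : nat) : {measure set 'rV[R]_d -> \bar R} :=
  match d with
  | 0 => dirac (0 : 'rV[R]_0)
  | d'.+1 => lebesgue_step (lebesgue_rV d')
  end.

End lebesgue_rV.

(* Fields on R^d (Euclidean) or on Z^d (Lattice). *)
Inductive setting := Euclidean | Lattice.

Definition site (R : realType) (G : setting) (d : nat) : zmodType :=
  match G with
  | Euclidean => 'rV[R]_d
  | Lattice => 'rV[int]_d
  end.

Definition pos (R : realType) (G : setting) (d : nat) :
    site R G d -> 'rV[R]_d :=
  match G with
  | Euclidean => fun x => x
  | Lattice => fun x : 'rV[int]_d => map_mx intr x
  end.

(* The closed ball B(r) of R^d, intersected with Z^d in the lattice case. *)
Definition site_ball (R : realType) (G : setting) (d : nat) (r : R) :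
    set (site R G d) :=
  [set x | enorm (pos x) <= r].

(* The torus R^d/Z^d is represented by the fundamental domain [-1/2, 1/2)^d:
   [freq_repr Lattice l] is the representative of the class of l.
   For Euclidean fields, frequencies range over R^d. *)
Definition freq_repr (R : realType) (G : setting) (d : nat) (l : 'rV[R]_d) :
    'rV[R]_d :=
  match G with
  | Euclidean => l
  | Lattice => \row_i (l 0 i - (Num.floor (l 0 i + 2^-1))%:~R)
  end.

(* The closed ball u + B(r) of frequencies: the coordinatewise nearest
   representative minimises the norm over the class of l - u, so for Lattice
   this is the ball for the flat distance of the torus. *)
Definition freq_ball (R : realType) (G : setting) (d : nat) (u : 'rV[R]_d)
    (r : R) : set 'rV[R]_d :=
  [set l | enorm (freq_repr G (l - u)) <= r].

Section sgf.
Context (R : realType) (G : setting) (d : nat).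
Context (dO : measure_display) (Omega : measurableType dO).
Context (P : probability Omega R).
Implicit Types f : site R G d -> {RV P >-> R}.

(* [normal_prob 0 0] is not the Dirac mass at 0, whence the case distinction. *)
Definition centred_gaussian (X : Omega -> R) : Prop :=
  exists2 s : R, 0 <= s & forall A : set (measurableTypeR R), measurable A ->
    P (X @^-1` A) = if s == 0 then \d_(0 : measurableTypeR R) A
                    else normal_prob 0 s A.

Definition covariance_kernel f (x : site R G d) : R :=
  fine 'E_P[fun w => f 0 w * f x w].

Definition continuous_field : (site R G d -> R) -> Prop :=
  match G return (site R G d -> R) -> Prop with
  | Euclidean => fun g : 'rV[R]_d -> R => continuous g
  | Lattice => fun=> True
  end.

Record is_sgf f : Prop := {
  sgf_gaussian : forall n (x : 'I_n -> site R G d) (c : 'I_n -> R),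
    centred_gaussian (fun w => \sum_(i < n) c i * f (x i) w);
  sgf_stationary : forall n (x : 'I_n -> site R G d) (y : site R G d)
      (A : 'I_n -> set (measurableTypeR R)), (forall i, measurable (A i)) ->
    P [set w | forall i, A i (f (x i + y) w)] =
    P [set w | forall i, A i (f (x i) w)];
  sgf_continuous : forall w, continuous_field (fun x => f x w);
  sgf_nondegenerate : 0 < covariance_kernel f 0 }.

End sgf.

Definition cis (R : realType) (t : R) : R[i] := cos t +i* sin t.

Definition cintegral (d : measure_display) (T : measurableType d)
    (R : realType) (mu : {measure set T -> \bar R}) (F : T -> R[i]) : R[i] :=
  (\int[mu]_x complex.Re (F x)) +i* (\int[mu]_x complex.Im (F x)).

Section spectral.
Context (R : realType) (G : setting) (d : nat).
Implicit Types (mu : {finite_measure set 'rV[R]_d -> \bar R}).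

(* F[g dmu], as a function on R^d or Z^d. *)
Definition fourier mu (g : 'rV[R]_d -> R[i]) (x : site R G d) : R[i] :=
  cintegral mu (fun l => cis (- (2 * pi * edot l (pos x))) * g l).

Record is_spectral_measure (dO : measure_display) (Omega : measurableType dO)
    (P : probability Omega R) (f : site R G d -> {RV P >-> R}) mu : Prop := {
  spectral_support : mu (~` [set l | freq_repr G l = l]) = 0%E;
  spectral_symmetric : forall A, measurable A ->
    mu [set l | A (freq_repr G (- l))] = mu A;
  spectral_fourier : forall x,
    (covariance_kernel f x)%:C = fourier mu (fun=> 1) x }.

Definition spectral_norm2 mu (g : 'rV[R]_d -> R[i]) : \bar R :=
  (\int[mu]_l (complex.Re (g l) ^+ 2 + complex.Im (g l) ^+ 2)%:E)%E.

Definition hermitian_L2 mu : set ('rV[R]_d -> R[i]) :=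
  [set g | [/\ measurable_fun setT
                 (fun l => complex.Re (g l) : measurableTypeR R),
               measurable_fun setT
                 (fun l => complex.Im (g l) : measurableTypeR R),
               (spectral_norm2 mu g < +oo)%E &
               {ae mu, forall l, g (freq_repr G (- l)) = (g l)^*}]].

Definition spectral_rep mu (h : site R G d -> R) : set ('rV[R]_d -> R[i]) :=
  [set g | hermitian_L2 mu g /\ forall x, (h x)%:C = fourier mu g x].

Definition cm_space mu : set (site R G d -> R) :=
  [set h | spectral_rep mu h !=set0].

(* By injectivity of the Fourier transform on finite measures, the infimum is
   over at most one class in L^2(mu). *)
Definition cm_norm2 mu (h : site R G d -> R) : \bar R :=
  ereal_inf (spectral_norm2 mu @` spectral_rep mu h).

Definition admissible mu (D : set (site R G d)) : set (site R G d -> R) :=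
  [set h | cm_space mu h /\ forall x, D x -> 1 <= h x].

Definition capacity mu (D : set (site R G d)) : \bar R :=
  ereal_inf (cm_norm2 mu @` admissible mu D).

(* The value when no minimiser exists is irrelevant: there is exactly one when
   the capacity is finite. *)
Definition equilibrium_potential mu (D : set (site R G d)) : site R G d -> R :=
  xget (fun=> 0) [set h | admissible mu D h /\ cm_norm2 mu h = capacity mu D].

End spectral.

Record is_lebesgue_decomposition (R : realType) (d : nat)
    (mu mu_ac mu_d mu_sc : {finite_measure set 'rV[R]_d -> \bar R}) : Prop := {
  decomposition_sum : forall A, measurable A ->
    mu A = (mu_ac A + mu_d A + mu_sc A)%E;
  decomposition_ac : mu_ac `<< lebesgue_rV R d;
  decomposition_discrete : exists2 C, countable C & mu_d (~` C) = 0%E;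
  decomposition_sc_atomless : forall x, mu_sc [set x] = 0%E;
  decomposition_sc_singular :
    exists N, [/\ measurable N, lebesgue_rV R d N = 0%E & mu_sc (~` N) = 0%E] }.

Section test_functions.
Context (R : realType).

Definition boundary (d : nat) (D : set 'rV[R]_d) : set 'rV[R]_d :=
  closure D `\` interior D.

(* Image of the unit cube of dimension d - 1 under a C^1 map which is injective
   with injective differential on the open cube.  The map is defined on all of
   R^(d-1): a C^1 map near the cube extends. *)
Definition smooth_patch (d : nat) (S : set 'rV[R]_d) : Prop :=
  exists phi : 'rV[R]_d.-1 -> 'rV[R]_d,
    [/\ forall t, differentiable phi t,
        continuous (jacobian phi),
        set_inj [set t : 'rV[R]_d.-1 | forall i, t 0 i \in `]0, 1[] phi,
        (forall t : 'rV[R]_d.-1, (forall i, t 0 i \in `]0, 1[) -> row_free (jacobian phi t)) &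
        S = phi @` [set t : 'rV[R]_d.-1 | forall i, t 0 i \in `[0, 1]]].

Definition piecewise_smooth_domain (d : nat) (D : set 'rV[R]_d) : Prop :=
  [/\ compact D, D = closure (interior D) &
      exists n (S : 'I_n -> set 'rV[R]_d),
        (forall i, smooth_patch (S i)) /\ boundary D = \bigcup_i S i].

(* [is_test xi D] states that xi 1_D dx is a test measure. *)
Definition is_test (d : nat) (xi : 'rV[R]_d -> R) (D : set 'rV[R]_d) : Prop :=
  [/\ continuous xi,
      exists L : R, forall x y, `|xi x - xi y| <= L * enorm (x - y) &
      piecewise_smooth_domain D].

(* The density of eta_T for eta = xi 1_D dx. *)
Definition rescaled_density (d : nat) (xi : 'rV[R]_d -> R) (D : set 'rV[R]_d)
    (T : R) (x : 'rV[R]_d) : R :=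
  T ^- d * xi (T^-1 *: x) * \1_D (T^-1 *: x).

(* The integral of g against the measure with density rho; the sum over Z^d has
   finite support when rho has bounded support. *)
Definition pairing (G : setting) (d : nat) :
    (site R G d -> R) -> ('rV[R]_d -> R) -> R :=
  match G return (site R G d -> R) -> ('rV[R]_d -> R) -> R with
  | Euclidean => fun (g : 'rV[R]_d -> R) rho =>
      \int[lebesgue_rV R d]_x (g x * rho x)
  | Lattice => fun (g : 'rV[int]_d -> R) rho =>
      \sum_(x \in [set: 'rV[int]_d]) g x * rho (map_mx intr x)
  end.

End test_functions.

Section conditioning.
Context (R : realType) (dO : measure_display) (Omega : measurableType dO).
Context (P : probability Omega R).

Definition cond_prob (A E : set Omega) : R := fine (P (E `&` A)) / fine (P A).

(* X_T, under P conditioned on A_T, tends to 0 in probability as T -> oo. *)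
Definition cond_cvg0_in_prob (A : R -> set Omega) (X : R -> Omega -> R) : Prop :=
  forall e : R, 0 < e ->
    cond_prob (A T) [set w | e < `|X T w|] @[T --> +oo] --> (0 : R).

Definition persistence (G : setting) (d : nat) (f : site R G d -> {RV P >-> R})
    (T : R) : set Omega :=
  [set w | forall x, site_ball T x -> 0 <= f x w].

End conditioning.

(* Main.v *)
(* Let l^2 = 2m(d - alpha) log T and let k = 1 / Cap(B(T)).  On a grid inside
   B(T) at most T^(d - alpha) essentially independent constraints cost nothing
   beyond level -l.  Lower bound for persistence: tilt f along the potential
   h_T; by Sidak's inequality and Fernique's bound f >= -(1 + e) l on B(T)
   costs exp(-T^(alpha - c)) only, whereas the tilt costs exp(-l^2 / 2k).
   Upper bound: on the persistence event local averages of f are at least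
   (1 - e) l, since an absolutely continuous part of the spectrum lets one
   compare f on a sparse grid with an i.i.d. Gaussian sample; hence f
   integrated against a near minimiser of the energy exceeds (1 - 2e) l.  Any
   linear functional of f deviating from l h_T as well costs a further factor
   exp(-c l^2 / k).  The functionals needed approximate <f, eta_T> by Riemann
   sums, whose variance is O(k) by a Dirichlet-kernel sieve. *)
Require Import Defs.
From HB Require Import structures.
From mathcomp Require Import all_boot all_order all_algebra.
From mathcomp Require Import all_classical all_reals all_analysis.
From mathcomp Require Import measurable_realfun lebesgue_integral_under complex ring lra zify.

Set Implicit Arguments.
Unset Strict Implicit.
Unset Printing Implicit Defensive.

Import Order.TTheory GRing.Theory Num.Theory.
Import numFieldNormedType.Exports.

Local Open Scope classical_set_scope.
Local Open Scope ring_scope.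

Local Notation mble := (measurable_fun setT).
Local Notation fin_measure R d := {finite_measure set 'rV[R]_d -> \bar R}.

(** Every functional of f is kept a finite linear combination: 1/Cap is replaced by the infimum of
    the energy over finitely supported probability measures, Gaussian laws are compared on finite
    systems of linear inequalities, and <f, eta_T> enters as the limit of its Riemann sums. By local
    dimension, doubling and origin dominance, l^2/k = T^(alpha + o(1)); so events of probability
    exp(-T^(alpha + c)) are negligible and costs exp(-T^(alpha - c)) are free. The level l involves
    m alone because all but a small mass of the discrete part sits on finitely many atoms, that is,
    on finitely many Gaussian coefficients, whose control costs a constant factor. On a sparse grid
    an independent component appears after adding a small independent field: exponentials are
    orthogonal only for a step function approximating the spectral density, and the added field pays
    for the difference. Averaging a measure over such a grid, of diameter T^(1 - e'), enlarges its
    support; hence near minimisers are taken on a slightly smaller ball, and the regularity of the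
    capacity says that k hardly changes. *)

Lemma indicb {T : Type} {R : realType} (p : T -> bool) z :
 \1_[set w | p w] z = (p z)%:R :> R.
Proof.
rewrite indicE; congr (_%:R).
by case: (boolP (p z)) => h; [rewrite mem_set|rewrite memNset//; exact/negP].
Qed.

(** * Bounded measurable functions and their integrals *)

Section bounded_functions.
Context {d : measure_display} {T : measurableType d} {R : realType}.
Implicit Types F G : T -> R.

Definition bmf F := mble F /\ exists M, forall w, `|F w| <= M.

Lemma bmf_mble F : bmf F -> mble F.
Proof. by case. Qed.

Lemma bmf_ge0 F : bmf F -> exists2 M, 0 <= M & forall w, `|F w| <= M.
Proof.
case=> _ [M hM]; exists (Num.max M 0); first by rewrite le_max lexx orbT.
by move=> w; rewrite le_max hM.
Qed.

Lemma bmf_cst c : bmf (fun=> c).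
Proof. by split => //; exists `|c|. Qed.

Lemma bmfD F G : bmf F -> bmf G -> bmf (fun w => F w + G w).
Proof.
move=> [mF [M hM]] [mG [N hN]]; split; first exact: measurable_funD.
by exists (M + N) => w; rewrite (le_trans (ler_normD _ _))// lerD.
Qed.

Lemma bmfM F G : bmf F -> bmf G -> bmf (fun w => F w * G w).
Proof.
move=> bF bG; split; first by apply: measurable_funM; [case: bF|case: bG].
have [M M0 hM] := bmf_ge0 bF; have [N N0 hN] := bmf_ge0 bG.
by exists (M * N) => w; rewrite normrM ler_pM.
Qed.

Lemma bmfZ c F : bmf F -> bmf (fun w => c * F w).
Proof. by move=> bF; apply: bmfM => //; exact: bmf_cst. Qed.

Lemma bmfN F : bmf F -> bmf (fun w => - F w).
Proof.
move=> [mF [M hM]]; split; first exact: measurableT_comp.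
by exists M => w; rewrite normrN.
Qed.

Lemma bmfB F G : bmf F -> bmf G -> bmf (fun w => F w - G w).
Proof. by move=> bF bG; apply: bmfD => //; exact: bmfN. Qed.

Lemma bmf_sum (I : Type) (s : seq I) (F : I -> T -> R) :
 (forall i, bmf (F i)) -> bmf (fun w => \sum_(i <- s) F i w).
Proof.
move=> bF; elim: s => [|i s IH].
 by under eq_fun do rewrite big_nil; exact: bmf_cst.
by under eq_fun do rewrite big_cons; exact: bmfD.
Qed.

Lemma bmf_indic (A : set T) : measurable A -> bmf (\1_A).
Proof.
move=> mA; split; first exact: measurable_indic.
by exists 1 => w; rewrite indicE; case: (_ \in _); rewrite ?normr1 ?normr0.
Qed.

Lemma bmf_cos F : mble F -> bmf (fun w => cos (F w)).
Proof.
move=> mF; split; last by exists 1 => w; exact: cos_max.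
by apply: measurableT_comp => //; apply: continuous_measurable_fun; exact: continuous_cos.
Qed.

Lemma bmf_sin F : mble F -> bmf (fun w => sin (F w)).
Proof.
move=> mF; split; last by exists 1 => w; exact: sin_max.
by apply: measurableT_comp => //; apply: continuous_measurable_fun; exact: continuous_sin.
Qed.

Lemma eq_bmf F G : bmf F -> F =1 G -> bmf G.
Proof. by move=> h /funext <-. Qed.

Variable mu : {finite_measure set T -> \bar R}.

Lemma bmf_integrable F : bmf F -> mu.-integrable setT (EFin \o F).
Proof.
move=> [mF [M hM]]; apply: measurable_bounded_integrable => //.
- by rewrite -ge0_fin_numE //; exact: fin_num_measure.
- exists M; split => //; first exact: num_real.
 by move=> x Mx y _; rewrite /= (le_trans (hM y))// ltW.
Qed.

Lemma RintD F G : bmf F -> bmf G ->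
 \int[mu]_w (F w + G w) = \int[mu]_w F w + \int[mu]_w G w.
Proof. by move=> bF bG; apply: RintegralD => //; exact: bmf_integrable. Qed.
Lemma RintB F G : bmf F -> bmf G ->
 \int[mu]_w (F w - G w) = \int[mu]_w F w - \int[mu]_w G w.
Proof. by move=> bF bG; apply: RintegralB => //; exact: bmf_integrable. Qed.
Lemma RintZ c F : bmf F -> \int[mu]_w (c * F w) = c * \int[mu]_w F w.
Proof. by move=> bF; apply: RintegralZl => //; exact: bmf_integrable. Qed.

Lemma Rint_sum (I : Type) (s : seq I) (F : I -> T -> R) :
 (forall i, bmf (F i)) ->
 \int[mu]_w (\sum_(i <- s) F i w) = \sum_(i <- s) \int[mu]_w F i w.
Proof.
move=> bF; elim: s => [|i s IH].
 under eq_Rintegral do rewrite big_nil.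
 by rewrite Rintegral_cst// mul0r big_nil.
under eq_Rintegral do rewrite big_cons.
by rewrite RintD ?IH ?big_cons//; exact: bmf_sum.
Qed.

Lemma le_Rint F G : bmf F -> bmf G -> (forall w, F w <= G w) ->
 \int[mu]_w F w <= \int[mu]_w G w.
Proof. by move=> bF bG h; apply: le_Rintegral => //; exact: bmf_integrable. Qed.
Lemma Rint_indic (A : set T) : measurable A ->
 \int[mu]_w (\1_A w) = fine (mu A).
Proof. by move=> mA; rewrite /Rintegral integral_indic// setIT. Qed.

Lemma EFin_Rint F : bmf F ->
 (\int[mu]_w F w)%:E = (\int[mu]_w (F w)%:E)%E.
Proof.
move=> bF; rewrite /Rintegral fineK//; apply: integrable_fin_num => //.
exact: bmf_integrable.
Qed.

Lemma Rint_bounded_cvg (F : nat -> T -> R) (G : T -> R) (M : R) :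
 (forall n, mble (F n)) ->
 (forall n w, `|F n w| <= M) ->
 (forall w, F n w @[n --> \oo] --> G w) ->
 \int[mu]_w F n w @[n --> \oo] --> \int[mu]_w G w.
Proof.
move=> mF hM cF.
have mG : mble G by apply: (measurable_fun_cvg mF) => w _; exact: cF.
have GM w : `|G w| <= M.
 by apply: (ler_cvg_to (cvg_norm (cF w)) (@cvg_cst _ M _ \oo _)); exact: nearW.
have bG : bmf G by split => //; exists M.
rewrite /Rintegral; apply: fine_cvg; rewrite -EFin_Rint//.
rewrite EFin_Rint//.
apply: (@dominated_cvg _ _ _ mu setT _ (fun n w => (F n w)%:E) _ (fun=> M%:E)) => //.
- by move=> n; apply/measurable_EFinP; exact: mF.
- by move=> w _; apply: cvg_EFin; [exact: nearW|exact: cF].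
- exact/bmf_integrable/bmf_cst.
- by move=> n w _ /=; rewrite lee_fin.
Qed.

End bounded_functions.

(** * Finite linear combinations of a family of functions *)

Section linear_combinations.
Context {R : realType} {T A : Type}.
Implicit Types (X : A -> T -> R) (s : seq (R * A)).

(** A combination is a list of pairs (coefficient, index), possibly with repeated indices, so that
    concatenation is addition and [scal] is scalar multiplication. *)
Definition lin X s (w : T) : R := \sum_(p <- s) p.1 * X p.2 w.

Definition scal (c : R) s := [seq (c * p.1, p.2) | p <- s].

Lemma lin_cat X s s' w : lin X (s ++ s') w = lin X s w + lin X s' w.
Proof. by rewrite /lin big_cat. Qed.

Lemma lin_scal X c s w : lin X (scal c s) w = c * lin X s w.
Proof.
rewrite /lin /scal big_map mulr_sumr; apply: eq_bigr => p _.
by rewrite /= mulrA.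
Qed.

Lemma lin1 X c a w : lin X [:: (c, a)] w = c * X a w.
Proof. by rewrite /lin big_seq1. Qed.
Lemma lin_nil X w : lin X [::] w = 0.
Proof. by rewrite /lin big_nil. Qed.

End linear_combinations.

Lemma measurable_lin {R : realType} {d} {T : measurableType d} {A : Type}
  (X : A -> T -> R) s :
 (forall a, mble (X a)) -> mble (lin X s).
Proof.
move=> mX; rewrite /lin; apply: measurable_sum => p.
exact: measurable_funM.
Qed.

(** Recovers an unbounded linear form as a limit of bounded trigonometric functions of it;
    [same_step] relies on this. *)
Lemma cvg_sinc {R : realType} (x : R) :
 n.+1%:R * sin (n.+1%:R^-1 * x) @[n --> \oo] --> x.
Proof.
have [->|x0] := eqVneq x 0.
 by under eq_fun do rewrite mulr0 sin0 mulr0; exact: cvg_cst.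
have hd : (fun h : R => h^-1 * sin h) @ 0^' --> (1 : R).
 have := @is_derive_sin R 0; rewrite cos0 => -[dv vd].
 move: dv; rewrite /derivable => /cvg_ex[l hl].
 have := vd; rewrite /derive => {}vd.
 have l1 : l = 1 by rewrite -vd; apply/esym/cvg_lim.
 rewrite -l1; apply: cvg_trans hl.
 apply: near_eq_cvg; near=> h.
 by rewrite /= /shift sin0 subr0 addr0 [h *: 1]mulr1.
have hu : (fun n : nat => n.+1%:R^-1 * x) @ \oo --> (0:R)^'.
 have hu0 : (fun n : nat => n.+1%:R^-1 * x) @ \oo --> (0 * x : R).
  by apply: cvgMl; exact: cvg_harmonic.
 move=> B hB; rewrite mul0r in hu0.
 have h3 : \forall n \near \oo, n.+1%:R^-1 * x != 0 -> B (n.+1%:R^-1 * x) := hu0 _ hB.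
 apply: filterS h3 => n; apply.
 by rewrite mulf_neq0// invr_eq0 pnatr_eq0.
have := cvg_comp _ _ hu hd => /(@cvgMl _ _ _ _ _ _ x).
rewrite mul1r; apply: cvg_trans; apply: near_eq_cvg; apply: nearW => n /=.
rewrite invfM invrK mulrAC -!mulrA; congr (_ * _).
by rewrite mulKf.
Unshelve. all: by end_near. Qed.

Section abs_approx.
Context {R : realType}.

(* Polynomials in x that increase to |x| on [-1, 1]. *)
Fixpoint abs_poly (n : nat) (x : R) : R :=
 if n is n'.+1 then abs_poly n' x + 2^-1 * (x * x - abs_poly n' x * abs_poly n' x)
 else 0.

Lemma abs_poly_bounds n x : `|x| <= 1 -> 0 <= abs_poly n x <= `|x|.
Proof.
move=> x1; elim: n => [|n /andP[h0 h1]] /=; first by rewrite lexx /=.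
have -> : x * x = `|x| * `|x| by rewrite -!expr2 real_normK// num_real.
by have x0 := normr_ge0 x; apply/andP; split; nra.
Qed.

(** Since x^2 - p^2 = (|x| - p)(|x| + p), one iteration multiplies the error |x| - p by 1 - (|x| +
    p)/2, which is at most 1 - |x|/2. *)
Lemma abs_poly_err n x : `|x| <= 1 ->
 `|x| - abs_poly n x <= `|x| * (1 - `|x| / 2) ^+ n.
Proof.
move=> x1; elim: n => [|n IH] /=; first by rewrite subr0 expr0 mulr1.
have /andP[h0 h1] := abs_poly_bounds n x1.
have x0 := normr_ge0 x.
have -> : x * x = `|x| * `|x| by rewrite -!expr2 real_normK// num_real.
rewrite exprSr mulrA.
apply: (@le_trans _ _ ((`|x| - abs_poly n x) * (1 - `|x| / 2))); first by nra.
by apply: ler_wpM2r => //; lra.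
Qed.

Lemma cvg_abs_poly x : `|x| <= 1 -> abs_poly n x @[n --> \oo] --> `|x|.
Proof.
move=> x1; have [->|x0] := eqVneq x 0.
 rewrite normr0 (_ : abs_poly^~ 0 = fun=> 0); first exact: cvg_cst.
 apply/funext => n; have := abs_poly_bounds n (_ : `|(0:R)| <= 1).
 by rewrite normr0 ler01 => /(_ isT); lra.
have xp : 0 < `|x| by rewrite normr_gt0.
apply: (@squeeze_cvgr _ _ _ _ (fun n => `|x| - `|x| * (1 - `|x| / 2) ^+ n) (fun=> `|x|)).
- apply: nearW => n; have := abs_poly_err n x1; have /andP[_ ->] := abs_poly_bounds n x1.
 by rewrite andbT; lra.
- have h : (1 - `|x| / 2) ^+ n @[n --> \oo] --> (0 : R).
  by apply: cvg_expr; rewrite ger0_norm; lra.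
 have h2 : `|x| - `|x| * (1 - `|x| / 2) ^+ n @[n --> \oo] --> `|x| - `|x| * 0.
  by apply: cvgB; [exact: cvg_cst|apply: cvgMr].
 by rewrite mulr0 subr0 in h2.
- exact: cvg_cst.
Qed.

End abs_approx.

(** * Equality of laws from characteristic functions *)

Section law.
Context {R : realType} {A : Type}.
Context {d} {T : measurableType d} (P : probability T R).
Context {d'} {T' : measurableType d'} (P' : probability T' R).
Variables (X : A -> T -> R) (X' : A -> T' -> R).
Hypothesis mX : forall a, mble (X a).
Hypothesis mX' : forall a, mble (X' a).
Hypothesis hcos : forall s,
 \int[P]_w cos (lin X s w) = \int[P']_w cos (lin X' s w).
Hypothesis hsin : forall s,
 \int[P]_w sin (lin X s w) = \int[P']_w sin (lin X' s w).

(* Pairs (F, F') of the same bounded function of the two families. *)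
Inductive same_fun : (T -> R) -> (T' -> R) -> Prop :=
| same_cos s : same_fun (fun w => cos (lin X s w)) (fun w => cos (lin X' s w))
| same_sin s : same_fun (fun w => sin (lin X s w)) (fun w => sin (lin X' s w))
| sameD F F' G G' : same_fun F F' -> same_fun G G' ->
  same_fun (fun w => F w + G w) (fun w => F' w + G' w)
| sameZ c F F' : same_fun F F' ->
  same_fun (fun w => c * F w) (fun w => c * F' w)
| same_lim (F : nat -> T -> R) (F' : nat -> T' -> R) G G' M :
  (forall n, same_fun (F n) (F' n)) ->
  (forall n w, `|F n w| <= M) -> (forall n w, `|F' n w| <= M) ->
  (forall w, F n w @[n --> \oo] --> G w) ->
  (forall w, F' n w @[n --> \oo] --> G' w) -> same_fun G G'.

Lemma same_bmf F F' : same_fun F F' -> bmf F /\ bmf F'.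
Proof.
elim=> [s|s|{}F {}F' G G' _ [? ?] _ [? ?]|c {}F {}F' _ [? ?]|].
- by split; apply: bmf_cos; exact: measurable_lin.
- by split; apply: bmf_sin; exact: measurable_lin.
- by split; exact: bmfD.
- by split; exact: bmfZ.
- move=> {}F {}F' G G' M _ IH hM hM' cF cF'; split; split.
 + apply: (@measurable_fun_cvg _ _ _ _ F) => [n|w _]; last exact: cF.
  by case: (IH n) => -[].
 + exists M => w.
  by apply: (ler_cvg_to (cvg_norm (cF w)) (@cvg_cst _ M _ \oo _)); exact: nearW.
 + apply: (@measurable_fun_cvg _ _ _ _ F') => [n|w _]; last exact: cF'.
  by case: (IH n) => _ [].
 + exists M => w.
  by apply: (ler_cvg_to (cvg_norm (cF' w)) (@cvg_cst _ M _ \oo _)); exact: nearW.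
Qed.

Lemma same_Rint F F' : same_fun F F' -> \int[P]_w F w = \int[P']_w F' w.
Proof.
elim=> [s|s|{}F {}F' G G' sF IF sG IG|c {}F {}F' sF IF|].
- exact: hcos.
- exact: hsin.
- have [? ?] := same_bmf sF; have [? ?] := same_bmf sG.
 by rewrite !RintD// IF IG.
- by have [? ?] := same_bmf sF; rewrite !RintZ// IF.
- move=> {}F {}F' G G' M sF IH hM hM' cF cF'.
 have h1 : \int[P]_w F n w @[n --> \oo] --> \int[P]_w G w.
  by apply: Rint_bounded_cvg => // n; case: (same_bmf (sF n)) => -[].
 have h2 : \int[P']_w F' n w @[n --> \oo] --> \int[P']_w G' w.
  by apply: Rint_bounded_cvg => // n; case: (same_bmf (sF n)) => _ [].
 have : \int[P]_w F n w @[n --> \oo] --> \int[P']_w G' w.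
  by move: h2; apply: cvg_trans; apply: near_eq_cvg; apply: nearW => n; rewrite IH.
 by move=> h3; have := cvg_unique _ h1 h3; apply; exact: Rhausdorff.
Qed.

Lemma eq_same F F' G G' : same_fun F F' -> F =1 G -> F' =1 G' -> same_fun G G'.
Proof. by move=> h /funext <- /funext <-. Qed.

Lemma same_cst c : same_fun (fun=> c) (fun=> c).
Proof.
apply: (eq_same (sameZ c (same_cos [::]))) => w;
by rewrite lin_nil cos0 mulr1.
Qed.

(** Product-to-sum formulas: the frequencies of a product are the sum [s ++ t] and the difference
    [s ++ scal (-1) t]. This makes the class an algebra, hence closed under the polynomials that
    approximate the absolute value. *)
Lemma same_trigM s F F' : same_fun F F' ->
 same_fun (fun w => cos (lin X s w) * F w) (fun w => cos (lin X' s w) * F' w) /\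
 same_fun (fun w => sin (lin X s w) * F w) (fun w => sin (lin X' s w) * F' w).
Proof.
have e1 (x y : R) : cos x * cos y = 2^-1 * (cos (x + y) + cos (x + -1 * y)).
 by rewrite !mulN1r cosB cosD; field.
have e2 (x y : R) : cos x * sin y = 2^-1 * (sin (x + y) + -1 * sin (x + -1 * y)).
 by rewrite !mulN1r sinB sinD; field.
have e3 (x y : R) : sin x * cos y = 2^-1 * (sin (x + y) + sin (x + -1 * y)).
 by rewrite !mulN1r sinB sinD; field.
have e4 (x y : R) : sin x * sin y = 2^-1 * (cos (x + -1 * y) + -1 * cos (x + y)).
 by rewrite !mulN1r cosB cosD; field.
elim=> [t|t|{}F {}F' G G' _ [IF JF] _ [IG JG]|c {}F {}F' _ [IF JF]|].
- split.
  apply: (eq_same (sameZ 2^-1 (sameD (same_cos (s ++ t)) (same_cos (s ++ scal (-1) t))))) => w;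
  by rewrite e1 !lin_cat lin_scal.
 apply: (eq_same (sameZ 2^-1 (sameD (same_sin (s ++ t)) (same_sin (s ++ scal (-1) t))))) => w;
 by rewrite e3 !lin_cat lin_scal.
- split.
  apply: (eq_same (sameZ 2^-1 (sameD (same_sin (s ++ t)) (sameZ (-1) (same_sin (s ++ scal (-1) t)))))) => w;
  by rewrite e2 !lin_cat lin_scal.
 apply: (eq_same (sameZ 2^-1 (sameD (same_cos (s ++ scal (-1) t)) (sameZ (-1) (same_cos (s ++ t)))))) => w;
 by rewrite e4 !lin_cat lin_scal.
- by split; [apply: (eq_same (sameD IF IG))|apply: (eq_same (sameD JF JG))] => w; rewrite mulrDr.
- by split; [apply: (eq_same (sameZ c IF))|apply: (eq_same (sameZ c JF))] => w; rewrite mulrCA.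
- move=> {}F {}F' G G' M _ IH hM hM' cF cF'.
 have hb (x y : R) : `|x| <= 1 -> `|y| <= M -> `|x * y| <= M.
  by move=> x1 yM; rewrite normrM -[leRHS]mul1r ler_pM.
 split.
 + apply: (same_lim (fun n => (IH n).1)).
  * by move=> n w; apply: hb => //; exact: cos_max.
  * by move=> n w; apply: hb => //; exact: cos_max.
  * by move=> w; apply: cvgMr; exact: cF.
  * by move=> w; apply: cvgMr; exact: cF'.
 + apply: (same_lim (fun n => (IH n).2)).
  * by move=> n w; apply: hb => //; exact: sin_max.
  * by move=> n w; apply: hb => //; exact: sin_max.
  * by move=> w; apply: cvgMr; exact: cF.
  * by move=> w; apply: cvgMr; exact: cF'.
Qed.

Lemma sameM F F' G G' : same_fun F F' -> same_fun G G' ->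
 same_fun (fun w => F w * G w) (fun w => F' w * G' w).
Proof.
move=> + sG; elim=> [s|s|{}F {}F' H H' _ IF _ IG|c {}F {}F' _ IF|].
- by case: (same_trigM s sG).
- by case: (same_trigM s sG).
- by apply: (eq_same (sameD IF IG)) => w; rewrite mulrDl.
- by apply: (eq_same (sameZ c IF)) => w; rewrite mulrA.
- move=> {}F {}F' H H' M _ IH hM hM' cF cF'.
 have [bG bG'] := same_bmf sG.
 have [N N0 hN] := bmf_ge0 bG; have [N' N'0 hN'] := bmf_ge0 bG'.
 have hm : N <= Num.max N N' by rewrite le_max lexx.
 have hm' : N' <= Num.max N N' by rewrite le_max lexx orbT.
 apply: (@same_lim _ _ _ _ (M * Num.max N N') IH).
 + by move=> n w; rewrite normrM ler_pM// (le_trans (hN w)).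
 + by move=> n w; rewrite normrM ler_pM// (le_trans (hN' w)).
 + by move=> w; apply: cvgMl; exact: cF.
 + by move=> w; apply: cvgMl; exact: cF'.
Qed.

Lemma same_abs F F' : same_fun F F' ->
 same_fun (fun w => `|F w|) (fun w => `|F' w|).
Proof.
move=> sF; have [bF bF'] := same_bmf sF.
have [N N0 hN] := bmf_ge0 bF; have [N' N'0 hN'] := bmf_ge0 bF'.
(* A common bound brings both functions into [-1, 1], where [abs_poly] converges; the 1 keeps it
   positive. *)
pose M := N + N' + 1.
have M0 : 0 < M by rewrite /M; lra.
have hx x : `|x| <= M -> `|M^-1 * x| <= 1.
 by move=> xM; rewrite normrM normfV (gtr0_norm M0) ler_pdivrMl// mulr1.
have hF w : `|M^-1 * F w| <= 1 by apply: hx; rewrite (le_trans (hN w))// /M; lra.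
have hF' w : `|M^-1 * F' w| <= 1 by apply: hx; rewrite (le_trans (hN' w))// /M; lra.
have hp n : same_fun (fun w => abs_poly n (M^-1 * F w)) (fun w => abs_poly n (M^-1 * F' w)).
 elim: n => [|n IH] /=; first exact: same_cst.
 apply: sameD => //; apply: sameZ.
 have s1 := sameM (sameZ M^-1 sF) (sameZ M^-1 sF).
 by apply: (eq_same (sameD s1 (sameZ (-1) (sameM IH IH)))) => w; rewrite mulN1r.
have habs : same_fun (fun w => `|M^-1 * F w|) (fun w => `|M^-1 * F' w|).
 apply: (@same_lim _ _ _ _ 1 hp).
 - move=> n w; have /andP[h0 h1] := abs_poly_bounds n (hF w).
  by rewrite ger0_norm// (le_trans h1).
 - move=> n w; have /andP[h0 h1] := abs_poly_bounds n (hF' w).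
  by rewrite ger0_norm// (le_trans h1).
 - by move=> w; exact: cvg_abs_poly.
 - by move=> w; exact: cvg_abs_poly.
by apply: (eq_same (sameZ M habs)) => w;
 rewrite normrM normfV (gtr0_norm M0) mulrA divff ?gt_eqF// mul1r.
Qed.

(** The truncation min(max(x, 0), 1), written with absolute values so that [same_abs] applies. *)
Definition clip (x : R) : R := 2^-1 * (`|x| + 1 + -1 * `|x + -1|).

Lemma clip_ge1 x : 1 <= x -> clip x = 1.
Proof. by move=> x1; rewrite /clip !ger0_norm; lra. Qed.
Lemma clip_le0 x : x <= 0 -> clip x = 0.
Proof. by move=> x0; rewrite /clip !ler0_norm; lra. Qed.

Lemma clip_bound x : `|clip x| <= 1.
Proof.
have [x0|x0] := lerP x 0; first by rewrite clip_le0// normr0.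
have [x1|x1] := lerP 1 x; first by rewrite clip_ge1// normr1.
by rewrite /clip (gtr0_norm x0) (ltr0_norm (_ : x + -1 < 0)) ?ger0_norm; lra.
Qed.

Lemma same_clip F F' : same_fun F F' ->
 same_fun (fun w => clip (F w)) (fun w => clip (F' w)).
Proof.
move=> sF; have h1 := same_abs sF.
have h2 := same_abs (sameD sF (same_cst (-1))).
exact: (sameZ _ (sameD (sameD h1 (same_cst 1)) (sameZ (-1) h2))).
Qed.

(** A double limit: n sin(x/n) tends to x, and then [clip] of 1 + k (x - b) tends to the indicator
    of b <= x as k grows. The truncation supplies the uniform bound that each limit requires. *)
Lemma same_step s b :
 same_fun (fun w => (b <= lin X s w)%R%:R) (fun w => (b <= lin X' s w)%R%:R).
Proof.
have clipc (T0 : Type) (F : nat -> R) l : F @ \oo --> l ->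
  clip (F n) @[n --> \oo] --> clip l.
 move=> cF; apply: cvgMr; apply: cvgD.
  by apply: cvgD; [exact: cvg_norm|exact: cvg_cst].
 apply: cvgMr; apply: cvg_norm; apply: cvgD => //; exact: cvg_cst.
have step1 k : same_fun (fun w => clip (1 + k%:R * (lin X s w + - b)))
            (fun w => clip (1 + k%:R * (lin X' s w + - b))).
 have hn n := same_clip (sameD (same_cst 1) (sameZ k%:R
  (sameD (sameZ n.+1%:R (same_sin (scal n.+1%:R^-1 s))) (same_cst (- b))))).
 apply: (same_lim hn).
 - by move=> n w; exact: clip_bound.
 - by move=> n w; exact: clip_bound.
 - move=> w; apply: clipc => //; apply: cvgD; first exact: cvg_cst.
  apply: cvgMr; apply: cvgD; last exact: cvg_cst.
  by under eq_fun do rewrite lin_scal; exact: cvg_sinc.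
 - move=> w; apply: clipc => //; apply: cvgD; first exact: cvg_cst.
  apply: cvgMr; apply: cvgD; last exact: cvg_cst.
  by under eq_fun do rewrite lin_scal; exact: cvg_sinc.
have lim2 (x : R) : clip (1 + k%:R * (x + - b)) @[k --> \oo] --> ((b <= x)%R%:R : R).
 have [bx|xb] := lerP b x.
  rewrite (_ : (fun _ => _) = fun=> 1); first exact: cvg_cst.
  by apply/funext => k; rewrite clip_ge1// lerDl mulr_ge0// subr_ge0.
 apply: cvg_near_cst; near=> k.
 rewrite clip_le0//.
 have : (b - x)^-1 <= k%:R by near: k; exact: nbhs_infty_ger.
 rewrite -[leLHS]div1r ler_pdivrMr ?subr_gt0// => h.
 by rewrite -opprB mulrN subr_le0.
apply: (same_lim step1).
- by move=> n w; exact: clip_bound.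
- by move=> n w; exact: clip_bound.
- by move=> w; exact: lim2.
- by move=> w; exact: lim2.
Unshelve. all: by end_near. Qed.

Lemma same_all (cs : seq (seq (R * A) * R)) :
 same_fun (fun w => (all (fun c => c.2 <= lin X c.1 w) cs)%:R)
     (fun w => (all (fun c => c.2 <= lin X' c.1 w) cs)%:R).
Proof.
elim: cs => [|c cs IH] /=; first exact: same_cst.
apply: (eq_same (sameM (same_step c.1 c.2) IH)) => w;
by case: (_ <= _); rewrite ?mul1r ?mul0r.
Qed.

End law.

(** Laws of Gaussian families are compared below on these finite systems of linear inequalities
    only. *)
Definition polyh {R : realType} {A : Type} (T0 : Type) (Y : A -> T0 -> R) (cs : seq (seq (R * A) * R)) : set T0 :=
 [set w | all (fun c => c.2 <= lin Y c.1 w) cs].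

Lemma poly_indic {R : realType} {A : Type} (T0 : Type) (Y : A -> T0 -> R) cs w :
 \1_(polyh Y cs) w = (all (fun c => c.2 <= lin Y c.1 w) cs)%:R :> R.
Proof.
rewrite indicE; congr (_%:R); rewrite /polyh.
by case: (boolP (all _ _)) => h; [rewrite mem_set|rewrite memNset//; exact/negP].
Qed.

Lemma measurable_polyh {R : realType} {A : Type} {d} {T : measurableType d}
  (X : A -> T -> R) cs : (forall a, mble (X a)) ->
 measurable (polyh X cs).
Proof.
move=> mX; elim: cs => [|c cs IH]; first by rewrite (_ : polyh X [::] = setT); [exact: measurableT|apply/seteqP].
have -> : polyh X (c :: cs) = (lin X c.1 @^-1` `[c.2, +oo[) `&` polyh X cs.
 apply/seteqP; split=> w; rewrite /polyh /= in_itv/= andbT.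
  by case/andP.
 by case=> -> ->.
by apply: measurableI => //; rewrite -[X in measurable X]setTI; apply: measurable_lin.
Qed.

Theorem same_law {R : realType} {A : Type}
  {d} {T : measurableType d} (P : probability T R)
  {d'} {T' : measurableType d'} (P' : probability T' R)
  (X : A -> T -> R) (X' : A -> T' -> R) cs :
 (forall a, mble (X a)) -> (forall a, mble (X' a)) ->
 (forall s, \int[P]_w cos (lin X s w) = \int[P']_w cos (lin X' s w)) ->
 (forall s, \int[P]_w sin (lin X s w) = \int[P']_w sin (lin X' s w)) ->
 fine (P (polyh X cs)) = fine (P' (polyh X' cs)).
Proof.
move=> mX mX' hc hs.
rewrite -!Rint_indic; [|exact: measurable_polyh..].
under eq_Rintegral do rewrite poly_indic.
under [RHS]eq_Rintegral do rewrite poly_indic.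
exact: (same_Rint mX mX' hc hs (same_all mX mX' cs)).
Qed.

(** * Integration against a density *)

Section density.
Context {d} {T : measurableType d} {R : realType}.
Variables (nu : {finite_measure set T -> \bar R})
 (mu : {sigma_finite_measure set T -> \bar R}) (p : T -> R).
Hypotheses (ip : mu.-integrable setT (EFin \o p))
 (nuE : forall A, measurable A -> nu A = (\int[mu]_(x in A) (p x)%:E)%E).

Lemma density_dominates : nu `<< mu.
Proof.
apply/null_content_dominatesP => A mA A0; rewrite nuE//.
apply: null_set_integral => //.
apply: measurable_funTS; exact: measurable_int ip.
Qed.

(** Transfers the change of variables from the Radon-Nikodym derivative to the given density p. *)
Lemma ae_density :
 ae_eq mu setT (Radon_Nikodym_SigmaFinite.f nu mu) (EFin \o p).
Proof.
apply: integral_ae_eq => //.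
- exact: Radon_Nikodym_SigmaFinite.f_integrable density_dominates.
- exact: measurable_int ip.
- move=> A _ mA; rewrite -nuE//.
 by rewrite -(Radon_Nikodym_SigmaFinite.f_integral density_dominates).
Qed.

Lemma ge0_integral_density (f : T -> \bar R) :
 mble f -> (forall x, (0 <= f x)%E) ->
 (\int[nu]_x f x = \int[mu]_x (f x * (p x)%:E))%E.
Proof.
move=> mf f0.
rewrite -(Radon_Nikodym_SigmaFinite.change_of_variables density_dominates)//.
apply: ae_eq_integral => //.
- apply: emeasurable_funM => //.
 apply: measurable_int; exact: Radon_Nikodym_SigmaFinite.f_integrable density_dominates.
- by apply: emeasurable_funM => //; exact: measurable_int ip.
- by apply: ae_eqe_mul2l; exact: ae_density.
Qed.

Lemma integral_density (f : T -> \bar R) : nu.-integrable setT f ->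
 (\int[nu]_x f x = \int[mu]_x (f x * (p x)%:E))%E.
Proof.
move=> intf; have mf := measurable_int _ intf.
rewrite -(Radon_Nikodym_change_of_variables density_dominates)//.
apply: ae_eq_integral => //.
- apply: emeasurable_funM => //; apply: measurable_int.
 by apply: Radon_Nikodym_integrable; exact: density_dominates.
- by apply: emeasurable_funM => //; exact: measurable_int ip.
- apply: ae_eqe_mul2l.
 apply: ae_eq_trans ae_density; apply: ae_eq_sym.
 exact: (ae_eq_Radon_Nikodym_SigmaFinite density_dominates).
Qed.

End density.

(** * Normal law: integration by parts, characteristic function, variance *)

Section normal.
Context {R : realType} (sigma : R) (s0 : sigma != 0).
Let lam := (@lebesgue_measure R).
Let p : R -> R := normal_pdf 0 sigma.

Lemma npdfE x : p x = normal_peak sigma * expR (- x ^+ 2 / (sigma ^+ 2 *+ 2)).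
Proof. by rewrite /p normal_pdfE// /normal_fun subr0. Qed.
Lemma npdf_ge0 x : 0 <= p x.
Proof. exact: normal_pdf_ge0. Qed.
Lemma npdfN x : p (- x) = p x.
Proof. by rewrite !npdfE sqrrN. Qed.

Lemma is_derive_npdf x : is_derive x (1 : R) p (- (x / sigma ^+ 2) * p x).
Proof.
have -> : p = fun x => normal_peak sigma * expR (- x ^+ 2 / (sigma ^+ 2 *+ 2)).
 by apply/funext => y; rewrite npdfE.
apply: is_derive_eq.
rewrite /GRing.scale /=; field.
by rewrite s0.
Qed.

Let G x := (1 + x ^+ 2) * p x.

Lemma measurable_npdf : mble p.
Proof. exact: measurable_normal_pdf. Qed.

(** Put y = 3 x^2 / (8 sigma^2). The exponential of the wider density, of deviation 2 sigma, exceeds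
    that of p by the factor exp(y), and 1 + x^2 <= C0 (1 + y) <= C0 exp(y) with C0 = 1 + 8 sigma^2 /
    3. The result is an integrable majorant for everything of quadratic growth. *)
Lemma npdf_tail : exists2 C, 0 <= C & forall x, G x <= C * normal_pdf 0 (2 * sigma) x.
Proof.
have s2 : 2 * sigma != 0 by rewrite mulf_neq0// pnatr_eq0.
pose C0 := 1 + 8 * sigma ^+ 2 / 3.
have ss : 0 < sigma ^+ 2 by rewrite exprn_even_gt0.
have C0p : 0 < C0 by rewrite /C0; lra.
have k0 := normal_peak_gt0 s0; have k2 := normal_peak_gt0 s2.
exists (C0 * normal_peak sigma / normal_peak (2 * sigma)).
 by rewrite divr_ge0// ?mulr_ge0// ltW.
move=> x; rewrite /G npdfE [normal_pdf _ _ _](_ : _ = normal_peak (2 * sigma) *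
 expR (- x ^+ 2 / ((2 * sigma) ^+ 2 *+ 2))); last by rewrite normal_pdfE// /normal_fun subr0.
rewrite [leRHS]mulrA divfK ?gt_eqF//.
rewrite [leLHS]mulrCA -mulrA [leRHS]mulrCA ler_pM2l//.
pose y := 3 * x ^+ 2 / (8 * sigma ^+ 2).
have -> : - x ^+ 2 / (sigma ^+ 2 *+ 2) = - x ^+ 2 / ((2 * sigma) ^+ 2 *+ 2) - y.
 by rewrite /y; field; rewrite s0.
rewrite expRD mulrCA [leRHS]mulrC ler_pM2l ?expR_gt0// expRN ler_pdivrMr ?expR_gt0//.
apply: (@le_trans _ _ (C0 * (1 + y))); last by rewrite ler_pM2l// expR_ge1Dx.
have y0 : 0 <= y by rewrite /y divr_ge0// mulr_ge0// ?sqr_ge0// ltW.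
have -> : x ^+ 2 = y * (8 * sigma ^+ 2 / 3) by rewrite /y; field; rewrite s0.
by rewrite /C0; nra.
Qed.

Lemma integrable_G : lam.-integrable setT (EFin \o G).
Proof.
have [C C0 hC] := npdf_tail.
apply: (@le_integrable _ _ _ lam setT measurableT _ (fun x => (C * normal_pdf 0 (2 * sigma) x)%:E)).
- apply/measurable_EFinP; apply: measurable_funM; last exact: measurable_npdf.
 by apply: measurable_funD => //; exact: measurable_funX.
- move=> x _ /=; rewrite lee_fin !ger0_norm ?hC//.
 + by rewrite mulr_ge0// normal_pdf_ge0.
 + by rewrite mulr_ge0 ?npdf_ge0// addr_ge0// sqr_ge0.
- under eq_fun do rewrite EFinM; apply: integrableZl => //.
 exact: integrable_normal_pdf.
Qed.

Lemma integrable_dom (f : R -> R) (C : R) : mble f ->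
 (forall x, `|f x| <= C * (1 + x ^+ 2)) ->
 lam.-integrable setT (fun x => (f x * p x)%:E).
Proof.
move=> mf hf.
apply: (@le_integrable _ _ _ lam setT measurableT _ (fun x => (C * G x)%:E)).
- by apply/measurable_EFinP; apply: measurable_funM => //; exact: measurable_npdf.
- move=> x _ /=; rewrite lee_fin normrM (ger0_norm (npdf_ge0 x)).
 rewrite (le_trans _ (ler_norm _))// /G mulrA ler_wpM2r ?npdf_ge0//.
- by under eq_fun do rewrite EFinM; apply: integrableZl => //; exact: integrable_G.
Qed.

Lemma cvg_npdf_seq (u : R^nat) (C : R) :
 (forall n, `|u n| <= C * n.+1%:R) ->
 u n * p n.+1%:R @[n --> \oo] --> (0 : R).
Proof.
move=> hu.
have [D D0 hD] := npdf_tail.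
pose k := normal_peak (2 * sigma).
have hG n : G n.+1%:R <= D * k.
 by rewrite (le_trans (hD _))// ler_wpM2l// normal_pdf_ub// mulf_neq0// pnatr_eq0.
have C0 : 0 <= C by have := hu 0%N; rewrite mulr1; apply: le_trans.
apply: norm_cvg0.
have hc : C * (D * k) * n.+1%:R^-1 @[n --> \oo] --> C * (D * k) * 0.
 by apply: cvgMr; exact: cvg_harmonic.
rewrite mulr0 in hc.
apply: (@squeeze_cvgr _ _ _ _ (fun=> 0) _ _ _ _ _ hc); last exact: cvg_cst.
apply: nearW => n; rewrite normr_ge0 /= normrM (ger0_norm (npdf_ge0 _)).
rewrite (le_trans (ler_wpM2r (npdf_ge0 _) (hu n)))//.
rewrite ler_pdivlMr ?ltr0n// -mulrA -mulrA ler_wpM2l//.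
apply: le_trans (hG n); rewrite /G mulrCA mulrC ler_wpM2r ?npdf_ge0//.
by rewrite expr2 lerDr.
Qed.

Lemma integral_derive0 (F f : R -> R) :
 (forall x, is_derive x (1 : R) F (f x)) -> continuous f ->
 lam.-integrable setT (EFin \o f) ->
 F n.+1%:R @[n --> \oo] --> (0 : R) -> F (- n.+1%:R) @[n --> \oo] --> (0 : R) ->
 \int[lam]_x f x = 0.
Proof.
move=> dF cf intf F1 F2.
have cF x : {for x, continuous F}.
 by apply: differentiable_continuous; apply/derivable1_diffP; case: (dF x).
have FTC n : (\int[lam]_(x in `[(- n.+1%:R : R)%R, (n.+1%:R : R)%R]) (f x)%:E = (F n.+1%:R - F (- n.+1%:R))%R%:E)%E.
 rewrite (@continuous_FTC2 _ f F).
 - by rewrite EFinB.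
 - by rewrite gtrN// ltr0n.
 - exact: continuous_subspaceT.
 - split.
  + by move=> x _; case: (dF x).
  + exact: cvg_at_right_filter (cF _).
  + exact: cvg_at_left_filter (cF _).
 - by move=> x _; rewrite derive1E; case: (dF x).
have mf : mble f by exact: continuous_measurable_fun.
have h1 : (\int[lam]_x (f x * \1_(`[(- n.+1%:R : R)%R, (n.+1%:R : R)%R]) x)%:E)%E @[n --> \oo] -->
  (\int[lam]_x (f x)%:E)%E.
 apply: (@dominated_cvg _ _ _ lam setT _ (fun n x => (f x * \1_(`[(- n.+1%:R : R)%R, (n.+1%:R : R)%R]) x)%:E)
  _ (fun x => `|f x|%:E)) => //.
 - move=> n; apply/measurable_EFinP; apply: measurable_funM => //.
 - move=> x _; apply: cvg_EFin; first exact: nearW.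
  apply: cvg_near_cst; near=> n => /=.
  rewrite indicE mem_set ?mulr1//= in_itv /= -ler_norml.
  have : `|x| <= n%:R by near: n; exact: nbhs_infty_ger.
  by move/le_trans; apply; rewrite ler_nat.
 - have := integrable_abse intf; apply: eq_integrable => // x _.
 - move=> n x _ /=; rewrite lee_fin normrM indicE.
  by case: (_ \in _); rewrite ?normr1 ?normr0 ?mulr1 ?mulr0.
have h2 : (\int[lam]_x (f x * \1_(`[(- n.+1%:R : R)%R, (n.+1%:R : R)%R]) x)%:E)%E @[n --> \oo] --> (0:R)%:E.
 have h3 : (F n.+1%:R - F (- n.+1%:R))%:E @[n --> \oo] --> (0:R)%:E.
  by apply: cvg_EFin; [exact: nearW|rewrite -[X in _ --> X](subrr 0); exact: cvgB].
 apply: cvg_trans h3; apply: near_eq_cvg; apply: nearW => n.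
 rewrite -FTC [LHS]integral_mkcond; apply: eq_integral => x _.
 rewrite patchE indicE; case: (x \in _); by rewrite ?mulr1 ?mulr0.
have := cvg_unique _ h1 h2 => /(_ (@ereal_hausdorff _)) h3.
by rewrite /Rintegral h3.
Unshelve. all: by end_near. Qed.

Lemma continuous_npdf : continuous p.
Proof. exact: continuous_normal_pdf. Qed.

Lemma measurable_cosZ t th : mble (fun x : R => cos (t * x + th)).
Proof.
apply: measurableT_comp; last by apply: measurable_funD => //; exact: measurable_funM.
by apply: continuous_measurable_fun; exact: continuous_cos.
Qed.

Lemma measurable_sinZ t th : mble (fun x : R => sin (t * x + th)).
Proof.
apply: measurableT_comp; last by apply: measurable_funD => //; exact: measurable_funM.
by apply: continuous_measurable_fun; exact: continuous_sin.
Qed.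

Lemma le1D x : 1 <= 1 + x ^+ 2 :> R.
Proof. by rewrite lerDl sqr_ge0. Qed.
Lemma leD1 (x : R) : `|x| <= 1 + x ^+ 2.
Proof. by rewrite -real_normK ?num_real//; have := normr_ge0 x; nra. Qed.

(** Since p' = -(x / sigma^2) p, the function h' p - sigma^-2 x h p is the derivative of h p, which
    vanishes at infinity. *)
Lemma stein (h h' : R -> R) (C : R) : (forall x, is_derive x (1 : R) h (h' x)) -> continuous h' ->
 (forall x, `|h x| <= 1 + `|x|) -> (forall x, `|h' x| <= C) ->
 \int[lam]_x (x * h x * p x) = sigma ^+ 2 * \int[lam]_x (h' x * p x).
Proof.
move=> dh ch' hb h'b; have C0 : 0 <= C by exact: le_trans (h'b 0).
have ch : continuous h.
 by move=> x; apply: differentiable_continuous; apply/derivable1_diffP; case: (dh x).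
have i1 : lam.-integrable setT (EFin \o (fun x => h' x * p x)).
 apply: (@integrable_dom _ C) => [|x]; first exact: continuous_measurable_fun.
 by rewrite (le_trans (h'b x))// ler_peMr// lerDl sqr_ge0.
have i2 : lam.-integrable setT (EFin \o (fun x => x * h x * p x)).
 apply: (@integrable_dom _ 2) => [|x].
  by apply: measurable_funM => //; exact: continuous_measurable_fun.
 rewrite normrM (le_trans (ler_wpM2l (normr_ge0 _) (hb x)))//.
 by rewrite -(real_normK (num_real x)); move: `|x| => y; nra.
have i3 : lam.-integrable setT (EFin \o (fun x => sigma ^- 2 * (x * h x * p x))).
 by rewrite (_ : EFin \o _ = (fun x => (sigma ^- 2)%:E * (x * h x * p x)%:E)%E)//; exact: integrableZl.
have bn (n : nat) x : `|x| = n.+1%:R -> `|h x| <= 2 * n.+1%:R.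
 move=> xn; apply: (le_trans (hb x)); rewrite xn mulr2n mulrDl mul1r lerD2r.
 by rewrite ler1n.
have : \int[lam]_x (h' x * p x - sigma ^- 2 * (x * h x * p x)) = 0.
 apply: (@integral_derive0 (fun x => h x * p x)).
 - move=> x; have dp := is_derive_npdf x; have dx := dh x.
  apply: is_derive_eq; rewrite /GRing.scale /=; field.
  by rewrite s0.
 - move=> x; apply: cvgB; [|apply: cvgMr]; apply: cvgM; [exact: ch'|exact: continuous_npdf| |exact: continuous_npdf].
  by apply: cvgM; [exact: cvg_id|exact: ch].
 - have := integrableB measurableT i1 i3; exact: eq_integrable.
 - by apply: (@cvg_npdf_seq _ 2) => n; apply: bn; rewrite ger0_norm.
 - under eq_fun do rewrite npdfN.
  by apply: (@cvg_npdf_seq _ 2) => n; apply: bn; rewrite normrN ger0_norm.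
rewrite RintegralB// (RintegralZl _ measurableT i2) => /subr0_eq ->.
by rewrite mulVKf// expf_neq0.
Qed.

Lemma int_xsin t th :
 \int[lam]_x (x * sin (t * x + th) * p x) = t * sigma ^+ 2 * \int[lam]_x (cos (t * x + th) * p x).
Proof.
have dh x : is_derive x (1 : R) (fun x => sin (t * x + th)) (t * cos (t * x + th)).
 by apply: is_derive_eq; rewrite /GRing.scale /=; ring.
rewrite (stein (C := `|t|) dh).
- under eq_Rintegral do rewrite -mulrA.
 rewrite RintegralZl//; first by rewrite mulrCA mulrA.
 apply: (@integrable_dom _ 1) => [|x]; first exact: measurable_cosZ.
 by rewrite mul1r (le_trans (cos_max _))// le1D.
- move=> x; apply: cvgMr; apply: (@continuous_comp _ _ _ (fun x => t * x + th) cos); last exact: continuous_cos.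
 by apply: cvgD; [apply: cvgMr|exact: cvg_cst].
- by move=> x; rewrite (le_trans (sin_max _))// lerDl.
- by move=> x; rewrite normrM ler_piMr// cos_max.
Qed.

Lemma int_sqr : \int[lam]_x (x ^+ 2 * p x) = sigma ^+ 2.
Proof.
under eq_Rintegral do rewrite expr2.
have dh (x : R) : is_derive x (1 : R) (fun x => x) 1 by exact: is_derive_id.
rewrite (stein (C := 1) dh) => [|x|x|x]; last 3 first.
- exact: cvg_cst.
- by rewrite lerDr.
- by rewrite normr1.
rewrite /Rintegral; under eq_integral do rewrite mul1r.
by rewrite integral_normal_pdf// mulr1.
Qed.

(** The phase th treats cosine and sine at once. Differentiating in t under the integral and
    applying [int_xsin] gives g' = - t sigma^2 g, so g(t) exp(t^2 sigma^2 / 2) is constant. *)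
Lemma int_cos t th : \int[lam]_x (cos (t * x + th) * p x) = cos th * expR (- (t ^+ 2 * sigma ^+ 2 / 2)).
Proof.
pose g t := \int[lam]_x (cos (t * x + th) * p x).
have i1 t' : lam.-integrable setT (EFin \o (fun x => cos (t' * x + th) * p x)).
 apply: (@integrable_dom _ 1) => [|x]; first exact: measurable_cosZ.
 by rewrite mul1r (le_trans (cos_max _))// le1D.
have i2 t' : lam.-integrable setT (EFin \o (fun x => x * sin (t' * x + th) * p x)).
 apply: (@integrable_dom _ 1) => [|x].
  by apply: measurable_funM => //; exact: measurable_sinZ.
 rewrite mul1r normrM (le_trans _ (leD1 x))// -[leRHS]mulr1 ler_wpM2l//.
 exact: sin_max.
have dcos x t' : is_derive t' (1 : R) (fun t => cos (t * x + th) * p x) (- (x * sin (t' * x + th) * p x)).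
 have d1 : is_derive t' (1 : R) (fun t => cos (t * x + th)) (- (x * sin (t' * x + th))).
  by apply: is_derive_eq; rewrite /GRing.scale /=; ring.
 by apply: is_derive_eq; rewrite /GRing.scale /=; ring.
have dg t' : is_derive t' (1 : R) g (- (t' * sigma ^+ 2 * g t')).
 have ha : `](t' - 1), (t' + 1)[%classic t' by rewrite /= in_itv/= ltrBlDr ltrDl andbb ltr01.
 have hG y : 0 <= G y by rewrite /G mulr_ge0 ?npdf_ge0// addr_ge0// sqr_ge0.
 have hub x y : `](t' - 1), (t' + 1)[%classic x -> setT y ->
  `|partial1of2 (fun t x => cos (t * x + th) * p x) x y| <= G y.
  move=> _ _; rewrite partial1of2E derive_val normrN normrM (ger0_norm (npdf_ge0 _)).
  rewrite ler_wpM2r ?npdf_ge0// normrM (le_trans _ (leD1 y))// -[leRHS]mulr1 ler_wpM2l//.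
  exact: sin_max.
 have hd (x y : R) : `](t' - 1), (t' + 1)[%classic x -> setT y ->
  @derivable R R^o R^o (fun t : R => cos (t * y + th) * p y) x 1 by case: (dcos y x).
 split.
  exact: (@derivable_under_integral _ _ _ lam (fun t x => cos (t * x + th) * p x) setT measurableT
   t' _ _ ha (fun x _ => i1 x) hd G hG integrable_G hub).
 rewrite -derive1E (@differentiation_under_integral _ _ _ lam (fun t x => cos (t * x + th) * p x) setT measurableT
   t' _ _ ha (fun x _ => i1 x) hd G hG integrable_G hub).
 transitivity (\int[lam]_x (-1 * (x * sin (t' * x + th) * p x))).
  by apply: eq_Rintegral => x _; rewrite partial1of2E derive_val mulN1r.
 by rewrite RintegralZl// int_xsin mulN1r.
have hc : g t * expR (t ^+ 2 * sigma ^+ 2 / 2) = g 0 * expR (0 ^+ 2 * sigma ^+ 2 / 2).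
 apply: (@is_derive_0_is_cst _ (fun t => g t * expR (t ^+ 2 * sigma ^+ 2 / 2))) => t'.
 have d2 : is_derive t' (1 : R) (fun t => expR (t ^+ 2 * sigma ^+ 2 / 2)) (t' * sigma ^+ 2 * expR (t' ^+ 2 * sigma ^+ 2 / 2)).
  by apply: is_derive_eq; rewrite /GRing.scale /=; field.
 have dgt := dg t'.
 by apply: is_derive_eq; rewrite /GRing.scale /=; ring.
have g0 : g 0 = cos th.
 rewrite /g; under eq_Rintegral do rewrite mul0r add0r.
 rewrite RintegralZl//; last exact: integrable_normal_pdf.
 by rewrite /Rintegral integral_normal_pdf mulr1.
move: hc; rewrite g0 expr0n /= !mul0r expR0 mulr1 => hc.
apply: (mulIf (lt0r_neq0 (expR_gt0 (t ^+ 2 * sigma ^+ 2 / 2)))).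
by rewrite [LHS]hc expRN mulfVK ?gt_eqF ?expR_gt0.
Qed.

Let N := normal_prob 0 sigma.

Lemma normal_Rint (f : R -> R) : bmf f -> \int[N]_x f x = \int[lam]_x (f x * p x).
Proof.
move=> bf; rewrite /Rintegral.
rewrite (@integral_density _ _ _ N lam p (integrable_normal_pdf 0 sigma) (fun A _ => erefl) (EFin \o f)); last exact: bmf_integrable.
by congr fine; apply: eq_integral => x _; rewrite EFinM.
Qed.

Lemma normal_cos t th : \int[N]_x cos (t * x + th) = cos th * expR (- (t ^+ 2 * sigma ^+ 2 / 2)).
Proof.
rewrite -int_cos; apply: (@normal_Rint (fun x => cos (t * x + th))).
by apply: bmf_cos; apply: measurable_funD => //; exact: measurable_funM.
Qed.

Lemma normal_ge0_integral (f : R -> \bar R) : mble f ->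
 (forall x, (0 <= f x)%E) ->
 (\int[N]_x f x = \int[lam]_x (f x * (p x)%:E))%E.
Proof.
move=> mf f0.
exact: (@ge0_integral_density _ _ _ N lam p (integrable_normal_pdf 0 sigma) (fun A _ => erefl) f).
Qed.

Lemma normal_sqr : (\int[N]_x (x ^+ 2)%:E = (sigma ^+ 2)%:E)%E.
Proof.
rewrite normal_ge0_integral//; last first.
- by move=> x; rewrite lee_fin sqr_ge0.
- by apply/measurable_EFinP; exact: measurable_funX.
rewrite -int_sqr /Rintegral fineK; last first.
 apply: integrable_fin_num => //; apply: (@integrable_dom _ 1) => [|x]; first exact: measurable_funX.
 by rewrite ger0_norm ?sqr_ge0// mul1r lerDr.
by apply: eq_integral => x _; rewrite EFinM.
Qed.

End normal.

(** * Tails of the standard normal law *)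

Section standard_normal_tails.
Context {R : realType}.
Let lam := (@lebesgue_measure R).
Let N1 : probability (measurableTypeR R) R := normal_prob (0 : R) 1.

(** For x >= t >= 0 one has x^2 >= t^2 + (x - t)^2, so the density is at most exp(-t^2/2) times the
    normal density centred at t. *)
Lemma std_tail_le (t : R) : 0 <= t -> fine (N1 `[t, +oo[%classic) <= expR (- (t ^+ 2 / 2)).
Proof.
move=> t0.
have o0 : (1 : R) != 0 by exact: oner_neq0.
rewrite -lee_fin fineK; last by apply: fin_num_measure; exact: measurable_itv.
apply: (@le_trans _ _ (\int[lam]_(x in `[t, +oo[) (expR (- (t ^+ 2 / 2)) * normal_pdf t 1 x)%:E)%E).
 rewrite /N1 /normal_prob; apply: ge0_le_integral => //.
 - by move=> x _; rewrite lee_fin normal_pdf_ge0.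
 - apply: measurable_funTS; apply/measurable_EFinP; exact: measurable_normal_pdf.
 - apply: measurable_funTS; apply/measurable_EFinP; apply: measurable_funM => //.
  exact: measurable_normal_pdf.
 - move=> x; rewrite /= in_itv/= andbT => tx; rewrite lee_fin !normal_pdfE//.
  rewrite mulrCA ler_pM2l ?normal_peak_gt0// /normal_fun -expRD ler_expR subr0 expr1n.
  rewrite !mulNr -opprD lerN2.
  have key (y : R) : t <= y -> t ^+ 2 / 2 + (y - t) ^+ 2 / (1 *+ 2) <= y ^+ 2 / (1 *+ 2).
   by move=> ty; rewrite -[1 *+ 2]/(2 : R); nra.
  exact: key.
apply: (@le_trans _ _ (\int[lam]_x (expR (- (t ^+ 2 / 2)) * normal_pdf t 1 x)%:E)%E).
 apply: ge0_subset_integral => //.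
 - apply/measurable_EFinP; apply: measurable_funM => //.
  exact: measurable_normal_pdf.
 - by move=> x _; rewrite lee_fin mulr_ge0 ?expR_ge0// normal_pdf_ge0.
under eq_integral do rewrite EFinM.
rewrite integralZl//; last exact: integrable_normal_pdf.
by rewrite integral_normal_pdf mule1.
Qed.

(** Only the interval [t, t + 1] is kept, where the density is at least its value at t + 1. *)
Lemma std_tail_ge (t : R) : 0 <= t ->
 normal_peak (1:R) * expR (- ((t + 1) ^+ 2 / 2)) <= fine (N1 `[t, +oo[%classic).
Proof.
move=> t0.
have o0 : (1 : R) != 0 by exact: oner_neq0.
rewrite -lee_fin fineK; last by apply: fin_num_measure; exact: measurable_itv.
apply: (@le_trans _ _ (\int[lam]_(x in `[t, (t+1)%R]) (normal_pdf 0 1 (t + 1))%:E)%E).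
 rewrite integral_cst//= lebesgue_measure_itv/= lte_fin ltrDl ltr01 -EFinB addrAC subrr add0r mule1.
 by rewrite lee_fin npdfE// expr1n mulNr.
apply: (@le_trans _ _ (\int[lam]_(x in `[t, (t+1)%R]) (normal_pdf 0 1 x)%:E)%E).
 apply: ge0_le_integral => //.
 - by move=> x _; rewrite lee_fin normal_pdf_ge0.
 - apply: measurable_funTS; apply/measurable_EFinP; exact: measurable_normal_pdf.
 - move=> x; rewrite /= in_itv/= => /andP[tx xt]; rewrite lee_fin !npdfE//.
  rewrite ler_pM2l ?normal_peak_gt0// ler_expR expr1n.
  rewrite ler_pM2r ?invr_gt0// lerN2 ler_sqr ?nnegrE; lra.
rewrite /N1 /normal_prob; apply: ge0_subset_integral => //.
- apply: measurable_funTS; apply/measurable_EFinP; exact: measurable_normal_pdf.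
- by move=> x _; rewrite lee_fin normal_pdf_ge0.
- by move=> x /=; rewrite !in_itv/= => /andP[->].
Qed.

End standard_normal_tails.

(** * Quadratic forms on finite combinations *)

Section quadratic_forms.
Context {R : realType} {A : Type}.
Implicit Types (S : A -> A -> R) (s t : seq (R * A)).

Definition qf S s t := \sum_(p <- s) \sum_(q <- t) p.1 * q.1 * S p.2 q.2.

Lemma qf_catl S s s' t : qf S (s ++ s') t = qf S s t + qf S s' t.
Proof. by rewrite /qf big_cat. Qed.
Lemma qf_catr S s t t' : qf S s (t ++ t') = qf S s t + qf S s t'.
Proof. by rewrite /qf -big_split; apply: eq_bigr => p _; rewrite big_cat. Qed.

Lemma qf_scall S c s t : qf S (scal c s) t = c * qf S s t.
Proof.
rewrite /qf big_map mulr_sumr; apply: eq_bigr => p _.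
by rewrite mulr_sumr; apply: eq_bigr => q _ /=; rewrite !mulrA.
Qed.

Lemma qf_scalr S c s t : qf S s (scal c t) = c * qf S s t.
Proof.
rewrite /qf mulr_sumr; apply: eq_bigr => p _.
by rewrite big_map mulr_sumr; apply: eq_bigr => q _ /=; rewrite mulrCA !mulrA.
Qed.

Lemma qf_nill S t : qf S [::] t = 0.
Proof. by rewrite /qf big_nil. Qed.
Lemma qf_nilr S s : qf S s [::] = 0.
Proof. by rewrite /qf big1// => p _; rewrite big_nil. Qed.

Lemma qfC S s t : (forall a b, S a b = S b a) -> qf S s t = qf S t s.
Proof.
move=> sS; rewrite /qf exchange_big; apply: eq_bigr => p _; apply: eq_bigr => q _.
by rewrite sS (mulrC q.1).
Qed.

Lemma eq_qf S S' s t : (forall a b, S a b = S' a b) -> qf S s t = qf S' s t.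
Proof.
by move=> e; apply: eq_bigr => p _; apply: eq_bigr => q _; rewrite e.
Qed.

Lemma qf1 S c a c' a' : qf S [:: (c, a)] [:: (c', a')] = c * c' * S a a'.
Proof. by rewrite /qf !big_seq1. Qed.

Lemma qfD S S' s t : qf (fun a b => S a b + S' a b) s t = qf S s t + qf S' s t.
Proof.
rewrite /qf -big_split; apply: eq_bigr => p _; rewrite -big_split.
by apply: eq_bigr => q _; rewrite mulrDr.
Qed.

End quadratic_forms.

Section flattening.
Context {R : realType} {A : Type}.

(** Substitution: every index b of a combination is expanded into the combination [g b]. *)
Definition lflat {B : Type} (g : B -> seq (R * A)) (s : seq (R * B)) :=
 flatten [seq scal p.1 (g p.2) | p <- s].

Lemma lin_lflat {B T : Type} (g : B -> seq (R * A)) (X : A -> T -> R) (s : seq (R * B)) w :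
 lin X (lflat g s) w = lin (fun b => lin X (g b)) s w.
Proof.
elim: s => [|p s IH]; first by rewrite !lin_nil.
rewrite /lflat /= -/(lflat g s) lin_cat lin_scal IH.
by rewrite [in RHS]/lin big_cons.
Qed.

Lemma qf_lflat {B : Type} (g : B -> seq (R * A)) (S : A -> A -> R) (s t : seq (R * B)) :
 qf S (lflat g s) (lflat g t) = qf (fun b b' : B => qf S (g b) (g b')) s t.
Proof.
elim: s => [|p s IH]; first by rewrite !qf_nill.
rewrite /lflat /= -/(lflat g s) qf_catl IH [in RHS]/qf big_cons; congr (_ + _).
rewrite qf_scall; elim: t {IH} => [|q t IH]; first by rewrite qf_nilr big_nil mulr0.
rewrite /lflat /= -/(lflat g t) qf_catr mulrDr IH big_cons; congr (_ + _).
by rewrite qf_scalr mulrA.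
Qed.

End flattening.

Lemma Rint_cst {R : realType} {d} {T : measurableType d} (P : probability T R) (c : R) :
 \int[P]_w c = c.
Proof.
transitivity (c * fine (P setT)); first exact: Rintegral_cst.
have -> : P setT = 1%E by exact: probability_setT.
by rewrite /= mulr1.
Qed.

(** * Gaussian families: tails, products, independence *)

Section gaussian_processes.
Context {R : realType}.

(** A centred Gaussian family with covariance S, described by the characteristic functions of its
    finite combinations; degenerate covariances fit in without a separate case. *)
Definition gproc {A : Type} {d} {T : measurableType d} (P : probability T R)
  (X : A -> T -> R) (S : A -> A -> R) : Prop :=
 (forall a, mble (X a)) /\
 forall s, \int[P]_w cos (lin X s w) = expR (- (qf S s s / 2)) /\
      \int[P]_w sin (lin X s w) = 0.

Section basics.
Context {A : Type} {d} {T : measurableType d} (P : probability T R).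
Variables (X : A -> T -> R) (S : A -> A -> R).
Hypothesis gX : gproc P X S.

Lemma gproc_measurable a : mble (X a).
Proof. by case: gX. Qed.
Lemma gproc_mlin s : mble (lin X s).
Proof. by apply: measurable_lin; exact: gproc_measurable. Qed.

Lemma gproc_map {B : Type} (g : B -> seq (R * A)) :
 gproc P (fun b => lin X (g b)) (fun b b' => qf S (g b) (g b')).
Proof.
split=> [b|s]; first exact: gproc_mlin.
rewrite -qf_lflat; have [h1 h2] := gX.2 (lflat g s).
by split; [rewrite -h1|rewrite -h2]; apply: eq_Rintegral => w _; rewrite lin_lflat.
Qed.

Lemma gproc_reindex {B : Type} (g : B -> A) :
 gproc P (fun b => X (g b)) (fun b b' => S (g b) (g b')).
Proof.
have := gproc_map (fun b => [:: (1, g b)]).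
rewrite (_ : (fun b => lin X [:: (1, g b)]) = fun b => X (g b)).
 rewrite (_ : (fun b b' => _) = fun b b' => S (g b) (g b'))//.
 by apply/funext => b; apply/funext => b'; rewrite qf1 !mul1r.
by apply/funext => b; apply/funext => w; rewrite lin1 mul1r.
Qed.

Lemma gproc_eq_cov S' : (forall s, qf S s s = qf S' s s) -> gproc P X S'.
Proof. by move=> e; split => [a|s]; [exact: gproc_measurable|rewrite -e; exact: gX.2]. Qed.

Lemma gproc_qf_ge0 s : 0 <= qf S s s.
Proof.
have [h _] := gX.2 s.
have : \int[P]_w cos (lin X s w) <= \int[P]_w 1.
 apply: le_Rint; [|exact: bmf_cst|by move=> w; exact: cos_le1].
 by apply: bmf_cos; exact: gproc_mlin.
rewrite h Rint_cst -[X in _ <= X]expR0 ler_expR.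
by lra.
Qed.

End basics.

Lemma gproc_law {A : Type} {d} {T : measurableType d} (P : probability T R)
  {d'} {T' : measurableType d'} (P' : probability T' R)
  (X : A -> T -> R) (X' : A -> T' -> R) (S S' : A -> A -> R) cs :
 gproc P X S -> gproc P' X' S' -> (forall s, qf S s s = qf S' s s) ->
 fine (P (polyh X cs)) = fine (P' (polyh X' cs)).
Proof.
move=> gX gX' e; apply: same_law.
- exact: gproc_measurable gX.
- exact: gproc_measurable gX'.
- by move=> s; rewrite (gX.2 s).1 (gX'.2 s).1 e.
- by move=> s; rewrite (gX.2 s).2 (gX'.2 s).2.
Qed.

Lemma std_normal_gproc :
 gproc (normal_prob (0 : R) 1) (fun (_ : unit) (x : R) => x) (fun _ _ => 1).
Proof.
split=> [_|s]; first exact: measurable_id.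
have e (x : R) : lin (fun (_ : unit) (x : R) => x) s x = (\sum_(p <- s) p.1) * x.
 by rewrite /lin mulr_suml.
have q : qf (fun _ _ : unit => 1) s s = (\sum_(p <- s) p.1) ^+ 2.
 rewrite /qf expr2 mulr_suml; apply: eq_bigr => p _; rewrite mulr_sumr.
 by apply: eq_bigr => p' _; rewrite mulr1.
split.
- under eq_Rintegral do rewrite e -[_ * _]addr0.
 by rewrite normal_cos ?oner_neq0// cos0 mul1r q expr1n mulr1.
- under eq_Rintegral do rewrite e -cosBpihalf.
 by rewrite normal_cos ?oner_neq0// cosN cos_pihalf mul0r.
Qed.

Section tails.
Context {A : Type} {d} {T : measurableType d} (P : probability T R).
Variables (X : A -> T -> R) (S : A -> A -> R).
Hypothesis gX : gproc P X S.

Lemma gproc_normal s b : 0 < qf S s s ->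
 fine (P [set w | b <= lin X s w]) =
 fine (normal_prob 0 1 `[b / Num.sqrt (qf S s s), +oo[%classic).
Proof.
move=> q0; set v := qf S s s in q0 *.
have g1 := gproc_map gX (fun _ : unit => s).
have g2 := gproc_map std_normal_gproc (fun _ : unit => [:: (Num.sqrt v, tt)]).
have := gproc_law [:: ([:: (1, tt)], b)] g1 g2.
rewrite (_ : polyh _ _ = [set w | b <= lin X s w]); last first.
 by apply/funext => w; rewrite /polyh /= lin1 mul1r andbT.
move=> -> //; last first.
 move=> u; apply: eq_qf => _ _; rewrite qf1 mulr1 -expr2 sqr_sqrtr//; exact: ltW.
congr (fine (_ _)); apply/seteqP; split=> x; rewrite /polyh /= !lin1 mul1r andbT in_itv/= andbT;
 by rewrite ler_pdivrMr ?sqrtr_gt0// mulrC.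
Qed.

Lemma gproc_tail s b v : qf S s s <= v -> 0 < v -> 0 <= b ->
 fine (P [set w | b <= lin X s w]) <= expR (- (b ^+ 2 / (2 * v))).
Proof.
move=> qv v0 b0.
have [q0|] := ltP 0 (qf S s s).
 rewrite gproc_normal// (le_trans (std_tail_le _))//; first by rewrite divr_ge0// sqrtr_ge0.
 rewrite ler_expR lerN2 expr_div_n sqr_sqrtr ?(ltW q0)//.
 rewrite -[leRHS]mulrA -invfM ler_wpM2l ?sqr_ge0// lef_pV2 ?posrE ?mulr_gt0//.
 by rewrite mulrC ler_pM2l.
(* Zero variance: the combination has the law of the empty one, so the event is null for b > 0, and
   for b = 0 the bound is 1. *)
move=> q0.
have qe : qf S s s = 0 by apply/eqP; rewrite eq_le q0 (gproc_qf_ge0 gX).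
have [b00|bn0] := eqVneq b 0.
 rewrite b00 expr0n mul0r oppr0 expR0 -lee_fin fineK ?probability_le1//; last first.
  by apply: fin_num_measure; have := gproc_mlin gX s measurableT (measurable_itv `[0, +oo[);
   rewrite setTI; congr measurable; apply/seteqP; split=> w; rewrite /= in_itv/= andbT.
 have := gproc_mlin gX s measurableT (measurable_itv `[0, +oo[);
   rewrite setTI; congr measurable; apply/seteqP; split=> w; by rewrite /= in_itv/= andbT.
have g1 := gproc_map gX (fun _ : unit => s).
have g2 := gproc_map gX (fun _ : unit => [::]).
have := gproc_law [:: ([:: (1, tt)], b)] g1 g2.
rewrite (_ : polyh _ _ = [set w | b <= lin X s w]); last first.
 by apply/funext => w; rewrite /polyh /= lin1 mul1r andbT.
move=> -> //; last first.
 by move=> u; apply: eq_qf => _ _; rewrite qe qf_nill.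
rewrite (_ : polyh _ _ = set0) ?measure0 ?expR_ge0//.
apply/seteqP; split=> w //; rewrite /polyh /= lin1 lin_nil mulr0 andbT => b0'.
by move: bn0; rewrite eq_le b0 b0'.
Qed.

Lemma gproc_tail_ge s b : 0 < qf S s s -> 0 <= b ->
 normal_peak (1:R) * expR (- ((b / Num.sqrt (qf S s s) + 1) ^+ 2 / 2)) <=
 fine (P [set w | b <= lin X s w]).
Proof.
by move=> q0 b0; rewrite gproc_normal// std_tail_ge// divr_ge0// sqrtr_ge0.
Qed.

End tails.

Section products.
Context {d} {T : measurableType d} (P : probability T R).
Context {d'} {T' : measurableType d'} (P' : probability T' R).

Definition prodP : probability (T * T')%type R := (P \x P')%E.

Lemma Rint_prod (F : T -> R) (G : T' -> R) : bmf F -> bmf G ->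
 \int[prodP]_z (F z.1 * G z.2) = (\int[P]_x F x) * (\int[P']_y G y).
Proof.
move=> bF bG.
have bF1 : bmf (fun z : T * T' => F z.1).
 by case: bF => mF [M hM]; split; [exact: measurableT_comp|exists M => z].
have bG2 : bmf (fun z : T * T' => G z.2).
 by case: bG => mG [M hM]; split; [exact: measurableT_comp|exists M => z].
have bFG := bmfM bF1 bG2.
have ie := bmf_integrable prodP bFG.
rewrite /Rintegral -(integral12_prod_meas1 ie) /fubini_F /=.
under eq_integral => x _.
 under eq_integral do rewrite EFinM.
 rewrite integralZl//; last exact: bmf_integrable.
 rewrite -EFin_Rint// muleC.
 over.
rewrite integralZl//; last exact: bmf_integrable.
by rewrite -EFin_Rint// -EFinM /= mulrC.
Qed.

Context {A B : Type} (X : A -> T -> R) (X' : B -> T' -> R).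
Variables (S : A -> A -> R) (S' : B -> B -> R).
Hypothesis gX : gproc P X S.
Hypothesis gX' : gproc P' X' S'.

Definition sum_proc {T0 : Type} (Y : A -> T0 -> R) (Y' : B -> T0 -> R) (c : A + B) : T0 -> R :=
 match c with inl a => Y a | inr b => Y' b end.

(** The block-diagonal covariance of two uncorrelated families placed side by side. *)
Definition sum_cov (c c' : A + B) : R :=
 match c, c' with
 | inl a, inl a' => S a a' | inr b, inr b' => S' b b' | _, _ => 0 end.

Definition lefts (s : seq (R * (A + B))) : seq (R * A) :=
 pmap (fun p => if p.2 is inl a then Some (p.1, a) else None) s.
Definition rights (s : seq (R * (A + B))) : seq (R * B) :=
 pmap (fun p => if p.2 is inr a then Some (p.1, a) else None) s.

Lemma lin_sum {T0 : Type} (Y : A -> T0 -> R) (Y' : B -> T0 -> R) s w :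
 lin (sum_proc Y Y') s w = lin Y (lefts s) w + lin Y' (rights s) w.
Proof.
elim: s => [|[c [a|b]] s IH]; first by rewrite !lin_nil addr0.
 rewrite /= {1}/lin big_cons -/(lin _ _ _) IH addrA; congr (_ + _).
 by rewrite {2}/lin big_cons.
rewrite /= {1}/lin big_cons -/(lin _ _ _) IH addrCA; congr (_ + _).
by rewrite [in RHS]/lin big_cons.
Qed.

Lemma qf_sum s t :
 qf sum_cov s t = qf S (lefts s) (lefts t) + qf S' (rights s) (rights t).
Proof.
elim: s => [|[c [a|b]] s IH]; first by rewrite !qf_nill addr0.
 rewrite /= {1}/qf big_cons -/(qf _ _ _) IH addrA; congr (_ + _).
 rewrite {2}/qf big_cons; congr (_ + _).
 elim: t {IH} => [|[c' [a'|b']] t IH]; rewrite ?big_nil// !big_cons/= ?IH ?big_cons//.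
 by rewrite mulr0 add0r.
rewrite /= {1}/qf big_cons -/(qf _ _ _) IH addrCA; congr (_ + _).
rewrite [in RHS]/qf big_cons; congr (_ + _).
elim: t {IH} => [|[c' [a'|b']] t IH]; rewrite ?big_nil// !big_cons/= ?IH ?big_cons//.
by rewrite mulr0 add0r.
Qed.

Lemma gproc_prod :
 gproc prodP (sum_proc (fun a z => X a z.1) (fun b z => X' b z.2)) sum_cov.
Proof.
split=> [[a|b]|s] /=.
- by apply: measurableT_comp => //; exact: (gproc_measurable gX).
- by apply: measurableT_comp => //; exact: (gproc_measurable gX').
have e z : lin (sum_proc (fun a z => X a z.1) (fun b z => X' b z.2)) s z =
  lin X (lefts s) z.1 + lin X' (rights s) z.2.
 by rewrite lin_sum /lin.
have m1 := gproc_mlin gX (lefts s); have m2 := gproc_mlin gX' (rights s).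
have b1 (F : T -> R) : bmf F -> bmf (fun z : T * T' => F z.1).
 by case=> mF [M hM]; split; [exact: measurableT_comp|exists M => z].
have b2 (F : T' -> R) : bmf F -> bmf (fun z : T * T' => F z.2).
 by case=> mF [M hM]; split; [exact: measurableT_comp|exists M => z].
have [c1 s1] := gX.2 (lefts s); have [c2 s2] := gX'.2 (rights s).
split.
- under eq_Rintegral do rewrite e cosD.
 rewrite RintB; last 2 first.
 + by apply: bmfM; [apply: (b1 (fun x => cos (lin X (lefts s) x))); exact: bmf_cos|apply: (b2 (fun x => cos (lin X' (rights s) x))); exact: bmf_cos].
 + by apply: bmfM; [apply: (b1 (fun x => sin (lin X (lefts s) x))); exact: bmf_sin|apply: (b2 (fun x => sin (lin X' (rights s) x))); exact: bmf_sin].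
 rewrite (Rint_prod (bmf_cos m1) (bmf_cos m2)) (Rint_prod (bmf_sin m1) (bmf_sin m2)).
 by rewrite c1 c2 s1 s2 mulr0 subr0 -expRD qf_sum mulrDl opprD.
- under eq_Rintegral do rewrite e sinD.
 rewrite RintD; last 2 first.
 + by apply: bmfM; [apply: (b1 (fun x => sin (lin X (lefts s) x))); exact: bmf_sin|apply: (b2 (fun x => cos (lin X' (rights s) x))); exact: bmf_cos].
 + by apply: bmfM; [apply: (b1 (fun x => cos (lin X (lefts s) x))); exact: bmf_cos|apply: (b2 (fun x => sin (lin X' (rights s) x))); exact: bmf_sin].
 rewrite (Rint_prod (bmf_sin m1) (bmf_cos m2)) (Rint_prod (bmf_cos m1) (bmf_sin m2)).
 by rewrite s1 s2 mulr0 mul0r addr0.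
Qed.

End products.

Definition inlc {A B : Type} (c : seq (R * A) * R) : seq (R * (A + B)) * R :=
 ([seq (p.1, inl p.2) | p <- c.1], c.2).
Definition inrc {A B : Type} (c : seq (R * B) * R) : seq (R * (A + B)) * R :=
 ([seq (p.1, inr p.2) | p <- c.1], c.2).

Lemma poly_event_sum {A B T : Type} (X : A -> T -> R) (X' : B -> T -> R) cs cs' :
 polyh (sum_proc X X') (map inlc cs ++ map inrc cs') =
 polyh X cs `&` polyh X' cs'.
Proof.
apply/funext => w; rewrite /polyh /setI /= all_cat !all_map.
rewrite (_ : all _ cs = all (fun c => c.2 <= lin X c.1 w) cs); last first.
 by apply: eq_all => c /=; rewrite /lin big_map.
rewrite (_ : all _ cs' = all (fun c => c.2 <= lin X' c.1 w) cs'); last first.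
 by apply: eq_all => c /=; rewrite /lin big_map.
by apply/propext; split=> [/andP[]|[-> ->]].
Qed.

(** Uncorrelated jointly Gaussian families have the law of independent copies on the product space,
    where the event is a rectangle. *)
Lemma gproc_indep {A B : Type} {d} {T : measurableType d} (P : probability T R)
  (X : A -> T -> R) (X' : B -> T -> R) S S' cs cs' :
 gproc P (sum_proc X X') (sum_cov S S') ->
 fine (P (polyh X cs `&` polyh X' cs')) =
 fine (P (polyh X cs)) * fine (P (polyh X' cs')).
Proof.
move=> gXX.
have gX : gproc P X S := gproc_reindex gXX inl.
have gX' : gproc P X' S' := gproc_reindex gXX inr.
have gp := gproc_prod gX gX'.
rewrite -poly_event_sum (gproc_law _ gXX gp)// poly_event_sum.
have m1 := measurable_polyh cs (gproc_measurable gX).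
have m2 := measurable_polyh cs' (gproc_measurable gX').
rewrite (_ : _ `&` _ = polyh X cs `*` polyh X' cs')//.
transitivity (fine (P (polyh X cs) * P (polyh X' cs'))%E).
 by congr fine; exact: product_measure1E.
by rewrite fineM//; exact: fin_num_measure.
Qed.

End gaussian_processes.

(** * Images of probability measures *)

Section image_measures.
Context {R : realType} {d} {T : measurableType d} (P : probability T R).
Context {d'} {T' : measurableType d'} (phi : {mfun T >-> T'}).

Definition image_prob : probability T' R := distribution P phi.

Lemma Rint_image (F : T' -> R) : bmf F ->
 \int[image_prob]_y F y = \int[P]_x F (phi x).
Proof.
move=> [mF [M hM]].
have bF : bmf (F \o phi) by split; [exact: measurableT_comp|exists M => w; exact: hM].
rewrite /Rintegral /image_prob; congr fine.
rewrite (@integral_distribution _ _ _ _ _ P phi (EFin \o F))//.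
 exact/measurable_EFinP.
exact: (bmf_integrable P bF).
Qed.

Lemma gproc_image {A : Type} (X : A -> T' -> R) S :
 (forall a, mble (X a)) ->
 gproc P (fun a x => X a (phi x)) S -> gproc image_prob X S.
Proof.
move=> mX gX; split=> // s.
have mlX : mble (lin X s) by exact: measurable_lin.
have [h1 h2] := gX.2 s; split.
- by rewrite (Rint_image (bmf_cos mlX)).
- by rewrite (Rint_image (bmf_sin mlX)).
Qed.

End image_measures.

(** * Standard Gaussian vectors and factorisation of covariances *)

Section standard_gaussian.
Context {R : realType}.

Definition rV_consM n : {mfun ('rV[R]_n * measurableTypeR R)%type >-> 'rV[R]_n.+1} :=
 mfun_Sub (mem_set (@measurable_rV_cons R n)).

Lemma rV_consME n z : rV_consM n z = rV_cons z.
Proof. by []. Qed.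

Let N1 : probability (measurableTypeR R) R := normal_prob (0 : R) 1.

(** Built one coordinate at a time, so that [prekopa_gauss] and [gauss_rV_orthant] can reduce to
    dimension one by Fubini. *)
Fixpoint gauss (n : nat) : probability 'rV[R]_n R :=
 match n with
 | 0 => dirac (0 : 'rV[R]_0)
 | n'.+1 => image_prob (prodP (gauss n') N1) (rV_consM n')
 end.

Definition coord n (i : 'I_n) (x : 'rV[R]_n) : R := x 0 i.

Lemma measurable_coordR n i : mble (@coord n i).
Proof. exact: (@measurable_coord R n i). Qed.

Lemma gauss_rV_gproc n : gproc (gauss n) (@coord n) (fun i j => (i == j)%:R).
Proof.
elim: n => [|n IH].
 split=> [i|s]; first exact: measurable_coordR.
 have -> : s = [::] by case: s => // -[c []].
 rewrite qf_nill mul0r oppr0 expR0; split.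
  by under eq_Rintegral do rewrite lin_nil cos0; rewrite Rint_cst.
 by under eq_Rintegral do rewrite lin_nil sin0; rewrite Rint_cst.
apply: gproc_image => [i|]; first exact: measurable_coordR.
pose g (i : 'I_n.+1) : 'I_n + unit := if unlift ord0 i is Some j then inl j else inr tt.
have := gproc_reindex (gproc_prod IH std_normal_gproc) g.
rewrite (_ : (fun b => _) = (fun i x => coord i (rV_consM n x))); last first.
 apply/funext => i; apply/funext => x; rewrite rV_consME /coord /rV_cons mxE /g.
 by case: (unlift ord0 i).
rewrite (_ : (fun b b' => _) = (fun i j : 'I_n.+1 => (i == j)%:R))//.
apply/funext => i; apply/funext => j; rewrite /g.
by case: unliftP => [i'|] ->; case: unliftP => [j'|] -> //=;
 rewrite ?(inj_eq lift_inj) ?eqxx ?eq_liftF// eq_sym eq_liftF.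
Qed.

Lemma gauss_rV_Rint n (F : 'rV[R]_n.+1 -> R) : bmf F ->
 \int[gauss n.+1]_z F z = \int[prodP (gauss n) N1]_z F (rV_cons z).
Proof. by move=> bF; rewrite Rint_image. Qed.

(** Cholesky factorisation: induction on the Schur complement of the first diagonal entry. *)
Lemma psd_factor n (S : 'I_n -> 'I_n -> R) :
 (forall i j, S i j = S j i) ->
 (forall c : 'I_n -> R, 0 <= \sum_i \sum_j c i * c j * S i j) ->
 exists M : 'I_n -> 'I_n -> R, forall i j, S i j = \sum_k M i k * M j k.
Proof.
elim: n S => [|n IH] S sS pS; first by exists (fun _ _ => 0) => -[].
pose a := S ord0 ord0.
have split2 (c : 'I_n.+1 -> R) :
  \sum_i \sum_j c i * c j * S i j = c ord0 ^+ 2 * a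
   + 2 * c ord0 * (\sum_j c (lift ord0 j) * S ord0 (lift ord0 j))
   + \sum_i \sum_j c (lift ord0 i) * c (lift ord0 j) * S (lift ord0 i) (lift ord0 j).
 rewrite big_ord_recl big_ord_recl.
 under [X in _ + X]eq_bigr do rewrite big_ord_recl.
 rewrite big_split /= !addrA; congr (_ + _).
 rewrite -expr2 -addrA; congr (_ + _).
 rewrite -mulrA [2 * _]mulr_natl mulr2n; congr (_ + _).
  by rewrite mulr_sumr; apply: eq_bigr => j _; rewrite mulrA.
 by rewrite mulr_sumr; apply: eq_bigr => j _; rewrite sS mulrA (mulrC (c (lift _ _))).
have a0 : 0 <= a.
 have := pS (fun i => (i == ord0)%:R); rewrite split2 eqxx /= big1 ?mulr0 ?addr0; last first.
  by move=> j _; rewrite mul0r.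
 rewrite big1 ?addr0 ?expr1n ?mul1r// => i _; rewrite big1// => j _.
 by rewrite !mul0r.
(* First column of the factor. For a = 0 the division yields 0, and positivity forces the first
   column of S to vanish as well. *)
pose m i := S i ord0 / Num.sqrt a.
have mS i : S i ord0 = m i * m ord0.
 rewrite /m mulrACA -invfM -expr2 sqr_sqrtr// -/a.
 have [a00|an0] := eqVneq a 0; last by rewrite mulfK.
 rewrite a00 mulr0 mul0r.
 case: (unliftP ord0 i) => [j ->|-> //].
 apply/eqP; rewrite -[_ == _]negbK; apply/negP => Sj.
 pose b := S (lift ord0 j) (lift ord0 j).
 (* With a = 0 the form at the vector with first coordinate t and j-th coordinate 1 is 2 t S_j0 + b,
    here -1: a contradiction. *)
 pose t := - (b + 1) / (2 * S (lift ord0 j) ord0).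
 have := pS (fun i => if i == ord0 then t else (i == lift ord0 j)%:R).
 rewrite split2 /= a00 mulr0 add0r.
 rewrite (bigD1 j)//= eqxx mul1r big1 ?addr0; last first.
  by move=> k kj; rewrite (inj_eq lift_inj) (negbTE kj) mul0r.
 have -> : \sum_i \sum_k (lift ord0 i == lift ord0 j)%:R * (lift ord0 k == lift ord0 j)%:R *
   S (lift ord0 i) (lift ord0 k) = b.
  rewrite (bigD1 j)//= [X in _ + X]big1 ?addr0; last first.
   move=> k kj; rewrite big1// => l _.
   by rewrite (inj_eq lift_inj) (negbTE kj) !mul0r.
  rewrite (bigD1 j)//= big1 ?addr0; last first.
   by move=> k kj; rewrite !(inj_eq lift_inj) (negbTE kj) mulr0 mul0r.
  by rewrite eqxx !mul1r.
 rewrite sS /t.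
 have -> : 2 * (- (b + 1) / (2 * S (lift ord0 j) ord0)) * S (lift ord0 j) ord0 = - (b + 1).
  by field.
 lra.
have hs i j : S (lift ord0 i) (lift ord0 j) - m (lift ord0 i) * m (lift ord0 j) =
  S (lift ord0 j) (lift ord0 i) - m (lift ord0 j) * m (lift ord0 i).
 by rewrite sS mulrC.
have hp (c : 'I_n -> R) : 0 <= \sum_i \sum_j c i * c j *
  (S (lift ord0 i) (lift ord0 j) - m (lift ord0 i) * m (lift ord0 j)).
 (* The first coordinate that minimises the form; the minimum is the Schur complement evaluated at
    c. *)
 pose t := - (\sum_j c j * m (lift ord0 j)) / Num.sqrt a.
 have := pS (fun i => if unlift ord0 i is Some j then c j else t).
 rewrite split2 unlift_none.
 under eq_bigr do rewrite liftK.
 under [X in _ -> _ <= X]eq_bigr do under eq_bigr do rewrite mulrBr.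
 under [X in _ + X]eq_bigr do under eq_bigr do rewrite !liftK.
 under [X in _ -> _ <= X]eq_bigr do rewrite sumrB.
 rewrite sumrB.
 set Q := \sum_i \sum_j c i * c j * S _ _.
 set L := \sum_j c j * m (lift ord0 j) in t *.
 have -> : \sum_j c j * S ord0 (lift ord0 j) = L * Num.sqrt a.
  rewrite /L mulr_suml; apply: eq_bigr => j _; rewrite sS mS -mulrA; congr (_ * (_ * _)).
  rewrite /m -/a; have [->|an0] := eqVneq a 0; first by rewrite sqrtr0 mul0r.
  by rewrite -{1}(sqr_sqrtr a0) expr2 mulfK// sqrtr_eq0 -ltNge lt_def an0.
 have -> : \sum_i \sum_j c i * c j * (m (lift ord0 i) * m (lift ord0 j)) = L ^+ 2.
  rewrite expr2 /L mulr_suml; apply: eq_bigr => i _; rewrite mulr_sumr.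
  by apply: eq_bigr => j _; rewrite mulrACA.
 have [a00|an0] := eqVneq a 0.
  have L0 : L = 0 by rewrite /L big1// => j _; rewrite /m a00 sqrtr0 invr0 !mulr0.
  by rewrite a00 L0 sqrtr0 !mulr0 add0r add0r expr0n subr0.
 have sa : Num.sqrt a != 0 by rewrite sqrtr_eq0 -ltNge lt_def an0.
 have -> : t ^+ 2 * a + 2 * t * (L * Num.sqrt a) + Q = Q - L ^+ 2.
  by rewrite -{1}(sqr_sqrtr a0) /t; field.
 by [].
have [M hM] := IH _ hs hp.
exists (fun i k => if unlift ord0 k is Some k' then
  (if unlift ord0 i is Some i' then M i' k' else 0) else m i) => i j.
rewrite big_ord_recl unlift_none.
under eq_bigr do rewrite liftK.
case: (unliftP ord0 i) => [i' ->|->]; last first.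
 by rewrite big1 ?addr0; [rewrite sS mS mulrC|move=> k _; rewrite mul0r].
case: (unliftP ord0 j) => [j' ->|->]; last first.
 by rewrite big1 ?addr0; [rewrite mS|move=> k _; rewrite mulr0].
by rewrite -hM addrC subrK.
Qed.

(** Moves any finite Gaussian family onto a standard Gaussian vector, where conditioning is Fubini
    and events are convex sets of R^n. *)
Lemma gauss_rV_repr n (S : 'I_n -> 'I_n -> R) :
 (forall i j, S i j = S j i) ->
 (forall s, 0 <= qf S s s) ->
 exists g : 'I_n -> seq (R * 'I_n),
  gproc (gauss n) (fun i => lin (@coord n) (g i)) S.
Proof.
move=> sS pS.
have [c|M hM] := psd_factor sS _.
 have := pS [seq (c i, i) | i <- index_enum 'I_n].
 by rewrite /qf big_map; under eq_bigr do rewrite big_map.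
exists (fun i => [seq (M i k, k) | k <- index_enum 'I_n]).
have := gproc_map (gauss_rV_gproc n) (fun i => [seq (M i k, k) | k <- index_enum 'I_n]).
rewrite (_ : (fun b b' => _) = S)//.
apply/funext => i; apply/funext => j; rewrite hM /qf big_map; apply: eq_bigr => k _.
rewrite big_map (bigD1 k)//= eqxx mulr1 big1 ?addr0// => l lk.
by rewrite eq_sym (negbTE lk) mulr0.
Qed.

End standard_gaussian.

(** * The Prekopa inequality for Gaussian integrals *)

Section prekopa.
Context {R : realType}.
Let lam := (@lebesgue_measure R).

Definition mix {V : lmodType R} (l : R) (x y : V) : V := (1 - l) *: x + l *: y.
Definition mixR (l x y : R) : R := (1 - l) * x + l * y.

(* Log-concavity, without logarithms of 0. *)
Definition lconc {V : lmodType R} (F : V -> R) : Prop :=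
 forall l x y a b, 0 < l < 1 -> expR a <= F x -> expR b <= F y ->
  expR (mixR l a b) <= F (mix l x y).

Lemma expR_convex l a b : 0 < l < 1 ->
 expR (mixR l a b) <= mixR l (expR a) (expR b).
Proof.
move=> /andP[l0 l1]; set r := mixR l a b.
have tl x : expR r * (1 + (x - r)) <= expR x.
 have -> : expR x = expR r * expR (x - r) by rewrite -expRD addrC subrK.
 by rewrite ler_pM2l ?expR_gt0// expR_ge1Dx.
have ha := tl a; have hb := tl b.
have e : expR r = (1 - l) * (expR r * (1 + (a - r))) + l * (expR r * (1 + (b - r))).
 by rewrite /r /mixR; ring.
rewrite e /mixR; apply: lerD; rewrite ler_pM2l//; lra.
Qed.

(** One-dimensional Brunn-Minkowski inequality for bounded intervals: K contains the open interval
    between the mixture of the infima and the mixture of the suprema. *)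
Lemma length_convex_mix (I J K : set R) l : 0 < l < 1 ->
 measurable I -> measurable J -> measurable K ->
 I !=set0 -> J !=set0 ->
 is_interval I -> is_interval J -> has_ubound I -> has_lbound I ->
 has_ubound J -> has_lbound J ->
 (forall x y, I x -> J y -> K (mixR l x y)) ->
 ((1 - l)%:E * lam I + l%:E * lam J <= lam K)%E.
Proof.
move=> /andP[l0 l1] mI mJ mK I0 J0 iI iJ uI bI uJ bJ hK.
have l10 : 0 < 1 - l by rewrite subr_gt0.
have sz (E : set R) : measurable E -> E !=set0 -> has_ubound E -> has_lbound E ->
  inf E <= sup E /\ (lam E <= (sup E - inf E)%:E)%E.
 move=> mE E0 uE bE.
 have hi : inf E <= sup E.
  by case: E0 => e Ee; apply: (@le_trans _ _ e); [exact: ge_inf|exact: ub_le_sup].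
 split => //.
 apply: (@le_trans _ _ (lam `[inf E, sup E]%classic)).
  apply: le_measure; rewrite ?inE//.
  move=> e Ee; rewrite /= in_itv/=; apply/andP; split; [exact: ge_inf|exact: ub_le_sup].
 rewrite /lam lebesgue_measure_itv/= lte_fin; case: ifPn => //.
 by rewrite lee_fin subr_ge0.
have [hI sI] := sz I mI I0 uI bI; have [hJ sJ] := sz J mJ J0 uJ bJ.
pose lo := mixR l (inf I) (inf J); pose hi := mixR l (sup I) (sup J).
have sub : `]lo, hi[%classic `<=` K.
 move=> u; rewrite /= in_itv/= => /andP[lu uh].
 pose e := u - lo; pose e' := hi - u.
 have e0 : 0 < e by rewrite subr_gt0.
 have e'0 : 0 < e' by rewrite subr_gt0.
 have [x1 Ix1 hx1] := inf_adherent e0 (conj I0 bI).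
 have [y1 Jy1 hy1] := inf_adherent e0 (conj J0 bJ).
 have [x2 Ix2 hx2] := sup_adherent e'0 (conj I0 uI).
 have [y2 Jy2 hy2] := sup_adherent e'0 (conj J0 uJ).
 have h1 : mixR l x1 y1 < u.
  have -> : u = mixR l (inf I + e) (inf J + e) by rewrite /mixR /e /lo /mixR; ring.
  by rewrite /mixR; apply: ltrD; rewrite ltr_pM2l.
 have h2 : u < mixR l x2 y2.
  have -> : u = mixR l (sup I - e') (sup J - e') by rewrite /mixR /e' /hi /mixR; ring.
  by rewrite /mixR; apply: ltrD; rewrite ltr_pM2l.
 pose D := mixR l x2 y2 - mixR l x1 y1.
 have D0 : 0 < D by rewrite subr_gt0 (lt_trans h1).
 (* The point u lies between a mixture of points near the infima and one of points near the suprema;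
    interpolating with weight [th] inside I and inside J separately keeps both points in their
    intervals. *)
 pose th := (u - mixR l x1 y1) / D.
 have th0 : 0 <= th by rewrite divr_ge0 ?ltW// subr_gt0.
 have th1 : th <= 1 by rewrite ler_pdivrMr// mul1r /D lerD2r ltW.
 have cv (E : set R) x y : is_interval E -> E x -> E y -> E (mixR th x y).
  move=> iE Ex Ey; have [xy|yx] := leP x y.
   by apply: (iE x y) => //; rewrite /mixR; apply/andP; split; nra.
  by apply: (iE y x) => //; rewrite /mixR; apply/andP; split; nra.
 have -> : u = mixR l (mixR th x1 x2) (mixR th y1 y2).
  have -> : mixR l (mixR th x1 x2) (mixR th y1 y2) = mixR l x1 y1 + th * D.
   by rewrite /mixR /D /mixR; ring.
  by rewrite /th divfK ?gt_eqF// addrC subrK.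
 by apply: hK; apply: cv.
apply: (@le_trans _ _ (lam `]lo, hi[%classic)); last first.
 by apply: le_measure; rewrite ?inE//.
rewrite {3}/lam lebesgue_measure_itv/= lte_fin.
apply: (@le_trans _ _ ((1 - l)%:E * (sup I - inf I)%:E + l%:E * (sup J - inf J)%:E)%E).
 by apply: leeD; apply: lee_wpmul2l => //; rewrite lee_fin ltW.
rewrite -!EFinM -EFinD; case: ifPn => [_|].
 by rewrite -EFinB lee_fin le_eqVlt; apply/orP; left; apply/eqP; rewrite /hi /lo /mixR; ring.
rewrite -leNgt lee_fin /lo /hi /mixR => h.
lra.
Qed.

Lemma measurable_gt {d} {T : measurableType d} (F : T -> R) (t : R) : mble F ->
 measurable [set x | t < F x].
Proof.
move=> mF; have := mF measurableT `]t, +oo[%classic (measurable_itv _).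
by rewrite setTI; congr measurable; apply/seteqP; split=> x /=; rewrite in_itv/= andbT.
Qed.

(* The interval of integration is [0, 1] because F is at most 1. *)
Lemma layer_cake (F : R -> R) : mble F -> (forall x, 0 <= F x <= 1) ->
 (\int[lam]_x (F x)%:E = \int[lam]_(t in `]0%R, 1%R[) lam [set x | (t < F x)%R])%E.
Proof.
move=> mF F01.
have leb (c : R) : 0 <= c -> lebesgue_measure (`]0, c[%classic : set R) = c%:E.
 move=> c0; rewrite lebesgue_measure_itv/= lte_fin; case: ifPn => [_|]; first by rewrite oppr0 addr0.
 by rewrite -leNgt => c0'; congr _%:E; apply/eqP; rewrite eq_le c0.
pose E : set (R * R) := [set z | 0 < z.2 < F z.1].
have mE : measurable E.
 have -> : E = ((fun z : R * R => z.2) @^-1` `]0, +oo[) `&`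
   ((fun z : R * R => F z.1 - z.2) @^-1` `]0, +oo[).
  apply/seteqP; split=> z /=; rewrite !in_itv/= !andbT subr_gt0.
   by case/andP.
  by case=> z0 zF; rewrite /E /= z0 zF.
 have mG : mble (fun z : R * R => F z.1 - z.2).
  by apply: measurable_funB; [exact: (measurableT_comp mF measurable_fst)|exact: measurable_snd].
 apply: measurableI; rewrite -[X in measurable X]setTI.
  by apply: measurable_snd => //; exact: measurable_itv.
 by apply: mG => //; exact: measurable_itv.
have h := @fubini_tonelli _ _ _ _ R lam lam (fun z => (\1_E z)%:E) _ _.
have -> : (\int[lam]_x (F x)%:E = \int[lam]_x \int[lam]_y (\1_E (x, y))%:E)%E.
 apply: eq_integral => x _.
 have -> : (fun y => (\1_E (x, y))%:E) = (fun y : R => (\1_(`]0, F x[%classic) y)%:E :> \bar R).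
  apply/funext => y; rewrite (indicb (fun z : R * R => 0 < z.2 < F z.1) (x, y)).
  by rewrite (indicb (fun y => y \in `]0, F x[) y) in_itv.
 rewrite (@integral_indic _ _ R lam setT measurableT `]0, F x[%classic (measurable_itv _)).
 rewrite setIT; apply/esym/leb; by case/andP: (F01 x).
have mI : mble (fun z : measurableTypeR R * measurableTypeR R => (\1_E z)%:E : \bar R).
 by apply/measurable_EFinP; exact: measurable_indic.
have I0 (z : measurableTypeR R * measurableTypeR R) : (0 <= (\1_E z)%:E :> \bar R)%E.
 by rewrite lee_fin indicE.
rewrite (h mI I0).
rewrite [RHS]integral_mkcond; apply: eq_integral => t _.
rewrite patchE; case: ifPn => [|/negP].
 rewrite inE/= in_itv/= => /andP[t0 t1].
 rewrite (_ : (fun x => _) = (fun x : R => (\1_[set x | t < F x] x)%:E :> \bar R)).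
  rewrite (@integral_indic _ _ R lam setT measurableT _ (measurable_gt _ _)) ?setIT//.
 apply/funext => x; rewrite (indicb (fun z : R * R => 0 < z.2 < F z.1) (x, t)).
 by rewrite (indicb (fun x => t < F x) x) /= t0.
move=> ht; rewrite (_ : (fun x => _) = cst 0%E); first by rewrite integral0.
apply/funext => x; rewrite (indicb (fun z : R * R => 0 < z.2 < F z.1) (x, t)) /=.
have [/andP[t0 tF]|//] := boolP (0 < t < F x); case: ht.
by rewrite inE/= in_itv/= t0/=; case/andP: (F01 x) => _; exact: lt_le_trans.
Qed.

Lemma measurable_layer (F : R -> R) : mble F ->
 mble (fun t : R => lam [set x | t < F x]).
Proof.
move=> mF; pose E : set (R * R) := [set z | z.2 < F z.1].
have mE : measurable E.
 have -> : E = ((fun z : R * R => F z.1 - z.2) @^-1` `]0, +oo[).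
  by apply/seteqP; split=> z /=; rewrite in_itv/= andbT subr_gt0.
 have mG : mble (fun z : R * R => F z.1 - z.2).
  by apply: measurable_funB; [exact: (measurableT_comp mF measurable_fst)|exact: measurable_snd].
 by rewrite -[X in measurable X]setTI; apply: mG => //; exact: measurable_itv.
have := measurable_fun_ysection lam mE.
by congr (mble _); apply/funext => t /=; congr (lam _);
 apply/seteqP; split=> x; rewrite /ysection/= inE.
Qed.

(** Once f and g are divided by their suprema, their superlevel sets are nonempty at every level in
    (0, 1), so the inequality of lengths holds level by level and integrates to an arithmetic-mean
    bound. Convexity of the exponential turns it into the geometric one, and the constant C restores
    the suprema. *)
Lemma prekopa1 (f g h : R -> R) (l a b : R) : 0 < l < 1 ->
 bmf f -> bmf g -> bmf h ->
 (forall x, 0 <= f x) -> (forall x, 0 <= g x) -> (forall x, 0 <= h x) ->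
 (forall t, 0 < t -> exists M, forall x, t < f x -> `|x| <= M) ->
 (forall t, 0 < t -> exists M, forall x, t < g x -> `|x| <= M) ->
 (forall t, 0 < t -> is_interval [set x | t < f x]) ->
 (forall t, 0 < t -> is_interval [set x | t < g x]) ->
 lam.-integrable setT (EFin \o f) -> lam.-integrable setT (EFin \o g) ->
 lam.-integrable setT (EFin \o h) ->
 (forall x y a b, expR a <= f x -> expR b <= g y ->
  expR (mixR l a b) <= h (mixR l x y)) ->
 expR a <= \int[lam]_x f x -> expR b <= \int[lam]_x g x ->
 expR (mixR l a b) <= \int[lam]_x h x.
Proof.
move=> l01 bf bg bh f0 g0 h0 tf tg qf' qg intf intg inth H ha hb.
have /andP[l0 l1] := l01.
have supP (F : R -> R) c : bmf F -> (forall x, 0 <= F x) -> expR c <= \int[lam]_x F x ->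
  has_sup (range F) /\ 0 < sup (range F).
 move=> bF F0 hc.
 have hs : has_sup (range F).
  split; first by exists (F 0), 0.
  by have [M _ hM] := bmf_ge0 bF; exists M => _ [x _ <-]; rewrite (le_trans (ler_norm _)).
 split=> //; rewrite ltNge; apply/negP => s0.
 have Fz x : F x = 0.
  apply/eqP; rewrite eq_le F0 andbT (le_trans _ s0)//.
  by apply: ub_le_sup; [case: hs|exists x].
 move: hc; rewrite (_ : F = cst 0); last exact/funext.
 by rewrite /Rintegral integral0/= leNgt expR_gt0.
have [sf A0] := supP f a bf f0 ha; have [sg B0] := supP g b bg g0 hb.
set A := sup (range f) in A0; set B := sup (range g) in B0.
have fA x : f x <= A by apply: ub_le_sup; [case: sf|exists x].
have gB x : g x <= B by apply: ub_le_sup; [case: sg|exists x].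
pose C := expR (mixR l (ln A) (ln B)).
have C0 : 0 < C by exact: expR_gt0.
(* The cap at 1 in [h1] is what [layer_cake] asks for; it is harmless since h is only bounded from
   below. *)
pose f1 x := f x / A; pose g1 x := g x / B; pose h1 x := Num.min (h x / C) 1.
have mf1 : mble f1 by apply: measurable_funM => //; case: bf.
have mg1 : mble g1 by apply: measurable_funM => //; case: bg.
have mh1 : mble h1.
 by apply: measurable_minr => //; apply: measurable_funM => //; case: bh.
have f101 x : 0 <= f1 x <= 1 by rewrite /f1 divr_ge0 ?(ltW A0)//= ler_pdivrMr// mul1r.
have g101 x : 0 <= g1 x <= 1 by rewrite /g1 divr_ge0 ?(ltW B0)//= ler_pdivrMr// mul1r.
have h101 x : 0 <= h1 x <= 1.
 by rewrite /h1 le_min ler01 andbT divr_ge0 ?(ltW C0)//= ge_min lexx orbT.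
have key : ((1 - l)%:E * (\int[lam]_x (f1 x)%:E) + l%:E * (\int[lam]_x (g1 x)%:E) <= \int[lam]_x (h1 x)%:E)%E.
 rewrite !layer_cake//.
 have l10 : 0 <= 1 - l by rewrite subr_ge0 ltW.
 rewrite -!ge0_integralZl_EFin ?(ltW l0)//; last 2 first.
 - by apply: measurable_funTS; exact: measurable_layer.
 - by apply: measurable_funTS; exact: measurable_layer.
 rewrite -ge0_integralD//; last 4 first.
 - by move=> t _; apply: mule_ge0 => //; rewrite lee_fin.
 - by apply: measurable_funeM; apply: measurable_funTS; exact: measurable_layer.
 - by move=> t _; apply: mule_ge0 => //; rewrite lee_fin ltW.
 - by apply: measurable_funeM; apply: measurable_funTS; exact: measurable_layer.
 apply: ge0_le_integral => //.
 - by move=> t _; apply: adde_ge0; apply: mule_ge0 => //; rewrite lee_fin// ltW.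
 - by apply: emeasurable_funD; apply: measurable_funeM; apply: measurable_funTS; exact: measurable_layer.
 - by apply: measurable_funTS; exact: measurable_layer.
 move=> t; rewrite /= in_itv/= => /andP[t0 t1].
 have lvl (F : R -> R) K : 0 < K -> [set x | t < F x / K] = [set x | t * K < F x].
  by move=> K0; apply/seteqP; split=> x /=; rewrite ltr_pdivlMr.
 have ne (F : R -> R) : has_sup (range F) -> 0 < sup (range F) ->
  [set x | t < F x / sup (range F)] !=set0.
  move=> sF S0; rewrite lvl//.
  have e0 : 0 < (1 - t) * sup (range F) by rewrite mulr_gt0// subr_gt0.
  have [_ [x _ <-] hx] := sup_adherent e0 sF; exists x => /=.
  by move: hx; rewrite mulrBl mul1r opprB addrC subrK.
 have bd (F : R -> R) K : 0 < K -> (forall t, 0 < t -> exists M, forall x, t < F x -> `|x| <= M) ->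
  has_ubound [set x | t < F x / K] /\ has_lbound [set x | t < F x / K].
  move=> K0 tF; rewrite lvl//; have [M hM] := tF (t * K) (mulr_gt0 t0 K0).
  split; [exists M|exists (- M)] => x /= /hM; rewrite ler_norml => /andP[]//.
 have [ubf lbf] := bd f A A0 tf; have [ubg lbg] := bd g B B0 tg.
 apply: length_convex_mix => //.
 - exact: measurable_gt.
 - exact: measurable_gt.
 - exact: measurable_gt.
 - exact: ne.
 - exact: ne.
 - by rewrite lvl//; apply: qf'; exact: mulr_gt0.
 - by rewrite lvl//; apply: qg; exact: mulr_gt0.
 move=> x y /= tx ty; rewrite /h1 lt_min t1 andbT ltr_pdivlMr//.
 move: tx ty; rewrite !ltr_pdivlMr// => tx ty.
 have fx0 : 0 < f x by rewrite (le_lt_trans _ tx)// mulr_ge0// ltW.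
 have gy0 : 0 < g y by rewrite (le_lt_trans _ ty)// mulr_ge0// ltW.
 have := H x y (ln (f x)) (ln (g y)); rewrite !lnK ?posrE// => /(_ (lexx _) (lexx _)).
 apply: lt_le_trans.
 rewrite -[t]lnK ?posrE// -expRD ltr_expR.
 have h3 : ln t + ln A < ln (f x) by rewrite -lnM ?posrE// ltr_ln ?posrE// mulr_gt0.
 have h4 : ln t + ln B < ln (g y) by rewrite -lnM ?posrE// ltr_ln ?posrE// mulr_gt0.
 by rewrite /mixR; nra.
have iZ (F : R -> R) k : lam.-integrable setT (EFin \o F) -> lam.-integrable setT (EFin \o (fun x => F x / k)).
 move=> iF; rewrite (_ : EFin \o _ = (fun x => (k^-1)%:E * (F x)%:E)%E); first exact: integrableZl.
 by apply/funext => x /=; rewrite mulrC EFinM.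
have ih1 : lam.-integrable setT (EFin \o h1).
 apply: (le_integrable measurableT _ _ (iZ h C inth)) => //; first exact/measurable_EFinP.
 move=> x _ /=; rewrite lee_fin ger0_norm; last by case/andP: (h101 x).
 by rewrite (le_trans _ (ler_norm _))// /h1 ge_min lexx.
have if1 := iZ f A intf; have ig1 := iZ g B intg.
have key2 : (1 - l) * (\int[lam]_x f1 x) + l * (\int[lam]_x g1 x) <= \int[lam]_x h1 x.
 rewrite -lee_fin EFinD !EFinM /Rintegral !fineK//; exact: integrable_fin_num.
have e1 : \int[lam]_x f1 x = (\int[lam]_x f x) / A by rewrite RintegralZr.
have e2 : \int[lam]_x g1 x = (\int[lam]_x g x) / B by rewrite RintegralZr.
have e3 : C * (\int[lam]_x h1 x) <= \int[lam]_x h x.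
 rewrite -RintegralZl//; apply: le_Rintegral => //.
  rewrite (_ : EFin \o _ = (fun x => C%:E * (h1 x)%:E)%E); first exact: integrableZl.
  by apply/funext => x /=; rewrite EFinM.
 move=> x _; rewrite mulrC -ler_pdivlMr// /h1 ge_min lexx//.
apply: le_trans e3; apply: (@le_trans _ _ (C * mixR l (expR (a - ln A)) (expR (b - ln B)))).
 have -> : mixR l a b = mixR l (ln A) (ln B) + mixR l (a - ln A) (b - ln B).
  by rewrite /mixR; ring.
 rewrite expRD ler_pM2l//; exact: expR_convex.
rewrite ler_pM2l//; apply: le_trans key2; rewrite e1 e2 /mixR.
rewrite !expRD !expRN !lnK ?posrE//.
by apply: lerD; rewrite ler_pM2l ?subr_gt0// ler_pM2r ?invr_gt0.
Qed.

Let N1 : probability (measurableTypeR R) R := normal_prob (0 : R) 1.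

Definition lconc2 {U V : lmodType R} (F : U -> V -> R) : Prop :=
 forall l x y u v a b, 0 < l < 1 -> expR a <= F x u -> expR b <= F y v ->
  expR (mixR l a b) <= F (mix l x y) (mix l u v).

Lemma mix_id {V : lmodType R} l (u : V) : mix l u u = u.
Proof. by rewrite /mix -scalerDl subrK scale1r. Qed.

(** The normal density is log-concave, so F(x, v) p(x) is jointly log-concave; its superlevel sets
    in x are therefore intervals, bounded because (1 + x^2) p(x) is bounded. *)
Lemma prekopa_normal {V : lmodType R} (F : R^o -> V -> R) :
 (forall v, mble (F^~ v : R -> R)) ->
 (forall x v, 0 <= F x v <= 1) -> lconc2 F ->
 lconc (fun v => \int[N1]_x F x v).
Proof.
move=> mF F01 lF l u v a b l01.
have o0 : (1 : R) != 0 by exact: oner_neq0.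
pose p : R -> R := normal_pdf 0 1.
have bF w : bmf (F^~ w : R -> R).
 split; first exact: mF.
 by exists 1 => x; have /andP[h0 h1] := F01 x w; rewrite ger0_norm.
rewrite !(normal_Rint 1 (bF _)).
have bp : bmf p.
 split; first exact: measurable_npdf.
 exists (normal_peak 1) => x; rewrite ger0_norm ?normal_pdf_ge0//; exact: normal_pdf_ub.
have bFp w : bmf (fun x : R => F x w * p x) by apply: bmfM.
have Fp0 w x : 0 <= F x w * p x by have /andP[h0 _] := F01 x w; rewrite mulr_ge0 ?normal_pdf_ge0.
have p0 x : 0 < p x by rewrite /p npdfE// mulr_gt0 ?expR_gt0// normal_peak_gt0.
have lnp x : ln (p x) = ln (normal_peak 1) - x ^+ 2 / 2.
 rewrite /p npdfE// lnM ?posrE ?normal_peak_gt0 ?expR_gt0// expRK expr1n.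
 by rewrite mulNr.
have lp m x y : 0 < m < 1 -> mixR m (ln (p x)) (ln (p y)) <= ln (p (mixR m x y)).
 move=> /andP[m0 m1]; rewrite !lnp -subr_ge0.
 rewrite (_ : _ - _ = m * (1 - m) * (x - y) ^+ 2 / 2); last by rewrite /mixR; field.
 by rewrite divr_ge0// mulr_ge0 ?sqr_ge0// mulr_ge0 ?subr_ge0// ltW.
have lFp m x y w w' c c' : 0 < m < 1 -> expR c <= F x w * p x -> expR c' <= F y w' * p y ->
  expR (mixR m c c') <= F (mixR m x y) (mix m w w') * p (mixR m x y).
 move=> m01 h1 h2; have /andP[m0 m1] := m01.
 have h3 : expR (mixR m (c - ln (p x)) (c' - ln (p y))) <= F (mixR m x y) (mix m w w').
  by apply: lF => //; rewrite expRD expRN lnK ?posrE// ler_pdivrMr.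
 rewrite -[p (mixR m x y)]lnK ?posrE//.
 apply: (@le_trans _ _ (expR (mixR m (c - ln (p x)) (c' - ln (p y))) * expR (mixR m (ln (p x)) (ln (p y))))).
  by rewrite -expRD ler_expR /mixR le_eqVlt; apply/orP; left; apply/eqP; ring.
 by rewrite ler_pM ?expR_ge0// ler_expR lp.
have tail w t : 0 < t -> exists M, forall x : R, t < F x w * p x -> `|x| <= M.
 move=> t0; have [D D0 hD] := npdf_tail o0.
 pose k := normal_peak (2 * 1 : R).
 exists (D * k / t) => x hx; rewrite ler_pdivlMr//.
 apply: (@le_trans _ _ ((1 + x ^+ 2) * p x)); last first.
  rewrite (le_trans (hD x))// ler_wpM2l// normal_pdf_ub// mulr1 pnatr_eq0//.
 apply: ler_pM => //; [exact: ltW|exact: leD1|].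
 rewrite (le_trans (ltW hx))// -[leRHS]mul1r ler_wpM2r ?(ltW (p0 _))//.
 by case/andP: (F01 x w).
have itv w t : 0 < t -> is_interval [set x : R | t < F x w * p x].
 move=> t0 x y /= tx ty z /andP[xz zy].
 have [->//|xz'] := eqVneq z x; have [->//|zy'] := eqVneq z y.
 have {}xz : x < z by rewrite lt_neqAle eq_sym xz' xz.
 have {}zy : z < y by rewrite lt_neqAle zy' zy.
 have xy : 0 < y - x by rewrite subr_gt0 (lt_trans xz).
 pose m := (z - x) / (y - x).
 have m01 : 0 < m < 1.
  by apply/andP; split; [rewrite divr_gt0// subr_gt0|rewrite ltr_pdivrMr// mul1r ltrD2r].
 have /andP[m0 m1] := m01.
 have ez : z = mixR m x y by rewrite /mixR /m; field; rewrite gt_eqF.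
 have fx0 := lt_trans t0 tx; have fy0 := lt_trans t0 ty.
 have := lFp m x y w w (ln (F x w * p x)) (ln (F y w * p y)) m01.
 rewrite !lnK ?posrE// mix_id -ez => /(_ (lexx _) (lexx _)); apply: lt_le_trans.
 rewrite -[t in X in X < _]lnK ?posrE// ltr_expR /mixR.
 have h1 : ln t < ln (F x w * p x) by rewrite ltr_ln ?posrE.
 have h2 : ln t < ln (F y w * p y) by rewrite ltr_ln ?posrE.
 by nra.
have iFp w : lam.-integrable setT (EFin \o (fun x => F x w * p x)).
 apply: (@integrable_dom _ 1 o0 (F^~ w) 1) => [|x]; first exact: mF.
 by rewrite mul1r; have /andP[h0 h1] := F01 x w; rewrite ger0_norm// (le_trans h1)// le1D.
apply: prekopa1 => //.
- by move=> t t0; exact: tail.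
- by move=> t t0; exact: tail.
- by move=> t t0; exact: itv.
- by move=> t t0; exact: itv.
- by move=> x y c c'; exact: lFp.
Qed.

Lemma mix_rV_cons n l (x x' : 'rV[R]_n) (y y' : R) :
 rV_cons (mix l x x', mixR l y y') = mix l (rV_cons (x, y)) (rV_cons (x', y')) :> 'rV[R]_n.+1.
Proof.
apply/rowP => i; rewrite /mix /rV_cons !mxE /=; case: (unlift ord0 i) => [j|] /=; last by [].
by rewrite !mxE.
Qed.

(** The newest coordinate is integrated out first, the remaining ones being joined to the parameter
    v; the result is again jointly log-concave, which feeds the induction. *)
Lemma prekopa_gauss n {V : lmodType R} (F : 'rV[R]_n -> V -> R) :
 (forall v, mble (F^~ v)) ->
 (forall x v, 0 <= F x v <= 1) -> lconc2 F ->
 lconc (fun v => \int[gauss n]_x F x v).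
Proof.
elim: n F => [|n IH] F mF F01 lF.
 have e v : \int[gauss 0]_x F x v = F 0 v.
  rewrite /Rintegral /= integral_dirac//; last exact/measurable_EFinP.
  by rewrite diracE mem_set// mul1e.
 move=> l u v a b l01; rewrite !e => h1 h2.
 by have := lF l 0 0 u v a b l01 h1 h2; rewrite mix_id.
have bF v : bmf (F^~ v).
 split; first exact: mF.
 by exists 1 => x; have /andP[h0 h1] := F01 x v; rewrite ger0_norm.
pose H (x : 'rV[R]_n) v := \int[N1]_y F (rV_cons (x, y)) v.
have bFc v : bmf (fun z : 'rV[R]_n * measurableTypeR R => F (rV_cons z) v).
 split; last by exists 1 => z; have /andP[h0 h1] := F01 (rV_cons z) v; rewrite ger0_norm.
 by apply: (measurableT_comp (mF v)); exact: measurable_rV_cons.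
have ie v := bmf_integrable (prodP (gauss n) N1) (bFc v).
have bFx x v : bmf (fun y : measurableTypeR R => F (rV_cons (x, y)) v).
 split; last by exists 1 => z; have /andP[h0 h1] := F01 (rV_cons (x, z)) v; rewrite ger0_norm.
 by apply: (measurableT_comp (bFc v).1); exact: measurable_pair1.
have e v : \int[gauss n.+1]_x F x v = \int[gauss n]_x H x v.
 rewrite gauss_rV_Rint// /Rintegral -(integral12_prod_meas1 (ie v)); congr fine.
 by apply: eq_integral => x _; rewrite /fubini_F /H EFin_Rint.
have H01 x v : 0 <= H x v <= 1.
 rewrite /H Rintegral_ge0//=; last by move=> y _; case/andP: (F01 (rV_cons (x, y)) v).
 rewrite -(Rint_cst N1 1); apply: le_Rint => //; first exact: bmf_cst.
 by move=> y; case/andP: (F01 (rV_cons (x, y)) v).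
have mH v : mble (H^~ v).
 apply/measurable_EFinP; have := measurable_fubini_F (ie v).
 by congr (mble _); apply/funext => x; rewrite /fubini_F /H /= EFin_Rint.
move=> l u v a b l01; rewrite !e; apply: IH => //.
move=> {}l x y {}u {}v {}a {}b {}l01.
pose F' (t : R^o) (w : ('rV[R]_n * V)%type) : R := F (rV_cons (w.1, t)) w.2.
have := @prekopa_normal ('rV[R]_n * V)%type F' _ _ _ l (x, u) (y, v) a b l01.
apply.
- by move=> w; case: (bFx w.1 w.2).
- by move=> t w; exact: F01.
- move=> m s t w w' c c' m01 h1 h2.
 have := lF m _ _ _ _ _ _ m01 h1 h2.
 by rewrite -mix_rV_cons.
Qed.

End prekopa.

(** * The Sidak inequality for symmetric strips *)

Section sidak.
Context {R : realType}.

Definition bands {A T : Type} (X : A -> T -> R) (ss : seq (seq (R * A) * R)) : set T :=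
 [set w | all (fun p => `|lin X p.1 w| <= p.2) ss].

Definition strips {A : Type} (ss : seq (seq (R * A) * R)) : seq (seq (R * A) * R) :=
 flatten [seq [:: (p.1, - p.2); (scal (-1) p.1, - p.2)] | p <- ss].

Lemma strip_poly {A T : Type} (X : A -> T -> R) ss :
 bands X ss = polyh X (strips ss).
Proof.
apply/funext => w; rewrite /bands /polyh /=; congr is_true.
elim: ss => // p ss IH /=; rewrite IH lin_scal mulN1r lerN2 ler_norml.
by case: (- _ <= _); case: (_ <= p.2).
Qed.

Lemma strip_indic {A T : Type} (X : A -> T -> R) ss w :
 \1_(bands X ss) w = (all (fun p => `|lin X p.1 w| <= p.2) ss)%:R :> R.
Proof.
rewrite indicE; congr (_%:R); rewrite /bands.
by case: (boolP (all _ _)) => h; [rewrite mem_set|rewrite memNset//; exact/negP].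
Qed.

Lemma measurable_strip {A : Type} {d} {T : measurableType d} (X : A -> T -> R) ss :
 (forall a, mble (X a)) -> measurable (bands X ss).
Proof. by rewrite strip_poly; exact: measurable_polyh. Qed.

(** The point w is a mixture of w0 and - w0, at which th takes the same value. *)
Lemma even_lconc (th : R^o -> R) (w w0 : R) : lconc th ->
 (forall x, 0 <= th x) -> (forall x, th (- x) = th x) -> `|w| <= `|w0| -> th w0 <= th w.
Proof.
move=> lt t0 te ww0.
have [-> //|tn] := eqVneq (th w0) 0.
have tp : 0 < th w0 by rewrite lt_def tn t0.
have [w00|w0n] := eqVneq w0 0.
 by move: ww0; rewrite w00 normr0 normr_le0 => /eqP ->.
wlog wp : w0 ww0 tn tp w0n / 0 < w0.
 move=> h; have [w0p|w0m] := ltP 0 w0; first exact: h.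
 by rewrite -te; apply: h; rewrite ?normrN ?te ?oppr_eq0// oppr_gt0 lt_def eq_sym w0n.
move: ww0; rewrite (gtr0_norm wp) ler_norml => /andP[hl hu].
have [->//|wne] := eqVneq w w0.
have [->|wne'] := eqVneq w (- w0); first by rewrite te.
have {}hl : - w0 < w by rewrite lt_neqAle eq_sym wne'.
have {}hu : w < w0 by rewrite lt_neqAle wne.
pose l := (1 - w / w0) / 2.
have h1 : w / w0 < 1 by rewrite ltr_pdivrMr// mul1r.
have h2 : -1 < w / w0 by rewrite ltr_pdivlMr// mulN1r.
have l01 : 0 < l < 1 by rewrite /l; apply/andP; split; lra.
have := lt l w0 (- w0) (ln (th w0)) (ln (th w0)) l01.
rewrite te lnK ?posrE// => /(_ (lexx _) (lexx _)).
have -> : mixR l (ln (th w0)) (ln (th w0)) = ln (th w0) by rewrite /mixR; ring.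
rewrite lnK ?posrE// (_ : mix l _ _ = w)//.
by rewrite /mix /GRing.scale /= /l; field.
Qed.

Lemma measurable_section2 {d1 d2} {T1 : measurableType d1} {T2 : measurableType d2}
  (G : T1 -> T2 -> R) w :
 mble (fun z : T1 * T2 => G z.1 z.2) -> mble (G^~ w).
Proof.
move=> mG.
have m2 : mble (fun x : T1 => (x, w)) by exact: measurable_pair2.
exact: (measurableT_comp mG m2).
Qed.

Lemma mixR_le0 (l a c : R) : 0 < l < 1 -> a <= 0 -> c <= 0 -> mixR l a c <= 0.
Proof. by move=> /andP[l0 l1] a0 c0; rewrite /mixR; nra. Qed.

Lemma normr_mixR (l x y m : R) : 0 < l < 1 -> `|x| <= m -> `|y| <= m ->
 `|(1 - l) * x + l * y| <= m.
Proof.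
move=> /andP[l0 l1]; rewrite !ler_norml => /andP[? ?] /andP[? ?]; apply/andP; split; nra.
Qed.

Lemma normr_band (z c x : R) :
 (- c - x <= z) && (- c + x <= - z) = (`|z + x| <= c).
Proof. by rewrite ler_norml; congr (_ && _); apply/idP/idP; lra. Qed.
Lemma le_mul_subst (a b c a' b' c' : R) :
 a = a' -> b = b' -> c = c' -> a' * b' <= c' -> a * b <= c.
Proof. by move=> -> -> ->. Qed.

(** Regress all strip variables on lin X s. Given the normalised value w of the latter, the
    probability [th w] of the other strips is even and, by Prekopa, log-concave, hence nonincreasing
    in |w|. So is the indicator I of the new strip, and two functions monotone in |w| in the same
    sense are positively correlated. *)
Theorem sidak {A : Type} {d} {T : measurableType d} (P : probability T R)
  (X : A -> T -> R) (S : A -> A -> R) s b ss :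
 gproc P X S -> (forall a a', S a a' = S a' a) -> 0 < qf S s s ->
 fine (P (bands X ss)) * fine (P (bands X [:: (s, b)])) <=
 fine (P (bands X ((s, b) :: ss))).
Proof.
move=> gX sS v0; set v := qf S s s in v0.
pose K := size ss; pose d0 : seq (R * A) * R := ([::], 0).
pose sk (k : 'I_K) := (nth d0 ss k).1; pose ck (k : 'I_K) := (nth d0 ss k).2.
(* Regression coefficients and residuals; the residuals [rk] are uncorrelated with s. *)
pose bk k := qf S (sk k) s / v; pose rk k := sk k ++ scal (- bk k) s.
pose S' (i j : 'I_K) := qf S (rk i) (rk j).
pose N1 : probability (measurableTypeR R) R := normal_prob (0 : R) 1.
have gr := gproc_map gX rk.
have [g gg] : exists g : 'I_K -> seq (R * 'I_K), gproc (gauss K) (fun i => lin (@coord R K) (g i)) S'.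
 apply: gauss_rV_repr => [i j|t]; first by rewrite /S' qfC.
 exact: (gproc_qf_ge0 gr).
have gn := gproc_map (@std_normal_gproc R) (fun _ : unit => [:: (Num.sqrt v, tt)]).
have g2 := gproc_prod gg gn.
have g1 := gproc_map gX (fun c : 'I_K + unit => if c is inl k then rk k else s).
have sv : Num.sqrt v ^+ 2 = v by rewrite sqr_sqrtr// ltW.
have ecov (c c' : 'I_K + unit) :
  qf S (if c is inl k then rk k else s) (if c' is inl k then rk k else s) =
  sum_cov S' (fun b b' : unit => qf (fun _ _ : unit => 1) [:: (Num.sqrt v, tt)] [:: (Num.sqrt v, tt)]) c c'.
 have o k : qf S (rk k) s = 0.
  by rewrite /rk qf_catl qf_scall /bk mulNr divfK ?subrr// gt_eqF.
 case: c c' => [k|[]] [k'|[]] //=; [by rewrite qfC|by rewrite qf1 mulr1 -expr2 sv].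
pose X1 : 'I_K + unit -> T -> R := fun c => lin X (if c is inl k then rk k else s).
pose X2 : 'I_K + unit -> ('rV[R]_K * measurableTypeR R)%type -> R := sum_proc
 (fun a z => lin (@coord R K) (g a) z.1)
 (fun b z => lin (fun (_ : unit) (x : R) => x) [:: (Num.sqrt v, tt)] z.2).
have law ss' : fine (P (bands X1 ss')) =
  fine (prodP (gauss K) N1 (bands X2 ss')).
 by rewrite !strip_poly; apply: (gproc_law _ g1 g2) => t; apply: eq_qf.
pose st := [seq ([:: (1, inl k : 'I_K + unit); (bk k, inr tt)], ck k) | k <- enum 'I_K].
pose sb : seq (R * ('I_K + unit)) * R := ([:: (1, inr tt)], b).
have lX1 k w : lin X1 [:: (1, inl k); (bk k, inr tt)] w = lin X (sk k) w.
 rewrite {1}/lin big_cons big_seq1 /= /X1 mul1r /rk lin_cat lin_scal.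
 by rewrite mulNr subrK.
have ess : ss = [seq nth d0 ss (k : 'I_K) | k <- enum 'I_K].
 by rewrite (map_comp (nth d0 ss) val) val_enum_ord -/(mkseq _ _) mkseq_nth.
have all1 w : all (fun p => `|lin X1 p.1 w| <= p.2) st = all (fun p => `|lin X p.1 w| <= p.2) ss.
 rewrite [in RHS]ess /st !all_map; apply: eq_all => k /=; by rewrite lX1.
have eb w : lin X1 [:: (1, inr tt)] w = lin X s w by rewrite lin1 mul1r.
have -> : bands X ss = bands X1 st.
 by apply/funext => w; rewrite /bands /= all1.
have -> : bands X [:: (s, b)] = bands X1 [:: sb].
 by apply/funext => w; rewrite /bands /= eb.
have -> : bands X ((s, b) :: ss) = bands X1 (sb :: st).
 by apply/funext => w; rewrite /bands /= eb all1.
rewrite !law.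
pose aff (z : 'rV[R]_K) (w : R) k := lin (@coord R K) (g k) z + bk k * Num.sqrt v * w.
pose F (z : 'rV[R]_K) (w : R^o) : R := (all (fun k => `|aff z w k| <= ck k) (enum 'I_K))%:R.
pose I (w : R) : R := (`|Num.sqrt v * w| <= b)%R%:R.
have mX2 c : mble (X2 c) by exact: (gproc_measurable g2).
have e2 z : all (fun p => `|lin X2 p.1 z| <= p.2) st = all (fun k => `|aff z.1 z.2 k| <= ck k) (enum 'I_K).
 rewrite /st all_map; apply: eq_all => k /=.
 by rewrite {1}/lin big_cons big_seq1 /= mul1r lin1 /aff mulrA.
have e3 z : lin X2 [:: (1, inr tt)] z = Num.sqrt v * z.2 by rewrite lin1 mul1r /= lin1.
have i1 z : \1_(bands X2 st) z = F z.1 z.2 by rewrite strip_indic e2.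
have i2 z : \1_(bands X2 [:: sb]) z = I z.2 by rewrite strip_indic /= e3 andbT.
have i3 z : \1_(bands X2 (sb :: st)) z = F z.1 z.2 * I z.2.
 by rewrite strip_indic /= e3 e2 /F /I -natrM mulnb andbC.
have mst ss' : measurable (bands X2 ss') by exact: measurable_strip.
have rI ss' : fine (prodP (gauss K) N1 (bands X2 ss')) =
  \int[prodP (gauss K) N1]_z \1_(bands X2 ss') z by rewrite Rint_indic.
have E1 : fine (prodP (gauss K) N1 (bands X2 st)) =
  \int[prodP (gauss K) N1]_z (F z.1 z.2).
 by apply: etrans (rI st) _; apply: eq_Rintegral => z _; rewrite i1.
have E2 : fine (prodP (gauss K) N1 (bands X2 [:: sb])) =
  \int[prodP (gauss K) N1]_z I z.2.
 by apply: etrans (rI _) _; apply: eq_Rintegral => z _; rewrite i2.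
have E3 : fine (prodP (gauss K) N1 (bands X2 (sb :: st))) =
  \int[prodP (gauss K) N1]_z (F z.1 z.2 * I z.2).
 by apply: etrans (rI _) _; apply: eq_Rintegral => z _; rewrite i3.
apply: (le_mul_subst E1 E2 E3).
have bF : bmf (fun z : 'rV[R]_K * measurableTypeR R => F z.1 z.2).
 by apply: (eq_bmf (bmf_indic (mst st))) => z; rewrite i1.
have bI : bmf (I : measurableTypeR R -> R).
 have mI : measurable [set w : measurableTypeR R | `|Num.sqrt v * w| <= b].
  have mN : mble (fun w : R => `|Num.sqrt v * w|).
   by apply: measurableT_comp => //; exact: measurable_funM.
  have := mN measurableT `]-oo, b]%classic (measurable_itv _).
  by rewrite setTI; congr measurable; apply/seteqP; split=> w /=; rewrite in_itv.
 by apply: (eq_bmf (bmf_indic mI)) => w; rewrite (indicb (fun w => `|Num.sqrt v * w| <= b)).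
have F01 z w : 0 <= F z w <= 1 by rewrite /F; case: (all _ _); rewrite ?lexx ?ler01.
have mFz w : mble (F^~ w).
 exact: (measurable_section2 (w : measurableTypeR R) bF.1).
pose th (w : R^o) := \int[gauss K]_z F z w.
have lth : lconc th.
 apply: prekopa_gauss => // l x y u w a c l01.
 rewrite /F; case: (boolP (all _ _)) => [h1|_]; last by rewrite leNgt expR_gt0.
 case: (boolP (all (fun k => `|aff y w k| <= ck k) _)) => [h2|_]; last first.
  by move=> _ hc; have := lt_le_trans (expR_gt0 c) hc; rewrite ltxx.

 move=> ha hc; have a0 : a <= 0 by rewrite -ler_expR expR0.
 have c0 : c <= 0 by rewrite -ler_expR expR0.
 rewrite (_ : all _ _ = true).
  by rewrite -[leRHS]expR0 ler_expR; apply: mixR_le0.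
 apply/allP => k kin; have /= := allP h1 k kin; have /= := allP h2 k kin.
 have -> : aff (mix l x y) (mix l u w) k = (1 - l) * aff x u k + l * aff y w k.
  rewrite /aff /mix /GRing.scale /= mulrDr [X in X + _ = _](_ : _ = (1 - l) * lin (@coord R K) (g k) x + l * lin (@coord R K) (g k) y).
   by ring.
  rewrite /lin !mulr_sumr -big_split; apply: eq_bigr => p _ /=.
  by rewrite /coord !mxE; ring.
 by move=> h3 h4; apply: normr_mixR.
(* Changing the sign of w amounts to changing the sign of all residuals, which preserves their
   law. *)
have evth w : th (- w) = th w.
 pose Y k := lin (@coord R K) (g k).
 pose Y' k := lin (@coord R K) (scal (-1) (g k)).
 have gY' := gproc_map (gauss_rV_gproc K) (fun k => scal (-1) (g k)).
 have gY := gproc_map (gauss_rV_gproc K) g.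
 pose cs u := flatten [seq [:: ([:: (1 : R, k)], - ck k - bk k * Num.sqrt v * u); ([:: (-1 : R, k)], - ck k + bk k * Num.sqrt v * u)] | k <- enum 'I_K].
 have ev (Z : 'I_K -> 'rV[R]_K -> R) u z : all (fun c => c.2 <= lin Z c.1 z) (cs u) =
   all (fun k => `|Z k z + bk k * Num.sqrt v * u| <= ck k) (enum 'I_K).
  rewrite /cs; elim: (enum 'I_K) => //= k l IH; by rewrite IH !lin1 mul1r mulN1r andbA normr_band.
 have eF u z : F z u = \1_(polyh Y (cs u)) z by rewrite poly_indic ev.
 have eF' u z : F z (- u) = \1_(polyh Y' (cs u)) z.
  rewrite poly_indic ev /F; apply: (congr1 (fun b : bool => b%:R)); apply: eq_all => k /=.
  by rewrite /aff /Y' lin_scal -normrN opprD mulrN opprK mulN1r.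
 rewrite /th; under eq_Rintegral do rewrite eF'.
 under [RHS]eq_Rintegral do rewrite eF.
 rewrite !Rint_indic; last 2 first.
 - by apply: measurable_polyh; exact: (gproc_measurable gY).
 - by apply: measurable_polyh; exact: (gproc_measurable gY').
 apply: (gproc_law _ gY' gY) => t; apply: eq_qf => k k'.
 by rewrite qf_scall qf_scalr mulN1r mulN1r opprK.
have th01 w : 0 <= th w <= 1.
 apply/andP; split; first by apply: Rintegral_ge0 => z _; case/andP: (F01 z w).
 rewrite -(Rint_cst (gauss K) 1); apply: le_Rint; [|exact: bmf_cst|].
 - by split => //; exists 1 => z; have /andP[h0 h1] := F01 z w; rewrite ger0_norm.
 - by move=> z; case/andP: (F01 z w).
have bI2 : bmf (fun z : 'rV[R]_K * measurableTypeR R => I z.2).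
 by case: bI => mI [M hM]; split; [exact: measurableT_comp|exists M => z].
have fub (J : R -> R) : bmf (J : measurableTypeR R -> R) ->
 \int[prodP (gauss K) N1]_z (F z.1 z.2 * J z.2) = \int[N1]_w (J w * th w).
 move=> bJ.
 have bJ2 : bmf (fun z : 'rV[R]_K * measurableTypeR R => J z.2).
  by case: bJ => mJ [M hM]; split; [exact: measurableT_comp|exists M => z].
 have ie := bmf_integrable (prodP (gauss K) N1) (bmfM bF bJ2).
 rewrite /Rintegral -(integral21_prod_meas1 ie) /fubini_G /=; congr fine.
 apply: eq_integral => w _ /=.
 have bFw : bmf (F^~ w) by split => //; exists 1 => z; have /andP[h0 h1] := F01 z w; rewrite ger0_norm.
 by rewrite -EFin_Rint; [congr (_%:E); under eq_Rintegral do rewrite mulrC; rewrite RintZ|apply: bmfM => //; exact: bmf_cst].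
have mth : mble (th : measurableTypeR R -> R).
 have ie := bmf_integrable (prodP (gauss K) N1) bF.
 apply/measurable_EFinP; have := measurable_fubini_G ie.
 congr (mble _); apply/funext => w; rewrite /fubini_G /th /= EFin_Rint//.
 by split => //; exists 1 => z; have /andP[h0 h1] := F01 z w; rewrite ger0_norm.
have bth : bmf (th : measurableTypeR R -> R).
 by split => //; exists 1 => w; have /andP[h0 h1] := th01 w; rewrite ger0_norm.
have E4 : \int[prodP (gauss K) N1]_z (F z.1 z.2) = \int[N1]_w th w.
 have := fub (fun=> 1) (bmf_cst 1).
 under eq_Rintegral do rewrite mulr1.
 by move=> ->; apply: eq_Rintegral => w _; rewrite mul1r.
have E5 : \int[prodP (gauss K) N1]_z I z.2 = \int[N1]_w I w.
 have := @Rint_prod R _ _ (gauss K) _ _ N1 (fun=> 1) I (bmf_cst 1) bI.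
 by rewrite Rint_cst mul1r => <-; apply: eq_Rintegral => z _; rewrite mul1r.
apply: (le_mul_subst E4 E5 (fub I bI)).
pose p := \int[N1]_w I w.
pose w0 := b / Num.sqrt v.
have sv0 : 0 < Num.sqrt v by rewrite sqrtr_gt0.
have p0 : 0 <= p by rewrite /p; apply: Rintegral_ge0 => w _; rewrite /I.
have I1 w : I w <= 1 by rewrite /I; case: (_ <= b); rewrite ?lexx ?ler01.
have p1 : p <= 1 by rewrite /p -(Rint_cst N1 1); apply: le_Rint => //; exact: bmf_cst.
(* Both factors change sign at |w| = w0: inside, I = 1 >= p and th w >= th w0; outside, I = 0 <= p
   and th w <= th w0. For b < 0 the first factor is 0. Integrating gives the correlation
   inequality. *)
have key w : 0 <= (I w - p) * (th w - th w0).
 have [b0|bn] := leP 0 b; last first.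
  have Iz u : I u = 0 by rewrite /I (lt_geF _)// (lt_le_trans bn).
  by rewrite /p; under eq_Rintegral do rewrite Iz; rewrite Rint_cst Iz subrr mul0r.
 have w00 : 0 <= w0 by rewrite divr_ge0// ltW.
 rewrite /I; have [h|h] := leP `|Num.sqrt v * w| b.
  apply: mulr_ge0; first by rewrite subr_ge0.
  rewrite subr_ge0; apply: even_lconc => //; first by move=> x; case/andP: (th01 x).
  by rewrite (ger0_norm w00) /w0 ler_pdivlMr// mulrC -[X in X * _](gtr0_norm sv0) -normrM.
 rewrite sub0r mulNr -mulrN opprB; apply: mulr_ge0 => //.
 rewrite subr_ge0; apply: even_lconc => //; first by move=> x; case/andP: (th01 x).
 by rewrite (ger0_norm w00) /w0 ler_pdivrMr// mulrC -[X in X * _](gtr0_norm sv0) -normrM ltW.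
have : 0 <= \int[N1]_w ((I w - p) * (th w - th w0)) by apply: Rintegral_ge0.
have bIp : bmf (fun w : measurableTypeR R => I w - p) by apply: bmfB => //; exact: bmf_cst.
have -> : \int[N1]_w ((I w - p) * (th w - th w0)) =
 \int[N1]_w (I w * th w) - p * (\int[N1]_w th w) - th w0 * (\int[N1]_w (I w - p)).
 rewrite -RintZ// -RintB//; last 2 first.
 - exact: bmfM.
 - exact: bmfZ.
 rewrite -RintZ// -RintB//; last 2 first.
 - by apply: bmfB; [exact: bmfM|exact: bmfZ].
 - exact: bmfZ.
 by apply: eq_Rintegral => w _; ring.
rewrite RintB//; last exact: bmf_cst.
by rewrite Rint_cst -/p subrr mulr0 subr0 subr_ge0 mulrC.
Qed.

End sidak.

(** * Elementary bounds on probabilities of events *)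

Section probability_facts.
Context {R : realType} {d} {T : measurableType d} (P : probability T R).
Implicit Types A B E : set T.

Lemma fineP_ge0 A : 0 <= fine (P A).
Proof. exact/fine_ge0/measure_ge0. Qed.

Lemma fineP_le1 A : measurable A -> fine (P A) <= 1.
Proof.
by move=> mA; rewrite -lee_fin fineK ?fin_num_measure// probability_le1.
Qed.

Lemma le_fineP A B : measurable A -> measurable B -> A `<=` B ->
 fine (P A) <= fine (P B).
Proof.
move=> mA mB AB; rewrite -lee_fin !fineK ?fin_num_measure//.
by apply: le_measure; rewrite ?inE.
Qed.

Lemma fineP_setC A : measurable A -> fine (P (~` A)) = 1 - fine (P A).
Proof.
move=> mA; rewrite probability_setC// -[P A]fineK ?fin_num_measure//.
Qed.

Lemma fineP_setU A B : measurable A -> measurable B ->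
 fine (P (A `|` B)) <= fine (P A) + fine (P B).
Proof.
move=> mA mB; rewrite -lee_fin EFinD !fineK ?fin_num_measure//; last exact: measurableU.
exact: measureU2.
Qed.

Lemma fineP_setI A B : measurable A -> measurable B ->
 fine (P A) + fine (P B) - 1 <= fine (P (A `&` B)).
Proof.
move=> mA mB.
have := fineP_setU (measurableC mA) (measurableC mB).
rewrite -setCI !fineP_setC//; last exact: measurableI.
lra.
Qed.

Lemma fineP_setD A B : measurable A -> measurable B ->
 fine (P A) - fine (P B) <= fine (P (A `\` B)).
Proof.
move=> mA mB; have := fineP_setI mA (measurableC mB).
rewrite fineP_setC// -setDE; lra.
Qed.

Lemma fineP_bigU {I : Type} (s : seq I) (A : I -> set T) (b : R) :
 (forall i, measurable (A i)) -> (forall i, fine (P (A i)) <= b) ->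
 fine (P (\big[setU/set0]_(i <- s) A i)) <= (size s)%:R * b.
Proof.
move=> mA hA; elim: s => [|i s IH]; first by rewrite big_nil measure0 mul0r.
have mU : measurable (\big[setU/set0]_(j <- s) A j).
 elim: s {IH} => [|j s IHs]; first by rewrite big_nil; exact: measurable0.
 by rewrite big_cons; apply: measurableU.
rewrite big_cons; apply: (le_trans (fineP_setU (mA i) mU)).
by rewrite /= -natr1 mulrDl mul1r addrC lerD.
Qed.

End probability_facts.

Lemma measurable_ge {R : realType} {d} {T : measurableType d} (f : T -> R) (b : R) :
 mble f -> measurable [set w | b <= f w].
Proof.
move=> mf; have := mf measurableT `[b, +oo[%classic (measurable_itv _).
by rewrite setTI; congr measurable; apply/seteqP; split=> x /=; rewrite in_itv/= andbT.
Qed.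

Lemma measurable_norm_le {R : realType} {d} {T : measurableType d} (f : T -> R) (b : R) :
 mble f -> measurable [set w | `|f w| <= b].
Proof.
move=> mf; have mn : mble (fun w => `|f w|) by exact: measurableT_comp.
have := mn measurableT `]-oo, b]%classic (measurable_itv _).
by rewrite setTI; congr measurable; apply/seteqP; split=> x /=; rewrite in_itv/=.
Qed.

(** * Products of strip probabilities *)

Section strips.
Context {R : realType} {A : Type} {d} {T : measurableType d} (P : probability T R).
Variables (X : A -> T -> R) (S : A -> A -> R).
Hypothesis gX : gproc P X S.

Lemma strip_cat {B T0 : Type} (Y : B -> T0 -> R) ss ss' :
 bands Y (ss ++ ss') = bands Y ss `&` bands Y ss'.
Proof.
by apply/funext => w; rewrite /bands /setI /= all_cat; apply/propext; split=> [/andP[]|[-> ->]].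
Qed.

Lemma mstrip ss : measurable (bands X ss).
Proof. exact: measurable_strip (gproc_measurable gX). Qed.

Lemma strip1_ge s b v : qf S s s <= v -> 0 < v -> 0 <= b ->
 1 - 2 * expR (- (b ^+ 2 / (2 * v))) <= fine (P (bands X [:: (s, b)])).
Proof.
move=> qv v0 b0.
have h1 := gproc_tail gX qv v0 b0.
have h2 : fine (P [set w | b <= lin X (scal (-1) s) w]) <= expR (- (b ^+ 2 / (2 * v))).
 by apply: (gproc_tail gX _ v0 b0); rewrite qf_scall qf_scalr mulN1r mulN1r opprK.
have m1 := measurable_ge b (gproc_mlin gX s).
have m2 := measurable_ge b (gproc_mlin gX (scal (-1) s)).
have := fineP_setU P m1 m2.
have hsub : ~` bands X [:: (s, b)] `<=` [set w | b <= lin X s w] `|` [set w | b <= lin X (scal (-1) s) w].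
 move=> w; rewrite /bands /= andbT => /negP; rewrite -ltNge ltr_normr => /orP[h|h].
  by left => /=; exact: ltW.
 by right => /=; rewrite lin_scal mulN1r ltW.
have := le_fineP P (measurableC (mstrip _)) (measurableU _ _ m1 m2) hsub.
rewrite fineP_setC; last exact: mstrip.
lra.
Qed.

Lemma sidak_seq (L ss : seq (seq (R * A) * R)) :
 (forall a a', S a a' = S a' a) ->
 all (fun p => 0 < qf S p.1 p.1) L ->
 fine (P (bands X ss)) * \prod_(p <- L) fine (P (bands X [:: p])) <=
 fine (P (bands X (L ++ ss))).
Proof.
move=> sS; elim: L => [_|[s b] L IH /= /andP[p0 /IH {}IH]]; first by rewrite big_nil mulr1.
rewrite big_cons mulrCA mulrC.
apply: le_trans (sidak b (L ++ ss) gX sS p0).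
by apply: ler_wpM2r => //; exact: fineP_ge0.
Qed.

Lemma prod_ge_exp {I : Type} (s : seq I) (f : I -> R) (b : R) : 0 <= b ->
 (forall i, b <= f i) -> b ^+ size s <= \prod_(i <- s) f i.
Proof.
move=> b0 hf; elim: s => [|i s IH]; first by rewrite big_nil.
by rewrite big_cons exprS ler_pM// exprn_ge0.
Qed.

End strips.

(** * Fernique's tail bound for the maximum of finitely many combinations *)

Section fernique.
Context {R : realType} {A : Type} {d} {T : measurableType d} (P : probability T R).
Variables (X : A -> T -> R) (S : A -> A -> R).
Hypothesis gX : gproc P X S.
Variable ns : seq (seq (R * A)).

(** Its [bands] form the event that the seminorm max |lin X s|, over s in [ns], is at most t. *)
Definition norm_strip (t : R) : seq (seq (R * A) * R) := [seq (s, t) | s <- ns].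
Let p t := fine (P (bands X (norm_strip t))).

(* (X + X')/sqrt 2 and (X - X')/sqrt 2 are again independent copies of X. *)
Lemma fernique_step s t : p s * (1 - p t) <= (1 - p ((t - s) / Num.sqrt 2)) ^+ 2.
Proof.
pose r := (Num.sqrt 2 : R)^-1.
have r2 : r * r = 2^-1 by rewrite /r -invfM -expr2 sqr_sqrtr//.
have r0 : 0 < r by rewrite invr_gt0 sqrtr_gt0.
have gp := gproc_prod gX gX.
pose rot (c : A + A) : seq (R * (A + A)) := match c with
 | inl a => [:: (r, inl a); (- r, inr a)]
 | inr a => [:: (r, inl a); (r, inr a)] end.
have gr := gproc_map gp rot.
have ecov (c c' : A + A) : qf (sum_cov S S) (rot c) (rot c') = sum_cov S S c c'.
 case: c c' => a [] a'; rewrite /qf !big_cons !big_nil /= !mulr0 !addr0 ?add0r;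
  by rewrite ?mulrN ?mulNr ?opprK r2; field.
set Y := sum_proc _ _ in gp gr.
pose Q := prodP P P.
pose NL (t : R) := [seq ([seq (p.1, inl p.2) | p <- s] : seq (R * (A + A)), t) | s <- ns].
pose NR (t : R) := [seq ([seq (p.1, inr p.2) | p <- s] : seq (R * (A + A)), t) | s <- ns].
have law ss : fine (Q (bands (fun c => lin Y (rot c)) ss)) = fine (Q (bands Y ss)).
 by rewrite !strip_poly; apply: (gproc_law _ gr gp) => u; exact: eq_qf.
have evL u : bands Y (NL u) = bands X (norm_strip u) `*` setT.
 apply/funext => -[w w']; rewrite /bands /setX /= /NL /norm_strip !all_map.
 rewrite (@eq_all _ _ (fun s => `|lin X s w| <= u)).
  by apply/propext; split=> [->|[]].
 by move=> s' /=; rewrite /lin big_map.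
have evR u : bands Y (NR u) = setT `*` bands X (norm_strip u).
 apply/funext => -[w w']; rewrite /bands /setX /= /NR /norm_strip !all_map.
 rewrite (@eq_all _ _ (fun s => `|lin X s w'| <= u)).
  by apply/propext; split=> [->|[]].
 by move=> s' /=; rewrite /lin big_map.
have mN u : measurable (bands X (norm_strip u)) by exact: mstrip gX _.
have QX (E F : set T) : measurable E -> measurable F ->
  fine (Q (E `*` F)) = fine (P E) * fine (P F).
 move=> mE mF; transitivity (fine (P E * P F)%E).
  by congr fine; exact: product_measure1E.
 by rewrite fineM//; exact: fin_num_measure.
pose E1 := bands (fun c => lin Y (rot c)) (NL s).
pose E2 := bands (fun c => lin Y (rot c)) (NR t).
have mE1 : measurable E1 by exact: mstrip gr _.
have mE2 : measurable E2 by exact: mstrip gr _.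
have q1 : fine (Q E1) = p s.
 by rewrite /E1 law evL QX// probability_setT mulr1.
have q12 : fine (Q (E1 `&` E2)) = p s * p t.
 rewrite /E1 /E2 -strip_cat law strip_cat evL evR.
 rewrite (_ : _ `&` _ = bands X (norm_strip s) `*` bands X (norm_strip t)) ?QX//.
 by apply/seteqP; split=> -[w w'] /=; [case=> [[? _] [_ ?]]|case=> ? ?].
pose u := (t - s) / Num.sqrt 2.
(* At the index where the rotated sum exceeds t the rotated difference is at most s, so both copies
   exceed (t - s)/sqrt 2 at that same index. *)
have sub : E1 `\` E2 `<=` (~` bands X (norm_strip u)) `*` (~` bands X (norm_strip u)).
 move=> [w w'] [h1 h2]; rewrite /E1 /bands /NL /= all_map in h1.
 move/negP: h2; rewrite /E2 /bands /NR /= all_map -has_predC => h2.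
 have [/= i ins] := has_nthP [::] h2; rewrite -ltNge /= => hi.
 have {h1} /= hi' := all_nthP [::] h1 i ins.
 set s0 := nth [::] ns i in hi hi'.
 have eU : lin (fun c => lin Y (rot c)) [seq (p.1, inl p.2) | p <- s0] (w, w') =
   r * (lin X s0 w - lin X s0 w').
  rewrite /lin big_map /= -sumrB mulr_sumr; apply: eq_bigr => q _.
  by rewrite /= !big_cons big_nil /=; ring.
 have eV : lin (fun c => lin Y (rot c)) [seq (p.1, inr p.2) | p <- s0] (w, w') =
   r * (lin X s0 w + lin X s0 w').
  rewrite /lin big_map /= -big_split mulr_sumr; apply: eq_bigr => q _.
  by rewrite /= !big_cons big_nil /=; ring.
 rewrite eU in hi'; rewrite eV in hi.
 have key a b : `|r * (a - b)| <= s -> t < `|r * (a + b)| -> u < `|a|.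
  move=> h1 h3; have -> : u = r * (t - s) by rewrite /u mulrC.
  have -> : `|a| = r * `|r * (a + b) + r * (a - b)|.
   transitivity (`|r| * `|r * (a + b) + r * (a - b)|); last by rewrite gtr0_norm.
   rewrite -normrM; congr (`| _ |).
   by rewrite -mulrDr mulrA r2; field.
  rewrite ltr_pM2l//; apply: (lt_le_trans _ (lerB_normD _ _)).
  by rewrite ltr_leB.
 have keep a : u < `|a| -> forall w0, lin X s0 w0 = a -> (~` bands X (norm_strip u)) w0.
  move=> ua w0 e; apply/negP; rewrite -has_predC; apply/(has_nthP ([::], 0)).
  by exists i; rewrite ?size_map//= (nth_map [::])//= -/s0 e -ltNge.
 split; [apply: (keep _ _ w erefl)|apply: (keep _ _ w' erefl)] => /=; first exact: key hi' hi.
 apply: (key _ (lin X s0 w)); first by rewrite -normrN -mulrN opprB.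
 by rewrite addrC.
have mC : measurable (~` bands X (norm_strip u)) by exact: measurableC.
have := le_fineP Q (measurableD mE1 mE2) (measurableX mC mC) sub.
rewrite QX// fineP_setC// -/(p u) -expr2; apply: le_trans.
have := fineP_ge0 Q (E1 `\` E2).
rewrite (_ : fine (Q (E1 `\` E2)) = p s - p s * p t) ?mulrBr ?mulr1//.
rewrite -q12 -q1 -fineB ?fin_num_measure//; last exact: measurableI.
congr fine; apply: measureD => //.
by rewrite ltey_eq fin_num_measure.
Qed.

(** Along the levels t_(n+1) = s + sqrt 2 t_n the step squares the ratio (1 - p(t_n)) / p(s), which
    starts at most at 1/3 <= exp(-2/3). *)
Lemma fernique_iter s n : 0 < s -> 3 / 4 <= p s ->
 1 - p (4 * s * Num.sqrt 2 ^+ n) <= expR (- (2 / 3 * 2 ^+ n)).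
Proof.
move=> s0 ps.
have mN u : measurable (bands X (norm_strip u)) by exact: mstrip gX _.
have p01 u : 0 <= p u <= 1 by rewrite fineP_ge0 fineP_le1.
have pmono u v : u <= v -> p u <= p v.
 move=> uv; apply: le_fineP => // w; rewrite /bands /= !all_map.
 by apply: sub_all => q /= /le_trans; apply.
have w2 : (Num.sqrt 2 : R) ^+ 2 = 2 by rewrite sqr_sqrtr.
have w0 : (0 : R) < Num.sqrt 2 by rewrite sqrtr_gt0.
have wb : (7 / 5 : R) <= Num.sqrt 2.
 by rewrite -(@ler_pXn2r _ 2%N) ?nnegrE ?(ltW w0)// w2; lra.
pose t := fix t n := if n is n'.+1 then s + Num.sqrt 2 * t n' else s.
(* The constant 5/2 is reproduced by the recursion because 1 + 5/2 <= (5/2) sqrt 2, that is, sqrt 2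
   >= 7/5. *)
have tb : t n <= s * (4 * Num.sqrt 2 ^+ n - 5 / 2).
 elim: n => [|n IH] /=; first by rewrite expr0; nra.
 rewrite exprS; set z := _ ^+ n in IH *.
 apply: (@le_trans _ _ (s + Num.sqrt 2 * (s * (4 * z - 5 / 2)))).
  by rewrite lerD2l ler_pM2l.
 have : 0 <= s * (Num.sqrt 2 - 7 / 5) by rewrite mulr_ge0 ?subr_ge0// ltW.
 by lra.
have xb : (1 - p (t n)) / p s <= expR (- (2 / 3 * 2 ^+ n)).
 elim: n {tb} => [|n IH] /=.
  rewrite expr0 mulr1; have := expR_ge1Dx (- (2 / 3) : R); apply: le_trans.
  by rewrite ler_pdivrMr; lra.
 have q0 : 0 < p s by lra.
 have := fernique_step s (s + Num.sqrt 2 * t n).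
 rewrite (_ : (_ - s) / Num.sqrt 2 = t n); last first.
  by rewrite addrAC subrr add0r mulrAC divff ?mul1r ?gt_eqF.
 move=> h; rewrite exprS.
 have -> : expR (- (2 / 3 * (2 * 2 ^+ n))) = expR (- (2 / 3 * 2 ^+ n)) ^+ 2 :> R.
  by rewrite expr2 -expRD; congr expR; ring.
 apply: (@le_trans _ _ (((1 - p (t n)) / p s) ^+ 2)).
  by rewrite ler_pdivrMr// (_ : _ ^+ 2 * _ = (1 - p (t n)) ^+ 2 / p s) ?ler_pdivlMr// 1?mulrC//; field; rewrite gt_eqF.
 by rewrite ler_pXn2r ?nnegrE ?expR_ge0// divr_ge0 ?(ltW q0)//; have /andP[_] := p01 (t n); rewrite subr_ge0.
apply: le_trans xb; rewrite ler_pdivlMr; last lra.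
have /andP[? ?] := p01 s; have /andP[? ?] := p01 (t n).
have : p (t n) <= p (4 * s * Num.sqrt 2 ^+ n) by apply: pmono; apply: (le_trans tb); nra.
by have /andP[? ?] := p01 (4 * s * Num.sqrt 2 ^+ n); nra.
Qed.

(** Let z = t^2 / (16 s^2) and 2^n <= z < 2^(n+1). The level 4 s sqrt 2^n is at most t, and the
    exponent (2/3) 2^n is at least z/3; hence 48 = 16 * 3. *)
Lemma fernique s t : 0 < s -> 4 * s <= t -> 3 / 4 <= p s ->
 1 - p t <= expR (- (t ^+ 2 / (48 * s ^+ 2))).
Proof.
move=> s0 st ps.
have mN u : measurable (bands X (norm_strip u)) by exact: mstrip gX _.
pose z := t ^+ 2 / (16 * s ^+ 2).
have s2 : 0 < 16 * s ^+ 2 by rewrite mulr_gt0// exprn_gt0.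
have z1 : 1 <= z.
 rewrite ler_pdivlMr// mul1r (_ : 16 * s ^+ 2 = (4 * s) ^+ 2); last by rewrite exprMn; congr (_ * _); ring.
 by rewrite ler_pXn2r ?nnegrE//; lra.
pose n := trunc_log 2 (Num.truncn z).
have tz : (0 < Num.truncn z)%N by rewrite truncn_gt0.
have /andP[n1 n2] : (2 ^ n <= Num.truncn z < 2 ^ n.+1)%N by exact: trunc_log_bounds.
have z2 : 2 ^+ n <= z.
 rewrite -natrX; apply: (le_trans (y := (Num.truncn z)%:R)); first by rewrite ler_nat.
 by rewrite truncn_le; lra.
have z3 : z < 2 ^+ n.+1.
 rewrite -natrX; apply: (lt_le_trans (y := (Num.truncn z).+1%:R)); last by rewrite ler_nat.
 exact: truncnS_gt.
apply: (le_trans (y := 1 - p (4 * s * Num.sqrt 2 ^+ n))).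
 rewrite lerD2l lerN2; apply: le_fineP => // w; rewrite /bands /= !all_map.
 apply: sub_all => q /= /le_trans; apply.
 rewrite -(@ler_pXn2r _ 2%N) ?nnegrE ?mulr_ge0 ?exprn_ge0 ?sqrtr_ge0 ?(ltW s0)//; last lra.
 rewrite exprMn -exprM mulnC exprM sqr_sqrtr// exprMn.
 rewrite (_ : 4 ^+ 2 = 16 :> R); last by ring.
 by rewrite mulrC -ler_pdivlMr.
apply: (le_trans (fernique_iter _ _ _)) => //.
rewrite ler_expR lerN2 (_ : _ / _ = z / 3); last first.
 by rewrite /z invfM -mulrA -!invfM; congr (_ / _); ring.
by move: z3; rewrite exprS; lra.
Qed.

End fernique.

(** * Joint tails of uncorrelated combinations, and shifts of persistence *)

Section joint.
Context {R : realType} {A : Type} {d} {T : measurableType d} (P : probability T R).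
Variables (X : A -> T -> R) (S : A -> A -> R).
Hypotheses (gX : gproc P X S)
 (sS : forall a b, S a b = S b a).

(** Both inequalities together force the combination (a/Vy) y + (b/Vz) z to be at least q = a^2/Vy +
    b^2/Vz, while orthogonality bounds its variance by q; the tail is exp(-q/2). *)
Lemma joint_tail y z Vy Vz a b : qf S y z = 0 -> qf S y y <= Vy -> qf S z z <= Vz ->
 0 < Vy -> 0 < Vz -> 0 <= a -> 0 <= b ->
 fine (P ([set w | a <= lin X y w] `&` [set w | b <= lin X z w])) <=
 expR (- ((a ^+ 2 / Vy + b ^+ 2 / Vz) / 2)).
Proof.
move=> yz qy qz Vy0 Vz0 a0 b0; set q := a ^+ 2 / Vy + b ^+ 2 / Vz.
have mI : measurable ([set w | a <= lin X y w] `&` [set w | b <= lin X z w]).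
 by apply: measurableI; [exact: measurable_ge (gproc_mlin gX y)|exact: measurable_ge (gproc_mlin gX z)].
have [q0|q0] := leP q 0.
 apply: (le_trans (fineP_le1 _ mI)); rewrite -[leLHS]expR0 ler_expR.
 by rewrite oppr_ge0; lra.
pose s := scal (a / Vy) y ++ scal (b / Vz) z.
have qs : qf S s s <= q.
 rewrite /s !(qf_catl, qf_catr, qf_scall, qf_scalr) yz (qfC z y sS) yz !mulr0 addr0 add0r.
 have e1 : a ^+ 2 / Vy = a / Vy * (a / Vy * Vy).
  by field; rewrite gt_eqF.
 have e2 : b ^+ 2 / Vz = b / Vz * (b / Vz * Vz).
  by field; rewrite gt_eqF.
 by rewrite /q e1 e2 lerD// !ler_wpM2l// divr_ge0// ltW.
have := gproc_tail gX qs q0 (ltW q0).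
rewrite (_ : q ^+ 2 / (2 * q) = q / 2); last by field; rewrite gt_eqF.
apply: le_trans; apply: le_fineP => //; first exact: measurable_ge (gproc_mlin gX _).
move=> w [/= h1 h2]; rewrite /s lin_cat !lin_scal /q.
have e1 : a ^+ 2 / Vy = a / Vy * a by rewrite expr2 mulrAC.
have e2 : b ^+ 2 / Vz = b / Vz * b by rewrite expr2 mulrAC.
by rewrite e1 e2 lerD// ler_wpM2l// divr_ge0// ltW.
Qed.

Definition pts_event (F : seq A) (c : R) : set T :=
 [set w | all (fun a => c <= X a w) F].

Lemma pts_poly (F : seq A) c : pts_event F c = polyh X [seq ([:: (1, a)], c) | a <- F].
Proof.
apply/funext => w; rewrite /pts_event /polyh /= all_map; congr is_true.
by apply: eq_all => a /=; rewrite lin1 mul1r.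
Qed.

Lemma measurable_pts (F : seq A) c : measurable (pts_event F c).
Proof. by rewrite pts_poly; apply: measurable_polyh => a; exact: gproc_measurable gX a. Qed.

(** A change of measure without densities. Write X a = X' a + (h a / v) lin X c with X' independent
    of lin X c. If X >= - l on F and lin X c < t v, then X' a >= - (1 + t) h a since l <= h a; an
    independent event lin X c >= (1 + t) v then makes X nonnegative on F. *)
Lemma lb_shift (F : seq A) (c : seq (R * A)) (l t : R) :
 0 < qf S c c -> 0 <= l -> all (fun a => l <= qf S [:: (1, a)] c) F ->
 fine (P [set w | (1 + t) * qf S c c <= lin X c w]) *
  (fine (P (pts_event F (- l))) - fine (P [set w | t * qf S c c <= lin X c w])) <=
 fine (P (pts_event F 0)).
Proof.
move=> v0 l0 hF; set v := qf S c c in v0 *.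
pose h a := qf S [:: (1, a)] c.
pose res a := [:: (1, a)] ++ scal (- (h a / v)) c.
pose g (x : A + unit) := match x with inl a => res a | inr _ => c end.
have gg := gproc_map gX g.
pose X' a := lin X (res a).
pose S' a b := qf S (res a) (res b).
have gg' : gproc P (sum_proc X' (fun _ : unit => lin X c)) (sum_cov S' (fun _ _ : unit => v)).
 rewrite (_ : sum_proc _ _ = fun b => lin X (g b)); last by apply/funext => -[].
 apply: (gproc_eq_cov gg) => s; apply: eq_qf => -[a|[]] [b|[]] //=.
  rewrite /res qf_catl qf_scall -/v /h; field; by rewrite gt_eqF.
 rewrite /res qf_catr qf_scalr -/v (qfC _ _ sS) /h; field; by rewrite gt_eqF.
have me z s : measurable [set w | z <= lin X s w] by exact: measurable_ge (gproc_mlin gX s).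
pose E1 := polyh X' [seq ([:: (1, a)], - ((1 + t) * h a)) | a <- F].
pose E2 := polyh (fun _ : unit => lin X c) [:: ([:: (1, tt)], (1 + t) * v)].
have E2E : E2 = [set w | (1 + t) * v <= lin X c w].
 by apply/funext => w; rewrite /E2 /polyh /= andbT lin1 mul1r.
have mE1 : measurable E1.
 by apply: measurable_polyh => a; exact: gproc_mlin gX _.
have ind : fine (P (E1 `&` E2)) = fine (P E1) * fine (P E2) by exact: gproc_indep gg'.
have XX' a w : X a w = X' a w + h a / v * lin X c w.
 by rewrite /X' /res lin_cat lin_scal lin1 mul1r mulNr addrNK.
have -> : fine (P [set w | (1 + t) * v <= lin X c w]) = fine (P E2) by rewrite E2E.
apply: (le_trans (y := fine (P E2) * fine (P E1))).
 apply: ler_wpM2l; first exact: fineP_ge0.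
 apply: (le_trans (fineP_setD P (measurable_pts _ _) (me _ _))).
 apply: le_fineP => //; first by apply: measurableD => //; exact: measurable_pts.
 move=> w [/= hw /negP]; rewrite -ltNge => hw'.
 rewrite /E1 /polyh /= all_map.
 have : all (fun a => (l <= h a) && (- l <= X a w)) F by rewrite all_predI hF.
 apply: sub_all => a /= /andP[h1 h2]; rewrite lin1 mul1r.
 have : h a / v * lin X c w <= t * h a.
  rewrite (_ : t * h a = h a / v * (t * v)); last by field; rewrite gt_eqF.
  by rewrite ler_wpM2l ?(ltW hw')// divr_ge0 ?(ltW v0)// (le_trans l0).
 by move: h2; rewrite XX'; move: (h a / v * _) => z; lra.
rewrite mulrC -ind; apply: le_fineP; first by apply: measurableI => //; rewrite E2E.
 exact: measurable_pts.
move=> w [h1]; rewrite E2E /= => h2; rewrite /pts_event /=.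
have : all (fun a => (l <= h a) && (- ((1 + t) * h a) <= X' a w)) F.
 rewrite all_predI hF /=; move: h1; rewrite /E1 /polyh /= all_map.
 by apply: sub_all => a /=; rewrite lin1 mul1r.
apply: sub_all => a /= /andP[h3 h4]; rewrite XX'.
have : (1 + t) * h a <= h a / v * lin X c w.
 rewrite (_ : (1 + t) * h a = h a / v * ((1 + t) * v)); last by field; rewrite gt_eqF.
 by rewrite ler_wpM2l// divr_ge0 ?(ltW v0)// (le_trans l0).
by move: h4; move: (h a / v * _) => z; lra.
Qed.

End joint.

(** * Strip probabilities in the presence of finitely many atoms *)

Section lower_bound.
Context {R : realType} {d} {T : measurableType d} (P : probability T R) (n K : nat).
Variables (X : 'I_n -> T -> R) (S S1 : 'I_n -> 'I_n -> R) (u : 'I_K -> 'I_n -> R).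
Hypotheses (gX : gproc P X S)
 (SE : forall i j, S i j = S1 i j + \sum_k u k i * u k j)
 (S1C : forall i j, S1 i j = S1 j i)
 (S1psd : forall s, 0 <= qf S1 s s).

(** The covariance splits into S1 and a sum of K squares, so X is realised as a Gaussian family of
    covariance S1 plus K independent normal coefficients times the bounded functions u. Sidak bounds
    the S1 part by L at each point and each coefficient by k: the number of points only multiplies
    the tail of the S1 part, of variance at most v, while the coefficients cost a factor that does
    not depend on the points. *)
Lemma lb_strips (ss : seq (seq (R * 'I_n) * R)) (pts : seq 'I_n) (v M L k : R) :
 (forall i, 0 < S1 i i <= v) -> (forall j i, `|u j i| <= M) -> 0 <= M -> 0 <= L -> 0 <= k ->
 0 <= 1 - 2 * expR (- (L ^+ 2 / (2 * v))) -> 0 <= 1 - 2 * expR (- (k ^+ 2 / (2 * 1))) ->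
 fine (P (bands X ss)) *
  ((1 - 2 * expR (- (L ^+ 2 / (2 * v)))) ^+ size pts *
  (1 - 2 * expR (- (k ^+ 2 / (2 * 1)))) ^+ K) <=
 fine (P (bands X (ss ++ [seq ([:: (1, i)], L + K%:R * (M * k)) | i <- pts]))).
Proof.
move=> S1v uM M0 L0 k0; set pL := 1 - _; set pk := 1 - _ => pL0 pk0.
have [g gg] := gauss_rV_repr S1C S1psd.
have gK := @gauss_rV_gproc R K.
have gZ := gproc_prod gg gK.
set Z := sum_proc _ _ in gZ; set C := sum_cov _ _ in gZ.
have CC a b : C a b = C b a by case: a b => a [] b //=; rewrite eq_sym.
pose rep (i : 'I_n) : seq (R * ('I_n + 'I_K)) :=
 (1, inl i) :: [seq (u j i, inr j) | j <- enum 'I_K].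
pose Q := prodP (gauss n) (gauss K : probability 'rV[R]_K R).
have gr := gproc_map gZ rep.
have law ss' : fine (P (bands X ss')) = fine (Q (bands (fun i => lin Z (rep i)) ss')).
 rewrite !strip_poly; apply: (gproc_law _ gX gr) => s; apply: eq_qf => i j.
 have rE a : rep a = [:: (1, inl a)] ++ [seq (u k1 a, inr k1) | k1 <- enum 'I_K] by [].
 rewrite SE !rE qf_catl !qf_catr qf1 !mul1r.
 have -> : qf C [:: (1, inl i)] [seq (u k1 j, inr k1) | k1 <- enum 'I_K] = 0.
  by rewrite /qf big_seq1 big_map big1// => z _; rewrite /= mulr0.
 have -> : qf C [seq (u k1 i, inr k1) | k1 <- enum 'I_K] [:: (1, inl j)] = 0.
  by rewrite /qf big_map big1// => z _; rewrite big_seq1 /= mulr0.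
 rewrite addr0 add0r /= /qf big_map big_enum /=; congr (_ + _); apply: eq_bigr => z _.
 rewrite big_map big_enum /= (bigD1 z)//= eqxx mulr1 big1 ?addr0// => z' zz'.
 by rewrite eq_sym (negbTE zz') mulr0.
rewrite !law.
pose up (p : seq (R * 'I_n) * R) := (lflat rep p.1, p.2).
have upE ss' : bands (fun i => lin Z (rep i)) ss' = bands Z (map up ss').
 apply/funext => w; rewrite /bands /= all_map; congr is_true.
 by apply: eq_all => p /=; rewrite lin_lflat.
pose LL : seq (seq (R * ('I_n + 'I_K)) * R) :=
 [seq ([:: (1, inl i)], L) | i <- pts] ++ [seq ([:: (1, inr j)], k) | j <- enum 'I_K].
have LLpos : all (fun p => 0 < qf C p.1 p.1) LL.
 rewrite /LL all_cat !all_map; apply/andP; split; apply/allP => i _ /=; rewrite qf1 !mul1r /=.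
  by have /andP[] := S1v i.
 by rewrite eqxx.
have := sidak_seq gZ (map up ss) CC LLpos.
rewrite -upE => hs; apply: (le_trans _ (le_trans hs _)).
 apply: ler_wpM2l; first exact: fineP_ge0.
 rewrite /LL big_cat !big_map /=; apply: ler_pM; rewrite ?exprn_ge0//.
  apply: prod_ge_exp => // i; apply: (strip1_ge gZ) => //.
   by rewrite qf1 !mul1r /=; have /andP[] := S1v i.
  by have /andP[] := S1v i; exact: lt_le_trans.
 apply: (le_trans (y := pk ^+ size (Finite.enum 'I_K))); first by rewrite -enumT size_enum_ord.
 apply: prod_ge_exp => // j.
 by apply: (strip1_ge gZ) => //; rewrite qf1 !mul1r /= eqxx.
apply: le_fineP; [exact: mstrip gZ _|exact: mstrip gr _|].
move=> w; rewrite strip_cat => -[h1 h2]; rewrite strip_cat upE; split=> //.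
move: h1; rewrite /bands /LL /= all_cat !all_map => /andP[/= h1 /allP h3].
apply: sub_all h1 => i /=; rewrite !lin1 !mul1r => hi.
rewrite /rep /lin big_cons mul1r (le_trans (ler_normD _ _))// lerD//.
rewrite big_map (le_trans (ler_norm_sum _ _ _))//.
apply: (le_trans (y := \sum_(j <- enum 'I_K) M * k)).
 apply: ler_sum => j _; have := h3 j; rewrite -enumT mem_enum /= lin1 mul1r => /(_ isT) hj.
 by rewrite normrM ler_pM.
by rewrite big_const_seq count_predT size_enum_ord iter_addr addr0 mulr_natl.
Qed.

End lower_bound.

(** * Persistence on a grid compared with an independent sample *)

Section upper_bound.
Context {R : realType}.
Let N1 := (normal_prob (0 : R) 1).
Let Q (x : R) := fine (N1 `[x, +oo[%classic).

Lemma Qmono x y : x <= y -> Q y <= Q x.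
Proof.
move=> xy; apply: le_fineP; [exact: measurable_itv|exact: measurable_itv|].
by move=> z /=; rewrite !in_itv/= !andbT; exact: le_trans.
Qed.

Lemma Q_ge0 x : 0 <= Q x. Proof. exact: fineP_ge0. Qed.

Lemma Q_le1 x : Q x <= 1. Proof. exact: fineP_le1. Qed.

Lemma Qpoly x : Q x = fine (N1 (polyh (fun (_ : unit) (y : R) => y) [:: ([:: (1, tt)], x)])).
Proof.
congr (fine (N1 _)); apply/seteqP; split=> y; rewrite /polyh /=;
 by rewrite in_itv/= !andbT lin1 mul1r.
Qed.

(** The half-lines y >= - a and - y >= a + 1 are disjoint; losing 1 in the threshold is harmless. *)
Lemma Q_neg a : Q (- a) <= 1 - Q (a + 1).
Proof.
have gm := gproc_map (@std_normal_gproc R) (fun _ : unit => [:: (-1, tt)]).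
have e : Q (a + 1) = fine (N1 [set y : R | a + 1 <= - y]).
 rewrite Qpoly (gproc_law (P' := N1) _ (@std_normal_gproc R) gm); last first.
  by move=> s; apply: eq_qf => x y; rewrite qf1; ring.
 by congr (fine (N1 _)); apply/funext => y; rewrite /polyh /= andbT lin1 mul1r lin1 mulN1r.
have m1 : measurable [set y : R | a + 1 <= - y].
 by apply: (@measurable_ge _ _ _ (fun y : R => - y)); exact: measurableT_comp.
have m2 : measurable (`[- a, +oo[%classic : set R) by exact: measurable_itv.
rewrite e -fineP_setC//; apply: le_fineP => //; first exact: measurableC.
by move=> y /=; rewrite in_itv/= andbT => h1 h2; lra.
Qed.

(** The bound is log-affine in a, so a product over grid points depends on the sum of the a's alone.
    For a >= a1 the exponent is nonnegative; for |a| <= a1 it follows from 1 - p <= exp(-p); below -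
    a1 the quadratic Gaussian tail beats the linear exponent. *)
Lemma Q_exp a a1 : 2 <= a1 ->
 Q (- a) <= expR (- (Q (a1 + 1) / 2 * (1 - a / a1))).
Proof.
move=> a12; have a10 : 0 < a1 by lra.
set p := Q (a1 + 1); have p0 : 0 <= p by exact: Q_ge0.
have [ha|ha] := leP a1 a.
 apply: (le_trans (Q_le1 _)); rewrite -[leLHS]expR0 ler_expR oppr_ge0.
 by rewrite mulr_ge0_le0 ?divr_ge0// subr_le0 ler_pdivlMr// mul1r.
have [hb|hb] := leP (- a1) a.
 apply: (le_trans (@Qmono (- a1) (- a) _)); first by rewrite lerN2 ltW.
 apply: (le_trans (Q_neg _)); apply: (le_trans (y := expR (- p))).
  by have := expR_ge1Dx (- p); rewrite -/p; lra.
 rewrite ler_expR lerN2.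
 have : - 1 <= a / a1 by rewrite ler_pdivlMr// mulN1r.
 by nra.
apply: (le_trans (std_tail_le _)); first by lra.
rewrite ler_expR lerN2 sqrrN.
have ph : p <= 1 / 2.
 apply: (le_trans (std_tail_le _)); first by lra.
 have h : 1 + (a1 + 1) ^+ 2 / 2 <= expR ((a1 + 1) ^+ 2 / 2) by exact: expR_ge1Dx.
 rewrite expRN mul1r lef_pV2 ?posrE ?expR_gt0//.
 by apply: le_trans h; nra.
set z := a / a1; have az : a = z * a1 by rewrite /z mulfVK ?gt_eqF.
have z1 : z <= -1 by rewrite /z ler_pdivrMr// mulN1r ltW.
clearbody z.
have : 4 * z ^+ 2 <= a ^+ 2.
 have : 0 <= z ^+ 2 * (a1 ^+ 2 - 4).
  by rewrite mulr_ge0 ?sqr_ge0// subr_ge0; nra.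
 by rewrite az exprMn; lra.
by nra.
Qed.

Lemma gauss_rV_orthant n (c : 'I_n -> R) :
 fine (gauss n [set x : 'rV[R]_n | forall i, c i <= x 0 i]) = \prod_i Q (c i).
Proof.
elim: n c => [|n IH] c.
 rewrite big_ord0 (_ : [set _ | _] = setT); last by apply/seteqP; split=> // x _ [].
 have -> : @gauss R 0 setT = 1%E by exact: probability_setT.
 by [].
rewrite big_ord_recl mulrC -IH.
set E := [set _ | _]; set E' := [set _ | _].
have mE k (b : 'I_k -> R) : measurable [set x : 'rV[R]_k | forall i, b i <= x 0 i].
 rewrite (_ : [set _ | _] = \bigcap_i [set x : 'rV[R]_k | b i <= x 0 i]); last first.
  by apply/seteqP; split=> x /= h => [i _|i]; exact: h.
 by apply: fin_bigcap_measurable => // i _; exact: measurable_ge (@measurable_coordR R k i).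
have -> : gauss n.+1 E = prodP (gauss n) N1 (E' `*` `[c ord0, +oo[%classic).
 rewrite /= /image_prob /distribution /pushforward; congr (prodP _ _ _).
 apply/seteqP; split=> -[x y] /=; rewrite /E /E' /= in_itv/= andbT.
  move=> h; split=> [i|].
   by have := h (lift ord0 i); rewrite /rV_cons mxE liftK.
  by have := h ord0; rewrite /rV_cons mxE unlift_none.
 move=> [h1 h2] i; rewrite /rV_cons mxE.
 by case: unliftP => [j ->|->] //=.
transitivity (fine (gauss n E' * N1 `[c ord0, +oo[%classic)%E).
 congr fine; apply: product_measure1E; [exact: mE|exact: measurable_itv].
by rewrite fineM ?fin_num_measure//; exact: mE.
Qed.

Lemma product_section_le {d1 d2} {T1 : measurableType d1} {T2 : measurableType d2}
  (P1 : probability T1 R) (P2 : probability T2 R) (E : set (T1 * T2)) (b : R) :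
 measurable E -> (forall w, fine (P2 (xsection E w)) <= b) -> fine (prodP P1 P2 E) <= b.
Proof.
move=> mE h; rewrite -lee_fin fineK ?fin_num_measure//.
have b0 : 0 <= b by apply: le_trans (h point); exact: fineP_ge0.
have -> : prodP P1 P2 E = (\int[P1]_w P2 (xsection E w))%E by [].
apply: (le_trans (y := (\int[P1]_w (cst b%:E) w)%E)).
 apply: ge0_le_integral => //.
 - by apply: measurable_fun_xsection.
 - move=> w _; rewrite -[P2 _]fineK ?lee_fin// fin_num_measure//; exact: measurable_xsection.
rewrite integral_cst//= (_ : P1 setT = 1%E) ?mule1//; exact: probability_setT.
Qed.

(** Adding an independent field Y of covariance [be] makes the total covariance dominate m times the
    identity, so X + Y has the law of W + sqrt m g with g standard normal and independent of W. With
    |Y| <= k, the event gives W + sqrt m g >= - k and a bound on its sum. Conditionally on W the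
    probability is a product of normal tails, which [Q_exp] turns into a function of the sum of
    W. *)
Lemma ub_grid {d} {T : measurableType d} (P : probability T R) (n : nat)
  (X : 'I_n -> T -> R) (S be : 'I_n -> 'I_n -> R) (m de r k a1 : R) :
 gproc P X S -> (forall i j, S i j = S j i) ->
 (forall i j, be i j = be j i) -> (forall s, 0 <= qf be s s) -> (forall i, be i i <= de) ->
 (forall s, m * qf (fun i j : 'I_n => (i == j)%:R) s s <= qf S s s + qf be s s) ->
 0 < m -> 0 < de -> 0 <= k -> 2 <= a1 -> (0 < n)%N ->
 fine (P (pts_event X (enum 'I_n) 0 `&` [set w | \sum_i X i w <= n%:R * r])) *
  (1 - n%:R * (2 * expR (- (k ^+ 2 / (2 * de))))) <=
 expR (- (k ^+ 2 * n%:R / (2 * m))) +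
 expR (- (Q (a1 + 1) / 2 * (n%:R * (1 - (r + 3 * k) / Num.sqrt m / a1)))).
Proof.
move=> gX sS sbe pbe bed hS m0 de0 k0 a12 n0.
have a10 : 0 < a1 by lra.
have nR : 0 < n%:R :> R by rewrite ltr0n.
have [gb ggb] := gauss_rV_repr sbe pbe.
have gY := gproc_prod gX ggb.
set Z := sum_proc _ _ in gY.
pose rep (i : 'I_n) : seq (R * ('I_n + 'I_n)) := [:: (1, inl i)] ++ [:: (1, inr i)].
have grY := gproc_map gY rep.
pose del (i j : 'I_n) : R := (i == j)%:R.
pose S2 i j := S i j + be i j - m * del i j.
have S2C i j : S2 i j = S2 j i by rewrite /S2 /del sS sbe eq_sym.
have S2E s : qf S2 s s = qf S s s + qf be s s - m * qf del s s.
 have -> : qf S2 s s = qf (fun i j => (S i j + be i j) + (- m * del i j)) s s.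
  by apply: eq_qf => i j; rewrite /S2 mulNr.
 rewrite qfD qfD; congr (_ + _); rewrite -mulNr /qf mulr_sumr; apply: eq_bigr => p _.
 by rewrite mulr_sumr; apply: eq_bigr => q _; ring.
have S2psd s : 0 <= qf S2 s s by rewrite S2E subr_ge0.
have [gw ggw] := gauss_rV_repr S2C S2psd.
have gN := @gauss_rV_gproc R n.
have gV := gproc_prod ggw gN.
set V := sum_proc _ _ in gV.
pose rep2 (i : 'I_n) : seq (R * ('I_n + 'I_n)) := [:: (1, inl i)] ++ [:: (Num.sqrt m, inr i)].
have grV := gproc_map gV rep2.
pose cs : seq (seq (R * 'I_n) * R) :=
 [seq ([:: (1, i)], - k) | i <- enum 'I_n] ++ [:: ([seq (-1, i) | i <- enum 'I_n], - (n%:R * (r + k)))].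
have csE (U : Type) (F : 'I_n -> U -> R) w : polyh F cs w <->
  (forall i, - k <= F i w) /\ \sum_i F i w <= n%:R * (r + k).
 rewrite /polyh /cs /= all_cat all_map /= andbT.
 have -> : lin F [seq (-1, i) | i <- enum 'I_n] w = - \sum_i F i w.
  by rewrite /lin big_map big_enum /= -sumrN; apply: eq_bigr => i _; rewrite mulN1r.
 rewrite lerN2; split=> [/andP[/allP h1 h2]|[h1 h2]].
  by split=> // i; have := h1 i; rewrite mem_enum /= lin1 mul1r; exact.
 by apply/andP; split=> //; apply/allP => i _ /=; rewrite lin1 mul1r.
have law : fine (prodP P (gauss n) (polyh (fun i => lin Z (rep i)) cs)) =
  fine (prodP (gauss n) (gauss n) (polyh (fun i => lin V (rep2 i)) cs)).
 apply: (gproc_law _ grY grV) => s; apply: eq_qf => i j.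
 rewrite /rep /rep2 !qf_catl !qf_catr !qf1 /= !mulr0 !addr0 !add0r !mul1r -expr2 sqr_sqrtr ?(ltW m0)//.
 by rewrite /S2 addrNK.
have ZE i w : lin Z (rep i) w = X i w.1 + lin (@coord R n) (gb i) w.2.
 by rewrite /rep lin_cat !lin1 !mul1r.
have VE i w : lin V (rep2 i) w = lin (@coord R n) (gw i) w.1 + Num.sqrt m * w.2 0 i.
 by rewrite /rep2 lin_cat !lin1 !mul1r.
have mX i : mble (X i) by exact: gproc_measurable gX i.
have mEX : measurable (pts_event X (enum 'I_n) 0 `&` [set w | \sum_i X i w <= n%:R * r]).
 apply: measurableI; first exact: measurable_pts gX _ _.
 have := @measurable_ge _ _ _ (fun w => - \sum_i X i w) (- (n%:R * r)).
 rewrite (_ : [set w | _] = [set w | \sum_i X i w <= n%:R * r]); last first.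
  by apply/funext => w /=; rewrite lerN2.
 by apply; apply: measurableT_comp => //; exact: measurable_sum.
pose B := bands (fun i => lin (@coord R n) (gb i)) [seq ([:: (1, i)], k) | i <- enum 'I_n].
have mB : measurable B by exact: mstrip ggb _.
have PB : 1 - n%:R * (2 * expR (- (k ^+ 2 / (2 * de)))) <= fine (gauss n B).
 have m1 i := mstrip ggb [:: ([:: (1, i)], k)].
 have hB : ~` B `<=` \big[setU/set0]_(i <- enum 'I_n)
   ~` bands (fun i => lin (@coord R n) (gb i)) [:: ([:: (1, i)], k)].
  move=> w /negP; rewrite -has_predC has_map => /hasP[i _ hi].
  rewrite -bigcup_seq; exists i; first by rewrite /= mem_enum.
  by move=> h; move: hi => /=; rewrite /bands /= andbT in h; rewrite h.
 have := le_fineP (gauss n) (measurableC mB) _ hB.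
 rewrite fineP_setC// => h.
 have := @fineP_bigU R _ _ (gauss n) _ (enum 'I_n)
  (fun i => ~` bands (fun i => lin (@coord R n) (gb i)) [:: ([:: (1, i)], k)])
  (2 * expR (- (k ^+ 2 / (2 * de)))).
 rewrite size_enum_ord => h2.
 have {}h := h _; have {}h2 := h2 _ _.
 have mU : measurable (\big[setU/set0]_(i <- enum 'I_n)
   ~` bands (fun i => lin (@coord R n) (gb i)) [:: ([:: (1, i)], k)]).
  by apply: bigsetU_measurable => i _; exact: measurableC.
 have {}h := h mU.
 have {h2} : fine (gauss n (\big[setU/set0]_(i <- enum 'I_n)
   ~` bands (fun i => lin (@coord R n) (gb i)) [:: ([:: (1, i)], k)])) <=
  n%:R * (2 * expR (- (k ^+ 2 / (2 * de)))).
  apply: h2 => i; first exact: measurableC.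
  rewrite fineP_setC//.
  have := @strip1_ge _ _ _ _ _ _ _ ggb [:: (1, i)] k de.
  by rewrite qf1 !mul1r => /(_ (bed i) de0 k0); lra.
 by move: h; lra.
have [hneg|hpos] := leP (1 - n%:R * (2 * expR (- (k ^+ 2 / (2 * de))))) 0.
 apply: (le_trans (y := 0)); last by rewrite addr_ge0 ?expR_ge0.
 by rewrite mulr_ge0_le0 ?fineP_ge0.
apply: (le_trans (ler_wpM2l (fineP_ge0 _ _) PB)).
rewrite -fineM ?fin_num_measure//.
set E0 := _ `&` _ in mEX *.
have -> : (P E0 * gauss n B)%E = prodP P (gauss n) (E0 `*` B).
 by apply/esym; exact: product_measure1E.
have mPY : measurable (polyh (fun i => lin Z (rep i)) cs).
 by apply: measurable_polyh => i; exact: gproc_mlin gY _.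
have mPV : measurable (polyh (fun i => lin V (rep2 i)) cs).
 by apply: measurable_polyh => i; exact: gproc_mlin gV _.
apply: (le_trans (y := fine (prodP P (gauss n) (polyh (fun i => lin Z (rep i)) cs)))).
 apply: le_fineP => //; first exact: measurableX.
 move=> [w x] /= [[/allP hp hs] hB]; apply/csE.
 have hb i : `|lin (@coord R n) (gb i) x| <= k.
  move: hB; rewrite /B /bands /= all_map => /allP /(_ i).
  by rewrite mem_enum /= lin1 mul1r; exact.
 split=> [i|].
  by rewrite ZE /=; have := hp i; rewrite mem_enum => /(_ isT); have := hb i; rewrite ler_norml => /andP[]; lra.
 under eq_bigr do rewrite ZE /=.
 rewrite big_split /= mulrDr lerD//.
 apply: (le_trans (y := \sum_(i < n) k)); last by rewrite sumr_const card_ord mulr_natl.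
 by apply: ler_sum => i _; have := hb i; rewrite ler_norml => /andP[].
rewrite {}law.
(* The mean of the sample g is at most - k / sqrt m. Off this event the sum of W is at most n (r +
   2k), which yields the 3k of the statement once the k of each constraint is added. *)
pose Eg := [set w : 'rV[R]_n * 'rV[R]_n | k * n%:R / Num.sqrt m <= lin V [seq (-1, inr i) | i <- enum 'I_n] w].
have EgE w : lin V [seq (-1, inr i) | i <- enum 'I_n] w = - \sum_i w.2 0 i.
 by rewrite /lin big_map big_enum /= -sumrN; apply: eq_bigr => i _; rewrite mulN1r.
have mEg : measurable Eg by exact: measurable_ge (gproc_mlin gV _).
have sm : 0 < Num.sqrt m by rewrite sqrtr_gt0.
have PEg : fine (prodP (gauss n) (gauss n) Eg) <= expR (- (k ^+ 2 * n%:R / (2 * m))).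
 have := @gproc_tail _ _ _ _ _ _ _ gV [seq (-1, inr i) | i <- enum 'I_n] (k * n%:R / Num.sqrt m) n%:R.
 have -> : (k * n%:R / Num.sqrt m) ^+ 2 / (2 * n%:R) = k ^+ 2 * n%:R / (2 * m).
  by rewrite exprMn exprVn sqr_sqrtr ?(ltW m0)//; field; rewrite !gt_eqF.
 have h0 : 0 <= k * n%:R / Num.sqrt m by rewrite divr_ge0 ?mulr_ge0// ltW.
 move=> hh; apply: hh => //.
 rewrite /qf big_map big_enum /= (eq_bigr (fun _ => 1)); last first.
  move=> i _; rewrite big_map big_enum /= (bigD1 i)//= eqxx mulr1 mulrNN mulr1 big1 ?addr0//.
  by move=> j ji; rewrite eq_sym (negbTE ji) mulr0.
 by rewrite sumr_const card_ord.
set PV := polyh _ _ in mPV *.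
apply: (le_trans (y := fine (prodP (gauss n) (gauss n) Eg) + fine (prodP (gauss n) (gauss n) (PV `\` Eg)))).
 apply: le_trans (fineP_setU _ mEg (measurableD mPV mEg)).
 apply: le_fineP => //; first by apply: measurableU => //; exact: measurableD.
 by move=> w hw; case: (pselect (Eg w)) => h; [left|right].
apply: lerD => //; apply: product_section_le; first exact: measurableD.
move=> w; pose W i := lin (@coord R n) (gw i) w.
have [hW|hW] := leP (\sum_i W i) (n%:R * (r + 2 * k)); last first.
 rewrite (_ : xsection _ _ = set0) ?measure0 ?expR_ge0//.
 apply/seteqP; split=> // x; rewrite /xsection /= inE => -[/csE[_ h] /negP].
 rewrite /Eg /= EgE -ltNge /= ltr_pdivlMr// => h'.
 move: h; under eq_bigr do rewrite VE /=.
 rewrite big_split /= -mulr_sumr -/(W _); move: hW h'.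
 rewrite mulNr (mulrC (\sum_i _) (Num.sqrt m)).
 under [X in _ -> _ -> X + _ <= _ -> _]eq_bigr do rewrite -/(W _).
 by lra.
apply: (le_trans (y := \prod_i Q ((- k - W i) / Num.sqrt m))).
 rewrite -gauss_rV_orthant; apply: le_fineP.
 - by apply: measurable_xsection; exact: measurableD.
 - rewrite (_ : [set _ | _] = \bigcap_i [set x : 'rV[R]_n | (- k - W i) / Num.sqrt m <= x 0 i]).
   by apply: fin_bigcap_measurable => // i _; exact: measurable_ge (@measurable_coordR R n i).
  by apply/seteqP; split=> x /= h => [i _|i]; exact: h.
 move=> x; rewrite /xsection /= inE => -[/csE[h _] _] i.
 by rewrite ler_pdivrMr// mulrC lerBlDl; have := h i; rewrite VE /= -/(W i).
apply: (le_trans (y := \prod_i expR (- (Q (a1 + 1) / 2 * (1 - (k + W i) / Num.sqrt m / a1))))).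
 apply: ler_prod => i _; rewrite Q_ge0 /= -opprD mulNr; exact: Q_exp.
rewrite -expR_sum ler_expR sumrN lerN2 -mulr_sumr.
apply: ler_wpM2l; first by rewrite divr_ge0 ?Q_ge0.
rewrite sumrB sumr_const card_ord -!mulr_suml big_split /= sumr_const card_ord -[k *+ n]mulr_natl.
have c0 : 0 <= (Num.sqrt m)^-1 * a1^-1 by rewrite mulr_ge0 ?invr_ge0 ?(ltW sm)// ltW.
have h : n%:R * k + \sum_i W i <= n%:R * (r + 3 * k) by move: hW; lra.
have := ler_wpM2r c0 h; rewrite -/(W _); clear.
move: (\sum_i _) ((Num.sqrt m)^-1) (a1^-1) (n%:R : R) => x y z t; lra.
Qed.

End upper_bound.

(** * Square-integrable functions: inner product and completeness *)

Section square_integrable.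
Context {R : realType} {d} {T : measurableType d} (mu : {measure set T -> \bar R}).
Implicit Types F G H : T -> R.

Definition sqi F := mble F /\ (\int[mu]_x (F x ^+ 2)%:E < +oo)%E.
Definition ip F G : R := \int[mu]_x (F x * G x).

Lemma sqi_measurable F : sqi F -> mble F. Proof. by case. Qed.

Lemma measurable_sqr F : mble F -> mble (fun x => (F x ^+ 2)%:E).
Proof.
move=> mF; apply/measurable_EFinP.
by under eq_fun do rewrite expr2; exact: measurable_funM.
Qed.

Lemma sqi_sqr F : sqi F -> mu.-integrable setT (fun x => (F x ^+ 2)%:E).
Proof.
move=> [mF fF]; apply/integrableP; split; first exact: measurable_sqr.
by under eq_integral do rewrite gee0_abs ?lee_fin ?sqr_ge0//.
Qed.

Lemma sqi_mul F G : sqi F -> sqi G -> mu.-integrable setT (fun x => (F x * G x)%:E).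
Proof.
move=> sF sG; have hFG := integrableD measurableT (sqi_sqr sF) (sqi_sqr sG).
apply: le_integrable hFG => //.
 by apply/measurable_EFinP; apply: measurable_funM; [case: sF|case: sG].
move=> x _ /=; rewrite lee_fin normrM.
rewrite [X in _ <= X]ger0_norm ?addr_ge0 ?sqr_ge0//.
rewrite -(real_normK (num_real (F x))) -(real_normK (num_real (G x))).
by have := sqr_ge0 (`|F x| - `|G x|); have := normr_ge0 (F x); have := normr_ge0 (G x); nra.
Qed.

Lemma sqi_lin2 a b F G : sqi F -> sqi G -> sqi (fun x => a * F x + b * G x).
Proof.
move=> sF sG; have mH : mble (fun x => a * F x + b * G x).
 by apply: measurable_funD; apply: measurable_funM => //; [case: sF|case: sG].
split => //.
have h1 := integrableZl measurableT (2 * a ^+ 2) (sqi_sqr sF).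
have h2 := integrableZl measurableT (2 * b ^+ 2) (sqi_sqr sG).
have /integrableP[_] := integrableD measurableT h1 h2.
apply: le_lt_trans; apply: ge0_le_integral => //.
- by move=> x _; rewrite lee_fin sqr_ge0.
- exact: measurable_sqr.
- by apply: measurableT_comp => //; have /integrableP[] := integrableD measurableT h1 h2.
- move=> x _ /=; rewrite lee_fin ger0_norm; last first.
  by rewrite addr_ge0// mulr_ge0 ?sqr_ge0// mulr_ge0 ?sqr_ge0.
 by have := sqr_ge0 (a * F x - b * G x); nra.
Qed.

Lemma sqiD F G : sqi F -> sqi G -> sqi (fun x => F x + G x).
Proof.
move=> sF sG; have := sqi_lin2 1 1 sF sG.
by rewrite (_ : (fun x => 1 * _ + _) = fun x => F x + G x)//; apply/funext => x; rewrite !mul1r.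
Qed.

Lemma sqiB F G : sqi F -> sqi G -> sqi (fun x => F x - G x).
Proof.
move=> sF sG; have := sqi_lin2 1 (-1) sF sG.
by rewrite (_ : (fun x => 1 * _ + _) = fun x => F x - G x)//; apply/funext => x; rewrite mul1r mulN1r.
Qed.

Lemma sqiZ c F : sqi F -> sqi (fun x => c * F x).
Proof.
move=> sF; have := sqi_lin2 c 0 sF sF.
by rewrite (_ : (fun x => c * _ + _) = fun x => c * F x)//; apply/funext => x; rewrite mul0r addr0.
Qed.

Lemma ipC F G : ip F G = ip G F.
Proof. by apply: eq_Rintegral => x _; rewrite mulrC. Qed.

Lemma ipDl F G H : sqi F -> sqi G -> sqi H -> ip (fun x => F x + G x) H = ip F H + ip G H.
Proof.
move=> sF sG sH; rewrite /ip -RintegralD//; [|exact: sqi_mul|exact: sqi_mul].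
by apply: eq_Rintegral => x _; rewrite mulrDl.
Qed.

Lemma ipZl c F H : sqi F -> sqi H -> ip (fun x => c * F x) H = c * ip F H.
Proof.
move=> sF sH; rewrite /ip -RintegralZl//; last exact: sqi_mul.
by apply: eq_Rintegral => x _; rewrite mulrA.
Qed.

Lemma ip0l H : ip (fun=> 0) H = 0.
Proof. by rewrite /ip /Rintegral; under eq_integral do rewrite mul0r; rewrite integral0. Qed.
Lemma ip_ge0 F : 0 <= ip F F.
Proof. by apply: Rintegral_ge0 => // x _; rewrite -expr2 sqr_ge0. Qed.

Lemma EFin_ip F : sqi F -> (ip F F)%:E = (\int[mu]_x (F x ^+ 2)%:E)%E.
Proof.
move=> sF; rewrite /ip /Rintegral; under eq_integral do rewrite -expr2.
by rewrite fineK// integrable_fin_num//; exact: sqi_sqr.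
Qed.

Lemma sqi_cvg (F : nat -> T -> R) (G : T -> R) (M : R) :
 (forall n, mble (F n)) -> (forall x, F n x @[n --> \oo] --> G x) ->
 (forall n, (\int[mu]_x (F n x ^+ 2)%:E <= M%:E)%E) ->
 mble G /\ (\int[mu]_x (G x ^+ 2)%:E <= M%:E)%E.
Proof.
move=> mF FG hM; have mG : mble G by apply: measurable_fun_cvg mF _ => x _; exact: FG.
split=> //.
have := @fatou _ _ _ mu setT measurableT (fun n x => (F n x ^+ 2)%:E).
have e x : limn_einf (fun n => (F n x ^+ 2)%:E) = (G x ^+ 2)%:E.
 have h : (F n x ^+ 2)%:E @[n --> \oo] --> (G x ^+ 2)%:E.
  apply: cvg_EFin; first by apply: nearW.
  by rewrite expr2 /=; under eq_fun do rewrite expr2; exact: cvgM.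
 by rewrite is_cvg_limn_einfE; [exact/cvg_lim|apply/cvg_ex; eexists; exact: h].
move=> /(_ (fun n => measurable_sqr (mF n))) /(_ _) h.
have {}h : (\int[mu]_x (limn_einf (fun n => (F n x ^+ 2)%:E)) <=
 limn_einf (fun n => \int[mu]_x (F n x ^+ 2)%:E))%E.
 by apply: h => n x _; rewrite lee_fin sqr_ge0.
have {}h : (\int[mu]_x (G x ^+ 2)%:E <= limn_einf (fun n => \int[mu]_x (F n x ^+ 2)%:E))%E.
 by apply: le_trans h; rewrite (eq_integral (fun x => limn_einf (fun n => (F n x ^+ 2)%:E)))// => x _; rewrite e.
apply: (le_trans h); rewrite limn_einf_lim; apply: lime_le; first exact: is_cvg_einfs.
by apply: nearW => n; apply: le_trans (hM n); apply: ereal_inf_lbound; exists n => /=.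
Qed.

(** A convergence test on the single sequence u, unchanged by u -> - u. Multiplying by it makes
    limits exist at every point rather than almost everywhere, so that pointwise symmetries pass to
    the limit. *)
Definition fastc (u : nat -> R) : bool :=
 `[< (\sum_(0 <= n <oo) (2 ^+ n * (u n.+1 - u n) ^+ 2)%:E < +oo)%E >].

Lemma fastcN (u : nat -> R) : fastc (fun n => - u n) = fastc u.
Proof.
rewrite /fastc; congr (`[< (_ < _)%E >]); apply: eq_eseriesr => n _.
by congr (_ * _)%:E; rewrite -opprB sqrrN; congr (_ ^+ 2); ring.
Qed.

(** Each term of the series is at most its sum, so the increments decay like 2^(-n/2). *)
Lemma fastc_cvg (u : nat -> R) : fastc u -> cvgn u.
Proof.
move=> /asboolP; set B := (\sum_(_ <= _ <oo) _)%E => hB.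
have t0 n : (0 <= (2 ^+ n * (u n.+1 - u n) ^+ 2)%:E)%E.
 by rewrite lee_fin mulr_ge0 ?sqr_ge0 ?exprn_ge0.
have B0 : (0 <= B)%E by apply: nneseries_ge0 => n _ _; exact: t0.
have Bf : B \is a fin_num by rewrite ge0_fin_numE.
have ub n : 2 ^+ n * (u n.+1 - u n) ^+ 2 <= fine B.
 rewrite -lee_fin fineK//.
 apply: le_trans (nneseries_lim_ge n.+1 (fun i _ _ => t0 i)).
 by rewrite big_nat_recr//= leeDr// sume_ge0.
pose q : R := Num.sqrt (2^-1).
have q0 : 0 <= q by exact: sqrtr_ge0.
have q2 : q ^+ 2 = 2^-1 by rewrite sqr_sqrtr// invr_ge0.
have q1 : `|q| < 1.
 rewrite ger0_norm// -(@ltr_pXn2r _ 2%N) ?nnegrE// expr1n q2; lra.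
pose v n := u n.+1 - u n.
have vb n : `|v n| <= Num.sqrt (fine B) * q ^+ n.
 rewrite -(@ler_pXn2r _ 2%N) ?nnegrE ?mulr_ge0 ?sqrtr_ge0 ?exprn_ge0//.
 rewrite exprMn sqr_sqrtr ?fine_ge0// -exprM mulnC exprM q2 real_normK ?num_real//.
 by rewrite exprVn ler_pdivlMr ?exprn_gt0// mulrC; exact: ub.
have cv : cvgn (series v).
 apply: normed_cvg.
 apply: (series_le_cvg _ _ vb (is_cvg_geometric_series q1)) => n; first exact: normr_ge0.
 by rewrite mulr_ge0 ?sqrtr_ge0 ?exprn_ge0.
have e : u = fun n => u 0%N + series v n.
 by apply/funext => n; rewrite /series /= telescope_sumr// addrC subrK.
rewrite e; apply: is_cvgD => //; exact: is_cvg_cst.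
Qed.

(** The weight 2^n against squared increments M / 8^n leaves the summable M / 4^n, so the test
    [fastc] holds almost everywhere. The rate towards the limit is obtained by Fatou's lemma. *)
Lemma sqi_complete (F : nat -> T -> R) (M : R) : (forall n, sqi (F n)) ->
 (forall n m, (n <= m)%N -> ip (fun x => F n x - F m x) (fun x => F n x - F m x) <= M / 8 ^+ n) ->
 exists G, [/\ sqi G, forall x, F n x * (fastc (F^~ x))%:R @[n --> \oo] --> G x
 & forall n, ip (fun x => F n x - G x) (fun x => F n x - G x) <= M / 8 ^+ n].
Proof.
move=> sF hF.
pose h n x := (2 ^+ n * (F n.+1 x - F n x) ^+ 2)%:E.
have h0 n x : (0 <= h n x)%E by rewrite lee_fin mulr_ge0 ?sqr_ge0 ?exprn_ge0.
have mD n : mble (fun x => F n.+1 x - F n x).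
 by apply: measurable_funB; apply: sqi_measurable.
have mh n : mble (h n).
 have -> : h n = fun x => ((2 ^+ n)%:E * ((F n.+1 x - F n x) ^+ 2)%:E)%E by [].
 apply: emeasurable_funM => //; exact: measurable_sqr.
have M0 : 0 <= M.
 by have := hF 0%N 0%N (leqnn _); rewrite expr0 divr1; apply: le_trans; exact: ip_ge0.
pose H x := (\sum_(0 <= n <oo) h n x)%E.
have mH : mble H.
 have := @ge0_emeasurable_sum _ _ _ setT h xpredT (fun k x _ _ => h0 k x) (fun k _ => mh k).
 by rewrite (_ : (fun x => _) = H)//; apply/funext => x; apply: eq_eseriesl.
have H0 x : (0 <= H x)%E by apply: nneseries_ge0 => n _ _; exact: h0.
have intH : (\int[mu]_x H x < +oo)%E.
 rewrite /H integral_nneseries//.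
 have hb n : (\int[mu]_x h n x <= (M * (1 / 4) ^+ n)%:E)%E.
  have sD : sqi (fun x => F n x - F n.+1 x) by exact: sqiB.
  have -> : (\int[mu]_x h n x = (2 ^+ n * ip (fun x => F n x - F n.+1 x) (fun x => F n x - F n.+1 x))%:E)%E.
   rewrite EFinM EFin_ip// -ge0_integralZl//; last first.
   - by move=> x _; rewrite lee_fin sqr_ge0.
   - exact: measurable_sqr (sqi_measurable sD).
   by apply: eq_integral => x _; rewrite /h EFinM -opprB sqrrN.
  rewrite lee_fin; have := hF n n.+1 (leqnSn _) => hn.
  apply: (le_trans (ler_wpM2l _ hn)); first exact: exprn_ge0.
  rewrite mulrCA ler_wpM2l// -exprVn -exprMn; apply: lerXn2r; rewrite ?nnegrE; lra.
 apply: (@le_lt_trans _ _ (\sum_(0 <= n <oo) (M * (1 / 4) ^+ n)%:E)%E).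
  by apply: lee_nneseries => n; [move=> _ _; apply: integral_ge0 => x _; exact: h0|move=> _; exact: hb].
 have hc : `|1 / 4 : R| < 1 by rewrite ger0_norm; lra.
 have := @cvg_geometric_series _ M _ hc.
 move=> c1; have cc : (series (geometric M (1 / 4 : R)) n)%:E @[n --> \oo] --> (M / (1 - 1 / 4))%:E.
  by apply: cvg_EFin; [exact: nearW|exact: c1].
 have -> : (\sum_(0 <= n <oo) (M * (1 / 4) ^+ n)%:E = (M / (1 - 1 / 4))%:E)%E.
  apply/cvg_lim => //; apply: cvg_trans cc; apply: near_eq_cvg; apply: nearW => n /=.
  by rewrite sumEFin.
 exact: ltry.
have aeH : {ae mu, forall x, fastc (F^~ x)}.
 have /(integrable_ae measurableT) : mu.-integrable setT H.
  by apply/integrableP; split=> //; under eq_integral do rewrite gee0_abs//.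
 apply: filterS => x /(_ I) hx; apply/asboolP; rewrite -/(H x).
 by rewrite -ge0_fin_numE.
pose F' n x := F n x * (fastc (F^~ x))%:R.
have mc : mble (fun x => (fastc (F^~ x))%:R : R).
 have mE : measurable [set x | (H x < +oo)%E].
  by rewrite -[X in measurable X]setTI; exact: emeasurable_fun_infty_o.
 rewrite (_ : (fun x => _) = \1_[set x | (H x < +oo)%E]); first exact: measurable_indic.
 by apply/funext => x; rewrite indicE.
have mF' n : mble (F' n) by apply: measurable_funM => //; exact: sqi_measurable.
have cF' x : cvgn (F'^~ x).
 rewrite /F'; case: (boolP (fastc _)) => hx /=; last by apply/cvg_ex; exists 0; under eq_fun do rewrite mulr0; exact: cvg_cst.
 by under eq_fun do rewrite mulr1; exact: fastc_cvg.
pose G x := limn (F'^~ x).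
have FG x : F' n x @[n --> \oo] --> G x by exact: cF'.
have key n : mble (fun x => F' n x - G x) /\
  (\int[mu]_x ((F' n x - G x) ^+ 2)%:E <= (M / 8 ^+ n)%:E)%E.
 apply: (@sqi_cvg (fun k x => F' n x - F' (k + n)%N x)) => [k|x|k].
 - exact: measurable_funB.
 - apply: cvgB; first exact: cvg_cst.
  have h1 := FG x; rewrite -(@cvg_shiftn n) in h1; exact: h1.
 - apply: le_trans (_ : (\int[mu]_x ((F n x - F (k + n)%N x) ^+ 2)%:E <= _)%E); last first.
   rewrite -EFin_ip ?lee_fin; first by apply: hF; rewrite leq_addl.
   exact: sqiB.
  apply: ge0_le_integral => //.
  + by move=> x _; rewrite lee_fin sqr_ge0.
  + by apply: measurable_sqr; exact: measurable_funB.
  + by apply: measurable_sqr; apply: measurable_funB; exact: sqi_measurable.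
  + move=> x _; rewrite lee_fin /F' -mulrBl exprMn -[X in _ <= X]mulr1 ler_wpM2l ?sqr_ge0//.
   by case: (fastc _); rewrite ?expr1n// expr0n.
have aeF' n : ae_eq mu setT (F n) (F' n).
 by apply: filterS aeH => x hx _; rewrite /F' hx mulr1.
have sF' n : sqi (F' n).
 split=> //; have [_] := sF n; apply: le_lt_trans; apply: ge0_le_integral => //.
 - by move=> x _; rewrite lee_fin sqr_ge0.
 - exact: measurable_sqr.
 - exact: measurable_sqr (sqi_measurable (sF n)).
 - move=> x _; rewrite lee_fin /F' exprMn -[X in _ <= X]mulr1 ler_wpM2l ?sqr_ge0//.
  by case: (fastc _); rewrite ?expr1n// expr0n.
have sG : sqi G.
 have s0 : sqi (fun x => F' 0%N x - G x).
  split; first by have [] := key 0%N.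
  by have [_ /le_lt_trans] := key 0%N; apply; exact: ltry.
 have := sqiB (sF' 0%N) s0; rewrite (_ : (fun x => _ - (_ - _)) = G)//.
 by apply/funext => x; rewrite subKr.
exists G; split=> // n.
rewrite -lee_fin EFin_ip; last exact: sqiB.
have [mk hk] := key n; apply: le_trans hk.
rewrite (@ge0_ae_eq_integral _ _ _ mu setT (fun x => ((F n x - G x) ^+ 2)%:E) (fun x => ((F' n x - G x) ^+ 2)%:E))//.
- apply: measurable_sqr; apply: measurable_funB; apply: sqi_measurable => //.
- exact: measurable_sqr.
- by move=> x _; rewrite lee_fin sqr_ge0.
- by move=> x _; rewrite lee_fin sqr_ge0.
- by apply: filterS (aeF' n) => x /(_ I) -> _.
Qed.

End square_integrable.

Section lin_ip.
Context {R : realType} {d} {T : measurableType d} (mu : {measure set T -> \bar R}) {A : Type}.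
Variable X : A -> T -> R.
Hypothesis sX : forall a, sqi mu (X a).

Lemma sqi_lin s : sqi mu (lin X s).
Proof.
elim: s => [|p s IH].
 rewrite (_ : lin X [::] = fun=> 0); last by apply/funext => x; rewrite lin_nil.
 split; first exact: measurable_cst.
 by under eq_integral do rewrite expr0n/=; rewrite integral0.
rewrite (_ : lin X (p :: s) = fun x => p.1 * X p.2 x + lin X s x); last first.
 by apply/funext => x; rewrite /lin big_cons.
by apply: sqiD => //; exact: sqiZ.
Qed.

Lemma ip_linl s G : sqi mu G -> ip mu (lin X s) G = \sum_(p <- s) p.1 * ip mu (X p.2) G.
Proof.
move=> sG; elim: s => [|p s IH].
 rewrite (_ : lin X [::] = fun=> 0) ?big_nil ?ip0l//.
 by apply/funext => x; rewrite lin_nil.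
rewrite (_ : lin X (p :: s) = fun x => p.1 * X p.2 x + lin X s x); last first.
 by apply/funext => x; rewrite /lin big_cons.
rewrite ipDl//; [|exact: sqiZ|exact: sqi_lin].
by rewrite ipZl// IH big_cons.
Qed.

Lemma ip_lin s t : ip mu (lin X s) (lin X t) = qf (fun a b => ip mu (X a) (X b)) s t.
Proof.
rewrite ip_linl; last exact: sqi_lin.
apply: eq_bigr => p _; rewrite ipC ip_linl// mulr_sumr; apply: eq_bigr => q _.
by rewrite ipC mulrA.
Qed.

End lin_ip.

(** * Gaussian variables: moments and joint laws *)

Section gaussian_variables.
Context {R : realType} {dO} {Omega : measurableType dO} (P : probability Omega R).

Lemma Rint_law (X : Omega -> R) (nu : {measure set (measurableTypeR R) -> \bar R}) (F : R -> R) :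
 mble X -> (forall A : set (measurableTypeR R), measurable A -> P (X @^-1` A) = nu A) ->
 bmf F -> \int[P]_w F (X w) = \int[nu]_x F x.
Proof.
move=> mX hX bF; rewrite /Rintegral; congr fine.
transitivity (\int[pushforward P (X : Omega -> measurableTypeR R)]_x (F x)%:E)%E.
 rewrite integral_pushforward//; first by apply/measurable_EFinP; exact: bmf_mble bF.
 rewrite preimage_setT; apply: (@bmf_integrable _ _ _ P (fun w => F (X w))).
 split; first by apply: measurableT_comp => //; exact: bmf_mble.
 by have [_ [M hM]] := bF; exists M.
by apply: eq_measure_integral => A mA _; rewrite /= -hX.
Qed.

Lemma int_sqr_law (X : Omega -> R) (nu : {measure set (measurableTypeR R) -> \bar R}) :
 mble X -> (forall A : set (measurableTypeR R), measurable A -> P (X @^-1` A) = nu A) ->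
 (\int[P]_w (X w ^+ 2)%:E = \int[nu]_x (x ^+ 2)%:E)%E.
Proof.
move=> mX hX; transitivity (\int[pushforward P (X : Omega -> measurableTypeR R)]_x (x ^+ 2)%:E)%E.
 rewrite ge0_integral_pushforward//.
  by apply/measurable_EFinP; under eq_fun do rewrite expr2; exact: measurable_funM.
 by move=> x _; rewrite lee_fin sqr_ge0.
by apply: eq_measure_integral => A mA _; rewrite /= -hX.
Qed.

Lemma gaussian_facts (X : Omega -> R) : mble X -> centred_gaussian P X ->
 [/\ \int[P]_w cos (X w) = expR (- (ip P X X / 2)), \int[P]_w sin (X w) = 0 & sqi P X].
Proof.
move=> mX [s s0 hX].
have bc : bmf (fun x : R => cos x) by apply: bmf_cos; exact: measurable_id.
have bs : bmf (fun x : R => sin x) by apply: bmf_sin; exact: measurable_id.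
case: (eqVneq s 0) hX => [_ hX|sn hX].
 have hX' (A : set (measurableTypeR R)) : measurable A -> P (X @^-1` A) = \d_(0 : measurableTypeR R) A.
  exact: hX.
 have I2 : (\int[P]_w (X w ^+ 2)%:E = 0)%E.
  rewrite (int_sqr_law mX hX') integral_dirac//; first by rewrite diracE mem_set// mul1e expr0n.
  by apply/measurable_EFinP; under eq_fun do rewrite expr2; exact: measurable_funM.
 have sX : sqi P X by split=> //; rewrite I2.
 have -> : ip P X X = 0 by apply: EFin_inj; rewrite EFin_ip// I2.
 rewrite mul0r oppr0 expR0; split=> //.
  rewrite (Rint_law mX hX' bc) /Rintegral integral_dirac//; last by apply/measurable_EFinP; exact: bmf_mble bc.
  by rewrite diracE mem_set// mul1e cos0.
 rewrite (Rint_law mX hX' bs) /Rintegral integral_dirac//; last by apply/measurable_EFinP; exact: bmf_mble bs.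
 by rewrite diracE mem_set// mul1e sin0.
have I2 : (\int[P]_w (X w ^+ 2)%:E = (s ^+ 2)%:E)%E.
 by rewrite (int_sqr_law mX hX) normal_sqr.
have sX : sqi P X by split=> //; rewrite I2 ltry.
have -> : ip P X X = s ^+ 2 by apply: EFin_inj; rewrite EFin_ip// I2.
have e t x : t * x + 0 = t * x :> R by rewrite addr0.
split=> //.
 rewrite (Rint_law mX hX bc); have := normal_cos sn 1 0.
 rewrite cos0 mul1r expr1n mul1r => <-; apply: eq_Rintegral => x _.
 by rewrite mul1r addr0.
rewrite (Rint_law mX hX bs); have := normal_cos sn 1 (- (pi / 2)).
rewrite cosN cos_pihalf mul0r => h.
by apply: etrans h; apply: eq_Rintegral => x _; rewrite mul1r cosBpihalf.
Qed.

(** Rectangles form a pi-system generating the product sigma-algebra, so the two joint laws agree,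
    and the inner product is an integral against the joint law. *)
Lemma eq_law_ip (X Y X' Y' : Omega -> R) :
 sqi P X -> sqi P Y -> sqi P X' -> sqi P Y' ->
 (forall A B : set (measurableTypeR R), measurable A -> measurable B ->
  P [set w | A (X w) /\ B (Y w)] = P [set w | A (X' w) /\ B (Y' w)]) ->
 ip P X Y = ip P X' Y'.
Proof.
move=> sX sY sX' sY' h.
have mp (U V : Omega -> R) : sqi P U -> sqi P V ->
  exists2 phi : {mfun Omega >-> (R * R)%type},
   (forall w, phi w = (U w, V w)) &
   ip P U V = fine (\int[image_prob P phi]_z (z.1 * z.2)%:E)%E.
 move=> sU sV.
 have mf : mble (fun w => (U w, V w)).
  by apply/measurable_fun_pairP; split; [case: sU|case: sV].
 pose phi : {mfun Omega >-> (R * R)%type} := mfun_Sub (mem_set mf).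
 exists phi => //; congr fine; rewrite integral_distribution//; last exact: sqi_mul.
 by apply/measurable_EFinP; apply: measurable_funM; [exact: measurable_fst|exact: measurable_snd].
have [phi e1 ->] := mp _ _ sX sY; have [psi e2 ->] := mp _ _ sX' sY'.
congr fine; apply: eq_measure_integral => D mD _.
pose rect : set (set (R * R)) :=
 [set A `*` B | A in measurable & B in measurable].
apply: (@measure_unique _ _ _ rect (fun=> setT)).
- exact: measurable_prod_measurableType.
- move=> _ _ [A mA [B mB <-]] [A' mA' [B' mB' <-]].
 exists (A `&` A'); first exact: measurableI.
 exists (B `&` B'); first exact: measurableI.
 by apply/seteqP; split=> -[x y] /=; [move=> [[? ?] [? ?]]|move=> [[? ?] [? ?]]].
- by move=> _; exists setT => //; exists setT => //; apply/seteqP; split.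
- by rewrite bigcup_const.
- move=> _ [A mA [B mB <-]].
 transitivity (P [set w | A (X w) /\ B (Y w)]).
  by apply: (congr1 P); apply/seteqP; split=> w /=; rewrite e1.
 rewrite (h _ _ mA mB); apply: (congr1 P).
 by apply/seteqP; split=> w /=; rewrite e2.
- by move=> _; rewrite ltey_eq fin_num_measure.
- exact: mD.
Qed.

End gaussian_variables.

(** * The covariance kernel as a Fourier transform *)

Section spectral_basics.
Context {R : realType} {G : setting} {d : nat}.
Implicit Types (x y : site R G d) (l : 'rV[R]_d).

Lemma posB x y : pos (x - y) = pos x - pos y.
Proof. by case: G x y => //= x y; apply/rowP => i; rewrite !mxE intrB. Qed.
Lemma posD x y : pos (x + y) = pos x + pos y.
Proof. by case: G x y => //= x y; apply/rowP => i; rewrite !mxE intrD. Qed.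
Lemma pos0 : pos (0 : site R G d) = 0.
Proof. by case: G => //=; apply/rowP => i; rewrite !mxE. Qed.
Lemma edotDr l (a b : 'rV[R]_d) : edot l (a + b) = edot l a + edot l b.
Proof. by rewrite /edot -big_split; apply: eq_bigr => i _; rewrite mxE mulrDr. Qed.
Lemma edotNr l (a : 'rV[R]_d) : edot l (- a) = - edot l a.
Proof. by rewrite /edot -sumrN; apply: eq_bigr => i _; rewrite mxE mulrN. Qed.
Lemma edotNl l (a : 'rV[R]_d) : edot (- l) a = - edot l a.
Proof. by rewrite /edot -sumrN; apply: eq_bigr => i _; rewrite mxE mulNr. Qed.
Lemma edot0r l : edot l 0 = 0.
Proof. by rewrite /edot big1// => i _; rewrite mxE mulr0. Qed.

Lemma measurable_edot (a : 'rV[R]_d) : mble (fun l => edot l a).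
Proof.
apply: measurable_sum => i; apply: measurable_funM => //; exact: measurable_coord.
Qed.

Definition phase x l : R := 2 * pi * edot l (pos x).
Definition cosw x l : R := cos (phase x l).
Definition sinw x l : R := sin (phase x l).

Lemma measurable_phase x : mble (phase x).
Proof. by apply: measurable_funM => //; exact: measurable_edot. Qed.

Lemma bmf_cosw x : bmf (cosw x). Proof. exact: bmf_cos (measurable_phase x). Qed.
Lemma bmf_sinw x : bmf (sinw x). Proof. exact: bmf_sin (measurable_phase x). Qed.

Lemma phaseB x y l : phase (x - y) l = phase x l - phase y l.
Proof. by rewrite /phase posB edotDr edotNr mulrDr mulrN. Qed.
Lemma phase0 l : phase 0 l = 0.
Proof. by rewrite /phase pos0 edot0r mulr0. Qed.

Variable mu : fin_measure R d.

Definition kern x : R := \int[mu]_l cosw x l.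
Definition kcov x y : R := kern (x - y).

Lemma sqi_bmf (F : 'rV[R]_d -> R) : bmf F -> sqi mu F.
Proof.
move=> bF; split; first exact: bmf_mble bF.
have := bmf_integrable mu (bmfM bF bF) => /integrableP[_]; apply: le_lt_trans.
apply: ge0_le_integral => //.
- by move=> x _; rewrite lee_fin sqr_ge0.
- exact: measurable_sqr (bmf_mble bF).
- by apply: measurableT_comp => //; apply/measurable_EFinP; exact: bmf_mble (bmfM bF bF).
- by move=> x _; rewrite /= -expr2 lee_fin ler_norm.
Qed.

Lemma sqi_cosw x : sqi mu (cosw x). Proof. exact: sqi_bmf (bmf_cosw x). Qed.
Lemma sqi_sinw x : sqi mu (sinw x). Proof. exact: sqi_bmf (bmf_sinw x). Qed.

(** The Hilbert-space picture used throughout: K(x - y) is the inner product of the pairs ([cosw x],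
    [sinw x]) and ([cosw y], [sinw y]). *)
Lemma kcovE x y : kcov x y = ip mu (cosw x) (cosw y) + ip mu (sinw x) (sinw y).
Proof.
rewrite /ip -RintD; last exact: bmfM (bmf_sinw x) (bmf_sinw y).
 by apply: eq_Rintegral => l _; rewrite /cosw phaseB cosB.
exact: bmfM (bmf_cosw x) (bmf_cosw y).
Qed.

Lemma kcovC x y : kcov x y = kcov y x.
Proof. by rewrite !kcovE ipC (ipC _ (sinw x)). Qed.
Lemma kcovDr x y z : kcov (x + z) (y + z) = kcov x y.
Proof. by rewrite /kcov opprD addrACA subrr addr0. Qed.

Lemma qf_kcov s t : qf kcov s t =
 ip mu (lin cosw s) (lin cosw t) + ip mu (lin sinw s) (lin sinw t).
Proof.
rewrite !ip_lin; [|exact: sqi_sinw|exact: sqi_cosw].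
by rewrite -qfD; apply: eq_qf => x y; rewrite kcovE.
Qed.

Lemma bmf_lin {A : Type} (X : A -> 'rV[R]_d -> R) s : (forall a, bmf (X a)) -> bmf (lin X s).
Proof. by move=> bX; apply: bmf_sum => p; exact: bmfZ. Qed.

Lemma qf_kcov_Rint s : qf kcov s s =
 \int[mu]_l (lin cosw s l ^+ 2 + lin sinw s l ^+ 2).
Proof.
have bc := bmf_lin s bmf_cosw; have bs := bmf_lin s bmf_sinw.
rewrite qf_kcov /ip -RintD; [|exact: bmfM|exact: bmfM].
by apply: eq_Rintegral => l _; rewrite !expr2.
Qed.

End spectral_basics.

(** * The field as a Gaussian family *)

Section field.
Context {R : realType} {G : setting} {d : nat} {dO : measure_display}
 {Omega : measurableType dO} (P : probability Omega R)
 (f : site R G d -> {RV P >-> R}) (mu : fin_measure R d).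
Hypotheses (hf : is_sgf f) (hmu : is_spectral_measure f mu).

Lemma kern_cov x : covariance_kernel f x = kern mu x.
Proof.
have := spectral_fourier hmu x; rewrite /fourier /cintegral => -[-> _].
apply: eq_Rintegral => l _; rewrite /cis /= mulr1 mulr0 subr0 cosN.
by rewrite /cosw /phase.
Qed.

Lemma measurable_field x : mble (f x : Omega -> R).
Proof. exact: measurable_funP. Qed.

Lemma field_lin_gaussian s : centred_gaussian P (lin (fun x w => f x w) s).
Proof.
have := sgf_gaussian hf (fun i : 'I_(size s) => (nth (0, 0) s i).2) (fun i => (nth (0, 0) s i).1).
congr centred_gaussian; apply/funext => w.
by rewrite /lin (big_nth (0, 0)) big_mkord.
Qed.

Lemma field_facts s : let X := lin (fun x w => f x w) s in
 [/\ \int[P]_w cos (X w) = expR (- (ip P X X / 2)), \int[P]_w sin (X w) = 0 & sqi P X].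
Proof.
move=> X; apply: gaussian_facts; last exact: field_lin_gaussian.
by apply: measurable_lin => x; exact: measurable_field.
Qed.

Lemma sqi_field x : sqi P (fun w => f x w).
Proof.
have [_ _] := field_facts [:: (1, x)].
rewrite (_ : lin _ _ = fun w => f x w)//.
by apply/funext => w; rewrite lin1 mul1r.
Qed.

Lemma ip_field x y : ip P (fun w => f x w) (fun w => f y w) = kcov mu x y.
Proof.
rewrite kcovC /kcov -kern_cov /covariance_kernel unlock.
transitivity (ip P (fun w => f 0 w) (fun w => f (y - x) w)); last by [].
apply: eq_law_ip; [exact: sqi_field|exact: sqi_field|exact: sqi_field|exact: sqi_field|].
move=> A B mA mB.
pose pt (i : 'I_2) : site R G d := if i == ord0 then 0 else y - x.
pose AB (i : 'I_2) : set (measurableTypeR R) := if i == ord0 then A else B.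
have mAB i : measurable (AB i) by rewrite /AB; case: ifP.
have := sgf_stationary hf pt x mAB.
have two (Q : 'I_2 -> Prop) : (forall i, Q i) <-> Q ord0 /\ Q (lift ord0 ord0).
 by split=> [h|[h0 h1] i]; [split|case: (unliftP ord0 i) => [j ->|->]//; rewrite (ord1 j)].
rewrite (_ : [set w | forall i, AB i (f (pt i + x) w)] = [set w | A (f x w) /\ B (f y w)]).
 rewrite (_ : [set w | forall i, AB i (f (pt i) w)] = [set w | A (f 0 w) /\ B (f (y - x) w)])//.
 by apply/funext => w /=; apply/propext; rewrite two /AB /pt /=.
by apply/funext => w /=; apply/propext; rewrite two /AB /pt /= add0r subrK.
Qed.

Lemma gproc_field : gproc P (fun x w => f x w) (kcov mu).
Proof.
split=> [x|s]; first exact: measurable_field.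
have [h1 h2 _] := field_facts s; split=> //.
rewrite h1 ip_lin; last exact: sqi_field.
congr (expR (- (_ / 2))); apply: eq_qf => x y; exact: ip_field.
Qed.

Lemma kern0_gt0 : 0 < kern mu (0 : site R G d).
Proof. by rewrite -kern_cov; exact: sgf_nondegenerate hf. Qed.

End field.

Lemma disc_le {R : realFieldType} (a b c : R) : 0 <= c ->
 (forall t, 0 <= a - 2 * t * b + t ^+ 2 * c) -> b ^+ 2 <= a * c.
Proof.
move=> c0 h; have [c1|c1] := ltP 0 c.
 have := h (b / c); have -> : a - 2 * (b / c) * b + (b / c) ^+ 2 * c = a - b ^+ 2 / c.
  by field; rewrite gt_eqF.
 by rewrite subr_ge0 ler_pdivrMr.
have cz : c = 0 by apply/le_anti; rewrite c0 c1.
rewrite cz mulr0; have [->|bn] := eqVneq b 0; first by rewrite expr0n.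
have := h ((a + 1) / (2 * b)); rewrite cz mulr0 addr0.
have -> : a - 2 * ((a + 1) / (2 * b)) * b = -1 by field; rewrite bn.
by rewrite lerNr oppr0 ler10.
Qed.

Lemma cvg_sq_geo {R : realType} (a : nat -> R) (l M : R) :
 (forall n, (a n - l) ^+ 2 <= M / 8 ^+ n) -> a n @[n --> \oo] --> l.
Proof.
move=> h; have M0 : 0 <= M by have := h 0%N; rewrite expr0 divr1; apply: le_trans; exact: sqr_ge0.
have h8 : `|8^-1 : R| < 1 by rewrite ger0_norm; lra.
have cg := cvg_geometric M h8.
apply/cvgrPdist_lt => e e0.
have /cvgrPdist_lt /(_ (e ^+ 2)) := cg; rewrite exprn_gt0// => /(_ isT).
apply: filterS => n; rewrite sub0r normrN /geometric /= => hn.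
rewrite -(@ltr_pXn2r _ 2%N) ?nnegrE ?(ltW e0)// real_normK ?num_real// -opprB sqrrN.
apply: (le_lt_trans (h n)); apply: le_lt_trans hn; rewrite exprVn ler_norm//.
Qed.

(** * Pairs of square-integrable functions *)

Section hilbert_pairs.
Context {R : realType} {d} {T : measurableType d} (mu : {measure set T -> \bar R}).
Implicit Types p q r : (T -> R) * (T -> R).

(** A pair stands for the complex function p.1 + i p.2, and [ip2] for the real part of the complex
    inner product. *)
Definition sqi2 p := sqi mu p.1 /\ sqi mu p.2.
Definition ip2 p q := ip mu p.1 q.1 + ip mu p.2 q.2.
Definition lc a p b q : (T -> R) * (T -> R) :=
 (fun x => a * p.1 x + b * q.1 x, fun x => a * p.2 x + b * q.2 x).

Lemma sqi2_lc a p b q : sqi2 p -> sqi2 q -> sqi2 (lc a p b q).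
Proof. by move=> [p1 p2] [q1 q2]; split; apply: sqi_lin2. Qed.
Lemma ip2C p q : ip2 p q = ip2 q p.
Proof. by rewrite /ip2 ipC (ipC _ p.2). Qed.

Lemma ip2_lcl a p b q r : sqi2 p -> sqi2 q -> sqi2 r ->
 ip2 (lc a p b q) r = a * ip2 p r + b * ip2 q r.
Proof.
move=> [p1 p2] [q1 q2] [r1 r2]; rewrite /ip2 /lc /=.
rewrite !ipDl//; try exact: sqiZ.
by rewrite !ipZl//; ring.
Qed.

Lemma ip2_lcr a p b q r : sqi2 p -> sqi2 q -> sqi2 r ->
 ip2 r (lc a p b q) = a * ip2 r p + b * ip2 r q.
Proof. by move=> sp sq sr; rewrite ip2C ip2_lcl// !(ip2C _ r). Qed.
Lemma ip2_ge0 p : 0 <= ip2 p p.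
Proof. by rewrite addr_ge0// ip_ge0. Qed.

Lemma ip2_CS p q : sqi2 p -> sqi2 q -> ip2 p q ^+ 2 <= ip2 p p * ip2 q q.
Proof.
move=> sp sq; apply: disc_le; first exact: ip2_ge0.
move=> t; have := ip2_ge0 (lc 1 p (- t) q).
rewrite ip2_lcl//; last exact: sqi2_lc.
by rewrite !ip2_lcr// (ip2C q p); move: (ip2 _ _) (ip2 _ _) (ip2 _ _) => x y z; nra.
Qed.

Lemma ip2B p q : sqi2 p -> sqi2 q ->
 ip2 (lc 1 p (-1) q) (lc 1 p (-1) q) = ip2 p p - 2 * ip2 p q + ip2 q q.
Proof.
move=> sp sq; rewrite ip2_lcl//; last exact: sqi2_lc.
by rewrite !ip2_lcr// (ip2C q p); ring.
Qed.

End hilbert_pairs.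

(** * Energy, capacity and equilibrium potential *)

Section capacity_value.
Context {R : realType} {G : setting} {d : nat}.
Variable mu : fin_measure R d.
Implicit Types (x y : site R G d) (v w : seq (R * site R G d)) (D : set (site R G d)).

Definition cvx D v := (forall p, p \in v -> 0 <= p.1 /\ D p.2) /\ \sum_(p <- v) p.1 = 1.
Definition en v := qf (kcov mu) v v.
(** The infimum of the energy over finitely supported probability measures; [equilibrium] identifies
    it with 1/Cap(D) when it is positive, so general measures on D never enter. *)
Definition kap D : R := inf [set en v | v in cvx D].
Definition gpair v : ('rV[R]_d -> R) * ('rV[R]_d -> R) := (lin cosw v, lin sinw v).

Lemma sqi2_gpair v : sqi2 mu (gpair v).
Proof. by split; apply: sqi_lin => x; [exact: sqi_cosw|exact: sqi_sinw]. Qed.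
Lemma qf_ip2 v w : qf (kcov mu) v w = ip2 mu (gpair v) (gpair w).
Proof. exact: qf_kcov. Qed.
Lemma en_ge0 v : 0 <= en v.
Proof. by rewrite /en qf_ip2 ip2_ge0. Qed.
Lemma kap_lb D : has_lbound [set en v | v in cvx D].
Proof. by exists 0 => _ [v _ <-]; exact: en_ge0. Qed.
Lemma kap_le D v : cvx D v -> kap D <= en v.
Proof. by move=> hv; apply: ge_inf; [exact: kap_lb|exists v]. Qed.

Lemma cvx1 D x : D x -> cvx D [:: (1, x)].
Proof.
by move=> Dx; split=> [p|]; [rewrite mem_seq1 => /eqP ->; split|rewrite big_seq1].
Qed.

Lemma kap_adh D e : D !=set0 -> 0 < e -> exists2 v, cvx D v & en v < kap D + e.
Proof.
move=> [x Dx] e0; have hi : has_inf [set en v | v in cvx D].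
 by split; [exists (en [:: (1, x)]), [:: (1, x)] => //; exact: cvx1|exact: kap_lb].
by have [_ [v hv <-] h] := inf_adherent e0 hi; exists v.
Qed.

Lemma kap_ge D a : D !=set0 -> (forall v, cvx D v -> a <= en v) -> a <= kap D.
Proof.
move=> [x Dx] h; apply: lb_le_inf; last by move=> _ [v hv <-]; exact: h.
by exists (en [:: (1, x)]), [:: (1, x)] => //; exact: cvx1.
Qed.

Lemma kap_mono D D' : D `<=` D' -> D !=set0 -> kap D' <= kap D.
Proof.
move=> DD D0; apply: kap_ge => // v [h1 h2]; apply: kap_le; split=> // p /h1[? ?].
by split=> //; exact: DD.
Qed.

Lemma cvx_mix D v w (t : R) : 0 <= t <= 1 -> cvx D v -> cvx D w ->
 cvx D (scal (1 - t) v ++ scal t w).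
Proof.
move=> /andP[t0 t1] [v1 v2] [w1 w2]; split.
 move=> p; rewrite mem_cat => /orP[]/mapP[q hq ->] /=.
  by have [? ?] := v1 _ hq; split=> //; rewrite mulr_ge0// subr_ge0.
 by have [? ?] := w1 _ hq; split=> //; rewrite mulr_ge0.
by rewrite big_cat !big_map /= -!mulr_sumr v2 w2; ring.
Qed.

Lemma kcov_sym v w : qf (kcov mu) v w = qf (kcov mu) w v.
Proof. by apply: qfC => x y; exact: kcovC. Qed.

Lemma en_mix v w (t : R) :
 en (scal (1 - t) v ++ scal t w) =
 (1 - t) ^+ 2 * en v + 2 * t * (1 - t) * qf (kcov mu) v w + t ^+ 2 * en w.
Proof.
by rewrite /en !(qf_catl, qf_catr, qf_scall, qf_scalr) (kcov_sym w v); ring.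
Qed.

(** Parallelogram law: the midpoint of v and w is again admissible, so its energy is at least
    [kap D]. Minimising sequences are therefore Cauchy. *)
Lemma en_sub D v w : cvx D v -> cvx D w ->
 en v - 2 * qf (kcov mu) v w + en w <= 2 * en v + 2 * en w - 4 * kap D.
Proof.
move=> hv hw; have h2 : 0 <= (2^-1 : R) <= 1 by lra.
have := kap_le (cvx_mix h2 hv hw); rewrite en_mix; lra.
Qed.

Section minimiser.
Variable D : set (site R G d).
Hypotheses (D0 : D !=set0)
 (h_im : forall x, \int[mu]_l sinw x l = 0).
Hypothesis h_sym : forall x l, cosw x (freq_repr G (- l)) = cosw x l /\
 sinw x (freq_repr G (- l)) = - sinw x l.

Let k_ x := gpair [:: (1, x)].

(** The limit u in L^2(mu) of [gpair] along a minimising sequence plays the role of the transform of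
    an equilibrium measure, and no such measure is built. The first variation at u gives <u, v> >=
    kap for every admissible v. The last two clauses say that the Fourier transform of u is real and
    that u is Hermitian, as membership in the Cameron-Martin space demands. *)
Lemma minimiser : exists u, [/\ sqi2 mu u,
 forall v, cvx D v -> ip2 mu (lc 1 u (-1) (gpair v)) (lc 1 u (-1) (gpair v)) <= en v - kap D,
 ip2 mu u u = kap D,
 forall v, cvx D v -> kap D <= ip2 mu u (gpair v) &
 (forall x, ip mu (cosw x) u.2 = ip mu (sinw x) u.1) /\
 forall l, u.1 (freq_repr G (- l)) = u.1 l /\ u.2 (freq_repr G (- l)) = - u.2 l].
Proof.
pose k := kap D.
(* Gaps of order 8^-n give, by [en_sub], the rate that [sqi_complete] expects. *)
have /choice[v hv] n : exists v, cvx D v /\ en v < k + 1 / 8 ^+ n.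
 have e0 : 0 < 1 / 8 ^+ n :> R by rewrite divr_gt0// exprn_gt0.
 by have [v ? ?] := kap_adh D0 e0; exists v.
pose g n := gpair (v n).
have sg n : sqi2 mu (g n) by exact: sqi2_gpair.
have gap n m : (n <= m)%N ->
  ip2 mu (lc 1 (g n) (-1) (g m)) (lc 1 (g n) (-1) (g m)) <= 4 / 8 ^+ n.
 move=> nm; rewrite ip2B// -!qf_ip2.
 have [hn1 hn2] := hv n; have [hm1 hm2] := hv m.
 apply: (le_trans (en_sub hn1 hm1)).
 have : 1 / 8 ^+ m <= 1 / 8 ^+ n :> R.
  rewrite !mul1r lef_pV2 ?posrE ?exprn_gt0//; apply: ler_weXn2l => //; lra.
 by move: hn2 hm2; rewrite -/k; move: (8 ^+ n) (8 ^+ m) => a b; lra.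
have lcE p q : lc 1 p (-1) q = (fun l => p.1 l - q.1 l, fun l => p.2 l - q.2 l) :> ('rV[R]_d -> R) * ('rV[R]_d -> R).
 by congr pair; apply/funext => l; rewrite mul1r mulN1r.
have [n|n m nm|A [sA cA hA]] := @sqi_complete _ _ _ mu (fun n => (g n).1) 4; first by case: (sg n).
 by have := gap n m nm; rewrite lcE; apply: le_trans; rewrite /ip2 lerDl ip_ge0.
have [n|n m nm|B [sB cB hB]] := @sqi_complete _ _ _ mu (fun n => (g n).2) 4; first by case: (sg n).
 by have := gap n m nm; rewrite lcE; apply: le_trans; rewrite /ip2 lerDr ip_ge0.
pose u := (A, B); have su : sqi2 mu u by [].
have gu n : ip2 mu (lc 1 (g n) (-1) u) (lc 1 (g n) (-1) u) <= 8 / 8 ^+ n.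
 by rewrite lcE /ip2 /=; have := hA n; have := hB n; move: (8 ^+ n) => a; lra.
have cip q : sqi2 mu q -> ip2 mu (g n) q @[n --> \oo] --> ip2 mu u q.
 move=> sq; apply: (@cvg_sq_geo _ _ _ (8 * ip2 mu q q)) => n.
 have := ip2_CS (sqi2_lc 1 (-1) (sg n) su) sq; rewrite ip2_lcl// mul1r mulN1r.
 move=> h; apply: (le_trans h); rewrite mulrAC; apply: ler_wpM2r; first exact: ip2_ge0.
 exact: gu.
have c8 : 8 / 8 ^+ n @[n --> \oo] --> (0 : R).
 have h8 : `|8^-1 : R| < 1 by rewrite ger0_norm; lra.
 have := cvg_geometric 8 h8; rewrite /geometric /=.
 by under [X in X @ _ --> _ -> _]eq_fun do rewrite exprVn.
have cen : en (v n) @[n --> \oo] --> ip2 mu u u.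
 have e n : en (v n) = ip2 mu (lc 1 (g n) (-1) u) (lc 1 (g n) (-1) u) + (2 * ip2 mu (g n) u - ip2 mu u u).
  by rewrite ip2B// /en qf_ip2 -/(g n); ring.
 rewrite (_ : (fun n => en (v n)) = fun n => ip2 mu (lc 1 (g n) (-1) u) (lc 1 (g n) (-1) u) + (2 * ip2 mu (g n) u - ip2 mu u u)); last exact/funext.
 rewrite -[X in _ --> X](_ : 0 + (2 * ip2 mu u u - ip2 mu u u) = _); last by ring.
 apply: cvgD; last by apply: cvgB; [apply: cvgMr; exact: cip|exact: cvg_cst].
 apply: (@squeeze_cvgr _ _ _ _ (fun=> 0) (fun n => 8 / 8 ^+ n)) => //; last exact: cvg_cst.
 by apply: nearW => n; rewrite ip2_ge0 gu.
have cen' : en (v n) @[n --> \oo] --> k.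
 apply: (@squeeze_cvgr _ _ _ _ (fun=> k) (fun n => k + 8 / 8 ^+ n)).
 - apply: nearW => n; have [h1 h2] := hv n; rewrite kap_le//=.
  apply: (le_trans (ltW h2)); rewrite lerD2l ler_wpM2r// ?invr_ge0 ?exprn_ge0//; lra.
 - exact: cvg_cst.
 - by rewrite -[X in _ --> X]addr0; apply: cvgD; [exact: cvg_cst|exact: c8].
have uu : ip2 mu u u = k by exact: (cvg_unique _ cen cen').
have hk w : cvx D w -> k <= ip2 mu u (gpair w).
 move=> hw; have sw := sqi2_gpair w.
 (* Minimality against the mixtures (1 - t) v_n + t w, in the limit n -> oo, with k subtracted and t
    divided out; small t then gives <u, w> >= k. *)
 have pos t : 0 < t <= 1 -> 0 <= - (2 * k) + t * k + 2 * (1 - t) * ip2 mu u (gpair w) + t * en w.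
  move=> /andP[t0 t1].
  have cl : (1 - t) ^+ 2 * en (v n) + 2 * t * (1 - t) * ip2 mu (g n) (gpair w) + t ^+ 2 * en w @[n --> \oo]
    --> (1 - t) ^+ 2 * k + 2 * t * (1 - t) * ip2 mu u (gpair w) + t ^+ 2 * en w.
   by apply: cvgD; [apply: cvgD; apply: cvgMr; [exact: cen'|exact: cip]|exact: cvg_cst].
  have : k <= (1 - t) ^+ 2 * k + 2 * t * (1 - t) * ip2 mu u (gpair w) + t ^+ 2 * en w.
   apply: (@ler_cvg_to _ _ _ _ (fun=> k) _ _ _ (cvg_cst _) cl).
   apply: nearW => n; rewrite -qf_ip2 -en_mix.
   by apply: kap_le; apply: cvx_mix; rewrite ?(ltW t0)//; have [] := hv n.
  move: (ip2 _ _ _) (en w) => b c h.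
  by rewrite -(pmulr_rge0 _ t0); move: h; lra.
 rewrite leNgt; apply/negP => hlt.
 set b := ip2 mu u (gpair w) in pos hlt.
 pose M := k + 2 * `|b| + en w.
 have M0 : 0 <= M.
  have k0 : 0 <= k by rewrite -uu ip2_ge0.
  by rewrite /M; have := en_ge0 w; have := normr_ge0 b; lra.
 have hp : 0 < k - b by rewrite subr_gt0.
 pose t := Num.min 1 ((k - b) / (M + 1)).
 have t0 : 0 < t <= 1 by rewrite /t lt_min ltr01 divr_gt0 ?ge_min ?lexx//; lra.
 have tM : t * M <= k - b.
  apply: (le_trans (y := (k - b) / (M + 1) * (M + 1))); last by rewrite divfK// gt_eqF//; lra.
  apply: ler_pM => //; [by case/andP: t0 => /ltW|by rewrite /t ge_min lexx orbT|lra].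
 have := pos _ t0; case/andP: t0 => t0 _.
 have : - t * b <= t * `|b| by rewrite mulNr -mulrN ler_wpM2l ?(ltW t0)// -normrN ler_norm.
 by move: tM; rewrite /M; lra.
exists u; split=> //; last split.
- move=> w hw; rewrite ip2B//; last exact: sqi2_gpair.
 by rewrite uu -(qf_ip2 w) -/(en w) -/k; have := hk w hw; lra.
- move=> x; apply/eqP; rewrite -subr_eq0; apply/eqP.
 have zero y : ip mu (cosw x) (sinw y) - ip mu (sinw x) (cosw y) = 0.
  have bc := bmfM (bmf_cosw x) (bmf_sinw y); have bs := bmfM (bmf_sinw x) (bmf_cosw y).
  rewrite /ip -RintB//; rewrite -[RHS](h_im (y - x)); apply: eq_Rintegral => l _.
  by rewrite /sinw /cosw phaseB sinB; ring.
 have c1 : ip mu (cosw x) (g n).2 - ip mu (sinw x) (g n).1 @[n --> \oo] --> ip mu (cosw x) u.2 - ip mu (sinw x) u.1.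
  have sq1 : sqi2 mu (fun=> 0, cosw x).
   by split; [exact: sqi_bmf (bmf_cst 0)|exact: sqi_cosw].
  have sq2 : sqi2 mu (sinw x, fun=> 0).
   by split; [exact: sqi_sinw|exact: sqi_bmf (bmf_cst 0)].
  have e1 q : ip2 mu q (fun=> 0, cosw x) = ip mu (cosw x) q.2.
   by rewrite /ip2 /= ipC ip0l add0r ipC.
  have e2 q : ip2 mu q (sinw x, fun=> 0) = ip mu (sinw x) q.1.
   by rewrite /ip2 /= addrC ipC ip0l add0r ipC.
  rewrite -(e1 u) -(e2 u).
  have cc : ip2 mu (g n) (fun=> 0, cosw x) - ip2 mu (g n) (sinw x, fun=> 0) @[n --> \oo] -->
   ip2 mu u (fun=> 0, cosw x) - ip2 mu u (sinw x, fun=> 0) by apply: cvgB; exact: cip.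
  by apply: cvg_trans cc; apply: near_eq_cvg; apply: nearW => n; rewrite e1 e2.
 have c0 : ip mu (cosw x) (g n).2 - ip mu (sinw x) (g n).1 @[n --> \oo] --> (0 : R).
  rewrite (_ : (fun n => _) = fun=> 0); first exact: cvg_cst.
  apply/funext => n; rewrite /g /= ipC (ipC _ (sinw x)).
  rewrite !ip_linl; [|exact: sqi_cosw|exact: sqi_sinw|exact: sqi_sinw|exact: sqi_cosw].
  rewrite -sumrB big1// => p _.
  by rewrite -mulrBr ipC (ipC _ (cosw p.2)) zero mulr0.
 exact: (cvg_unique _ c1 c0).
- move=> l; have e1 n : (g n).1 (freq_repr G (- l)) = (g n).1 l.
  by rewrite /g /=; apply: eq_bigr => p _; have [-> _] := h_sym p.2 l.
 have e2 n : (g n).2 (freq_repr G (- l)) = - (g n).2 l.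
  by rewrite /g /= /lin -sumrN; apply: eq_bigr => p _; have [_ ->] := h_sym p.2 l; rewrite mulrN.
 split=> /=.
  have := cA (freq_repr G (- l)); under eq_fun do rewrite e1.
  rewrite (_ : (fun n => (g n).1 (freq_repr G (- l))) = (fun n => (g n).1 l)); last exact/funext.
  by move=> h; exact: (cvg_unique _ h (cA l)).
 have := cB (freq_repr G (- l)); under eq_fun do rewrite e2.
 rewrite (_ : (fun n => (g n).2 (freq_repr G (- l))) = (fun n => - (g n).2 l)); last exact/funext.
 (* The convergence test ignores signs, so oddness of the imaginary parts survives at every
    point. *)
 rewrite fastcN => h.
 have h' : - ((g n).2 l * (fastc (fun n => (g n).2 l))%:R) @[n --> \oo] --> - B l by apply: cvgN; exact: cB.
 set c := (fastc _)%:R in h h'.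
 have h2 : - (g n).2 l * c @[n --> \oo] --> - B l.
  rewrite (_ : (fun n => - (g n).2 l * c) = (fun n => - ((g n).2 l * c)))//.
  by apply/funext => n; rewrite mulNr.
 exact: (cvg_unique _ h h2).
Qed.

End minimiser.

Lemma trig_int (a : R) (k : int) :
 cos (a + 2 * pi * k%:~R) = cos a /\ sin (a + 2 * pi * k%:~R) = sin a.
Proof.
have h (b : R) n : cos (b + 2 * pi * n%:R) = cos b /\ sin (b + 2 * pi * n%:R) = sin b.
 have -> : 2 * pi * n%:R = (pi *+ 2) *+ n :> R by rewrite mulr_natl mulr_natr.
 by rewrite (periodicn (@cosD2pi R)) (periodicn (@sinD2pi R)).
case: k => n; first exact: h.
rewrite NegzE intrN mulrN; set b := a - _.
have [e1 e2] := h b n.+1; have e : a = b + 2 * pi * n.+1%:R by rewrite /b subrK.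
by rewrite -[in cos b]e1 -[in sin b]e2 -!e.
Qed.

Lemma repr_shift (x : site R G d) l : exists k : int,
 phase x (freq_repr G l) = phase x l + 2 * pi * k%:~R.
Proof.
case: G x => x /=; first by exists 0; rewrite mulr0 addr0.
exists (- \sum_i Num.floor (l 0 i + 2^-1) * x 0 i).
rewrite /phase -mulrDr; congr (_ * _); rewrite intrN raddf_sum /edot -sumrN -big_split.
apply: eq_bigr => i _ /=; rewrite !mxE intrM mulrBl; congr (_ - _).
Qed.

Lemma trig_repr x l : cosw x (freq_repr G l) = cosw x l /\ sinw x (freq_repr G l) = sinw x l.
Proof.
have [k hk] := repr_shift x l; rewrite /cosw /sinw hk; exact: trig_int.
Qed.

Lemma trig_sym x l : cosw x (freq_repr G (- l)) = cosw x l /\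
 sinw x (freq_repr G (- l)) = - sinw x l.
Proof.
have [-> ->] := trig_repr x (- l).
have e : phase x (- l) = - phase x l by rewrite /phase edotNl mulrN.
by rewrite /cosw /sinw e cosN sinN.
Qed.

Section equilibrium.
Variable D : set (site R G d).
Hypotheses (D0 : D !=set0)
 (h_im : forall x, \int[mu]_l sinw x l = 0)
 (k0 : 0 < kap D).

Let N2 (g : 'rV[R]_d -> R[i]) := (fun l => complex.Re (g l), fun l => complex.Im (g l)).

Lemma spectral_norm2E g : mble (N2 g).1 -> mble (N2 g).2 ->
 spectral_norm2 mu g = (\int[mu]_l ((N2 g).1 l ^+ 2)%:E + \int[mu]_l ((N2 g).2 l ^+ 2)%:E)%E.
Proof.
move=> m1 m2; rewrite /spectral_norm2; under eq_integral do rewrite EFinD.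
by rewrite ge0_integralD//; try exact: measurable_sqr; move=> l _; rewrite lee_fin sqr_ge0.
Qed.

Lemma rep_sqi2 g : hermitian_L2 G mu g ->
 sqi2 mu (N2 g) /\ spectral_norm2 mu g = (ip2 mu (N2 g) (N2 g))%:E.
Proof.
move=> [m1 m2 hn _]; have e := spectral_norm2E m1 m2.
have p1 : (0 <= \int[mu]_l (complex.Re (g l) ^+ 2)%:E)%E by apply: integral_ge0 => l _; rewrite lee_fin sqr_ge0.
have p2 : (0 <= \int[mu]_l (complex.Im (g l) ^+ 2)%:E)%E by apply: integral_ge0 => l _; rewrite lee_fin sqr_ge0.
rewrite e in hn.
have s1 : sqi mu (fun l => complex.Re (g l)) by split=> //; apply: le_lt_trans hn; rewrite leeDl.
have s2 : sqi mu (fun l => complex.Im (g l)) by split=> //; apply: le_lt_trans hn; rewrite leeDr.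
by split=> //; rewrite e /ip2 EFinD !EFin_ip.
Qed.

Lemma rep_val h g x : spectral_rep mu h g -> h x = ip2 mu (N2 g) (gpair [:: (1, x)]).
Proof.
move=> [hg]; move=> /(_ x); rewrite /fourier /cintegral => -[-> _].
have [[s1 s2] _] := rep_sqi2 hg.
have e : gpair [:: (1, x)] = (cosw x, sinw x).
 by congr pair; apply/funext => l; rewrite lin1 mul1r.
rewrite e /ip2 /ip -RintegralD//; [|exact: sqi_mul s1 (sqi_cosw mu x)|exact: sqi_mul s2 (sqi_sinw mu x)].
apply: eq_Rintegral => l _; rewrite /cis /N2 /=.
by case: (g l) => a b /=; rewrite cosN sinN -/(phase x l) /cosw /sinw; ring.
Qed.

Lemma ip2_gpair p v : sqi2 mu p ->
 ip2 mu p (gpair v) = \sum_(q <- v) q.1 * ip2 mu p (gpair [:: (1, q.2)]).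
Proof.
move=> [p1 p2]; rewrite /ip2 /gpair /=.
rewrite ipC (ipC _ p.2) !ip_linl//; [|exact: sqi_sinw|exact: sqi_cosw].
rewrite -big_split; apply: eq_bigr => q _ /=; rewrite -mulrDr; congr (_ * (_ + _)).
 by rewrite ipC; congr ip; apply/funext => l; rewrite lin1 mul1r.
by rewrite ipC; congr ip; apply/funext => l; rewrite lin1 mul1r.
Qed.

Lemma rep_ge1 h g v : admissible mu D h -> spectral_rep mu h g -> cvx D v ->
 1 <= ip2 mu (N2 g) (gpair v).
Proof.
move=> [_ hD] hg [v1 v2]; have [sg _] := rep_sqi2 hg.1.
rewrite ip2_gpair// -[leLHS]v2 !big_seq; apply: ler_sum => q /v1[q0 qD].
by rewrite -(rep_val q.2 hg) ler_peMr// hD.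
Qed.

Lemma rep_norm h g : admissible mu D h -> spectral_rep mu h g ->
 (kap D)^-1 <= ip2 mu (N2 g) (N2 g).
Proof.
move=> ha hg; have [sg _] := rep_sqi2 hg.1.
have pos : 0 < ip2 mu (N2 g) (N2 g).
 rewrite lt_neqAle ip2_ge0 andbT eq_sym; apply/eqP => e0.
 have [x Dx] := D0; have := rep_ge1 ha hg (cvx1 Dx).
 have := ip2_CS sg (sqi2_gpair [:: (1, x)]); rewrite e0 mul0r => h1 h2.
 have : 1 <= ip2 mu (N2 g) (gpair [:: (1, x)]) ^+ 2 by rewrite exprn_ege1.
 lra.
rewrite -[leLHS]mul1r ler_pdivrMr// -ler_pdivrMl//.
apply: kap_ge => // v hv; rewrite ler_pdivrMl// mulrC.
rewrite mulrC /en qf_ip2; apply: le_trans (ip2_CS sg (sqi2_gpair v)).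
by rewrite exprn_ege1// (rep_ge1 ha hg).
Qed.

(** The candidate is h0 = F[u]/kap, of squared norm 1/kap. If g represents an admissible h, then <g,
    v> >= 1 for each v, and Cauchy-Schwarz gives |g|^2 en(v) >= 1. In the limit <g, u> >= 1, hence
    |g - u/kap|^2 <= |g|^2 - 1/kap; so every minimiser equals h0, in particular the one picked by
    [xget]. *)
Lemma equilibrium : exists u, [/\ sqi2 mu u,
 forall v, cvx D v -> ip2 mu (lc 1 u (-1) (gpair v)) (lc 1 u (-1) (gpair v)) <= en v - kap D,
 ip2 mu u u = kap D,
 forall v, cvx D v -> kap D <= ip2 mu u (gpair v) &
 capacity mu D = ((kap D)^-1)%:E /\
 forall x, equilibrium_potential mu D x = ip2 mu u (gpair [:: (1, x)]) / kap D].
Proof.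
have [u [su u1 u2 u3 [u4 u5]]] := minimiser D0 h_im trig_sym.
exists u; split=> //.
pose k := kap D; pose uk := lc k^-1 u 0 u.
have suk : sqi2 mu uk by exact: sqi2_lc.
pose g0 (l : 'rV[R]_d) : R[i] := (uk.1 l +i* uk.2 l)%C.
pose h0 x := ip2 mu u (gpair [:: (1, x)]) / k.
have g0E : N2 g0 = uk by [].
have nuk : ip2 mu uk uk = k^-1.
 by rewrite ip2_lcl// !ip2_lcr// u2 -/k; field; rewrite gt_eqF.
have hg0 : hermitian_L2 G mu g0.
 have fin : spectral_norm2 mu g0 = (k^-1)%:E.
  rewrite -nuk /ip2 EFinD !EFin_ip; [|by case: suk|by case: suk].
  by apply: spectral_norm2E; [case: suk => -[]|case: suk => _ []].
 split; [by case: suk => -[]|by case: suk => _ []|by rewrite fin ltry|].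
 apply: aeW => l; have [e1 e2] := u5 l.
 by rewrite /g0 /uk /lc /= e1 e2; congr (_ +i* _)%C; ring.
have rg0 : spectral_rep mu h0 g0.
 split=> // x; rewrite /fourier /cintegral.
 have e : gpair [:: (1, x)] = (cosw x, sinw x).
  by congr pair; apply/funext => l; rewrite lin1 mul1r.
 have [a1 a2] := suk.
 congr (_ +i* _)%C.
  have -> : h0 x = ip2 mu uk (gpair [:: (1, x)]).
   by rewrite ip2_lcl//; [rewrite /h0; ring|exact: sqi2_gpair].
  rewrite e /ip2 /ip -RintegralD//; [|exact: sqi_mul a1 (sqi_cosw mu x)|exact: sqi_mul a2 (sqi_sinw mu x)].
  apply: eq_Rintegral => l _; rewrite /cis /g0 /=.
  by rewrite cosN sinN -/(phase x l) /cosw /sinw; ring.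
 transitivity (ip mu (cosw x) uk.2 - ip mu (sinw x) uk.1).
  rewrite ipC (ipC _ (sinw x)) /uk /lc /= !ipDl ?ipZl; try (by case: su); try (apply: sqiZ; by case: su); try exact: sqi_cosw; try exact: sqi_sinw.
  rewrite ipC (ipC _ u.1) u4; ring.
 rewrite /ip -RintegralB//; [|exact: sqi_mul (sqi_cosw mu x) a2|exact: sqi_mul (sqi_sinw mu x) a1].
 apply: eq_Rintegral => l _; rewrite /cis /g0 /=.
 by rewrite cosN sinN -/(phase x l) /cosw /sinw; ring.
have ah0 : admissible mu D h0.
 split; first by exists g0.
 move=> x Dx; rewrite /h0 ler_pdivlMr// mul1r; exact: u3 (cvx1 Dx).
have lb h : admissible mu D h -> ((k^-1)%:E <= cm_norm2 mu h)%E.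
 move=> ha; apply: le_ereal_inf_tmp => _ [g hg <-].
 by have [_ ->] := rep_sqi2 hg.1; rewrite lee_fin; exact: rep_norm ha hg.
have nh0 : cm_norm2 mu h0 = (k^-1)%:E.
 apply/le_anti; rewrite lb// andbT; apply: ereal_inf_lbound; exists g0 => //.
 by have [_ ->] := rep_sqi2 hg0; rewrite g0E nuk.
have capE : capacity mu D = (k^-1)%:E.
 apply/le_anti/andP; split; first by rewrite -nh0; apply: ereal_inf_lbound; exists h0.
 by apply: le_ereal_inf_tmp => _ [h ha <-]; exact: lb.
split=> // x.
have [ha hn] : admissible mu D (equilibrium_potential mu D) /\
  cm_norm2 mu (equilibrium_potential mu D) = capacity mu D.
 apply: (@xgetPex _ (fun=> 0) [set h | admissible mu D h /\ cm_norm2 mu h = capacity mu D]).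
 by exists h0; rewrite /= nh0 capE.
set h := equilibrium_potential mu D in ha hn *.
rewrite -/(h0 x); apply/eqP; rewrite -subr_eq0 -sqrf_eq0; apply/eqP/le_anti; rewrite sqr_ge0 andbT.
(* The norm of h is an infimum over its representatives, so one within [e'] of it is used and e is
   sent to 0. *)
apply/ler_addgt0Pl => e e0; rewrite addr0.
have K0 : 0 <= en [:: (1, x)] by exact: en_ge0.
pose e' := e / (en [:: (1, x)] + 1).
have e'0 : 0 < e' by rewrite divr_gt0//; lra.
have fn : cm_norm2 mu h \is a fin_num by rewrite hn capE.
have [_ [g hg <-]] := lb_ereal_inf_adherent e'0 fn.
rewrite -/(cm_norm2 mu h) hn capE; have [sg ->] := rep_sqi2 hg.1.
rewrite -EFinD lte_fin => hN.
(* If <g, u> were smaller than 1, Cauchy-Schwarz would keep u - v away from 0 for all admissible v,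
   against |u - v|^2 <= en(v) - kap. *)
have gu : 1 <= ip2 mu (N2 g) u.
  rewrite leNgt; apply/negP => hlt.
  have : forall v, cvx D v -> (1 - ip2 mu (N2 g) u) ^+ 2 <= ip2 mu (N2 g) (N2 g) * (en v - k).
   move=> v hv; have h1 := rep_ge1 ha hg hv.
   apply: (le_trans (y := ip2 mu (N2 g) (lc 1 u (-1) (gpair v)) ^+ 2)).
    rewrite ip2_lcr//; last exact: sqi2_gpair.
    by move: h1 hlt; move: (ip2 _ _ _) (ip2 _ _ _) => y z; nra.
   apply: (le_trans (ip2_CS sg (sqi2_lc 1 (-1) su (sqi2_gpair v)))).
   by rewrite ler_wpM2l ?ip2_ge0// u1.
  set z := (1 - _) ^+ 2 => hz; have z0 : 0 < z by rewrite exprn_gt0// subr_gt0.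
  set M := ip2 mu (N2 g) (N2 g) in hz; have M0 : 0 <= M by exact: ip2_ge0.
  have q0 : 0 < z / (M + 1) by rewrite divr_gt0//; lra.
  have [v hv hv2] := kap_adh D0 q0.
  have := hz v hv; rewrite -/k in hv2.
  have h3 : (M + 1) * (en v - k) < z by rewrite mulrC -ltr_pdivlMr; lra.
  have h4 : 0 <= en v - k by rewrite subr_ge0; exact: kap_le.
  by move: h3 h4; move: (en v - k) => y; lra.
have -> : h x - h0 x = ip2 mu (lc 1 (N2 g) (-1) uk) (gpair [:: (1, x)]).
 rewrite ip2_lcl//; last exact: sqi2_gpair.
 by rewrite -(rep_val x hg) ip2_lcl//; [rewrite /h0 -/k; ring|exact: sqi2_gpair].
apply: (le_trans (ip2_CS (sqi2_lc 1 (-1) sg suk) (sqi2_gpair _))).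
rewrite -qf_ip2 -/(en _) ip2B// nuk ip2_lcr// .
apply: (le_trans (y := e' * en [:: (1, x)])).
 apply: ler_wpM2r => //.
 have : k^-1 <= k^-1 * ip2 mu (N2 g) u.
  by rewrite ler_peMr ?invr_ge0 ?(ltW k0).
 by move: hN; rewrite -/k; lra.
by rewrite /e' mulrAC ler_pdivrMr; [rewrite ler_pM2l//; lra|lra].
Qed.

End equilibrium.
End capacity_value.

(** * Measurability of countable-valued maps *)

Lemma measurable_countable {d} {T : measurableType d} (I : countType) (phi : T -> I) :
 (forall i, measurable (phi @^-1` [set i])) -> forall B : set I, measurable (phi @^-1` B).
Proof.
move=> h B.
have -> : phi @^-1` B = \bigcup_n (if unpickle n is Some i then (if `[< B i >] then phi @^-1` [set i] else set0) else set0).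
 apply/seteqP; split=> [t /= Bt|t [n _]] /=.
  by exists (pickle (phi t)) => //; rewrite pickleK asboolT.
 by case: (unpickle n) => // i; case: asboolP => // Bi /= ->.
apply: bigcupT_measurable => n; case: (unpickle n) => [i|]; last exact: measurable0.
by case: ifP => _; [exact: h|exact: measurable0].
Qed.

Lemma measurable_floor_set {R : realType} (k : int) :
 measurable [set x : R | Num.floor x = k].
Proof.
have -> : [set x : R | Num.floor x = k] = `[k%:~R, (k + 1)%:~R[%classic.
 apply/seteqP; split=> x /=; rewrite in_itv/=.
  by move=> <-; rewrite floor_le_tmp floorD1_gt.
 by move=> h; apply/floor_def.
exact: measurable_itv.
Qed.

Lemma measurable_floor {R : realType} : mble (fun x : R => (Num.floor x)%:~R : R).
Proof.
move=> _ Y mY; rewrite setTI.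
have := @measurable_countable _ R int (fun x => Num.floor x) _ [set k | Y k%:~R]; apply.
by move=> k; have := measurable_floor_set (R := R) k.
Qed.

(** With z = y/2, sin y = 2 sin z cos z. On [0, pi/4] the cosine is at least 1/2, and by the mean
    value theorem sin z >= z/2. *)
Lemma sin_ge4 {R : realType} (y : R) : 0 <= y -> y <= pi / 2 -> y / 4 <= sin y.
Proof.
move=> y0 y1; have pi0 : (0 : R) < pi := pi_gt0 R.
pose z := y / 2.
have c4 x : 0 <= x -> x <= pi / 4 -> 1 / 2 <= cos x :> R.
 move=> x0 x1.
 have cpos : 0 <= cos x by apply: cos_ge0_pihalf; lra.
 have e : cos (x + x) = cos x ^+ 2 *+ 2 - 1.
  by rewrite cosD -(cos2Dsin2 x); ring.
 have : 0 <= cos (x + x) by apply: cos_ge0_pihalf; lra.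
 by rewrite e mulr2n; nra.
have s2 : z / 2 <= sin z.
 have z0 : 0 <= z by rewrite /z; lra.
 have [->|zn] := eqVneq z 0; first by rewrite mul0r sin0.
 have zp : 0 < z by rewrite lt_neqAle eq_sym zn.
 have [|c] := @MVT R sin cos 0 z zp (fun x _ => is_derive_sin x).
  by apply: continuous_subspaceT => x; exact: continuous_sin.
 rewrite in_itv/= => /andP[c0 c1]; rewrite sin0 !subr0 => ->.
 have : 1 / 2 <= cos c by apply: c4; [exact: ltW|rewrite /z in c1; lra].
 by nra.
have e : sin y = 2 * (sin z * cos z).
 have -> : y = z + z by rewrite /z; field.
 by rewrite sinD; ring.
rewrite e; have hc : 1 / 2 <= cos z by apply: c4; rewrite /z; lra.
have : 0 <= z by rewrite /z; lra.
have : y = 2 * z by rewrite /z; field.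
by move: s2 hc; move: (sin z) (cos z) => a b; nra.
Qed.

(** * Dirichlet kernels *)

Section dirichlet.
Context {R : realType}.
Implicit Types t : R.

(** The squared modulus of the sum of exp(2 pi i k t) over k < N, that is, N times the Fejer
    kernel. *)
Definition dir (N : nat) t : R :=
 (\sum_(k < N) cos (2 * pi * (k%:R * t))) ^+ 2 + (\sum_(k < N) sin (2 * pi * (k%:R * t))) ^+ 2.

Lemma dir_le N t : dir N t <= (N ^ 2)%:R * 2.
Proof.
have b (F : R -> R) : (forall x, `|F x| <= 1) -> (\sum_(k < N) F (2 * pi * (k%:R * t))) ^+ 2 <= (N ^ 2)%:R.
 move=> hF; rewrite natrX -real_normK ?num_real// ler_pXn2r ?nnegrE//.
 apply: (le_trans (ler_norm_sum _ _ _)); rewrite -[X in _ <= X%:R]card_ord -sumr_const.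
 exact: ler_sum.
rewrite /dir mulr_natr mulr2n; apply: lerD; apply: b => x; rewrite ler_norml.
 by rewrite cos_geN1 cos_le1.
by rewrite sin_geN1 sin_le1.
Qed.

(** Multiplied by 2 sin(pi t), each of the two sums telescopes. *)
Lemma dir_sin N t : dir N t * sin (pi * t) ^+ 2 <= 1.
Proof.
pose a k := 2 * pi * (k%:R * t) - pi * t.
have aS k : a k.+1 = 2 * pi * (k%:R * t) + pi * t by rewrite /a -natr1; ring.
have telC n : (\sum_(k < n) cos (2 * pi * (k%:R * t))) * (2 * sin (pi * t)) = sin (a n) - sin (a 0%N).
 elim: n => [|n IH]; first by rewrite big_ord0 mul0r subrr.
 have e1 : sin (a n.+1) = sin (2 * pi * (n%:R * t)) * cos (pi * t) + cos (2 * pi * (n%:R * t)) * sin (pi * t).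
  by rewrite aS sinD.
 have e2 : sin (a n) = sin (2 * pi * (n%:R * t)) * cos (pi * t) - cos (2 * pi * (n%:R * t)) * sin (pi * t).
  by rewrite /a sinB.
 by rewrite big_ord_recr /= mulrDl IH e1 e2; ring.
have telS n : (\sum_(k < n) sin (2 * pi * (k%:R * t))) * (2 * sin (pi * t)) = cos (a 0%N) - cos (a n).
 elim: n => [|n IH]; first by rewrite big_ord0 mul0r subrr.
 have e1 : cos (a n.+1) = cos (2 * pi * (n%:R * t)) * cos (pi * t) - sin (2 * pi * (n%:R * t)) * sin (pi * t).
  by rewrite aS cosD.
 have e2 : cos (a n) = cos (2 * pi * (n%:R * t)) * cos (pi * t) + sin (2 * pi * (n%:R * t)) * sin (pi * t).
  by rewrite /a cosB.
 by rewrite big_ord_recr /= mulrDl IH e1 e2; ring.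
rewrite /dir; move: (telC N) (telS N).
move: (\sum_(k < N) _) (\sum_(k < N) _) (sin (pi * t)) => C S s hC hS.
have : 4 * ((C ^+ 2 + S ^+ 2) * s ^+ 2) = (sin (a N) - sin (a 0%N)) ^+ 2 + (cos (a 0%N) - cos (a N)) ^+ 2.
 by rewrite -hC -hS; ring.
have h1 := cos2Dsin2 (a N); have h2 := cos2Dsin2 (a 0%N).
move: (sin (a N)) (sin (a 0%N)) (cos (a N)) (cos (a 0%N)) h1 h2 => x y u v h1 h2.
by have := sqr_ge0 (x + y); have := sqr_ge0 (u + v); nra.
Qed.

Definition wt (k : nat) : R := 4 / (maxn 1 k)%:R ^+ 2.

Lemma wt_ge0 k : 0 <= wt k.
Proof. by rewrite /wt divr_ge0// exprn_ge0. Qed.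

(** The integer part of t N on either side of 0: (true, k) stands for k and (false, k) for - (k +
    1). In both cases k is a lower bound for |t| N, which is what the decay [wt k] needs. *)
Definition cell (c : bool * nat) : int := if c.1 then c.2%:Z else - (c.2.+1)%:Z.

Lemma dir_wt N t : (0 < N)%N -> `|t| <= 1 / 2 ->
 exists2 c, (c.2 < N)%N & Num.floor (t * N%:R) = cell c /\ dir N t <= (N ^ 2)%:R * wt c.2.
Proof.
move=> N0 t2; set k := Num.floor _.
have NR : (0 : R) < N%:R by rewrite ltr0n.
have /andP[kb1 kb2] : k%:~R <= t * N%:R < (k + 1)%:~R by rewrite floor_le_tmp floorD1_gt.
have pi0 : (0 : R) < pi := pi_gt0 R.
have pi2 : (2 : R) <= pi := pi_ge2 R.
have key (j : nat) : j%:R <= `|t| * N%:R -> dir N t <= (N ^ 2)%:R * wt j.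
 move=> jt; rewrite /wt; have [->|j0] := posnP j.
  rewrite (maxn_idPl _)// expr1n divr1.
  by apply: (le_trans (dir_le _ _)); rewrite ler_wpM2l//; lra.
 rewrite (maxn_idPr j0).
 have jR : (0 : R) < j%:R by rewrite ltr0n.
 have sl : (pi * `|t|) / 4 <= sin (pi * `|t|).
  by apply: sin_ge4; [rewrite mulr_ge0 ?(ltW pi0)|nra].
 have t0 : 0 <= `|t| by [].
 have s2 : sin (pi * `|t|) ^+ 2 = sin (pi * t) ^+ 2.
  by have [h|h] := ger0P t; rewrite ?mulrN ?sinN ?sqrrN.
 have := dir_sin N t; rewrite -s2.
 set D := dir N t; have D0 : 0 <= D by rewrite /D /dir addr_ge0// sqr_ge0.
 have h1 : `|t| / 2 <= sin (pi * `|t|) by nra.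
 move: (sin _) h1 => s h1 h2.
 have h3 : D * `|t| ^+ 2 <= 4.
  have : D * (`|t| / 2) ^+ 2 <= D * s ^+ 2.
   by rewrite ler_wpM2l// ler_pXn2r ?nnegrE//; lra.
  lra.
 rewrite mulrA ler_pdivlMr ?exprn_gt0//.
 apply: (le_trans (y := D * (`|t| * N%:R) ^+ 2)).
  by rewrite ler_wpM2l// ler_pXn2r ?nnegrE ?mulr_ge0// ltW.
 rewrite exprMn mulrA natrX mulrC ler_wpM2l ?exprn_ge0// ltW//.
have Nt : `|t| * N%:R <= N%:R / 2 by nra.
have [k0|k0] := leP 0 k.
 have ek : k = `|k|%N by rewrite gez0_abs.
 have kt : `|k|%N%:R <= `|t| * N%:R.
  rewrite pmulrn -ek (le_trans kb1)//.
  by rewrite -[X in _ <= _ * X]ger0_norm ?ler0n// -normrM ler_norm.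
 exists (true, `|k|%N); last by split; [exact: ek|exact: key].
 by rewrite -(ltr_nat R) /=; lra.
have ek : - (k + 1) = `|- (k + 1)|%N by rewrite gez0_abs//; lia.
have kt : `|- (k + 1)|%N%:R <= `|t| * N%:R.
 rewrite pmulrn -ek intrN.
 apply: (le_trans (y := - (t * N%:R))); first by rewrite lerN2 ltW.
 by rewrite -mulNr ler_wpM2r ?ler0n// -normrN ler_norm.
exists (false, `|- (k + 1)|%N); last first.
 by split; [rewrite /cell /=; lia|exact: key].
by rewrite -(ltr_nat R) /=; lra.
Qed.

(** By 1/(n+1)^2 <= 1/n - 1/(n+1) the sum over k is at most 4 + 4 * 2, and the two sides of 0 double
    it. *)
Lemma sum_wt N : \sum_(c : bool * 'I_N) wt c.2 <= 24.
Proof.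
have -> : \sum_(c : bool * 'I_N) wt c.2 = 2 * \sum_(k < N) wt k.
 rewrite -(pair_big xpredT xpredT (fun (b : bool) (k : 'I_N) => wt k)) /=.
 by rewrite sumr_const card_bool mulr_natl.
have h n : \sum_(k < n.+2) wt k <= 4 + 4 * (2 - n.+1%:R^-1).
 elim: n => [|n IH]; first by rewrite !big_ord_recr big_ord0 /= /wt /= expr1n invr1; lra.
 rewrite big_ord_recr /= (le_trans (lerD IH (lexx _)))// /wt (maxn_idPr _)//.
 have x1 : (1 : R) <= n.+1%:R by rewrite ler1n.
 have -> : n.+2%:R = n.+1%:R + 1 :> R by rewrite natr1.
 move: (n.+1%:R : R) x1 => x x1.
 have e : x^-1 - (x + 1)^-1 = (x * (x + 1))^-1.
  by field; apply/andP; split; rewrite gt_eqF//; lra.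
 have : ((x + 1) ^+ 2)^-1 <= (x * (x + 1))^-1.
  by rewrite lef_pV2 ?posrE; nra.
 by rewrite -e; lra.
case: N => [|[|N]]; first by rewrite big_ord0; lra.
 by rewrite big_ord1 /wt /= expr1n; lra.
have := h N; have : (0 : R) <= N.+1%:R^-1 by rewrite invr_ge0.
by move: (N.+1%:R^-1) (\sum_(_ < _) _) => x y; lra.
Qed.

End dirichlet.

(** * The Schur test *)

Section schur.
Context {R : realType} {d} {T : measurableType d} (mu : {finite_measure set T -> \bar R}).
Variables (I : finType) (E : I -> T -> R).
Hypothesis bE : forall i, bmf (E i).
Let k x y := \sum_i E i x * E i y.

(** The left side is the double integral of g(x) g(y) k(x, y). As k is nonnegative, g(x) g(y) may be
    replaced by (g(x)^2 + g(y)^2)/2, and each half is controlled by the row integrals of k. *)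
Lemma schur (M : R) (g : T -> R) : bmf g -> (forall x y, 0 <= k x y) ->
 (forall x, \int[mu]_y k x y <= M) ->
 \sum_i (\int[mu]_x (g x * E i x)) ^+ 2 <= M * \int[mu]_x (g x ^+ 2).
Proof.
move=> bg k0 kM; pose c i := \int[mu]_x (g x * E i x).
have bg2 : bmf (fun x => g x ^+ 2) by apply: eq_bmf (bmfM bg bg) _ => x; rewrite expr2.
have bk x : bmf (k x) by apply: bmf_sum => i; exact: bmfZ.
have bgE i : bmf (fun x => g x * E i x) by exact: bmfM.
have bg2E i : bmf (fun x => g x ^+ 2 * E i x) by exact: bmfM.
have kC x y : k x y = k y x by apply: eq_bigr => i _; rewrite mulrC.
have e1 x : \sum_i c i * (g x * E i x) = \int[mu]_y (g x * g y * k x y).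
 transitivity (\int[mu]_y (\sum_i (g x * E i x) * (g y * E i y))).
  rewrite Rint_sum; last by move=> i; exact: bmfZ.
  by apply: eq_bigr => i _; rewrite RintZ// mulrC.
 by apply: eq_Rintegral => y _; rewrite mulr_sumr; apply: eq_bigr => i _; ring.
have e2 x : \int[mu]_y (g y ^+ 2 * k x y) = \sum_i E i x * \int[mu]_y (g y ^+ 2 * E i y).
 transitivity (\sum_i \int[mu]_y (E i x * (g y ^+ 2 * E i y))); last by apply: eq_bigr => i _; rewrite RintZ.
 rewrite -Rint_sum; last by move=> i; exact: bmfZ.
 by apply: eq_Rintegral => y _; rewrite mulr_sumr; apply: eq_bigr => i _; ring.
have -> : \sum_i (c i) ^+ 2 = \int[mu]_x (\sum_i c i * (g x * E i x)).
 rewrite Rint_sum; last by move=> i; exact: bmfZ.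
 by apply: eq_bigr => i _; rewrite RintZ// expr2.
pose G2 := \int[mu]_x (g x ^+ 2).
have e3 : \int[mu]_x (\sum_i E i x * \int[mu]_y (g y ^+ 2 * E i y)) <= M * G2.
 have bs : bmf (fun x => \sum_i E i x * \int[mu]_y (g y ^+ 2 * E i y)).
  by apply: bmf_sum => i; apply: eq_bmf (bmfZ (\int[mu]_y (g y ^+ 2 * E i y)) (bE i)) _ => x; rewrite mulrC.
 have -> : \int[mu]_x (\sum_i E i x * \int[mu]_y (g y ^+ 2 * E i y)) =
   \int[mu]_y (g y ^+ 2 * \sum_i E i y * \int[mu]_x E i x).
  rewrite Rint_sum; last by move=> i; apply: eq_bmf (bmfZ (\int[mu]_y (g y ^+ 2 * E i y)) (bE i)) _ => x; rewrite mulrC.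
  transitivity (\int[mu]_y (\sum_i (\int[mu]_x E i x) * (g y ^+ 2 * E i y))).
   rewrite Rint_sum; last by move=> i; exact: bmfZ.
   apply: eq_bigr => i _; rewrite RintZ//.
   rewrite -[RHS]mulrC -RintZ//; apply: eq_Rintegral => x _; exact: mulrC.
  by apply: eq_Rintegral => y _; rewrite mulr_sumr; apply: eq_bigr => i _; ring.
 rewrite /G2 -RintZ//; apply: le_Rint.
 - apply: bmfM => //; apply: bmf_sum => i; apply: eq_bmf (bmfZ (\int[mu]_x E i x) (bE i)) _ => x; exact: mulrC.
 - exact: bmfZ.
 move=> y; rewrite [M * _]mulrC ler_wpM2l ?sqr_ge0//.
 apply: le_trans (kM y); rewrite le_eqVlt; apply/orP; left; apply/eqP.
 rewrite Rint_sum; last by move=> i; exact: bmfZ.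
 by apply: eq_bigr => i _; rewrite RintZ.
have bH : bmf (fun x => 2^-1 * (M * g x ^+ 2 + \sum_i E i x * \int[mu]_y (g y ^+ 2 * E i y))).
 apply: bmfZ; apply: bmfD; first exact: bmfZ.
 by apply: bmf_sum => i; apply: eq_bmf (bmfZ (\int[mu]_y (g y ^+ 2 * E i y)) (bE i)) _ => x; rewrite mulrC.
apply: (le_trans (y := \int[mu]_x (2^-1 * (M * g x ^+ 2 + \sum_i E i x * \int[mu]_y (g y ^+ 2 * E i y))))).
 apply: le_Rint => //; first by apply: bmf_sum => i; exact: bmfZ.
 move=> x; rewrite e1 -e2.
 have bkg : bmf (fun y => g y ^+ 2 * k x y) by exact: bmfM.
 apply: (le_trans (y := \int[mu]_y (2^-1 * (g x ^+ 2 * k x y + g y ^+ 2 * k x y)))).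
  apply: le_Rint.
  - by apply: bmfM => //; exact: bmfZ.
  - by apply: bmfZ; apply: bmfD => //; exact: bmfZ.
  - by move=> y; have := mulr_ge0 (k0 x y) (sqr_ge0 (g x - g y)); lra.
 rewrite RintZ; last by apply: bmfD => //; exact: bmfZ.
 rewrite ler_wpM2l ?invr_ge0// RintD//; last exact: bmfZ.
 by rewrite RintZ// lerD2r mulrC ler_wpM2r ?sqr_ge0.
rewrite RintZ; last by apply: bmfD; [exact: bmfZ|apply: bmf_sum => i; apply: eq_bmf (bmfZ (\int[mu]_y (g y ^+ 2 * E i y)) (bE i)) _ => x; rewrite mulrC].
rewrite RintD; [|exact: bmfZ|by apply: bmf_sum => i; apply: eq_bmf (bmfZ (\int[mu]_y (g y ^+ 2 * E i y)) (bE i)) _ => x; rewrite mulrC].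
rewrite RintZ//; move: e3; rewrite -/G2; lra.
Qed.

End schur.

(** * A large sieve bound for the variance of grid sums *)

Section sieve.
Context {R : realType} {G : setting} {d : nat}.
Variable mu : fin_measure R d.
Variable de : R.
Hypotheses (de0 : 0 < de)
 (deG : G = Lattice -> de = 1).
Implicit Types (l : 'rV[R]_d).

Definition gsite (p : 'I_d -> nat) : site R G d :=
 match G return site R G d with
 | Euclidean => \row_i (de * (p i)%:R)
 | Lattice => \row_i (p i)%:Z
 end.

Lemma pos_gsite p : pos (gsite p) = \row_i (de * (p i)%:R).
Proof.
rewrite /gsite; case: G deG => //= h; apply/rowP => i; rewrite !mxE h// mul1r.
by rewrite -pmulrn.
Qed.

Lemma gsiteD p q : gsite (fun i => p i + q i)%N = gsite p + gsite q.
Proof.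
rewrite /gsite; case: G; apply/rowP => i; rewrite !mxE; first by rewrite natrD mulrDr.
by rewrite PoszD.
Qed.

Lemma phase_gsite p l : phase (gsite p) l = \sum_i 2 * pi * ((p i)%:R * (de * l 0 i)).
Proof.
rewrite /phase pos_gsite /edot mulr_sumr; apply: eq_bigr => i _.
by rewrite mxE; ring.
Qed.

Notation J n := {ffun 'I_d -> 'I_n}.
Definition gs {n} (j : J n) : site R G d := gsite (fun i => j i : nat).

Definition csq (z : R[i]) : R := complex.Re z ^+ 2 + complex.Im z ^+ 2.

Lemma csqM z w : csq (z * w) = csq z * csq w.
Proof. by case: z w => [a b] [c e]; rewrite /csq /=; ring. Qed.
Lemma csq1 : csq 1 = 1.
Proof. by rewrite /csq /= expr1n expr0n addr0. Qed.
Lemma cisD (a b : R) : cis (a + b) = cis a * cis b.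
Proof. by rewrite /cis cosD sinD; congr (_ +i* _)%C; ring. Qed.

Lemma cis_sum (I : Type) (s : seq I) (F : I -> R) :
 cis (\sum_(i <- s) F i) = \prod_(i <- s) cis (F i).
Proof.
elim: s => [|i s IH]; first by rewrite !big_nil /cis cos0 sin0.
by rewrite !big_cons cisD IH.
Qed.

Lemma sum_cis (I : Type) (s : seq I) (F : I -> R) :
 \sum_(i <- s) cis (F i) = ((\sum_(i <- s) cos (F i)) +i* (\sum_(i <- s) sin (F i)))%C.
Proof.
elim: s => [|i s IH]; first by rewrite !big_nil.
by rewrite !big_cons IH.
Qed.

(** A grid sum of characters factorises over the coordinates; complex exponentials express this. *)
Lemma dirichlet_prod N l :
 (\sum_(p : J N) cosw (gs p) l) ^+ 2 + (\sum_(p : J N) sinw (gs p) l) ^+ 2 =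
 \prod_i dir N (de * l 0 i).
Proof.
have -> : (\sum_(p : J N) cosw (gs p) l) ^+ 2 + (\sum_(p : J N) sinw (gs p) l) ^+ 2 =
  csq (\sum_(p : J N) cis (phase (gs p) l)) by rewrite sum_cis.
have -> : \sum_(p : J N) cis (phase (gs p) l) = \prod_i \sum_(k < N) cis (2 * pi * (k%:R * (de * l 0 i))).
 rewrite bigA_distr_bigA; apply: eq_bigr => p _.
 by rewrite phase_gsite cis_sum.
rewrite (big_morph csq csqM csq1); apply: eq_bigr => i _.
by rewrite sum_cis.
Qed.

Definition corner (rho : R) {N} (c : {ffun 'I_d -> bool * 'I_N}) : 'rV[R]_d :=
 \row_i ((cell ((c i).1, (c i).2 : nat))%:~R * rho).

Lemma enorm_le (l : 'rV[R]_d) r : 0 <= r -> (forall i, `|l 0 i| <= r) -> enorm l <= Num.sqrt d%:R * r.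
Proof.
move=> r0 h; rewrite -(ger0_norm r0) -sqrtr_sqr -sqrtrM// /enorm ler_wsqrtr//.
rewrite -[d in d%:R]card_ord -sumr_const mulr_suml; apply: ler_sum => i _.
by rewrite mul1r -real_normK ?num_real// ler_pXn2r ?nnegrE// h.
Qed.

(** On the torus the difference is folded anew. Its distance to the corner lies in [0, rho) with rho
    <= 1/2, so the fold removes the same integer as before. *)
Lemma repr_corner N (c : {ffun 'I_d -> bool * 'I_N}) (rho : R) l : 0 < rho ->
 (G = Lattice -> rho <= 1 / 2) ->
 (forall i, Num.floor (freq_repr G l 0 i / rho) = cell ((c i).1, (c i).2 : nat)) ->
 enorm (freq_repr G (l - corner rho c)) <= Num.sqrt d%:R * rho.
Proof.
move=> r0 rG h; apply: enorm_le; first exact: ltW.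
have b i : 0 <= freq_repr G l 0 i - corner rho c 0 i < rho.
 rewrite mxE; set x := freq_repr G l 0 i in h *.
 have : (cell ((c i).1, (c i).2 : nat))%:~R <= x / rho < (cell ((c i).1, (c i).2 : nat) + 1)%:~R.
  by rewrite -h floor_le_tmp floorD1_gt.
 by rewrite intrD ler_pdivlMr// ltr_pdivrMr// subr_ge0 ltrBlDl mulrDl mul1r addrC => /andP[-> ->].
move=> i; have := b i; rewrite /freq_repr; case: G rG b => rG b /=.
 by rewrite !mxE => /andP[h1 h2]; rewrite ger0_norm// ltW.
rewrite !mxE; set x := l 0 i; set k := Num.floor _ => /andP[h1 h2].
set z := _ * rho in h1 h2 *.
have e : Num.floor (x - z + 2^-1) = k.
 apply/floor_def; rewrite intrD.
 by have := rG erefl; lra.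
by rewrite e ger0_norm; lra.
Qed.

Lemma measurable_repr : mble (@freq_repr R G d).
Proof.
apply: measurable_fun_rV => i; rewrite /freq_repr; case: G; first exact: measurable_coord.
under eq_fun do rewrite mxE.
apply: measurable_funB; first exact: measurable_coord.
have mg : mble (fun l : 'rV[R]_d => l 0 i + 2^-1 : R).
 by apply: measurable_funD => //; exact: measurable_coord.
exact: (measurableT_comp (@measurable_floor R) mg).
Qed.

Lemma measurable_enorm : mble (@enorm R d).
Proof.
have ms : mble (fun x : 'rV[R]_d => \sum_i x 0 i ^+ 2).
 apply: measurable_sum => i; under eq_fun do rewrite expr2.
 by apply: measurable_funM; exact: measurable_coord.
by apply: measurableT_comp => //; apply: continuous_measurable_fun; exact: sqrt_continuous.
Qed.

Lemma measurable_shift (u : 'rV[R]_d) : mble (fun l : 'rV[R]_d => l - u).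
Proof.
apply: measurable_fun_rV => i; under eq_fun do rewrite !mxE.
by apply: measurable_funB => //; exact: measurable_coord.
Qed.

Lemma measurable_freq_ball (u : 'rV[R]_d) r : measurable (freq_ball G u r).
Proof.
have := @measurable_ge _ _ _ (fun l => - enorm (freq_repr G (l - u))) (- r).
rewrite (_ : [set w | _] = freq_ball G u r); last first.
 by apply/funext => l; rewrite /freq_ball /= lerN2.
apply; apply: measurableT_comp => //; apply: (measurableT_comp measurable_enorm).
exact: (measurableT_comp measurable_repr (measurable_shift u)).
Qed.

Section bound.
Variables (n : nat) (w : J n -> R) (a : R) (chi : set 'rV[R]_d) (B : R) (x0 : site R G d).
Hypotheses (n0 : (0 < n)%N)
 (wa : forall j, `|w j| <= a)
 (mchi : measurable chi)
 (chiE : forall l l', chi l -> chi l' -> forall i, `|de * freq_repr G (l' - l) 0 i| <= 1 / 2).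
Let N := (n + n)%N.
Let rho := (de * N%:R)^-1.
Hypothesis hB : forall u, fine (mu (freq_ball G u (Num.sqrt d%:R * rho))) <= B.

Let N0 : (0 < N)%N. Proof. by rewrite /N addn_gt0 n0. Qed.
Let dN0 : 0 < de * N%:R. Proof. by rewrite mulr_gt0// ltr0n. Qed.
Let rho0 : 0 < rho. Proof. by rewrite invr_gt0. Qed.
Let rhoG : G = Lattice -> rho <= 1 / 2.
Proof.
move=> /deG h; rewrite /rho h !mul1r lef_pV2 ?posrE ?ltr0n// ler_nat /N; lia.
Qed.

Let a0 : 0 <= a.
Proof. by apply: le_trans (wa [ffun=> Ordinal n0]). Qed.

Let E (i : J N * J N * bool) l : R :=
 \1_chi l * (if i.2 then cosw (gs i.1.1 - gs i.1.2) l else sinw (gs i.1.1 - gs i.1.2) l).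

Let bE i : bmf (E i).
Proof.
apply: bmfM; first exact: bmf_indic.
by case: i.2; [exact: bmf_cosw|exact: bmf_sinw].
Qed.

(** Indexing by pairs (p, q) of grid points, with the character at p - q, turns the kernel into a
    squared modulus of a Dirichlet sum, hence makes it nonnegative as [schur] requires. *)
Lemma sieve_kernel l l' : \sum_i E i l * E i l' =
 \1_chi l * \1_chi l' * \prod_i dir N (de * freq_repr G (l' - l) 0 i).
Proof.
have -> : \sum_i E i l * E i l' = \sum_(p : J N * J N) \sum_(b : bool) E (p, b) l * E (p, b) l'.
 by rewrite pair_big /=; apply: eq_bigr => -[[p q] b].
rewrite -dirichlet_prod.
have ph x : phase (x : site R G d) (l' - l) = phase x l' - phase x l.
 rewrite /phase -mulrBr; congr (_ * _); rewrite /edot -sumrB.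
 by apply: eq_bigr => i _; rewrite !mxE mulrBl.
have -> : (\sum_(p : J N) cosw (gs p) (freq_repr G (l' - l))) = \sum_(p : J N) cos (phase (gs p) (l' - l)).
 by apply: eq_bigr => p _; have [-> _] := trig_repr (gs p) (l' - l).
have -> : (\sum_(p : J N) sinw (gs p) (freq_repr G (l' - l))) = \sum_(p : J N) sin (phase (gs p) (l' - l)).
 by apply: eq_bigr => p _; have [_ ->] := trig_repr (gs p) (l' - l).
rewrite !expr2 !big_distrlr /= -big_split /= mulr_sumr.
rewrite -(pair_big xpredT xpredT (fun p q => \sum_(b : bool) E (p, q, b) l * E (p, q, b) l')) /=.
apply: eq_bigr => p _; rewrite -big_split /= mulr_sumr; apply: eq_bigr => q _.
rewrite big_bool /= /E /= /cosw /sinw -cosB !phaseB.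
set A := \1_chi l; set A' := \1_chi l'.
transitivity (A * A' * cos ((phase (gs p) l - phase (gs q) l) - (phase (gs p) l' - phase (gs q) l'))).
 by rewrite [in RHS]cosB; ring.
congr (_ * _); rewrite -cosN !ph; congr cos; ring.
Qed.

Lemma sieve_ge0 l l' : 0 <= \sum_i E i l * E i l'.
Proof.
rewrite sieve_kernel !mulr_ge0// ?indicE ?ler0n//; apply: prodr_ge0 => i _.
by rewrite /dir addr_ge0// sqr_ge0.
Qed.

(** Within [chi] the differences l' - l meet a single peak of the kernel. Splitting them into cells
    of side 1/(de N), the kernel is at most N^(2d) times a product of weights [wt] on each cell,
    each cell lies in a ball of measure at most B, and the weights sum to at most 24 per
    coordinate. *)
Lemma sieve_int l : \int[mu]_l' (\sum_i E i l * E i l') <= (N ^ 2)%:R ^+ d * 24 ^+ d * B.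
Proof.
have bk : bmf (fun l' => \sum_i E i l * E i l') by apply: bmf_sum => i; exact: bmfZ.
pose K := {ffun 'I_d -> bool * 'I_N}.
pose ball (c : K) := freq_ball G (l + corner rho c) (Num.sqrt d%:R * rho).
have mb c : measurable (ball c) by exact: measurable_freq_ball.
pose W (c : K) : R := \prod_i ((N ^ 2)%:R * wt (c i).2).
have W0 c : 0 <= W c by apply: prodr_ge0 => i _; rewrite mulr_ge0 ?wt_ge0.
have hle l' : \sum_i E i l * E i l' <= \sum_(c : K) W c * \1_(ball c) l'.
 rewrite sieve_kernel.
 have S0 : 0 <= \sum_(c : K) W c * \1_(ball c) l' by apply: sumr_ge0 => c _; rewrite mulr_ge0// indicE.
 have [hl|hl] := pselect (chi l); last by rewrite indicE memNset// mul0r mul0r.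
 have [hl'|hl'] := pselect (chi l'); last by rewrite [\1_chi l']indicE memNset// mulr0 mul0r.
 rewrite !indicE !mem_set// !mul1r.
 have hc i := dir_wt N0 (chiE hl hl' i).
 have /fin_all_exists [c hcc] i : exists c : bool * 'I_N,
   Num.floor (de * freq_repr G (l' - l) 0 i * N%:R) = cell (c.1, c.2 : nat) /\
   dir N (de * freq_repr G (l' - l) 0 i) <= (N ^ 2)%:R * wt c.2.
  by have [[b k] /= kN hk] := hc i; exists (b, Ordinal kN).
 pose c' : K := [ffun i => c i].
 apply: (le_trans (y := W c' * \1_(ball c') l')); last first.
  by rewrite (bigD1 c')//= lerDl; apply: sumr_ge0 => c0 _; rewrite mulr_ge0// indicE.
 have -> : \1_(ball c') l' = 1 :> R.
  rewrite indicE mem_set// /ball /freq_ball /= opprD addrA; apply: repr_corner => // i.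
  rewrite ffunE /rho invrK; have [<- _] := hcc i; congr Num.floor; ring.
 rewrite mulr1; apply: ler_prod => i _; rewrite ffunE; have [_ ->] := hcc i.
 by rewrite andbT /dir addr_ge0// sqr_ge0.
have bW c : bmf (fun l' => W c * \1_(ball c) l') by apply: bmfZ; exact: bmf_indic.
apply: (le_trans (le_Rint mu bk (bmf_sum _ bW) hle)).
rewrite Rint_sum//.
have B0 : 0 <= B by apply: le_trans (hB 0); exact: fine_ge0.
apply: (le_trans (y := \sum_(c : K) W c * B)).
 apply: ler_sum => c _; rewrite RintZ; last exact: bmf_indic.
 rewrite ler_wpM2l//.
 have -> : \int[mu]_l' (\1_(ball c) l') = fine (mu (ball c)) by exact: Rint_indic.
 exact: hB.
rewrite -mulr_suml ler_wpM2r// /W -(bigA_distr_bigA (fun (i : 'I_d) (c : bool * 'I_N) => (N ^ 2)%:R * wt c.2)).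
rewrite -exprMn -[X in _ ^+ X]card_ord -prodr_const; apply: ler_prod => i _.
rewrite -mulr_sumr mulr_ge0//=; last by apply: sumr_ge0 => c _; exact: wt_ge0.
by rewrite ler_wpM2l// sum_wt.
Qed.

Let s : seq (R * site R G d) := [seq (w j, x0 + gs j) | j <- enum {: J n}].

Lemma sieve_shift : en mu s = en mu [seq (w j, gs j) | j <- enum {: J n}].
Proof.
rewrite /en /qf /s !big_map; apply: eq_bigr => i _; rewrite !big_map; apply: eq_bigr => j _ /=.
by rewrite ![x0 + _]addrC kcovDr.
Qed.

(** Let V be the part of the variance carried by [chi]. For each shift r, V is the sum over j of w_j
    times Fourier coefficients at (j + r) - r. Summing over the n^d shifts, Cauchy-Schwarz and
    [schur] give (n^d V)^2 <= n^(2d) a^2 * 2 M V, hence V <= 2 a^2 M. Off [chi] the trivial bound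
    (n^d a)^2 is used. *)
Lemma sieve_var : en mu s <=
 2 * a ^+ 2 * ((N ^ 2)%:R ^+ d * 24 ^+ d * B) + (n%:R ^+ d * a) ^+ 2 * fine (mu (~` chi)).
Proof.
rewrite sieve_shift; set s' := [seq _ | j <- _].
set M := _ ^+ d * _ * B.
have bc := bmf_lin s' (@bmf_cosw R G d); have bs := bmf_lin s' (@bmf_sinw R G d).
have linE (F : site R G d -> 'rV[R]_d -> R) l : lin F s' l = \sum_(j : J n) w j * F (gs j) l.
 by rewrite /lin big_map big_enum.
pose g1 l := \1_chi l * lin cosw s' l; pose g2 l := \1_chi l * lin sinw s' l.
have bx : bmf (\1_chi : 'rV[R]_d -> R) by exact: bmf_indic.
have bg1 : bmf g1 by exact: bmfM.
have bg2 : bmf g2 by exact: bmfM.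
have bg12 : bmf (fun l => g1 l ^+ 2 + g2 l ^+ 2).
 by apply: eq_bmf (bmfD (bmfM bg1 bg1) (bmfM bg2 bg2)) _ => l; rewrite !expr2.
have bg1s : bmf (fun l => g1 l ^+ 2) by apply: eq_bmf (bmfM bg1 bg1) _ => l; rewrite expr2.
have bg2s : bmf (fun l => g2 l ^+ 2) by apply: eq_bmf (bmfM bg2 bg2) _ => l; rewrite expr2.
pose V := \int[mu]_l (g1 l ^+ 2 + g2 l ^+ 2).
have V0 : 0 <= V by apply: Rintegral_ge0 => // l _; rewrite addr_ge0// sqr_ge0.
have tail : en mu s' <= V + (n%:R ^+ d * a) ^+ 2 * fine (mu (~` chi)).
 have bt : bmf (\1_(~` chi) : 'rV[R]_d -> R) by apply: bmf_indic; exact: measurableC.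
 have -> : fine (mu (~` chi)) = \int[mu]_l \1_(~` chi) l by rewrite Rint_indic//; exact: measurableC.
 rewrite /en qf_kcov_Rint -RintZ// -RintD//; last exact: bmfZ.
 apply: le_Rint.
 - by apply: eq_bmf (bmfD (bmfM bc bc) (bmfM bs bs)) _ => l; rewrite !expr2.
 - by apply: bmfD => //; exact: bmfZ.
 move=> l; rewrite /g1 /g2 !indicE in_setC; case: (l \in chi) => /=.
  by rewrite !mul1r mulr0 addr0.
 rewrite !mul0r expr0n !add0r mulr1.
 have -> : lin cosw s' l ^+ 2 + lin sinw s' l ^+ 2 =
   \sum_(j : J n) \sum_(k : J n) w j * w k * cos (phase (gs j) l - phase (gs k) l).
  rewrite !linE !expr2 !big_distrlr -big_split; apply: eq_bigr => j _.
  rewrite -big_split; apply: eq_bigr => k _ /=; rewrite cosB /cosw /sinw; ring.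
 apply: (le_trans (y := \sum_(j : J n) \sum_(k : J n) a * a)).
  apply: ler_sum => j _; apply: ler_sum => k _; apply: (le_trans (ler_norm _)).
  rewrite !normrM -[X in _ <= X]mulr1 ler_pM ?mulr_ge0// ?ler_pM//.
  by rewrite ler_norml cos_geN1 cos_le1.
 rewrite !sumr_const card_ffun !card_ord; set k := (n ^ d)%N.
 rewrite -[_ *+ k *+ k]mulr_natr -[_ *+ k]mulr_natr.
 have -> : n%:R ^+ d = k%:R :> R by rewrite natrX.
 by rewrite le_eqVlt; apply/orP; left; apply/eqP; ring.
apply: (le_trans tail); rewrite lerD2r.
have [->|Vn] := eqVneq V 0.
 by rewrite !mulr_ge0 ?sqr_ge0 ?exprn_ge0// (le_trans _ (hB 0))// fine_ge0.
have Vp : 0 < V by rewrite lt_neqAle eq_sym Vn.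
pose nd : R := n%:R ^+ d.
have nd0 : 0 < nd by rewrite exprn_gt0// ltr0n.
have hlt (u v : 'I_n) : (u + v < N)%N by rewrite /N -addnS leq_add// ltnW.
(* The pair (j + r, r), whose difference is j for every r; N = n + n leaves room for j + r. *)
pose idx (jr : J n * J n) : J N * J N :=
 ([ffun i => Ordinal (hlt (jr.1 i) (jr.2 i))], [ffun i => widen_ord (leq_addr n n) (jr.2 i)]).
have idx_inj : injective idx.
 move=> [j r] [j' r'] [/ffunP h1 /ffunP h2]; have er : r = r'.
  by apply/ffunP => i; have := h2 i; rewrite !ffunE => /(congr1 val) /= h; apply: val_inj.
 congr pair => //; apply/ffunP => i; have := h1 i; rewrite !ffunE => /(congr1 val) /=.
 by rewrite er => /addIn h; apply: val_inj.
have gsidx jr : gs (idx jr).1 - gs (idx jr).2 = gs jr.1.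
 have -> : gs (idx jr).1 = gs jr.1 + gs (idx jr).2; last by rewrite addrK.
 rewrite /gs -gsiteD; congr gsite; apply/funext => i; by rewrite !ffunE.
pose al jr := \int[mu]_l (g1 l * E (idx jr, true) l).
pose be jr := \int[mu]_l (g2 l * E (idx jr, false) l).
have EE1 jr l : E (idx jr, true) l = \1_chi l * cosw (gs jr.1) l.
 by rewrite -gsidx.
have EE2 jr l : E (idx jr, false) l = \1_chi l * sinw (gs jr.1) l.
 by rewrite -gsidx.
clearbody idx.
have VE (r : J n) : V = \sum_j w j * (al (j, r) + be (j, r)).
 transitivity (\int[mu]_l (\sum_j w j * (g1 l * E (idx (j, r), true) l + g2 l * E (idx (j, r), false) l))).
  apply: eq_Rintegral => l _.
  transitivity (g1 l * (\1_chi l * lin cosw s' l) + g2 l * (\1_chi l * lin sinw s' l)); first by rewrite !expr2.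
  rewrite !linE; under [RHS]eq_bigr do rewrite EE1 EE2 /=.
  move: (g1 l) (g2 l) (\1_chi l) => x y z.
  transitivity ((x * z) * (\sum_j w j * cosw (gs j) l) + (y * z) * (\sum_j w j * sinw (gs j) l)); first by rewrite !mulrA.
  rewrite !mulr_sumr -big_split; apply: eq_bigr => j _ /=; ring.
 rewrite Rint_sum; last by move=> j; apply: bmfZ; apply: bmfD; exact: bmfM.
 apply: eq_bigr => j _; rewrite RintZ; last by apply: bmfD; exact: bmfM.
 by rewrite RintD//; exact: bmfM.
have sum_inj (h : J n * J n -> J N * J N * bool) (F : J N * J N * bool -> R) :
  injective h -> (forall i, 0 <= F i) -> \sum_x F (h x) <= \sum_i F i.
 move=> hi F0; have -> : \sum_x F (h x) = \sum_(i in [set h x | x : J n * J n]%SET) F i.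
  by rewrite (big_imset _ (in2W hi)); apply: eq_bigl => x; rewrite inE.
 rewrite [X in _ <= X](bigID (mem [set h x | x : J n * J n]%SET)) /= lerDl.
 by apply: sumr_ge0.
have i1 : injective (fun jr => (idx jr, true)) by move=> x y [/idx_inj].
have i2 : injective (fun jr => (idx jr, false)) by move=> x y [/idx_inj].
have q1 : \sum_jr al jr ^+ 2 <= M * \int[mu]_l (g1 l ^+ 2).
 apply: le_trans (schur bE bg1 sieve_ge0 sieve_int).
 by apply: (sum_inj _ (fun i => (\int[mu]_l (g1 l * E i l)) ^+ 2) i1) => i; exact: sqr_ge0.
have q2 : \sum_jr be jr ^+ 2 <= M * \int[mu]_l (g2 l ^+ 2).
 apply: le_trans (schur bE bg2 sieve_ge0 sieve_int).
 by apply: (sum_inj _ (fun i => (\int[mu]_l (g2 l * E i l)) ^+ 2) i2) => i; exact: sqr_ge0.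
have q12 : \sum_jr (al jr + be jr) ^+ 2 <= 2 * M * V.
 have -> : 2 * M * V = 2 * (M * \int[mu]_l (g1 l ^+ 2) + M * \int[mu]_l (g2 l ^+ 2)).
  by rewrite -mulrDr -RintD// mulrA.
 apply: (le_trans (y := 2 * (\sum_jr al jr ^+ 2 + \sum_jr be jr ^+ 2))).
  rewrite -big_split mulr_sumr; apply: ler_sum => jr _ /=.
  by have := sqr_ge0 (al jr - be jr); lra.
 by rewrite ler_wpM2l// lerD.
have ndV : nd * V = \sum_jr w jr.1 * (al jr + be jr).
 have -> : \sum_jr w jr.1 * (al jr + be jr) = \sum_j \sum_r w j * (al (j, r) + be (j, r)).
  by rewrite pair_big /=; apply: eq_bigr => -[j r] _.
 rewrite exchange_big /=.
 rewrite (eq_bigr (fun=> V)); last by move=> r _; rewrite -VE.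
 by rewrite sumr_const card_ffun !card_ord -mulr_natl natrX.
have CS : (nd * V) ^+ 2 <= (\sum_(jr : J n * J n) w jr.1 ^+ 2) * \sum_jr (al jr + be jr) ^+ 2.
 apply: disc_le; first by apply: sumr_ge0 => jr _; exact: sqr_ge0.
 move=> t; rewrite ndV.
 have -> : \sum_(jr : J n * J n) w jr.1 ^+ 2 - 2 * t * (\sum_jr w jr.1 * (al jr + be jr)) +
   t ^+ 2 * (\sum_jr (al jr + be jr) ^+ 2) = \sum_jr (w jr.1 - t * (al jr + be jr)) ^+ 2.
  rewrite mulr_sumr -sumrB mulr_sumr -big_split; apply: eq_bigr => jr _ /=; ring.
 by apply: sumr_ge0 => jr _; exact: sqr_ge0.
have ws : \sum_(jr : J n * J n) w jr.1 ^+ 2 <= nd ^+ 2 * a ^+ 2.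
 apply: (le_trans (y := \sum_(jr : J n * J n) a ^+ 2)).
  apply: ler_sum => jr _; rewrite -real_normK ?num_real// ler_pXn2r ?nnegrE//; exact: wa.
 by rewrite sumr_const card_prod card_ffun !card_ord -mulr_natl natrM natrX expr2.
have fin : (nd * V) ^+ 2 <= nd ^+ 2 * a ^+ 2 * (2 * M * V).
 apply: (le_trans CS); apply: ler_pM => //; apply: sumr_ge0 => jr _; exact: sqr_ge0.
have : (nd ^+ 2 * V) * V <= (nd ^+ 2 * V) * (2 * a ^+ 2 * M).
 by move: fin; rewrite exprMn; lra.
by rewrite ler_pM2l// mulr_gt0// exprn_gt0.
Qed.

End bound.
End sieve.

(** * Uniform laws on intervals and their trigonometric integrals *)

Section uniform.
Context {R : realType} (M : nat).
Hypothesis M0 : (0 < M)%N.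
Let lam := @lebesgue_measure R.

Lemma ltNM : - M%:R < M%:R :> R.
Proof. by rewrite -subr_gt0 opprK -natrD ltr0n addn_gt0 M0. Qed.

Definition Uni : probability (measurableTypeR R) R := uniform_prob ltNM.

Lemma bmf_itv_integrable (F : R -> R) (a b : R) : bmf F -> lam.-integrable `[a, b] (EFin \o F).
Proof.
move=> [mF [C hC]]; apply: (@le_integrable _ _ _ _ _ _ _ (cst C%:E)) => //.
- by apply/measurable_EFinP; exact: measurable_funTS.
- by move=> x _ /=; rewrite lee_fin; apply: (le_trans (hC x)); exact: ler_norm.
- apply/integrableP; split=> //; rewrite integral_cst//=.
 by rewrite lebesgue_measure_itv /=; case: ifP => _; rewrite ?mule0 -?EFinB -?EFinM ltry.
Qed.

Lemma Rint_uni (F : R -> R) : bmf F ->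
 \int[Uni]_x F x = (M%:R - - M%:R)^-1 * \int[lam]_(x in `[- M%:R, M%:R]) F x.
Proof.
move=> bF; have [C C0 hC] := bmf_ge0 bF.
have bC : bmf (fun x : R => F x + C) by apply: bmfD => //; exact: bmf_cst.
have pos (x : R) : (0 <= (F x + C)%:E)%E.
 by rewrite lee_fin; have := hC x; rewrite ler_norml => /andP[h _]; lra.
have e1 : \int[Uni]_x (F x + C) = (M%:R - - M%:R)^-1 * \int[lam]_(x in `[- M%:R, M%:R]) (F x + C).
 rewrite /Rintegral integral_uniform//; last by apply/measurable_EFinP; exact: bmf_mble bC.
 by rewrite fineM// ?integrable_fin_num//; exact: bmf_itv_integrable.
rewrite RintD// in e1; last exact: bmf_cst.
rewrite Rint_cst RintegralD// in e1; [|exact: bmf_itv_integrable|exact: bmf_itv_integrable _ _ (bmf_cst C)].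
have e2 : \int[lam]_(x in `[- M%:R, M%:R]) C = C * (M%:R - - M%:R).
 rewrite /Rintegral integral_cst//= lebesgue_measure_itv /= lte_fin ltNM -EFinB -EFinM//.
have p0 : (M%:R - - M%:R : R) != 0 by rewrite subr_eq0 gt_eqF// ltNM.
rewrite e2 mulrDr mulrCA mulVf// mulr1 in e1.
exact: (addIr _ e1).
Qed.

Lemma Uni_null (B : set R) : measurable B -> Uni B = 0%E -> lam (B `&` `[- M%:R, M%:R]) = 0%E.
Proof.
move=> mB B0; have := @integral_uniform _ _ _ ltNM (fun x => (\1_B x)%:E).
rewrite integral_indic// setIT => h.
have {}h := h _ _; rewrite /= -/Uni B0 in h.
have : (0 = ((M%:R - - M%:R)^-1)%:E * \int[lam]_(x in `[(- M%:R)%R, (M%:R)%R]) (\1_B x)%:E)%E.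
 by apply: h; [apply/measurable_EFinP; exact: measurable_indic|move=> x; rewrite lee_fin indicE].
rewrite integral_indic// => /esym/eqP; rewrite mule_eq0 => /orP[|/eqP//].
by rewrite eqe invr_eq0 subr_eq0 gt_eqF// ltNM.
Qed.

Lemma int_cos_itv (a b th c : R) : a < b -> c != 0 ->
 \int[lam]_(x in `[a, b]) cos (th + c * x) = (sin (th + c * b) - sin (th + c * a)) / c.
Proof.
move=> ab c0; pose F (x : R) := sin (th + c * x) / c.
have dF x : is_derive x (1 : R) F (cos (th + c * x)).
 apply: is_derive_eq; rewrite /GRing.scale /=; field.
 exact: c0.
have cF : continuous F.
 by move=> x; apply: differentiable_continuous; apply/derivable1_diffP; have [] := dF x.
have cc : continuous (fun x : R => cos (th + c * x)).
 move=> x; apply: continuous_comp; last exact: continuous_cos.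
 by apply: cvgD; [exact: cvg_cst|apply: cvgMr; exact: cvg_id].
rewrite /Rintegral (@continuous_FTC2 _ _ F a b ab).
- by rewrite -EFinB /= /F mulrBl.
- exact: continuous_subspaceT.
- split; first by move=> x _; have [] := dF x.
  by apply: cvg_at_right_filter; exact: cF.
 by apply: cvg_at_left_filter; exact: cF.
- by move=> x _; rewrite derive1E; have [_ ->] := dF x.
Qed.

(** On each interval of length 1/L with endpoints in Z/L, s is constant up to endpoints and the
    cosine runs through |j| full periods; as M is an integer, [-M, M] is a union of 2 M L such
    intervals. *)
Lemma uni_trig0 (L : nat) (s : R -> R) (th : R) (j : int) : (0 < L)%N -> j != 0 -> bmf s ->
 (forall x y, Num.floor (L%:R * x) = Num.floor (L%:R * y) -> s x = s y) ->
 \int[Uni]_t (s t * cos (th + 2 * pi * (L%:R * j%:~R * t))) = 0.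
Proof.
move=> L0 j0 bs sL.
have LR : (0 : R) < L%:R by rewrite ltr0n.
have bF : bmf (fun t : R => s t * cos (th + 2 * pi * (L%:R * j%:~R * t))).
 apply: bmfM => //; apply: bmf_cos; apply: measurable_funD => //.
 by apply: measurable_funM => //; exact: measurable_funM.
rewrite Rint_uni//; set F := (fun t => _) in bF *.
suff h k : \int[lam]_(x in `[- M%:R, - M%:R + k%:R / L%:R]) F x = 0.
 have := h (2 * M * L)%N; rewrite (_ : - M%:R + _ = M%:R) => [->|]; first by rewrite mulr0.
 by rewrite !natrM mulfK ?gt_eqF//; ring.
elim: k => [|k IH].
 rewrite mul0r addr0 set_itv1 /Rintegral integral_set1//=.
set a : R := - M%:R; set b := a + k%:R / L%:R; set b' := a + _.
have bb' : b < b' by rewrite ltrD2l ltr_pM2r ?invr_gt0// ltr_nat.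
have ab : a <= b by rewrite lerDl divr_ge0.
have hB := @Rintegral_itvB R F (BLeft a) (BRight b') b (bmf_itv_integrable _ _ bF).
rewrite -[LHS]addr0 -[X in _ + X]oppr0 -[X in _ - X]IH hB; last 2 first.
- by rewrite bnd_simp.
- by rewrite bnd_simp ltW.
have io G : bmf G -> lam.-integrable `]b, b'] (EFin \o G).
 move=> bG; apply: integrableS (bmf_itv_integrable b b' bG) => //.
 by move=> x /=; rewrite !in_itv/= => /andP[/ltW -> ->].
have ioo G : bmf G -> lam.-integrable `]b, b'[ (EFin \o G).
 move=> bG; apply: integrableS (io _ bG) => //.
 by move=> x /=; rewrite !in_itv/= => /andP[-> /ltW ->].
rewrite -Rintegral_itv_bndo_bndc; last exact: ioo.
have bc : bmf (fun t : R => cos (th + 2 * pi * (L%:R * j%:~R) * t)).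
 by apply: bmf_cos; apply: measurable_funD => //; exact: measurable_funM.
transitivity (\int[lam]_(x in `]b, b'[) (s b * cos (th + 2 * pi * (L%:R * j%:~R) * x))).
 apply: eq_Rintegral => x; rewrite inE /= in_itv/= => /andP[x1 x2].
 rewrite /F mulrA; congr (_ * cos (_ + _)); apply: sL.
 have e : L%:R * b = (k%:Z - (M * L)%:Z)%:~R.
  rewrite /b /a intrB /= -!pmulrn mulrDr mulrCA divff ?gt_eqF// natrM; ring.
 have -> : Num.floor (L%:R * b) = k%:Z - (M * L)%:Z.
  by apply/floor_def; rewrite e lexx/= ltr_int ltrDl.
 apply/floor_def; rewrite -e ler_pM2l// ltW//= intrD -e.
 have : L%:R * b' = L%:R * b + 1.
  by rewrite /b' /b -natr1 mulrDl mul1r !mulrDr mulfV ?gt_eqF// addrA.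
 by move=> <-; rewrite ltr_pM2l.
rewrite RintegralZl//; last exact: ioo.
rewrite Rintegral_itv_bndo_bndc; last exact: ioo.
rewrite Rintegral_itv_obnd_cbnd; last exact: io.
have c0 : 2 * pi * (L%:R * j%:~R) != 0 :> R.
 by rewrite !mulf_neq0// ?intr_eq0// gt_eqF// ?pi_gt0.
rewrite int_cos_itv// (_ : sin _ - _ = 0) ?mul0r ?mulr0//.
apply/eqP; rewrite subr_eq0; apply/eqP.
have -> : th + 2 * pi * (L%:R * j%:~R) * b' = (th + 2 * pi * (L%:R * j%:~R) * b) + 2 * pi * j%:~R.
 rewrite /b' /b -natr1; field; rewrite gt_eqF//.
by have [_ ->] := @trig_int R (th + 2 * pi * (L%:R * j%:~R) * b) j.
Qed.

End uniform.

(** * Uniform laws on boxes of R^n *)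

Section unif_rV.
Context {R : realType} (M : nat).
Hypothesis M0 : (0 < M)%N.
Let U : probability (measurableTypeR R) R := Uni M0.

Fixpoint unif_rV (n : nat) : probability 'rV[R]_n R :=
 match n with
 | 0 => dirac (0 : 'rV[R]_0)
 | n'.+1 => image_prob (prodP (unif_rV n') U) (rV_consM n')
 end.

Lemma unif_rV_Rint n (F : 'rV[R]_n.+1 -> R) : bmf F ->
 \int[unif_rV n.+1]_z F z = \int[prodP (unif_rV n) U]_z F (rV_cons z).
Proof. by move=> bF; rewrite Rint_image. Qed.

Lemma Rint_prod12 {d1 d2} {T1 : measurableType d1} {T2 : measurableType d2}
  (P1 : probability T1 R) (P2 : probability T2 R) (F : T1 * T2 -> R) : bmf F ->
 (forall x, \int[P2]_y F (x, y) = 0) -> \int[prodP P1 P2]_z F z = 0.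
Proof.
move=> bF h; have iF := bmf_integrable (prodP P1 P2) bF.
rewrite /Rintegral -(integral12_prod_meas1 iF) /fubini_F.
under eq_integral => x _.
 rewrite -EFin_Rint ?h; last first.
  split; last by have [_ [C hC]] := bF; exists C.
  by apply: (measurableT_comp (bmf_mble bF)); exact: measurable_pair1.
 over.
by rewrite integral0.
Qed.

Lemma Rint_prod21 {d1 d2} {T1 : measurableType d1} {T2 : measurableType d2}
  (P1 : probability T1 R) (P2 : probability T2 R) (F : T1 * T2 -> R) : bmf F ->
 (forall y, \int[P1]_x F (x, y) = 0) -> \int[prodP P1 P2]_z F z = 0.
Proof.
move=> bF h; have iF := bmf_integrable (prodP P1 P2) bF.
rewrite /Rintegral -(integral21_prod_meas1 iF) /fubini_G.
under eq_integral => x _.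
 rewrite -EFin_Rint ?h; last first.
  split; last by have [_ [C hC]] := bF; exists C.
  by apply: (measurableT_comp (bmf_mble bF)); exact: measurable_pair2.
 over.
by rewrite integral0.
Qed.

Definition floors n (L : nat) (x : 'rV[R]_n) : 'rV[int]_n := \row_i Num.floor (L%:R * x 0 i).
(** Step functions on the grid of mesh 1/L, whose Fourier coefficients at nonzero multiples of L
    vanish by [unif_trig0]. *)
Definition fmeas n (L : nat) (s : 'rV[R]_n -> R) : Prop :=
 forall x y, floors L x = floors L y -> s x = s y.

Lemma floors_cons n L (x : 'rV[R]_n) (t : R) :
 floors L (rV_cons (x, t)) = \row_i oapp (floors L x 0) (Num.floor (L%:R * t)) (unlift ord0 i).
Proof. by apply/rowP => i; rewrite !mxE; case: (unlift ord0 i) => //= j; rewrite mxE. Qed.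

Lemma unif_trig0 n (L : nat) (s : 'rV[R]_n -> R) (th : R) (j : 'rV[int]_n) :
 (0 < L)%N -> j != 0 -> bmf s -> fmeas L s ->
 \int[unif_rV n]_x (s x * cos (th + 2 * pi * (\sum_i L%:R * (j 0 i)%:~R * x 0 i))) = 0.
Proof.
move=> L0; elim: n s th j => [|n IH] s th j j0 bs fs.
 by exfalso; move/eqP: j0; apply; apply/rowP => -[].
have bF : bmf (fun x : 'rV[R]_n.+1 => s x * cos (th + 2 * pi * (\sum_i L%:R * (j 0 i)%:~R * x 0 i))).
 apply: bmfM => //; apply: bmf_cos; apply: measurable_funD => //; apply: measurable_funM => //.
 by apply: measurable_sum => i; apply: measurable_funM => //; exact: measurable_coord.
rewrite unif_rV_Rint//.
pose phi (x : 'rV[R]_n) := \sum_i L%:R * (j 0 (lift ord0 i))%:~R * x 0 i.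
have e x t : \sum_i L%:R * (j 0 i)%:~R * (rV_cons (x, t)) 0 i = L%:R * (j 0 ord0)%:~R * t + phi x.
 rewrite big_ord_recl /rV_cons mxE unlift_none /=; congr (_ + _).
 by apply: eq_bigr => i _; rewrite mxE liftK.
have mc : mble (@rV_cons R n) by exact: measurable_rV_cons.
have bF' : bmf (fun z => s (rV_cons z) * cos (th + 2 * pi * (\sum_i L%:R * (j 0 i)%:~R * (rV_cons z) 0 i))).
 split; first exact: (measurableT_comp (bmf_mble bF) mc).
 by have [_ [C hC]] := bF; exists C => z; exact: hC.
have bsx x : bmf (fun t : R => s (rV_cons (x, t))).
 split; last by have [_ [C hC]] := bs; exists C.
 by apply: (measurableT_comp (bmf_mble bs)); apply: (measurableT_comp mc); exact: measurable_pair1.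
have bst t : bmf (fun x : 'rV[R]_n => s (rV_cons (x, t))).
 split; last by have [_ [C hC]] := bs; exists C.
 by apply: (measurableT_comp (bmf_mble bs)); apply: (measurableT_comp mc); exact: measurable_pair2.
have [j00|j00] := eqVneq (j 0 ord0) 0.
 apply: Rint_prod21 => // t.
 have j'0 : (\row_i j 0 (lift ord0 i) : 'rV[int]_n) != 0.
  apply/eqP => /rowP h; move/eqP: j0; apply; apply/rowP => i; rewrite mxE.
  by case: (unliftP ord0 i) => [k ->|->]//; have := h k; rewrite !mxE.
 apply: etrans (IH (fun x => s (rV_cons (x, t))) th _ j'0 (bst t) _).
  apply: eq_Rintegral => x _; rewrite e j00 mulr0 mul0r add0r /phi.
  by under [in RHS]eq_bigr do rewrite mxE.
 by move=> x y xy; apply: fs; rewrite !floors_cons xy.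
apply: Rint_prod12 => // x.
apply: etrans (uni_trig0 M0 (th + 2 * pi * phi x) L0 j00 (bsx x) _).
 by apply: eq_Rintegral => t _; rewrite e; congr (_ * cos _); ring.
by move=> t t' tt'; apply: fs; rewrite !floors_cons tt'.
Qed.

Definition rbox n : set 'rV[R]_n := [set x | forall i, - M%:R <= x 0 i <= M%:R].

Lemma measurable_rbox n : measurable (@rbox n).
Proof.
have -> : @rbox n = \bigcap_(i : 'I_n) ((fun x : 'rV[R]_n => x 0 i) @^-1` `[- M%:R, M%:R]%classic).
 by apply/seteqP; split=> [x h i _|x h i]; [rewrite /= in_itv; exact: h|have := h i I; rewrite /= in_itv].
apply: fin_bigcap_measurable => // i _.
by rewrite -[X in measurable X]setTI; apply: measurable_coord => //; exact: measurable_itv.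
Qed.

(** Transfers absolute continuity from Lebesgue measure to the uniform law; proved along the common
    inductive construction of the two measures. *)
Lemma unif_null n (A : set 'rV[R]_n) : measurable A -> unif_rV n A = 0%E ->
 lebesgue_rV R n (A `&` @rbox n) = 0%E.
Proof.
elim: n A => [|n IH] A mA A0.
 apply/le_anti; rewrite measure_ge0 andbT -A0; apply: le_measure; rewrite ?inE//.
 by apply: measurableI => //; exact: measurable_rbox.
have mc : mble (@rV_cons R n) by exact: measurable_rV_cons.
pose A' := @rV_cons R n @^-1` A.
have mA' : measurable A' by rewrite -[A']setTI; exact: mc.
have e : unif_rV n.+1 A = (\int[unif_rV n]_x U (xsection A' x))%E by [].
have mU : mble (fun x => U (xsection A' x)) by exact: measurable_fun_xsection.
pose Z := [set x | U (xsection A' x) != 0%E].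
have mZ : measurable Z.
 have -> : Z = setT `&` (fun x => U (xsection A' x)) @^-1` (~` [set 0%E]).
  by rewrite setTI; apply/seteqP; split=> x /= /eqP.
 by apply: mU => //; apply: measurableC; exact: emeasurable_set1.
have Z0 : unif_rV n Z = 0%E.
 have /(ae_eq_integral_abs _ measurableT mU) : (\int[unif_rV n]_x `|U (xsection A' x)| = 0)%E.
  by rewrite -A0 e; apply: eq_integral => x _; rewrite gee0_abs.
 move=> [N [mN N0 hN]]; apply/le_anti; rewrite measure_ge0 andbT -N0.
 apply: le_measure; rewrite ?inE//; apply: subset_trans hN => x /= /eqP hx h.
 by apply: hx; exact: h.
have {IH} hZ := IH Z mZ Z0.
pose B := @rV_cons R n @^-1` (A `&` @rbox n.+1).
have mB : measurable B by rewrite -[B]setTI; apply: mc => //; apply: measurableI => //; exact: measurable_rbox.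
have -> : lebesgue_rV R n.+1 (A `&` @rbox n.+1) = (\int[lebesgue_rV R n]_x lebesgue_measure (xsection B x))%E by [].
rewrite (_ : (\int[lebesgue_rV R n]_x _ = \int[lebesgue_rV R n]_(x in Z `&` @rbox n) lebesgue_measure (xsection B x))%E); last first.
 rewrite [RHS]integral_mkcond; apply: eq_integral => x _; rewrite patchE; case: ifPn => //.
 rewrite notin_setE => hx.
 have [hb|hb] := pselect (rbox x); last first.
  rewrite (_ : xsection B x = set0) ?measure0//; apply/seteqP; split=> // t; rewrite /xsection /= inE => -[_ h].
  by apply: hb => i; have := h (lift ord0 i); rewrite /rV_cons mxE liftK.
 have z0 : U (xsection A' x) = 0%E by apply/eqP; apply/negPn/negP => h; apply: hx; split.
 have mX : measurable (xsection A' x) by exact: measurable_xsection.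
 have h0 := Uni_null mX z0.
 transitivity (0%E : \bar R) => //; apply/le_anti; rewrite measure_ge0 andbT.
 apply: le_trans (_ : lebesgue_measure (xsection A' x `&` `[(- M%:R)%R, M%:R%R]) <= 0)%E; last by rewrite h0.
 apply: le_measure; rewrite ?inE; [exact: measurable_xsection| |].
  by apply: measurableI; [exact: measurable_xsection|exact: measurable_itv].
 move=> t; rewrite /xsection /= !inE => -[h1 h2]; split=> //.
 have := h2 ord0; rewrite /rV_cons mxE unlift_none => h.
 by rewrite subitvE !bnd_simp.
apply: null_set_integral; first by apply: measurableI => //; exact: measurable_rbox.
 by apply: measurable_funTS; exact: measurable_fun_xsection.
exact: hZ.
Qed.

End unif_rV.

Import HBNNSimple.

(** * Approximation in mean by dyadic step functions *)

Section dyadic_class.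
Context {R : realType} {n : nat} (nu : probability 'rV[R]_n R).

Definition dyad (F : 'rV[R]_n -> R) : Prop := forall e : R, 0 < e ->
 exists q (s : 'rV[R]_n -> R), [/\ bmf s, fmeas (2 ^ q) s & \int[nu]_x `|F x - s x| <= e].

Lemma bmf_abs {d} {T : measurableType d} (F : T -> R) : bmf F -> bmf (fun x => `|F x|).
Proof.
move=> [mF [C hC]]; split; first exact: measurableT_comp.
by exists C => x; rewrite normr_id.
Qed.

Lemma floor_half (x : R) (y : R) : Num.floor (2 * x) = Num.floor (2 * y) -> Num.floor x = Num.floor y.
Proof.
have h (z w : R) : Num.floor (2 * z) = Num.floor (2 * w) -> Num.floor z <= Num.floor w.
 move=> e; rewrite leNgt; apply/negP => hlt.
 have h1 : Num.floor w + 1 <= Num.floor z by rewrite lezD1.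
 have h2 : w < (Num.floor z)%:~R.
  by apply: (lt_le_trans (floorD1_gt w)); rewrite ler_int.
 have h3 : (Num.floor z)%:~R <= z by exact: floor_le_tmp.
 have h4 : Num.floor (2 * w) < 2 * Num.floor z by rewrite floor_lt_int// intrM ltr_pM2l.
 have h5 : 2 * Num.floor z <= Num.floor (2 * z) by rewrite floor_ge_int_tmp intrM ler_pM2l.
 by move: h4 h5; rewrite e; lia.
by move=> e; apply/le_anti; rewrite !h.
Qed.

Lemma fmeas_up q q' (s : 'rV[R]_n -> R) : (q <= q')%N -> fmeas (2 ^ q) s -> fmeas (2 ^ q') s.
Proof.
move=> qq fs; rewrite -(subnK qq); elim: (q' - q)%N => [|k IH]; first exact: fs.
move=> x y /rowP h; apply: IH; apply/rowP => i; have := h i; rewrite !mxE => e.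
apply: floor_half; move: e; rewrite !addSn expnS natrM -!mulrA; exact.
Qed.

Lemma dyadD F G : bmf F -> bmf G -> dyad F -> dyad G -> dyad (fun x => F x + G x).
Proof.
move=> bF bG dF dG e e0; have e2 : 0 < e / 2 by rewrite divr_gt0.
have [q [s [bs fs hs]]] := dF _ e2; have [q' [t [bt ft ht]]] := dG _ e2.
exists (maxn q q'), (fun x => s x + t x); split; first exact: bmfD.
 move=> x y xy; rewrite (fmeas_up (leq_maxl q q') fs xy).
 by rewrite (fmeas_up (leq_maxr q q') ft xy).
apply: (le_trans (y := \int[nu]_x (`|F x - s x| + `|G x - t x|))).
 apply: le_Rint; [| |move=> x].
 - by apply: bmf_abs; apply: bmfB; exact: bmfD.
 - by apply: bmfD; apply: bmf_abs; exact: bmfB.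
 - by rewrite opprD addrACA ler_normD.
rewrite RintD; [lra|by apply: bmf_abs; exact: bmfB|by apply: bmf_abs; exact: bmfB].
Qed.

Lemma dyadM F G : bmf F -> bmf G -> dyad F -> dyad G -> dyad (fun x => F x * G x).
Proof.
move=> bF bG dF dG e e0; have [C C0 hC] := bmf_ge0 bF.
have e1 : 0 < e / 2 / (C + 1) by rewrite !divr_gt0//; lra.
have [q' [t [bt ft ht]]] := dG _ e1; have [C' C'0 hC'] := bmf_ge0 bt.
have e2 : 0 < e / 2 / (C' + 1) by rewrite !divr_gt0//; lra.
have [q [s [bs fs hs]]] := dF _ e2.
exists (maxn q q'), (fun x => s x * t x); split; first exact: bmfM.
 move=> x y xy; rewrite (fmeas_up (leq_maxl q q') fs xy).
 by rewrite (fmeas_up (leq_maxr q q') ft xy).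
have b1 : bmf (fun x => `|F x - s x|) by apply: bmf_abs; exact: bmfB.
have b2 : bmf (fun x => `|G x - t x|) by apply: bmf_abs; exact: bmfB.
apply: (le_trans (y := \int[nu]_x ((C + 1) * `|G x - t x| + (C' + 1) * `|F x - s x|))).
 apply: le_Rint; [| |move=> x].
 - by apply: bmf_abs; apply: bmfB; exact: bmfM.
 - by apply: bmfD; exact: bmfZ.
 - have -> : F x * G x - s x * t x = F x * (G x - t x) + (F x - s x) * t x by ring.
  apply: (le_trans (ler_normD _ _)); rewrite !normrM [X in _ + X]mulrC; apply: lerD.
   by rewrite ler_wpM2r//; have := hC x; lra.
  by rewrite ler_wpM2r//; have := hC' x; lra.
rewrite RintD; [|exact: bmfZ|exact: bmfZ]; rewrite !RintZ//.
have h1 : (C + 1) * \int[nu]_x `|G x - t x| <= e / 2.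
 by rewrite mulrC -ler_pdivlMr//; lra.
have h2 : (C' + 1) * \int[nu]_x `|F x - s x| <= e / 2.
 by rewrite mulrC -ler_pdivlMr//; lra.
lra.
Qed.

Lemma dyad_cst c : dyad (fun=> c).
Proof.
move=> e e0; exists 0%N, (fun=> c); split=> //; first exact: bmf_cst.
by under eq_Rintegral do rewrite subrr normr0; rewrite Rint_cst ltW.
Qed.

Lemma dyad_lim (F : nat -> 'rV[R]_n -> R) G C : (forall k, bmf (F k)) ->
 (forall k x, `|F k x| <= C) -> (forall x, F k x @[k --> \oo] --> G x) ->
 (forall k, dyad (F k)) -> bmf G /\ dyad G.
Proof.
move=> bF hC FG dF.
have bG : bmf G.
 split; first by apply: (@measurable_fun_cvg _ _ _ setT F) => [k|x _]; [exact: bmf_mble|exact: FG].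
 exists C => x; have cn : `|F k x| @[k --> \oo] --> `|G x| by apply: cvg_norm; exact: FG.
 by apply: (@ler_cvg_to _ _ _ _ _ _ _ _ cn (cvg_cst C)); apply: nearW => k; exact: hC.
split=> // e e0; have e2 : 0 < e / 2 by rewrite divr_gt0.
have C0 : 0 <= C by apply: le_trans (hC 0%N 0).
have cv : \int[nu]_x `|F k x - G x| @[k --> \oo] --> \int[nu]_x (0 : R).
 apply: (@Rint_bounded_cvg _ _ _ nu (fun k x => `|F k x - G x|) (fun=> 0) (C + C)).
 - by move=> k; apply: bmf_mble; apply: bmf_abs; exact: bmfB.
 - move=> k x; rewrite normr_id (le_trans (ler_normB _ _))// lerD//.
  have cn : `|F k x| @[k --> \oo] --> `|G x| by apply: cvg_norm; exact: FG.
  by apply: (@ler_cvg_to _ _ _ _ _ _ _ _ cn (cvg_cst C)); apply: nearW => k'; exact: hC.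
 - move=> x; rewrite -(normr0 R) -(subrr (G x)); apply: cvg_norm; apply: cvgB; [exact: FG|exact: cvg_cst].
rewrite Rint_cst in cv; move/cvgrPdist_lt : cv => /(_ _ e2) [k _ /(_ k (leqnn k))] /=.
rewrite sub0r normrN => hk.
have [q [s [bs fs hs]]] := dF k _ e2; exists q, s; split=> //.
apply: (le_trans (y := \int[nu]_x (`|F k x - G x| + `|F k x - s x|))).
 apply: le_Rint; [| |move=> x].
 - by apply: bmf_abs; exact: bmfB.
 - by apply: bmfD; apply: bmf_abs; exact: bmfB.
 - have -> : G x - s x = - (F k x - G x) + (F k x - s x) by ring.
  by rewrite (le_trans (ler_normD _ _))// normrN.
rewrite RintD; [|by apply: bmf_abs; exact: bmfB|by apply: bmf_abs; exact: bmfB].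
by have := le_lt_trans (ler_norm _) hk; lra.
Qed.

Let K : set (set 'rV[R]_n) := [set A | measurable A /\ dyad (\1_A)].

Lemma dyad_setC A : K A -> K (~` A).
Proof.
move=> [mA dA]; split; first exact: measurableC.
have bA : bmf (\1_A : 'rV[R]_n -> R) by exact: bmf_indic.
have := dyadD (bmf_cst 1) (bmfZ (-1) bA) (@dyad_cst 1) (dyadM (bmf_cst (-1)) bA (@dyad_cst (-1)) dA).
rewrite (_ : (fun x => 1 + -1 * \1_A x) = \1_(~` A))//.
by apply/funext => x; rewrite !indicE in_setC; case: (x \in A) => /=; lra.
Qed.

Lemma dyad_setI A B : K A -> K B -> K (A `&` B).
Proof.
move=> [mA dA] [mB dB]; split; first exact: measurableI.
have := dyadM (bmf_indic mA) (bmf_indic mB) dA dB.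
rewrite (_ : (fun x => \1_A x * \1_B x) = \1_(A `&` B))//.
by apply/funext => x; rewrite indicI.
Qed.

Lemma dyad_bigcap (A : nat -> set 'rV[R]_n) : (forall i, K (A i)) -> K (\bigcap_i A i).
Proof.
move=> hA; split; first by apply: bigcapT_measurable => i; have [] := hA i.
pose B k := \big[setI/setT]_(i < k) A i.
have KB k : K (B k).
 rewrite /B; elim: k => [|k IH]; last by rewrite big_ord_recr /=; exact: dyad_setI.
 rewrite big_ord0; split=> //; rewrite (_ : \1_setT = fun=> 1); first exact: dyad_cst.
 by apply/funext => x; rewrite indicE in_setT.
have [] // := @dyad_lim (fun k => \1_(B k)) (\1_(\bigcap_i A i)) 1.
- by move=> k; apply: bmf_indic; have [] := KB k.
- by move=> k x; rewrite indicE; case: (_ \in _); rewrite ?normr1 ?normr0.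
- move=> x; have Bx k : B k x <-> forall i, (i < k)%N -> A i x.
  by rewrite /B -bigcap_mkord; split=> [h i ik|h i ik]; exact: h.
 have [h|h] := pselect ((\bigcap_i A i) x).
  rewrite indicE mem_set//; apply: cvg_near_cst; apply: nearW => k.
  by rewrite indicE mem_set//; apply/Bx => i _; exact: h.
 rewrite indicE memNset//; have [i hi] : exists i, ~ A i x.
  by apply/existsNP => h'; apply: h => i _; exact: h'.
 apply: cvg_near_cst; exists i.+1 => // k /= ik; rewrite indicE memNset//.
 by move=> /Bx /(_ i ik).
- by move=> k; have [] := KB k.
Qed.

Lemma dyad_ray (i : 'I_n) (c : R) : K [set x | x 0 i < c].
Proof.
have mr (b : R) : measurable [set x : 'rV[R]_n | x 0 i < b].
 have := @measurable_coord R n i measurableT `]-oo, b[%classic (measurable_itv _).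
 by rewrite setTI; congr measurable; apply/seteqP; split=> x /=; rewrite in_itv.
split; first exact: mr.
(* The largest multiple of 2^-k below c, for which the ray is a union of dyadic cells; these rays
   increase to the ray at c. *)
pose cc k : R := (Num.floor ((2 ^ k)%:R * c))%:~R / (2 ^ k)%:R.
have p2 k : (0 : R) < (2 ^ k)%:R by rewrite ltr0n expn_gt0.
have cle k : cc k <= c by rewrite ler_pdivrMr// mulrC floor_le_tmp.
have cgt k : c - (2 ^ k)%:R^-1 < cc k.
 rewrite ltr_pdivlMr// mulrBl mulVf ?gt_eqF// ltrBlDr mulrC.
 by have := floorD1_gt ((2 ^ k)%:R * c); rewrite intrD.
have [] // := @dyad_lim (fun k => \1_[set x : 'rV[R]_n | x 0 i < cc k]) (\1_[set x : 'rV[R]_n | x 0 i < c]) 1.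
- by move=> k; apply: bmf_indic.
- by move=> k x; rewrite indicE; case: (_ \in _); rewrite ?normr1 ?normr0.
- move=> x; rewrite !indicE; have [xc|xc] := ltP (x 0 i) c; last first.
  rewrite memNset /=; last by apply/negP; rewrite -leNgt.
  apply: cvg_near_cst; apply: nearW => k; rewrite indicE memNset//=.
  by apply/negP; rewrite -leNgt (le_trans (cle k)).
 rewrite mem_set//; apply: cvg_near_cst.
 pose k0 := Num.truncn ((c - x 0 i)^-1).
 exists k0.+1 => // k /= hk; rewrite indicE mem_set//=.
 apply: lt_trans (cgt k); rewrite ltrBrDl -ltrBrDr.
 have d0 : 0 < c - x 0 i by rewrite subr_gt0.
 rewrite -[X in _ < X]invrK ltf_pV2 ?posrE ?invr_gt0//.
 apply: (lt_le_trans (truncnS_gt _)); rewrite ler_nat (leq_trans hk)//.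
 by rewrite ltnW// ltn_expl.
- move=> k e e0; exists k, (\1_[set x : 'rV[R]_n | x 0 i < cc k]); split.
 + exact: bmf_indic.
 + move=> x y /rowP /(_ i); rewrite !mxE => h; rewrite !indicE.
  have hz (z : 'rV[R]_n) : (z 0 i < cc k) = (Num.floor ((2 ^ k)%:R * z 0 i) < Num.floor ((2 ^ k)%:R * c))%R.
   by rewrite ltr_pdivlMr// mulrC floor_lt_int.
  by congr (nat_of_bool _)%:R; apply/asbool_equiv_eq; rewrite /= !hz h.
 + by under eq_Rintegral do rewrite subrr normr0; rewrite Rint_cst ltW.
Qed.

(** Sets with approximable indicator form a sigma-algebra that contains the coordinate rays, hence
    all measurable sets. *)
Lemma dyad_measurable A : measurable A -> K A.
Proof.
have KT : K setT.
 split=> //; rewrite (_ : \1_setT = fun=> 1); first exact: dyad_cst.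
 by apply/funext => x; rewrite indicE in_setT.
have K0 : K set0 by rewrite -setCT; exact: dyad_setC.
have sig : sigma_algebra setT K.
 split=> //; first by move=> B KB; rewrite setTD; exact: dyad_setC.
 move=> F hF; rewrite -[X in K X]setCK setC_bigcup; apply: dyad_setC.
 by apply: dyad_bigcap => i; apply: dyad_setC.
move=> mA; apply: (@smallest_sub _ (sigma_algebra setT) _ K sig _ A mA).
rewrite -bigcup_seq => _ [i /= _ [C mC <-]].
pose K' : set (set R) := [set C | K (setT `&` (fun x : 'rV[R]_n => x 0 i) @^-1` C)].
have sig' : sigma_algebra setT K'.
 split.
 - by rewrite /K' /= preimage_set0 setI0.
 - by move=> B KB; rewrite /K' /= setTI setTD preimage_setC; apply: dyad_setC; rewrite /K' /= setTI in KB.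
 - move=> F hF; rewrite /K' /= setTI preimage_bigcup -[X in K X]setCK setC_bigcup; apply: dyad_setC.
  by apply: dyad_bigcap => k; apply: dyad_setC; have := hF k; rewrite /K' /= setTI.
have mC' : (@RGenInftyO.G R).-sigma.-measurable C by rewrite -RGenInftyO.measurableE.
apply: (@smallest_sub _ (sigma_algebra setT) _ K' sig' _ C mC') => _ [c ->].
by rewrite /K' /= setTI; have := dyad_ray i c; congr K.
Qed.

Lemma dyad_bmf F : bmf F -> dyad F.
Proof.
move=> bF; have [C C0 hC] := bmf_ge0 bF.
have hF x : 0 <= F x + C <= 2 * C by have := hC x; rewrite ler_norml; lra.
have bH : bmf (fun x => F x + C) by apply: bmfD => //; exact: bmf_cst.
have mH : mble (fun x => (F x + C)%:E).
 by apply/measurable_EFinP; exact: bmf_mble bH.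
pose S (k : nat) : 'rV[R]_n -> R := nnsfun_approx measurableT mH k.
have cS x : S k x @[k --> \oo] --> F x + C.
 apply: (@fine_cvg _ _ _ _ (fun k => (S k x)%:E)); apply: cvg_nnsfun_approx => // y _.
 by rewrite lee_fin; case/andP: (hF y).
have S0 k x : 0 <= S k x by [].
have SC k x : S k x <= 2 * C.
 apply: (@le_trans _ _ (F x + C)); last by case/andP: (hF x).
 rewrite -(cvg_lim _ (cS x))//; apply: nondecreasing_cvgn_le; last by apply/cvg_ex; exists (F x + C).
 by move=> i j ij; exact/lefP/(nd_nnsfun_approx measurableT mH).
have bS k : bmf (S k).
 by split; [exact: measurable_funP|exists (2 * C) => x; rewrite ger0_norm].
have dS k : dyad (S k).
 rewrite [S k](funext (fimfunEord (nnsfun_approx measurableT mH k))).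
 move: (finmap.enum_fset _) => s; rewrite -/(S k).
 have bI i : bmf (fun x => s`_i * \1_(S k @^-1` [set s`_i]) x : R).
  by apply: bmfZ; exact: bmf_indic.
 elim: (size s) => [|m IH]; first by under eq_fun do rewrite big_ord0; exact: dyad_cst.
 under eq_fun do rewrite big_ord_recr /=.
 apply: dyadD => //; first exact: bmf_sum.
 apply: dyadM; [exact: bmf_cst|exact: bmf_indic|exact: dyad_cst|].
 by have [] := @dyad_measurable _ (measurable_funPTI (nnsfun_approx measurableT mH k) (measurable_set1 s`_m)).
have [|_ dH] := @dyad_lim S (fun x => F x + C) (2 * C) bS _ cS dS.
 by move=> k x; rewrite ger0_norm.
have := dyadD bH (bmf_cst (- C)) dH (@dyad_cst (- C)).
by under eq_fun do rewrite addrK.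
Qed.

End dyadic_class.

(** * Bounded densities below an absolutely continuous measure *)

Section truncated_density.
Context {R : realType} {d : nat}.

Lemma rbox_exhaust (nu : fin_measure R d) (e : R) : 0 < e ->
 exists2 M : nat, (0 < M)%N & fine (nu setT) - e <= fine (nu (@rbox R M d)).
Proof.
move=> e0.
have c : nu (@rbox R n d) @[n --> \oo] --> nu (\bigcup_n @rbox R n d).
 apply: nondecreasing_cvg_mu => [i||].
 - exact: measurable_rbox.
 - by apply: bigcup_measurable => i _; exact: measurable_rbox.
 - move=> n m nm; apply/subsetPset => x hx i.
  have /andP[h1 h2] := hx i; have h : n%:R <= m%:R :> R by rewrite ler_nat.
  by apply/andP; split; [apply: le_trans h1; rewrite lerN2|apply: le_trans h].
have UT : \bigcup_n @rbox R n d = setT.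
 apply/seteqP; split=> // x _.
 exists (Num.truncn (\sum_i `|x 0 i|)).+1 => // i.
 rewrite -ler_norml; apply: (le_trans (y := \sum_i `|x 0 i|)).
  by rewrite (bigD1 i)//= lerDl sumr_ge0.
 exact/ltW/truncnS_gt.
rewrite UT in c.
have c' : fine (nu (@rbox R n d)) @[n --> \oo] --> fine (nu setT).
 by apply: fine_cvg; rewrite fineK// fin_num_measure.
have [N _ hN] := (cvgr_dist_le _ _ c') _ e0.
exists N.+1 => //; have := hN N.+1 (leqnSn _).
by rewrite ler_norml => /andP[_]; rewrite lerBlDr lerBlDl addrC.
Qed.

(** The measure is restricted to a large box and its density against the uniform law is capped; each
    of the two truncations loses at most e/2 of the mass. *)
Lemma truncated_density (nu : fin_measure R d) (e : R) : 0 < e ->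
 nu `<< lebesgue_rV R d -> exists (M : nat) (M0 : (0 < M)%N) (rho : 'rV[R]_d -> R),
 [/\ bmf rho, forall x, 0 <= rho x,
  forall F, bmf F -> (forall x, 0 <= F x) ->
   \int[unif_rV M0 d]_x (F x * rho x) <= \int[nu]_x F x
 & fine (nu setT) - e <= \int[unif_rV M0 d]_x rho x].
Proof.
move=> e0 hnu; have e20 : 0 < e / 2 by rewrite divr_gt0.
have [M M0 hM] := rbox_exhaust nu e20.
exists M, M0; set U := unif_rV M0 d.
have mD : measurable (@rbox R M d) by exact: measurable_rbox.
have fD : (nu (@rbox R M d) < +oo)%E by rewrite ltey_eq fin_num_measure.
pose nub := mfrestr mD fD : fin_measure R d.
have dom : nub `<< U.
 apply/null_content_dominatesP => A mA A0.
 have h := @unif_null R M M0 d A mA A0.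
 have /null_content_dominatesP dn := hnu.
 by apply: dn => //; apply: measurableI.
pose g := Radon_Nikodym_SigmaFinite.f nub U.
have g0 := Radon_Nikodym_SigmaFinite.f_ge0 dom.
have gf := Radon_Nikodym_SigmaFinite.f_fin_num dom.
have gi := Radon_Nikodym_SigmaFinite.f_integrable dom.
have mg : mble (fun x => fine (g x)).
 by apply: measurableT_comp => //; exact: measurable_int gi.
pose r (k : nat) x := Num.min (fine (g x)) k%:R.
have r0 k x : 0 <= r k x by rewrite /r le_min fine_ge0//=.
have mr k : mble (r k) by apply: measurable_minr.
have br k : bmf (r k).
 split => //; exists k%:R => x; rewrite ger0_norm//.
 by rewrite /r ge_min lexx orbT.
have rg k x : ((r k x)%:E <= g x)%E by rewrite -[g x]fineK// lee_fin /r ge_min lexx.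
have hc : (\int[U]_x (r k x)%:E @[k --> \oo] --> \int[U]_x g x)%E.
 rewrite (_ : (\int[U]_x g x = \int[U]_x (limn (fun k => (r k x)%:E)))%E); last first.
  apply: eq_integral => x _; apply/esym/cvg_lim => //.
  apply: cvg_near_cst; exists (Num.truncn (fine (g x))).+1 => // k /= hk.
  rewrite -[RHS]fineK//; congr EFin; rewrite /r; apply/min_idPl.
  by apply/ltW; apply: (lt_le_trans (truncnS_gt _)); rewrite ler_nat.
 apply: (@cvg_monotone_convergence _ _ _ U setT _ (fun k x => (r k x)%:E)) => //.
 - by move=> k; exact/measurable_EFinP.
 - by move=> k x _; rewrite lee_fin.
 - move=> x _ i j ij; rewrite lee_fin /r le_min ge_min lexx/= ge_min.
  by apply/orP; right; rewrite ler_nat.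
have gE : (\int[U]_x g x)%E = nu (@rbox R M d).
 rewrite -(Radon_Nikodym_SigmaFinite.f_integral dom)//.
 by congr (nu _); rewrite setTI.
have hc' : \int[U]_x r k x @[k --> \oo] --> fine (nu (@rbox R M d)).
 by apply: fine_cvg; rewrite fineK -?gE//; rewrite gE fin_num_measure.
have [N _ hN] := (cvgr_dist_le _ _ hc') _ e20.
exists (r N); split => //.
 move=> F bF F0; rewrite -lee_fin !EFin_Rint//; last exact: bmfM.
 apply: (le_trans (y := \int[nub]_x (F x)%:E)%E); last first.
  apply: ge0_le_measure_integral => //; last by apply/measurable_EFinP; exact: bmf_mble bF.
  by move=> S mS; apply: le_measure; rewrite ?inE//; apply: measurableI.
 rewrite -(Radon_Nikodym_SigmaFinite.change_of_variables dom)//; last first.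
  by apply/measurable_EFinP; exact: bmf_mble bF.
 apply: ge0_le_integral => //.
 - by move=> x _; rewrite lee_fin mulr_ge0.
 - by apply/measurable_EFinP; exact: bmf_mble (bmfM bF (br N)).
 - apply: emeasurable_funM; last exact: measurable_int gi.
  by apply/measurable_EFinP; exact: bmf_mble bF.
 - by move=> x _; rewrite EFinM; apply: lee_pmul => //; rewrite ?lee_fin.
have := hN N (leqnn _); rewrite ler_norml => /andP[_]; lra.
Qed.

End truncated_density.

(** * Domination of a multiple of the identity on a sparse grid *)

Section beta.
Context {R : realType} {G : setting} {d : nat}.

Lemma qf_weighted (nu : fin_measure R d) (b : 'rV[R]_d -> R)
  (s : seq (R * site R G d)) : bmf b ->
 qf (fun x y => \int[nu]_l (cosw (x - y) l * b l)) s s =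
 \int[nu]_l ((lin (@cosw R G d) s l ^+ 2 + lin (@sinw R G d) s l ^+ 2) * b l).
Proof.
move=> bb.
have b1 (x y : site R G d) : bmf (fun l => cosw (x - y) l * b l) by apply: bmfM => //; exact: bmf_cosw.
transitivity (\int[nu]_l (\sum_(p <- s) \sum_(q <- s) p.1 * q.1 * (cosw (p.2 - q.2) l * b l))).
 rewrite Rint_sum; last by move=> p; apply: bmf_sum => q; exact: bmfZ.
 apply: eq_bigr => p _; rewrite Rint_sum; last by move=> q; exact: bmfZ.
 by apply: eq_bigr => q _; rewrite RintZ.
apply: eq_Rintegral => l _.
rewrite !expr2 /lin !mulr_suml -big_split mulr_suml; apply: eq_bigr => p _.
rewrite !mulr_sumr -big_split mulr_suml; apply: eq_bigr => q _ /=.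
rewrite /cosw /sinw phaseB cosB; ring.
Qed.

(** Approximate the truncated density rho in mean by a step function s0 of mesh 2^-q. On the grid of
    spacing L = 2^q the spectral density s0 yields exactly a multiple of the identity, by
    [unif_trig0]. The correction [be] has spectral density b, so that rho + b >= s0; its mass is at
    most the error of approximation. *)
Lemma ac_beta (nu : fin_measure R d) (e : R) : 0 < e ->
 nu `<< lebesgue_rV R d -> exists (L : nat) (be : site R G d -> site R G d -> R),
 [/\ (0 < L)%N, forall x y, be x y = be y x, forall s, 0 <= qf be s s,
  forall x, be x x <= e
 & forall n (p : 'I_n -> 'I_d -> nat), (forall i j, p i =1 p j -> i = j) ->
  let g i : site R G d := gsite 1 (fun k => L * p i k)%N in
  forall s, (fine (nu setT) - e) * qf (fun i j : 'I_n => (i == j)%:R) s s <=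
   qf (fun i j => kcov nu (g i) (g j)) s s + qf (fun i j => be (g i) (g j)) s s].
Proof.
move=> e0 hnu; have e20 : 0 < e / 2 by rewrite divr_gt0.
have [M [M0 [rho [brho rho0 hrho rhoT]]]] := truncated_density e20 hnu.
set U := unif_rV M0 d in hrho rhoT.
have [q [s0 [bs fs hs]]] := dyad_bmf U brho e20.
(* The positive part of s0 - rho. *)
pose b x := 2^-1 * (`|rho x - s0 x| + (s0 x - rho x)).
have babs : bmf (fun x => `|rho x - s0 x|) by apply: bmf_abs; exact: bmfB.
have bb : bmf b by apply: bmfZ; apply: bmfD => //; exact: bmfB.
have b0 x : 0 <= b x.
 rewrite /b mulr_ge0//; have := ler_norm (rho x - s0 x); lra.
have bs0 x : s0 x <= rho x + b x.
 rewrite /b; have := ler_norm (s0 x - rho x); rewrite distrC; lra.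
have ble x : b x <= `|rho x - s0 x|.
 rewrite /b; have := ler_norm (s0 x - rho x); rewrite distrC; lra.
pose be (x y : site R G d) := \int[U]_l (cosw (x - y) l * b l).
have L0 : (0 < 2 ^ q)%N by rewrite expn_gt0.
have bP (t : seq (R * site R G d)) : bmf (fun l => lin (@cosw R G d) t l ^+ 2 + lin (@sinw R G d) t l ^+ 2).
 under eq_fun do rewrite !expr2.
 by apply: bmfD; apply: bmfM; apply: bmf_lin; [exact: bmf_cosw..|exact: bmf_sinw|exact: bmf_sinw].
have P0 (t : seq (R * site R G d)) l : 0 <= lin (@cosw R G d) t l ^+ 2 + lin (@sinw R G d) t l ^+ 2.
 by rewrite addr_ge0 ?sqr_ge0.
exists (2 ^ q)%N, be; split => //.
- move=> x y; apply: eq_Rintegral => l _; congr (_ * _).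
 by rewrite /cosw !phaseB -cosN opprB.
- move=> s; rewrite /be qf_weighted//; apply: Rintegral_ge0 => l _.
 by rewrite mulr_ge0.
- move=> x; apply: le_trans (le_trans hs _); last by lra.
 apply: le_Rint => //; first by apply: bmfM => //; exact: bmf_cosw.
 by move=> l; rewrite subrr /cosw phase0 cos0 mul1r.
move=> n p inj g s.
pose t := [seq (c.1, g c.2) | c <- s].
have tE S : qf (fun i j => S (g i) (g j)) s s = qf S t t.
 by rewrite /qf big_map; apply: eq_bigr => c _; rewrite big_map.
rewrite !tE qf_kcov_Rint /be qf_weighted//.
set W := fun l => _ + _ in bP P0 *.
have h1 := hrho _ (bP t) (P0 t).
apply: le_trans (lerD h1 (lexx _)).
have bPt := bP t; rewrite -RintD; [|exact: bmfM|exact: bmfM].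
apply: (le_trans (y := \int[U]_l ((lin (@cosw R G d) t l ^+ 2 + lin (@sinw R G d) t l ^+ 2) * s0 l))); last first.
 apply: le_Rint; [exact: bmfM|by apply: bmfD; exact: bmfM|].
 by move=> l; rewrite -mulrDr ler_wpM2l//; exact: P0.
rewrite -qf_weighted// -tE.
have dg i j : \int[U]_l (cosw (g i - g j) l * s0 l) = (i == j)%:R * \int[U]_l s0 l.
 case: eqVneq => [->|ij].
  by rewrite mul1r; apply: eq_Rintegral => l _; rewrite subrr /cosw phase0 cos0 mul1r.
 rewrite mul0r; pose jj : 'rV[int]_d := \row_k ((p i k)%:Z - (p j k)%:Z).
 have jj0 : jj != 0.
  apply: contra_neq ij => /rowP h; apply: inj => k.
  by have := h k; rewrite !mxE => /eqP; rewrite subr_eq0 => /eqP[].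
 have := unif_trig0 M0 0 L0 jj0 bs fs => h; apply: etrans h.
 apply: eq_Rintegral => l _; rewrite mulrC add0r; congr (_ * cos _).
 rewrite phaseB !phase_gsite// -sumrB mulr_sumr; apply: eq_bigr => k _.
 rewrite mxE intrB !natrM -!pmulrn mul1r; ring.
have -> : qf (fun i j => \int[U]_l (cosw (g i - g j) l * s0 l)) s s =
 (\int[U]_l s0 l) * qf (fun i j : 'I_n => (i == j)%:R) s s.
 rewrite /qf mulr_sumr; apply: eq_bigr => c _; rewrite mulr_sumr; apply: eq_bigr => c' _.
 by rewrite dg; ring.
apply: ler_wpM2r.
 have -> : qf (fun i j : 'I_n => (i == j)%:R : R) s s = \sum_(i < n) (lin (fun (k : 'I_n) (_ : unit) => (k == i)%:R) s tt) ^+ 2.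
  under [in RHS]eq_bigr do rewrite expr2 /lin mulr_suml.
  rewrite exchange_big; apply: eq_bigr => c _.
  under [in RHS]eq_bigr do rewrite mulr_sumr.
  rewrite exchange_big; apply: eq_bigr => c' _ /=.
  rewrite (bigD1 c.2)//= eqxx mulr1 big1 ?addr0; last first.
   by move=> i /negPf ni; rewrite eq_sym ni mulr0 mul0r.
  by rewrite eq_sym mulrA.
 by apply: sumr_ge0 => i _; exact: sqr_ge0.
have h3 : \int[U]_l rho l <= \int[U]_l s0 l + \int[U]_l `|rho l - s0 l|.
 rewrite -RintD//; apply: le_Rint => //; first exact: bmfD.
 by move=> l; have := ler_norm (rho l - s0 l); lra.
lra.
Qed.

End beta.

(** * Powers, cosines and the Cauchy-Schwarz inequality in R^d *)

Section powers.
Context {R : realType}.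

Lemma powR_large (C c : R) : 0 < c -> exists2 T0, 1 <= T0 & forall T, T0 <= T -> C <= T `^ c.
Proof.
move=> c0; exists (Num.max 1 (Num.max C 1 `^ c^-1)); first by rewrite le_max lexx.
move=> T; rewrite ge_max => /andP[T1 hT].
have C1 : 0 < Num.max C 1 by rewrite lt_max ltr01 orbT.
apply: (le_trans (y := Num.max C 1)); first by rewrite le_max lexx.
have -> : Num.max C 1 = (Num.max C 1 `^ c^-1) `^ c.
 by rewrite -powRrM mulVf ?gt_eqF// powRr1// ltW.
by apply: ge0_ler_powR; rewrite ?nnegrE ?powR_ge0//; lra.
Qed.

Lemma cos_ge_half (t : R) : `|t| <= pi / 4 -> 1 / 2 <= cos t.
Proof.
rewrite ler_norml => /andP[t1 t2]; have p0 := pi_gt0 R.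
have c0 : 0 <= cos t by apply: cos_ge0_pihalf; apply/andP; split; lra.
have c2 : 0 <= cos (t *+ 2).
 by apply: cos_ge0_pihalf; rewrite -mulr_natr; apply/andP; split; lra.
rewrite cos_mulr2n -mulr_natr in c2; nra.
Qed.

Lemma edot_CS d (x y : 'rV[R]_d) : `|edot x y| <= enorm x * enorm y.
Proof.
have sq0 (z : 'rV[R]_d) : 0 <= \sum_i z 0 i ^+ 2 by apply: sumr_ge0 => i _; exact: sqr_ge0.
rewrite /enorm -sqrtrM// -sqrtr_sqr ler_wsqrtr//; apply: disc_le; first exact: sq0.
move=> t; rewrite /edot !mulr_sumr -sumrB -big_split /=; apply: sumr_ge0 => i _.
by have := sqr_ge0 (x 0 i - t * y 0 i); lra.
Qed.

End powers.

Section spectral_hypotheses.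
Context {R : realType} (G : setting) {d : nat}.
Variable mu : fin_measure R d.

Definition doubling := exists2 c : R, 0 < c & forall r : R, 0 < r ->
 (mu (freq_ball G 0 (2 * r)) <= c%:E * mu (freq_ball G 0 r))%E.

Definition origin_dominance := exists2 c : R, 0 < c & forall r : R, 0 < r ->
 (ereal_sup [set mu (freq_ball G u r) | u in [set: 'rV[R]_d]] <= c%:E * mu (freq_ball G 0 r))%E.

Definition local_dimension (alpha : R) :=
 (lne (mu (freq_ball G 0 r)) * ((ln r)^-1)%:E)%E @[r --> 0^'+] --> alpha%:E.

End spectral_hypotheses.

(** * Energy of balls compared with spectral mass near the origin *)

Section scaling.
Context {R : realType} {G : setting} {d : nat}.
Variable mu : fin_measure R d.
Notation J n := {ffun 'I_d -> 'I_n}.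

Definition mub (r : R) : R := fine (mu (freq_ball G 0 r)).
Definition kapT (T : R) : R := kap mu (site_ball (G := G) (d := d) T).

Lemma mub_ge0 r : 0 <= mub r. Proof. exact: fine_ge0. Qed.

Lemma le_mub u r r' : r <= r' -> fine (mu (freq_ball G u r)) <= fine (mu (freq_ball G u r')).
Proof.
move=> rr; apply: fine_le; rewrite ?fin_num_measure//; try exact: measurable_freq_ball.
apply: le_measure; rewrite ?inE; try exact: measurable_freq_ball.
by move=> l; rewrite /freq_ball /= => /le_trans; apply.
Qed.

Lemma site_ball_nonempty T : 0 <= T -> site_ball (R := R) (G := G) (d := d) T !=set0.
Proof.
move=> T0; exists 0; rewrite /site_ball /= pos0 /enorm big1 ?sqrtr0// => i _.
by rewrite mxE expr0n.
Qed.

Lemma sub_site_ball T T' : T <= T' -> site_ball (R := R) (G := G) (d := d) T `<=` site_ball T'.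
Proof. by move=> TT x; rewrite /site_ball /= => /le_trans; apply. Qed.
Lemma kapT_mono T T' : 0 <= T -> T <= T' -> kapT T' <= kapT T.
Proof. by move=> T0 TT; apply: kap_mono; [exact: sub_site_ball|exact: site_ball_nonempty]. Qed.

Lemma kapT_le0 T : 0 <= T -> kapT T <= kern mu (0 : site R G d).
Proof.
move=> T0; have := kap_le mu (@cvx1 R G d (site_ball T) 0 _).
by rewrite /en qf1 !mul1r /kcov subrr; apply; rewrite /site_ball /= pos0 /enorm big1 ?sqrtr0// => i _;
 rewrite mxE expr0n.
Qed.

(** For |l| <= 1/(8T) and |x| <= T the phase 2 pi <l, x> is at most pi/4 in modulus, so its cosine
    is at least 1/2; the transform of any probability measure on the ball has squared modulus at
    least 1/4 there. *)
Lemma kap_lower T : 0 < T -> mub (8 * T)^-1 / 4 <= kapT T.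
Proof.
move=> T0; apply: kap_ge; first by apply: site_ball_nonempty; exact: ltW.
move=> v [v1 v2]; pose A : set 'rV[R]_d := freq_ball G 0 (8 * T)^-1.
have mA : measurable A by exact: measurable_freq_ball.
rewrite /en qf_kcov_Rint /mub -/A -(Rint_indic mu mA) mulrC -RintZ; last exact: bmf_indic.
have bc := bmf_lin v (@bmf_cosw R G d); have bs := bmf_lin v (@bmf_sinw R G d).
apply: le_Rint.
- by apply: bmfZ; exact: bmf_indic.
- by under eq_fun do rewrite !expr2; apply: bmfD; apply: bmfM.
move=> l; have [Al|Al] := pselect (A l); last first.
 by rewrite indicE memNset// mulr0 addr_ge0 ?sqr_ge0.
rewrite indicE mem_set// mulr1; apply: (le_trans (y := lin (@cosw R G d) v l ^+ 2)); last first.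
 by rewrite lerDl sqr_ge0.
have h : 1 / 2 <= lin (@cosw R G d) v l.
 rewrite -[leLHS]mul1r -[X in X * _]v2 mulr_suml /lin !big_seq; apply: ler_sum => p /v1[p0 pD].
 rewrite ler_wpM2l//; have [<- _] := trig_repr p.2 l; apply: cos_ge_half.
 rewrite /phase normrM ger0_norm; last by rewrite mulr_ge0 ?pi_ge0.
 have := edot_CS (freq_repr G l) (pos p.2); move: Al; rewrite /A /freq_ball /= subr0.
 move: pD; rewrite /site_ball /=.
 set a := enorm (pos _); set b := enorm (freq_repr _ _) => aT bT hab.
 have b0 : 0 <= b by exact: sqrtr_ge0.
 have : b * a <= (8 * T)^-1 * T by apply: ler_pM => //; exact: sqrtr_ge0.
 rewrite invfM -mulrA mulVf ?gt_eqF// mulr1 => h2.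
 by have := pi_gt0 R; have := le_trans hab h2; nra.
by rewrite (_ : 4^-1 = (1 / 2) ^+ 2 :> R); [rewrite ler_pXn2r ?nnegrE//; lra|field].
Qed.

Hypotheses (h4 : doubling G mu)
 (h5 : origin_dominance G mu).

Lemma mub_doubling (A : R) : exists2 C, 0 < C & forall r, 0 < r -> mub (A * r) <= C * mub r.
Proof.
have [c c0 hc] := h4.
have it k r : 0 < r -> mub (2 ^+ k * r) <= c ^+ k * mub r.
 move=> r0; elim: k => [|k IH]; first by rewrite !expr0 !mul1r.
 have rk : 0 < 2 ^+ k * r by rewrite mulr_gt0// exprn_gt0.
 rewrite !exprS -!mulrA; apply: (le_trans (y := c * mub (2 ^+ k * r))); last by rewrite ler_wpM2l// ltW.
 have := hc _ rk; rewrite -lee_fin EFinM !fineK//; rewrite fin_num_measure//; exact: measurable_freq_ball.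
have [k hk] : exists k : nat, A <= 2 ^+ k.
 exists (Num.truncn `|A|).+1; apply: (le_trans (ler_norm _)); apply: (le_trans (ltW (truncnS_gt _))).
 by rewrite -natrX ler_nat ltnW// ltn_expl.
exists (c ^+ k); first exact: exprn_gt0.
by move=> r r0; apply: le_trans (it k r r0); apply: le_mub; rewrite ler_wpM2r// ltW.
Qed.

Lemma mub_origin : exists2 C, 0 < C & forall u r, 0 < r -> fine (mu (freq_ball G u r)) <= C * mub r.
Proof.
have [c c0 hc] := h5; exists c => // u r r0.
have fin v : mu (freq_ball G v r) \is a fin_num by rewrite fin_num_measure//; exact: measurable_freq_ball.
rewrite -lee_fin EFinM !fineK//; apply: le_trans (hc r r0).
by apply: ereal_sup_ubound; exists u.
Qed.

Lemma fine_setC (A : set 'rV[R]_d) : measurable A -> fine (mu (~` A)) = fine (mu setT) - fine (mu A).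
Proof.
move=> mA; have mC : measurable (~` A) by exact: measurableC.
have : mu (A `|` ~` A) = (mu A + mu (~` A))%E.
 by apply: measureU => //; rewrite setICr.
rewrite setUv => ->; rewrite fineD ?fin_num_measure//; lra.
Qed.

Hypothesis mub_gt0 : forall r, 0 < r -> 0 < mub r.

(** An instance of [sieve_var] with frequency balls of radius comparable to 1/T, moved to the origin
    by origin dominance and resized by doubling. For Euclidean fields [chi] is a box missing mass at
    most [mub] of 1/T, and the mesh is small enough to separate the peaks of the Dirichlet kernel on
    it; on the torus [chi] is everything. *)
Lemma sieve_mub : exists2 C, 0 < C & forall T, 0 < T -> exists2 de0, 0 < de0 &
 forall de, 0 < de -> (G = Lattice -> de = 1) -> (G = Euclidean -> de <= de0) ->
 forall n, (0 < n)%N -> T <= de * n%:R ->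
 forall (w : J n -> R) A (x0 : site R G d), (forall j, `|w j| <= A / n%:R ^+ d) ->
 en mu [seq (w j, x0 + gs de j) | j <- enum {: J n}] <= C * A ^+ 2 * mub T^-1.
Proof.
have [c5 c50 hc5] := mub_origin; have [c4 c40 hc4] := mub_doubling (Num.sqrt d%:R + 1).
(* Here 96 = 24 * 4, the 4 coming from N = 2n; the added 1 pays for the mass outside [chi]. *)
exists (2 * 96 ^+ d * (c5 * c4) + 1).
 by rewrite ltr_wpDl// !mulr_ge0// ?exprn_ge0// ltW.
move=> T T0; have iT : 0 < T^-1 by rewrite invr_gt0.
have [M M0 hM] := rbox_exhaust mu (mub_gt0 iT).
have M0R : 0 < M%:R :> R by rewrite ltr0n.
exists (4 * M%:R)^-1; first by rewrite invr_gt0 mulr_gt0.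
move=> de de0 deG deE n n0 Tn w A x0 hw.
have nd : 0 < n%:R ^+ d :> R by rewrite exprn_gt0// ltr0n.
pose chi : set 'rV[R]_d := if G is Euclidean then @rbox R M d else setT.
have mchi : measurable chi by rewrite /chi; case: (G) => //; exact: measurable_rbox.
have chiE l l' : chi l -> chi l' -> forall i, `|de * freq_repr G (l' - l) 0 i| <= 1 / 2.
 rewrite /chi; case: (G) deG deE => [_ /(_ erefl) hde|/(_ erefl) -> _] => [hl hl' i|_ _ i].
  rewrite /= !mxE normrM gtr0_norm//.
  have /andP[a1 a2] := hl i; have /andP[b1 b2] := hl' i.
  have h : `|l' 0 i - l 0 i| <= 2 * M%:R by rewrite ler_norml; apply/andP; split; lra.
  apply: (le_trans (ler_pM (ltW de0) (normr_ge0 _) hde h)).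
  by rewrite (_ : (4 * M%:R)^-1 * (2 * M%:R) = 1 / 2 :> R)//; field; rewrite gt_eqF.
 rewrite mul1r /freq_repr mxE; set y := (l' - l) 0 i.
 have := floor_le_tmp (y + 2^-1); have := floorD1_gt (y + 2^-1); rewrite intrD.
 move: (Num.floor _)%:~R => z h1 h2; rewrite ler_norml; apply/andP; split; lra.
have chi0 : fine (mu (~` chi)) <= mub T^-1.
 rewrite /chi; case: (G); last by rewrite setCT measure0 mub_ge0.
 by rewrite fine_setC; [lra|exact: measurable_rbox].
have hB u : fine (mu (freq_ball G u (Num.sqrt d%:R * (de * (n + n)%:R)^-1))) <= c5 * c4 * mub T^-1.
 apply: (le_trans (y := fine (mu (freq_ball G u ((Num.sqrt d%:R + 1) * T^-1))))).
  apply: le_mub; apply: ler_pM; rewrite ?sqrtr_ge0 ?lerDl//.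
   by rewrite invr_ge0 mulr_ge0// ltW.
  rewrite lef_pV2 ?posrE//; last by rewrite mulr_gt0// ltr0n addn_gt0 n0.
  by apply: (le_trans Tn); rewrite ler_wpM2l ?ltW// ltr_nat -addn1 leq_add2l.
 apply: (le_trans (hc5 _ _ _)); first by rewrite mulr_gt0// ltr_wpDl// sqrtr_ge0.
 by rewrite -mulrA (ler_wpM2l (ltW c50))// hc4.
apply: (le_trans (sieve_var de0 deG x0 n0 hw mchi chiE hB)).
have -> : ((n + n) ^ 2)%:R ^+ d * 24 ^+ d * (c5 * c4 * mub T^-1) = 96 ^+ d * (n%:R ^+ d) ^+ 2 * (c5 * c4 * mub T^-1) :> R.
 by congr (_ * _); rewrite natrX natrD [in RHS]exprAC -!exprMn; congr (_ ^+ d); ring.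
have -> : n%:R ^+ d * (A / n%:R ^+ d) = A by field; rewrite gt_eqF.
have -> : 2 * (A / n%:R ^+ d) ^+ 2 * (96 ^+ d * (n%:R ^+ d) ^+ 2 * (c5 * c4 * mub T^-1)) =
 2 * 96 ^+ d * (c5 * c4) * A ^+ 2 * mub T^-1 by field; rewrite gt_eqF.
rewrite [(_ + 1) * _]mulrDl mul1r [leRHS]mulrDl lerD2l; apply: ler_wpM2l => //; exact: sqr_ge0.
Qed.

Hypothesis d0 : (0 < d)%N.

(** The test measure is uniform on a grid in a cube of side X = T/d, contained in the ball because
    sqrt d * X <= T. *)
Lemma kap_upper : exists2 C, 0 < C & forall T, 4 * d%:R <= T -> kapT T <= C * mub T^-1.
Proof.
have [C C0 hC] := sieve_mub; have [c4 c40 hc4] := mub_doubling (4 * d%:R).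
exists (C * c4); first exact: mulr_gt0.
move=> T hT; have dR : 0 < d%:R :> R by rewrite ltr0n.
have T0 : 0 < T by apply: lt_le_trans hT; rewrite mulr_gt0.
pose X := T / d%:R; have X4 : 4 <= X by rewrite /X ler_pdivlMr.
have T'0 : 0 < T / (4 * d%:R) by rewrite divr_gt0// mulr_gt0.
have [de0 de00 h] := hC _ T'0.
have [de [de_0 deG deE deX]] : exists de : R, [/\ 0 < de, G = Lattice -> de = 1, G = Euclidean -> de <= de0 & de <= X / 2].
 case: (G); [exists (Num.min de0 (X / 2))|exists 1]; split => //; try lra.
 - by rewrite lt_min de00/=; lra.
 - by rewrite ge_min lexx.
 - by rewrite ge_min lexx orbT.
pose n := Num.truncn (X / de).
have n1 : de * n%:R <= X by rewrite mulrC -ler_pdivlMr// truncn_le// divr_ge0 ?ltW//; lra.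
have n2 : X / 2 <= de * n%:R.
 have : X < de * n.+1%:R by rewrite mulrC -ltr_pdivrMr// truncnS_gt.
 by rewrite -natr1 mulrDr mulr1; lra.
have n0 : (0 < n)%N.
 by rewrite lt0n; apply/eqP => e; move: n2; rewrite e mulr0; lra.
have nR : 0 < n%:R ^+ d :> R by rewrite exprn_gt0// ltr0n.
have hTn : T / (4 * d%:R) <= de * n%:R.
 by apply: le_trans n2; rewrite invfM mulrCA mulrC -/X; lra.
pose w (j : J n) : R := 1 / n%:R ^+ d.
have hw j : `|w j| <= 1 / n%:R ^+ d by rewrite ger0_norm// divr_ge0// ltW.
have := h de de_0 deG deE n n0 hTn w 1 0 hw; rewrite expr1n mulr1 => hen.
have hv : cvx (site_ball T) [seq (w j, (0 : site R G d) + gs de j) | j <- enum {: J n}].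
 split; last first.
  rewrite big_map big_enum /= sumr_const card_ffun !card_ord /w -[LHS]mulr_natr natrX.
  by field; rewrite gt_eqF.
 move=> p /mapP[j _ ->] /=; split; first by rewrite divr_ge0// ltW.
 rewrite /site_ball /= add0r pos_gsite//.
 apply: (le_trans (y := Num.sqrt d%:R * X)).
  apply: enorm_le; first lra.
  move=> i; rewrite mxE ger0_norm; last by rewrite mulr_ge0// ltW.
  by apply: le_trans n1; rewrite ler_pM2l// ler_nat ltnW.
 have -> : T = d%:R * X by rewrite /X mulrC divfK ?gt_eqF.
 rewrite ler_wpM2r//; first lra.
 have -> : d%:R = Num.sqrt (d%:R ^+ 2) :> R by rewrite sqrtr_sqr ger0_norm.
 rewrite sqrtr_sqr ger0_norm// -[X in _ <= X](ger0_norm (ltW dR)) -sqrtr_sqr ler_wsqrtr//.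
 by rewrite -natrX ler_nat expnS expn1 leq_pmulr.
apply: (le_trans (kap_le mu hv)); apply: (le_trans hen).
rewrite -mulrA (ler_wpM2l (ltW C0))//; have := hc4 T^-1; rewrite invr_gt0 => /(_ T0).
by rewrite invf_div.
Qed.

End scaling.

(** * Power laws for spectral mass and capacity *)

Section power_law.
Context {R : realType} {G : setting} {d : nat}.
Variable mu : fin_measure R d.
Variable alpha : R.
Hypotheses (h1 : local_dimension G mu alpha)
 (h4 : doubling G mu)
 (h5 : origin_dominance G mu)
 (d0 : (0 < d)%N).
Notation mb := (@mub R G d mu).
Notation kp := (@kapT R G d mu).

(** Positivity comes with the limit: a null ball would make the logarithmic quotient infinite,
    against its being finite near 0. *)
Lemma mub_power c : 0 < c -> exists2 r0, 0 < r0 < 1 & forall r, 0 < r -> r < r0 ->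
 0 < mb r /\ r `^ (alpha + c) <= mb r <= r `^ (alpha - c).
Proof.
move=> c0.
have /fine_cvgP[[e1 /= e10 he1] hc] := h1.
have [e2 /= e20 he2] := (cvgr_dist_le _ _ hc) _ c0.
exists (Num.min (1 / 2) (Num.min e1 e2)).
 by rewrite !lt_min e10 e20 !andbT/= gt_min; apply/andP; split; [lra|apply/orP; left; lra].
move=> r r0; rewrite !lt_min => /andP[r1 /andP[re1 re2]].
have b e : r < e -> ball (0 : R) e r by rewrite /ball /= sub0r normrN gtr0_norm.
have fn := he1 r (b _ re1) r0; have hd := he2 r (b _ re2) r0; rewrite /= in hd.
have lr : ln r < 0 by rewrite ln_lt0// r0/=; lra.
have il : (ln r)^-1 < 0 by rewrite invr_lt0.
have mfin : mu (freq_ball G 0 r) \is a fin_num by rewrite fin_num_measure//; exact: measurable_freq_ball.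
have mE : mu (freq_ball G 0 r) = (mb r)%:E by rewrite /mub fineK.
have m0 : 0 < mb r.
 rewrite lt_neqAle mub_ge0 andbT eq_sym; apply/eqP => e; move: fn.
 by rewrite mE e le0_lneNy// muleC lt0_muleNy// lte_fin.
split=> //; move: hd; rewrite mE lne_EFin//=.
have -> : ln (mb r) = (ln (mb r) / ln r) * ln r by rewrite divfK// lt_eqF.
rewrite mulfK ?lt_eqF// => hd; move: hd; rewrite ler_norml => /andP[hd1 hd2].
have -> : mb r = expR ((ln (mb r) / ln r) * ln r) by rewrite divfK ?lt_eqF// lnK.
rewrite /powR gt_eqF//.
by rewrite !ler_expR !ler_nM2r//; apply/andP; split; lra.
Qed.

Lemma mub_gt0 r : 0 < r -> 0 < mb r.
Proof.
move=> r0; have [r1 /andP[r10 _] h] := mub_power ltr01.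
have [h2 _] : 0 < mb (Num.min r (r1 / 2)) /\ true.
 split=> //; have [] // := h (Num.min r (r1 / 2)).
  by rewrite lt_min r0/=; lra.
 by rewrite gt_min; apply/orP; right; lra.
by apply: (lt_le_trans h2); apply: le_mub; rewrite ge_min lexx.
Qed.

Lemma kapT_gt0 T : 0 < T -> 0 < kp T.
Proof.
move=> T0; apply: (lt_le_trans _ (kap_lower mu T0)).
by rewrite divr_gt0// mub_gt0// invr_gt0 mulr_gt0.
Qed.

Lemma kap_lower_mub : exists2 C, 0 < C & forall T, 0 < T -> mb T^-1 <= C * kp T.
Proof.
have [c c0 hc] := mub_doubling h4 8; exists (4 * c); first by rewrite mulr_gt0.
move=> T T0; have := kap_lower (G := G) mu T0.
have := hc (8 * T)^-1; rewrite invr_gt0 mulr_gt0// => /(_ isT).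
have -> : 8 * (8 * T)^-1 = T^-1 by field; rewrite gt_eqF.
by move: (mb _) (mb _) (kp _) => x y z; nra.
Qed.

Lemma kap_power c : 0 < c -> exists2 T0, 1 <= T0 & forall T, T0 <= T ->
 T `^ (alpha - c) <= (kp T)^-1 <= T `^ (alpha + c).
Proof.
move=> c0; have c20 : 0 < c / 2 by rewrite divr_gt0.
have [r0 /andP[r00 r01] hr] := mub_power c20.
have [C1 C10 hC1] := kap_upper h4 h5 mub_gt0 d0.
have [C2 C20 hC2] := kap_lower_mub.
have [T1 T11 hT1] := powR_large (Num.max C1 C2) c20.
exists (Num.max T1 (Num.max (2 / r0) (4 * d%:R))); first by rewrite le_max T11.
move=> T; rewrite !ge_max => /andP[hT1T /andP[hrT hdT]].
have := hT1 _ hT1T; rewrite ge_max => /andP[C1T C2T].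
have T0 : 0 < T by lra.
have iT : 0 < T^-1 by rewrite invr_gt0.
have iTr : T^-1 < r0.
 rewrite -[r0]invrK ltf_pV2 ?posrE ?invr_gt0//; apply: lt_le_trans hrT.
 by rewrite mulrC ltr_pMr ?invr_gt0//; lra.
have [m0 /andP[m1 m2]] := hr _ iT iTr.
have k0 := kapT_gt0 T0.
have pV a : T^-1 `^ a = T `^ (- a) by rewrite -powR_inv1 ?ltW// -powRrM mulN1r.
rewrite !pV in m1 m2.
have P0 a : 0 < T `^ a by exact: powR_gt0.
apply/andP; split.
 rewrite -[leLHS]invrK lef_pV2 ?posrE ?invr_gt0// -powRN.
 apply: (le_trans (hC1 _ hdT)).
 apply: (le_trans (ler_pM (ltW C10) (mub_ge0 _ _) C1T m2)).
 by rewrite -powRD ?(gt_eqF T0) ?implybT//; apply: ler_powR; [lra|lra].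
rewrite -[leRHS]invrK lef_pV2 ?posrE ?invr_gt0// -powRN.
rewrite -(ler_pM2l C20); apply: (le_trans _ (hC2 _ T0)); apply: le_trans m1.
apply: (le_trans (ler_wpM2r (ltW (P0 _)) C2T)).
by rewrite -powRD ?(gt_eqF T0) ?implybT//; apply: ler_powR; [lra|lra].
Qed.

End power_law.

(** * The equilibrium potential tested against finite combinations *)

Section potential.
Context {R : realType} {G : setting} {d : nat}.
Variable mu : fin_measure R d.
Hypothesis h_im : forall x : site R G d, \int[mu]_l sinw x l = 0.

(** The third clause compares kap * h with the potential of a near minimiser v, with an error that
    vanishes as en(v) tends to kap. The fourth is boundedness of evaluations in the Cameron-Martin
    space and yields the continuity of h. *)
Lemma potential (D : set (site R G d)) : D !=set0 -> 0 < kap mu D ->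
 let h := equilibrium_potential mu D in
 [/\ capacity mu D = ((kap mu D)^-1)%:E, forall x, D x -> 1 <= h x,
  forall v w, cvx D v ->
   (kap mu D * (\sum_(q <- w) q.1 * h q.2) - qf (kcov mu) w v) ^+ 2 <=
   en mu w * (en mu v - kap mu D)
 & forall w, (\sum_(q <- w) q.1 * h q.2) ^+ 2 <= en mu w / kap mu D].
Proof.
move=> D0 k0 h; have [u [su u1 u2 u3 [u4 u5]]] := equilibrium D0 h_im k0.
have uw w : ip2 mu u (gpair w) = kap mu D * (\sum_(q <- w) q.1 * h q.2).
 rewrite ip2_gpair// mulr_sumr; apply: eq_bigr => q _.
 by rewrite /h u5; field; rewrite gt_eqF.
split=> //.
- move=> x Dx; rewrite /h u5 ler_pdivlMr// mul1r; apply: u3; exact: cvx1.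
- move=> v w hv; rewrite -uw qf_ip2 (ip2C _ (gpair w)).
 have -> : ip2 mu u (gpair w) - ip2 mu (gpair v) (gpair w) = ip2 mu (lc 1 u (-1) (gpair v)) (gpair w).
  by rewrite ip2_lcl//; [ring|exact: sqi2_gpair|exact: sqi2_gpair].
 apply: (le_trans (ip2_CS (sqi2_lc 1 (-1) su (sqi2_gpair mu v)) (sqi2_gpair mu w))).
 rewrite mulrC -qf_ip2; apply: ler_wpM2l; [exact: en_ge0|exact: u1].
- move=> w; rewrite ler_pdivlMr// -(ler_pM2l k0).
 have := ip2_CS su (sqi2_gpair mu w); rewrite uw u2 -qf_ip2 -/(en mu w).
 by rewrite exprMn; move: (\sum_(q <- w) _) => z; lra.
Qed.

End potential.

(** * Regularity of the capacity under shrinking of the ball *)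

Section shrink.
Context {R : realType} {G : setting} {d : nat} {dO : measure_display}
 {Omega : measurableType dO} (P : probability Omega R)
 (f : site R G d -> {RV P >-> R}) (mu : fin_measure R d).
Hypotheses (hmu : is_spectral_measure f mu).

Lemma sin_int (x : site R G d) : \int[mu]_l sinw x l = 0.
Proof.
have := spectral_fourier hmu x; rewrite /fourier /cintegral => -[_ h].
have : \int[mu]_l (- 1 * sinw x l) = 0.
 rewrite [RHS]h; apply: eq_Rintegral => l _; rewrite /cis /= mulr1 mulr0 add0r sinN.
 by rewrite /sinw /phase mulN1r.
by rewrite RintZ; [lra|exact: bmf_sinw].
Qed.

Hypothesis kap0 : forall T, 0 < T -> 0 < kapT (G := G) mu T.
Hypothesis h3 : forall e : R, 0 < e ->
 fine (capacity mu (site_ball (G := G) (d := d) (T + T `^ (1 - e)))) /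
  fine (capacity mu (site_ball (G := G) (d := d) T)) @[T --> +oo] --> (1 : R).

(** The hypothesis on capacities is applied at T = S - (S/2)^(1-e). Since T >= S/2, the enlarged
    radius T + T^(1-e) is at least S. *)
Lemma kap_shrink e eta : 0 < e < 1 -> 0 < eta -> exists2 S0, 2 <= S0 & forall S, S0 <= S ->
 (S / 2) `^ (1 - e) <= S / 2 /\ kapT (G := G) mu (S - (S / 2) `^ (1 - e)) <= (1 + eta) * kapT (G := G) mu S.
Proof.
move=> /andP[e0 e1] eta0.
have /(cvgr_dist_le _ _)/(_ _ eta0)[A [_ hA]] := h3 e0.
exists (Num.max 2 (2 * (A + 1))); first by rewrite le_max lexx.
move=> S; rewrite ge_max => /andP[S2 SA].
have S1 : 1 <= S / 2 by lra.
have hs : (S / 2) `^ (1 - e) <= S / 2.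
 apply: (le_trans (y := (S / 2) `^ 1)); first by apply: ler_powR; lra.
 by rewrite powRr1//; lra.
split=> //; set T := S - _; have T2 : S / 2 <= T by rewrite /T; lra.
have AT : A < T by lra.
have T0 : 0 < T by lra.
have TP : 0 < T + T `^ (1 - e) by rewrite ltr_wpDr// powR_ge0.
have := hA T AT; rewrite /=.
have cE r : 0 < r -> fine (capacity mu (site_ball (G := G) (d := d) r)) = (kapT (G := G) mu r)^-1.
 move=> r0; have [-> _ _ _] := potential sin_int (site_ball_nonempty (ltW r0)) (kap0 r0); by [].
rewrite !cE// invrK ler_norml => /andP[+ _].
have k1 := kap0 T0; have k2 := kap0 TP.
have ST : S <= T + T `^ (1 - e).
 have : (S / 2) `^ (1 - e) <= T `^ (1 - e) by apply: ge0_ler_powR; rewrite ?nnegrE; lra.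
 by rewrite {2}/T; lra.
have k3 : kapT (G := G) mu (T + T `^ (1 - e)) <= kapT (G := G) mu S by apply: kapT_mono => //; lra.
rewrite lerBrDl -lerBrDr opprK => h.
have : kapT (G := G) mu T <= (1 + eta) * kapT (G := G) mu (T + T `^ (1 - e)).
 by rewrite -ler_pdivrMr// mulrC; lra.
by move/le_trans; apply; rewrite ler_wpM2l//; lra.
Qed.

End shrink.

(** * Finite sets of atoms *)

Section atoms.
Context {R : realType} {d : nat}.
Implicit Types (x : 'rV[R]_d) (s : seq 'rV[R]_d).

Lemma measurable_point x : measurable [set x].
Proof.
have -> : [set x] = \bigcap_(i : 'I_d) ((fun y : 'rV[R]_d => y 0 i) @^-1` [set x 0 i]).
 apply/seteqP; split=> [y -> i _//|y h].
 by apply/rowP => i; exact: h i I.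
apply: fin_bigcap_measurable => // i _.
by rewrite -[X in measurable X]setTI; apply: measurable_coord.
Qed.

Lemma set_seq_cons x s : [set` x :: s] = [set x] `|` [set` s].
Proof.
by apply/seteqP; split=> y /=; rewrite inE; [case/predU1P; [left|right]|case=> [->|->]; rewrite ?eqxx ?orbT].
Qed.

Lemma measurable_seq s : measurable [set` s].
Proof.
elim: s => [|x s IH]; first by rewrite set_nil.
by rewrite set_seq_cons; apply: measurableU => //; exact: measurable_point.
Qed.

Lemma Rint_seq (mu : fin_measure R d) (F : 'rV[R]_d -> R) s : uniq s -> bmf F ->
 \int[mu]_l (F l * \1_[set` s] l) = \sum_(a <- s) fine (mu [set a]) * F a.
Proof.
move=> + bF; elim: s => [_|a s IH /= /andP[nas us]].
 rewrite big_nil set_nil -[RHS](mul0r (fine (mu setT))) -Rintegral_cst//.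
 by apply: eq_Rintegral => l _; rewrite indic0 mulr0.
rewrite big_cons -IH//; have ma := measurable_point a.
rewrite mulrC -(Rint_indic mu ma) -RintZ; last exact: bmf_indic.
rewrite -RintD; [|by apply: bmfZ; exact: bmf_indic|by apply: bmfM => //; apply: bmf_indic; exact: measurable_seq].
apply: eq_Rintegral => l _; rewrite !indicE set_seq_cons in_setU /=.
have -> : (l \in [set a]) = (l == a) by apply/idP/eqP => [|->]; rewrite inE.
have -> : (l \in [set` s]) = (l \in s) by apply/idP/idP; rewrite inE.
case: eqVneq => [->|_]/=; first by rewrite (negPf nas) !mulr1 mulr0 addr0.
by rewrite mulr0 add0r.
Qed.

Lemma atoms (nu : fin_measure R d) (C : set 'rV[R]_d) (e : R) :
 countable C -> nu (~` C) = 0%E -> 0 < e ->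
 exists2 s, uniq s & fine (nu (~` [set` s])) <= e.
Proof.
move=> /countable_injP[g gi] C0 e0.
pose a k := xget 0 [set x | C x /\ g x = k].
pose s n := undup [seq a k | k <- iota 0 n].
have sE n x : (x \in s n) <-> exists2 k, (k < n)%N & x = a k.
 by rewrite mem_undup; split=> [/mapP[k]|[k kn ->]]; [rewrite mem_iota => kn ->; exists k|
  apply/mapP; exists k => //; rewrite mem_iota].
pose F n := [set` s n] : set 'rV[R]_d.
have c : nu (F n) @[n --> \oo] --> nu (\bigcup_n F n).
 apply: nondecreasing_cvg_mu => [i||].
 - exact: measurable_seq.
 - by apply: bigcup_measurable => i _; exact: measurable_seq.
 - move=> n m nm; apply/subsetPset => x /= /sE[k kn ->]; apply/sE; exists k => //.
  exact: leq_trans nm.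
have mU : measurable (\bigcup_n F n) by apply: bigcup_measurable => i _; exact: measurable_seq.
have CU : C `<=` \bigcup_n F n.
 move=> x Cx; exists (g x).+1 => //; apply/sE; exists (g x) => //.
 have : [set y | C y /\ g y = g x] (a (g x)) by apply: xgetPex; exists x.
 by move=> [h1 h2]; apply: gi; rewrite ?inE.
have mC : measurable C.
 have -> : C = \bigcup_(k in [set k | exists2 x, C x & g x = k]) [set a k].
  apply/seteqP; split=> [x Cx|_ [k [x Cx gx] ->]].
   exists (g x); first by exists x.
   have : [set y | C y /\ g y = g x] (a (g x)) by apply: xgetPex; exists x.
   by move=> [h1 h2]; apply: gi; rewrite ?inE.
  have : [set y | C y /\ g y = k] (a k) by apply: xgetPex; exists x.
  by case.
 by apply: bigcup_measurable => k _; exact: measurable_point.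
have U0 : fine (nu (\bigcup_n F n)) = fine (nu setT).
 have h : nu (~` (\bigcup_n F n)) = 0%E.
  apply/le_anti; rewrite measure_ge0 andbT -C0; apply: le_measure; rewrite ?inE; [exact: measurableC|exact: measurableC|].
  exact: subsetC.
 by have := fine_setC nu mU; rewrite h /=; lra.
have c' : fine (nu (F n)) @[n --> \oo] --> fine (nu setT).
 by apply: fine_cvg; rewrite -U0 fineK// fin_num_measure.
have [N _ hN] := (cvgr_dist_le _ _ c') _ e0.
exists (s N); first exact: undup_uniq.
have mN : measurable [set` s N] by exact: measurable_seq.
rewrite fine_setC//; have := hN N (leqnn _); rewrite ler_norml => /andP[_]; exact.
Qed.

End atoms.

Section lebesgue_points.
Context {R : realType} {d : nat}.
Implicit Types (x : 'rV[R]_d) (s : seq 'rV[R]_d).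

Lemma lebesgue_point x : (0 < d)%N -> lebesgue_rV R d [set x] = 0%E.
Proof.
case: d x => // n x _.
pose B := @rV_cons R n @^-1` [set x].
have mc : mble (@rV_cons R n) by exact: measurable_rV_cons.
have mB : measurable B by have := mc measurableT _ (measurable_point x); rewrite setTI.
have -> : lebesgue_rV R n.+1 [set x] = (\int[lebesgue_rV R n]_y lebesgue_measure (xsection B y))%E by [].
rewrite -[RHS](integral0 (lebesgue_rV R n) setT); apply: eq_integral => y _.
apply/le_anti; rewrite measure_ge0 andbT.
have h : (lebesgue_measure (xsection B y) <= lebesgue_measure [set x 0%R ord0])%E.
 apply: le_measure; rewrite ?inE; [exact: measurable_xsection|exact: measurable_set1|].
 move=> t; rewrite /xsection /= inE /B /= => <-.
 by rewrite /rV_cons mxE unlift_none.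
rewrite lebesgue_measure_set1 in h; exact: h.
Qed.

Lemma lebesgue_seq s : (0 < d)%N -> lebesgue_rV R d [set` s] = 0%E.
Proof.
move=> d0; elim: s => [|x s IH]; first by rewrite set_nil measure0.
rewrite set_seq_cons; apply/le_anti; rewrite measure_ge0 andbT.
have := measureU2 (lebesgue_rV R d) (measurable_point x) (measurable_seq s).
move/le_trans; apply; rewrite (_ : (_ + _)%E = (0 + 0)%E) ?adde0//.
by rewrite -[RHS]adde0; congr (_ + _)%E; [exact: lebesgue_point|exact: IH].
Qed.

End lebesgue_points.

(** * Splitting off finitely many atoms *)

Section discrete_split.
Context {R : realType} {G : setting} {d : nat}.
Variables (mu mu_ac mu_d mu_sc : fin_measure R d).
Hypotheses (hdec : is_lebesgue_decomposition mu mu_ac mu_d mu_sc)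
 (h2 : mu_ac setT <> 0%E /\ mu_sc setT = 0%E)
 (d0 : (0 < d)%N).

Lemma ac_mass_gt0 : 0 < fine (mu_ac setT).
Proof.
rewrite lt_neqAle fine_ge0// andbT eq_sym; apply/eqP => e; apply: h2.1.
by rewrite -[LHS]fineK ?e// fin_num_measure.
Qed.

(** Finitely many atoms carry all but e of the discrete part. Each of them contributes a cosine and
    a sine, scaled by the root of its mass, to u; S1 is the kernel of mu off these atoms. A finite
    set is Lebesgue null, so the whole absolutely continuous mass stays in S1, whose variance is
    then between m and m + e. *)
Lemma discrete_split e : 0 < e -> exists (K : nat) (u : 'I_K -> site R G d -> R)
  (S1 : site R G d -> site R G d -> R) (M : R),
 [/\ forall x y, kcov mu x y = S1 x y + \sum_k u k x * u k y,
   forall x y, S1 x y = S1 y x, forall s, 0 <= qf S1 s s,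
   forall x, 0 < S1 x x <= fine (mu_ac setT) + e
  & 0 <= M /\ forall k x, `|u k x| <= M].
Proof.
move=> e0; have [C cC C0] := decomposition_discrete hdec.
have [s us hs] := atoms cC C0 e0; set A := [set` s] in hs.
have mA : measurable A by exact: measurable_seq.
have mCA : measurable (~` A) by exact: measurableC.
pose n := size s; pose at_ (k : 'I_n) : 'rV[R]_d := nth 0 s k.
pose q k := Num.sqrt (fine (mu [set at_ k])).
pose u (k : 'I_(n + n)) (x : site R G d) : R := match fintype.split k with
 | inl i => q i * cosw x (at_ i) | inr i => q i * sinw x (at_ i) end.
pose S1 (x y : site R G d) := \int[mu]_l (cosw (x - y) l * \1_(~` A) l).
have q2 k : q k * q k = fine (mu [set at_ k]) by rewrite -expr2 sqr_sqrtr// fine_ge0.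
have q0 k : 0 <= q k by exact: sqrtr_ge0.
have bx (B : set 'rV[R]_d) : measurable B -> bmf (\1_B : 'rV[R]_d -> R) by exact: bmf_indic.
have S1xx x : S1 x x = fine (mu (~` A)).
 rewrite -Rint_indic//; apply: eq_Rintegral => l _.
 by rewrite subrr /cosw phase0 cos0 mul1r.
have fin (nu : fin_measure R d) : nu (~` A) \is a fin_num by exact: fin_num_measure.
have muE : fine (mu (~` A)) = fine (mu_ac (~` A)) + fine (mu_d (~` A)).
 rewrite (decomposition_sum hdec)// (_ : mu_sc (~` A) = 0%E) ?adde0 ?fineD//.
 by apply/le_anti; rewrite measure_ge0 andbT -(h2.2) le_measure// ?inE.
have acE : fine (mu_ac (~` A)) = fine (mu_ac setT).
 rewrite fine_setC// (_ : mu_ac A = 0%E) ?subr0//.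
 have /null_content_dominatesP dn := decomposition_ac hdec.
 by apply: dn => //; exact: lebesgue_seq.
exists (n + n)%N, u, S1, (1 + \sum_k q k); split.
- move=> x y; rewrite big_split_ord /= /S1.
 have -> : \sum_(i < n) u (lshift n i) x * u (lshift n i) y + \sum_(i < n) u (rshift n i) x * u (rshift n i) y =
   \sum_(a <- s) fine (mu [set a]) * cosw (x - y) a.
  rewrite -big_split (big_nth 0) big_mkord; apply: eq_bigr => i _.
  have ul z : u (lshift n i) z = q i * cosw z (at_ i) by rewrite /u -[lshift n i]/(unsplit (inl i)) unsplitK.
  have ur z : u (rshift n i) z = q i * sinw z (at_ i) by rewrite /u -[rshift n i]/(unsplit (inr i)) unsplitK.
  rewrite /= !ul !ur -q2 /cosw /sinw phaseB cosB /at_; ring.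
 rewrite -(Rint_seq mu us (bmf_cosw (x - y))) -RintD; [|by apply: bmfM; [exact: bmf_cosw|exact: bx]..].
 apply: eq_Rintegral => l _; rewrite -mulrDr !indicE in_setC.
 by case: (l \in A); rewrite /= ?add0r ?addr0 mulr1.
- move=> x y; apply: eq_Rintegral => l _; congr (_ * _).
 by rewrite /cosw !phaseB -cosN opprB.
- move=> t; rewrite qf_weighted; last exact: bx.
 by apply: Rintegral_ge0 => l _; rewrite mulr_ge0 ?indicE// addr_ge0 ?sqr_ge0.
- move=> x; rewrite S1xx muE acE lerD2l hs andbT ltr_pwDl ?fine_ge0//.
 exact: ac_mass_gt0.
- split; first by rewrite addr_ge0// sumr_ge0.
 have h i t : `|t| <= 1 -> `|q i * t| <= 1 + \sum_k q k.
  move=> t1; rewrite normrM ger0_norm//; apply: (le_trans (ler_wpM2l (q0 i) t1)).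
  by rewrite mulr1 (bigD1 i)//= addrCA lerDl addr_ge0// sumr_ge0.
 move=> k x; rewrite /u; case: (fintype.split k) => i; apply: h.
  exact: cos_max.
 exact: sin_max.
Qed.

End discrete_split.

Section strips_seq.
Context {R : realType} {A : eqType} {d} {T : measurableType d} (P : probability T R) (K : nat).
Variables (X : A -> T -> R) (S S1 : A -> A -> R) (u : 'I_K -> A -> R).
Hypotheses (gX : gproc P X S)
 (SE : forall i j, S i j = S1 i j + \sum_k u k i * u k j)
 (S1C : forall i j, S1 i j = S1 j i)
 (S1psd : forall s, 0 <= qf S1 s s).

(** Transfers [lb_strips] to an arbitrary index type: only finitely many indices occur, and they are
    numbered by their position in [all0]. *)
Lemma lb_strips_seq (a0 : A) (ss : seq (seq (R * A) * R)) (pts : seq A) (v M L k : R) :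
 (forall i, 0 < S1 i i <= v) -> (forall j i, `|u j i| <= M) -> 0 <= M -> 0 <= L -> 0 <= k ->
 0 <= 1 - 2 * expR (- (L ^+ 2 / (2 * v))) -> 0 <= 1 - 2 * expR (- (k ^+ 2 / (2 * 1))) ->
 fine (P (bands X ss)) *
  ((1 - 2 * expR (- (L ^+ 2 / (2 * v)))) ^+ size pts *
  (1 - 2 * expR (- (k ^+ 2 / (2 * 1)))) ^+ K) <=
 fine (P (bands X (ss ++ [seq ([:: (1, i)], L + K%:R * (M * k)) | i <- pts]))).
Proof.
move=> S1v uM M0 L0 k0 pL pk.
pose all0 := a0 :: (flatten [seq [seq p.2 | p <- q.1] | q <- ss] ++ pts).
pose n := size all0.
have n0 : (index a0 all0 < n)%N by rewrite index_mem inE eqxx.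
pose g (i : 'I_n) := nth a0 all0 i.
pose inv a : 'I_n := insubd (Ordinal n0) (index a all0).
have gK a : a \in all0 -> g (inv a) = a.
 by move=> ha; rewrite /g val_insubd index_mem ha nth_index.
pose tr (q : seq (R * A) * R) : seq (R * 'I_n) * R := ([seq (p.1, inv p.2) | p <- q.1], q.2).
have gXg := gproc_reindex gX g.
have trE (q : seq (R * A) * R) w : {subset [seq p.2 | p <- q.1] <= all0} ->
  lin (fun i => X (g i)) (tr q).1 w = lin X q.1 w.
 move=> h; rewrite /lin big_map; apply: eq_big_seq => p pq /=.
 by rewrite gK// h//; apply: map_f.
have evE qs : (forall q, q \in qs -> {subset [seq p.2 | p <- q.1] <= all0}) ->
  bands (fun i => X (g i)) (map tr qs) = bands X qs.
 move=> h; apply/funext => w; rewrite /bands /= all_map; congr is_true.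
 by apply: eq_in_all => q hq /=; rewrite trE//; exact: h.
have ssub q : q \in ss -> {subset [seq p.2 | p <- q.1] <= all0}.
 move=> hq a ha; rewrite inE mem_cat; apply/orP; right; apply/orP; left.
 by apply/flattenP; exists [seq p.2 | p <- q.1] => //; apply/mapP; exists q.
have psub a : a \in pts -> a \in all0 by move=> h; rewrite inE mem_cat h !orbT.
have := @lb_strips R _ T P n K (fun i => X (g i)) (fun i j => S (g i) (g j))
 (fun i j => S1 (g i) (g j)) (fun j i => u j (g i)) gXg.
have hS s : 0 <= qf (fun i j => S1 (g i) (g j)) s s.
 rewrite (_ : qf _ s s = qf S1 [seq (p.1, g p.2) | p <- s] [seq (p.1, g p.2) | p <- s])//.
 by rewrite /qf big_map; apply: eq_bigr => c _; rewrite big_map.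
move=> /(_ (fun i j => SE (g i) (g j)) (fun i j => S1C (g i) (g j)) hS).
move=> /(_ (map tr ss) (map inv pts) v M L k (fun i => S1v (g i)) (fun j i => uM j (g i)) M0 L0 k0 pL pk).
rewrite size_map evE// => /le_trans; apply.
rewrite le_eqVlt; apply/orP; left; apply/eqP; congr (fine (P _)).
rewrite -evE; last first.
 move=> q; rewrite mem_cat => /orP[/ssub//|/mapP[a ha ->] b].
 by rewrite mem_seq1 => /eqP ->; exact: psub.
by rewrite map_cat -!map_comp.
Qed.

End strips_seq.

(** * Cells of a grid of sites *)

Section cells.
Context {R : realType} {G : setting} {d : nat}.
Implicit Types (x y : site R G d).

Definition in_cell (h : R) y := forall i, 0 <= pos y 0 i < h.

(** The lower corner of the cell of mesh h containing x; on the lattice h = 1 and cells are single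
    sites. *)
Definition cellof (h : R) x : site R G d :=
 match G as G0 return site R G0 d -> site R G0 d with
 | Euclidean => fun z : 'rV[R]_d => \row_i (h * (Num.floor (z 0 i / h))%:~R)
 | Lattice => fun z => z
 end x.

Lemma in_cell_lattice y : G = Lattice -> in_cell 1 y -> y = 0.
Proof.
rewrite /in_cell; case: G y => // y _ h; apply/rowP => i; have := h i; rewrite /pos !mxE ler0z ltrz1.
by move: (y 0 i : int) => z; lia.
Qed.

Lemma in_cellof h x : 0 < h -> (G = Lattice -> h = 1) -> in_cell h (x - cellof h x).
Proof.
move=> h0 hG i; rewrite posB /cellof; case: G x hG => [|] x hG /=.
 rewrite !mxE; have := floor_le_tmp (x 0 i / h); have := floorD1_gt (x 0 i / h).
 rewrite intrD; move: (Num.floor _)%:~R => z; rewrite ltr_pdivrMr// ler_pdivlMr// => h1 h2.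
 by apply/andP; split; lra.
by rewrite !mxE subrr lexx h0.
Qed.

Definition cell_site (h : R) (N : nat) (k : {ffun 'I_d -> 'I_(N + N).+1}) : site R G d :=
 match G return site R G d with
 | Euclidean => \row_i (h * ((k i)%:Z - N%:Z)%:~R)
 | Lattice => \row_i ((k i)%:Z - N%:Z)
 end.

Lemma cell_siteP h N x : 0 < h -> (G = Lattice -> h = 1) ->
 (forall i, `|pos x 0 i| <= N%:R * h) -> exists k, cellof h x = @cell_site h N k.
Proof.
move=> h0 hG hx.
have hk i : - N%:Z <= Num.floor (pos x 0 i / h) <= N%:Z.
 have := hx i; rewrite ler_norml => /andP[h1 h2].
 rewrite floor_ge_int_tmp -[X in _ && X]ltzD1 floor_lt_int; apply/andP; split.
  by rewrite ler_pdivlMr// intrN mulNr.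
 rewrite ltr_pdivrMr// intrD mulrDl mul1r; apply: (le_lt_trans h2).
 by rewrite ltrDl.
pose fl (i : 'I_d) : int := Num.floor (pos x 0 i / h).
have kb i : (`|(fl i + N%:Z)%R| < (N + N).+1)%N by have := hk i; rewrite -/(fl i); lia.
exists [ffun i => Ordinal (kb i)].
rewrite /cellof /cell_site; rewrite /fl {fl} in kb *; case: G x hx hk kb hG => x hx hk kb hG; apply/rowP => i; rewrite !mxE ffunE /=.
 by congr (_ * _%:~R); have := hk i => /=; move: (Num.floor _) => z; lia.
have := hk i; rewrite /= mxE (hG erefl) divr1 intrKfloor; lia.
Qed.

Lemma cell_count h N (F : seq (site R G d)) : 0 < h -> (G = Lattice -> h = 1) ->
 (forall x, x \in F -> forall i, `|pos x 0 i| <= N%:R * h) ->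
 (size (undup (map (cellof h) F)) <= (N + N).+1 ^ d)%N.
Proof.
move=> h0 hG hF.
have -> : ((N + N).+1 ^ d)%N = size [seq @cell_site h N k | k <- enum {: {ffun 'I_d -> 'I_(N + N).+1}}].
 by rewrite size_map -cardE card_ffun !card_ord.
apply: uniq_leq_size; first exact: undup_uniq.
move=> c; rewrite mem_undup => /mapP[x xF ->].
by have [k ->] := cell_siteP h0 hG (hF x xF); apply: map_f; rewrite mem_enum.
Qed.

Lemma continuous_cell (g : site R G d -> R) s : G = Euclidean -> continuous_field g -> 0 < s ->
 exists2 e, 0 < e & forall y, in_cell e y -> `|g y - g 0| <= s.
Proof.
rewrite /in_cell; case: G g => // g _ /= cg s0.
have /(cvgr_dist_le _ _)/(_ _ s0) := cg 0; rewrite nearE => /nbhs_ballP[e /= e0 he].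
exists e => // y hy; rewrite distrC; apply: he; split=> // i j.
rewrite ord1 /ball/= !mxE sub0r normrN; have /andP[y0 ye] := hy j.
by rewrite ger0_norm.
Qed.

End cells.

Lemma two_strips {R : realType} (a b p q : R) : `|a| <= p -> `|b - a| <= q -> - (q + p) <= b.
Proof. by rewrite !ler_norml => /andP[a1 _] /andP[b1 _]; lra. Qed.

(** * Oscillation in cells and the absence of low values *)

Section oscillation.
Context {R : realType} {G : setting} {d : nat} {dO : measure_display}
 {Omega : measurableType dO} (P : probability Omega R)
 (f : site R G d -> {RV P >-> R}) (mu : fin_measure R d).
Hypotheses (hf : is_sgf f) (hmu : is_spectral_measure f mu).
Let X (x : site R G d) (w : Omega) : R := f x w.
Let gX : gproc P X (kcov mu). Proof. exact: gproc_field hf hmu. Qed.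

Lemma shift_law cs (c : site R G d) :
 fine (P (polyh X cs)) = fine (P (polyh (fun x => X (x + c)) cs)).
Proof.
apply: (gproc_law _ gX (gproc_reindex gX (fun x => x + c))) => s.
by apply: eq_qf => x y; rewrite kcovDr.
Qed.

Let ostrip (F : seq (site R G d)) := [seq [:: (1 : R, y); (-1, 0)] | y <- F].

Lemma small_osc s : 0 < s -> exists h, [/\ 0 < h, (G = Lattice -> h = 1)
 & forall F : seq (site R G d), (forall y, y \in F -> in_cell h y) ->
  3 / 4 <= fine (P (bands X (norm_strip (ostrip F) s)))].
Proof.
move=> s0; have linE y w : lin X [:: (1, y); (-1, 0)] w = X y w - X 0 w.
 by rewrite /lin big_cons big_seq1 /= mul1r mulN1r.
have GE : G = Lattice \/ G = Euclidean by case: (G); [right|left].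
have [GL|GE'] := GE.
 exists 1; split=> // F hF.
 rewrite (_ : bands _ _ = setT).
  by rewrite (_ : P setT = 1%E) ?probability_setT//=; lra.
 apply/seteqP; split=> // w _; rewrite /bands /= /norm_strip /ostrip -map_comp all_map.
 apply/allP => y /hF /(in_cell_lattice GL) -> /=.
 by rewrite linE subrr normr0 ltW.
apply: contrapT => H.
have Hn n : exists F : seq (site R G d), (forall y, y \in F -> in_cell n.+1%:R^-1 y) /\
  fine (P (bands X (norm_strip (ostrip F) s))) < 3 / 4.
 apply: contrapT => H2; apply: H; exists n.+1%:R^-1; split=> //; first by rewrite GE'.
 move=> F hF; rewrite leNgt; apply/negP => h; apply: H2; by exists F.
have [F hF] := choice Hn.
(* The failure events; the limsup is used because they need not be monotone in n. *)
pose B n := ~` bands X (norm_strip (ostrip (F n)) s).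
have mB n : measurable (B n) by apply: measurableC; exact: mstrip gX _.
have B4 n : 1 / 4 <= fine (P (B n)).
 rewrite /B fineP_setC; last exact: mstrip gX _.
 by have [_] := hF n; lra.
have c := lim_sup_set_cvg P B mB.
have c' : fine (P (\bigcup_(k >= n) B k)) @[n --> \oo] --> fine (P (lim_sup_set B)).
 apply: fine_cvg; rewrite fineK; first apply: c; last first.
  rewrite fin_num_measure//; apply: bigcap_measurable => // i _.
  by apply: bigcup_measurable => j _; exact: mB.
 by rewrite ltey_eq fin_num_measure//; apply: bigcup_measurable => j _; exact: mB.
have h4 : 1 / 4 <= fine (P (lim_sup_set B)).
 apply: (ler_cvg_to (@cvg_cst _ (1 / 4 : R) _ \oo _) c'); apply: nearW => n; apply: (le_trans (B4 n)).
 apply: le_fineP => //; first by apply: bigcup_measurable => j _; exact: mB.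
 by move=> w Bw; exists n => //=.
have [w hw] : lim_sup_set B !=set0.
 apply/set0P/negP => /eqP e; move: h4; rewrite e measure0 /=; lra.
have [e e0 he] := continuous_cell GE' (sgf_continuous hf w) s0.
have [j /= hj] := hw (Num.truncn e^-1).+1 I; apply.
rewrite /bands /= /norm_strip /ostrip -map_comp all_map.
apply/allP => y yF /=; rewrite linE; apply: he => i.
have [/(_ _ yF i) /andP[y0 y1] _] := hF j; rewrite y0/=; apply: (lt_le_trans y1).
rewrite -[leRHS]invrK lef_pV2 ?posrE ?invr_gt0//; apply: (le_trans (ltW (truncnS_gt _))).
by rewrite ler_nat (leq_trans hj).
Qed.

Variables (h s : R).
Hypotheses (h0 : 0 < h) (hG : G = Lattice -> h = 1) (s0 : 0 < s).
Hypothesis hs : forall F : seq (site R G d), (forall y, y \in F -> in_cell h y) ->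
  3 / 4 <= fine (P (bands X (norm_strip [seq [:: (1 : R, y); (-1, 0)] | y <- F] s))).

Definition cell_strips (F : seq (site R G d)) (tau : R) : seq (seq (R * site R G d) * R) :=
 [seq ([:: (1, x); (-1, cellof h x)], tau) | x <- F].

(** Stationarity moves each cell to the origin, Fernique's bound applies there, and a union bound
    runs over the cells. *)
Lemma osc_all (F : seq (site R G d)) N tau : 4 * s <= tau ->
 (forall x, x \in F -> forall i, `|pos x 0 i| <= N%:R * h) ->
 1 - ((N + N).+1 ^ d)%:R * expR (- (tau ^+ 2 / (48 * s ^+ 2))) <=
 fine (P (bands X (cell_strips F tau))).
Proof.
move=> st hF; set cs := undup (map (cellof h) F).
pose Fc c := [seq x <- F | cellof h x == c].
pose sc c := norm_strip [seq [:: (1 : R, x); (-1, c)] | x <- Fc c] tau.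
pose A c := ~` bands X (sc c).
have mA c : measurable (A c) by apply: measurableC; exact: mstrip gX _.
have hA c : fine (P (A c)) <= expR (- (tau ^+ 2 / (48 * s ^+ 2))).
 rewrite /A fineP_setC; last exact: mstrip gX _.
 pose F' := [seq x - c | x <- Fc c].
 have hF' y : y \in F' -> in_cell h y.
  move=> /mapP[x]; rewrite mem_filter => /andP[/eqP <- _] ->; exact: in_cellof.
 have := fernique gX s0 st (hs hF'); rewrite strip_poly (shift_law _ c) -strip_poly.
 congr (1 - fine (P _) <= _); apply/funext => w; rewrite /bands /sc /norm_strip /F' /=.
 rewrite -!map_comp !all_map; congr is_true; apply: eq_all => x /=.
 by rewrite /lin !big_cons !big_nil /= subrK add0r.
have mB : measurable (\big[setU/set0]_(c <- cs) A c).
 by elim/big_rec: _ => [|c B _ mB]; [exact: measurable0|exact: measurableU].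
apply: (le_trans (y := 1 - (size cs)%:R * expR (- (tau ^+ 2 / (48 * s ^+ 2))))).
 rewrite lerD2l lerN2 ler_wpM2r ?expR_ge0// ler_nat; exact: cell_count.
apply: (le_trans (y := fine (P (~` (\big[setU/set0]_(c <- cs) A c))))).
 by rewrite fineP_setC// lerD2l lerN2; exact: fineP_bigU.
apply: le_fineP; [exact: measurableC|exact: mstrip gX _|].
move=> w; rewrite -bigcup_seq => hw; rewrite /bands /cell_strips /= all_map.
apply/allP => x xF /=; have [hx|hx] := pselect (bands X (sc (cellof h x)) w).
 move: hx; rewrite /bands /sc /norm_strip /= !all_map => /allP; apply.
 by rewrite mem_filter eqxx.
exfalso; apply: hw; exists (cellof h x) => //=; rewrite mem_undup; exact: map_f.
Qed.

(** Each site is compared with the corner of its cell: the oscillation bands enter [lb_strips_seq]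
    as the given strips, and the corners, at most (2N+1)^d of them, as the new points. *)
Lemma nolow K (u : 'I_K -> site R G d -> R) S1 v M F N tau L k :
 (forall i j, kcov mu i j = S1 i j + \sum_k u k i * u k j) ->
 (forall i j, S1 i j = S1 j i) -> (forall s, 0 <= qf S1 s s) ->
 (forall i, 0 < S1 i i <= v) -> (forall j i, `|u j i| <= M) -> 0 <= M -> 0 <= L -> 0 <= k ->
 0 <= 1 - 2 * expR (- (L ^+ 2 / (2 * v))) -> 0 <= 1 - 2 * expR (- (k ^+ 2 / (2 * 1))) ->
 4 * s <= tau -> (forall x, x \in F -> forall i, `|pos x 0 i| <= N%:R * h) ->
 (1 - ((N + N).+1 ^ d)%:R * expR (- (tau ^+ 2 / (48 * s ^+ 2)))) *
  ((1 - 2 * expR (- (L ^+ 2 / (2 * v)))) ^+ ((N + N).+1 ^ d)%N *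
  (1 - 2 * expR (- (k ^+ 2 / (2 * 1)))) ^+ K) <=
 fine (P (pts_event X F (- (tau + (L + K%:R * (M * k)))))).
Proof.
move=> SE S1C S1p S1v uM M0 L0 k0 pL0 pk0 st hF.
pose pts := undup (map (cellof h) F).
have := lb_strips_seq gX SE S1C S1p (0 : site R G d) (cell_strips F tau) pts S1v uM M0 L0 k0 pL0 pk0.
set pL := 1 - 2 * _ in pL0 *; set pk := 1 - 2 * _ in pk0 *.
have pL1 : pL <= 1 by rewrite lerBlDr lerDl mulr_ge0// expR_ge0.
move=> h1; apply: (le_trans _ (le_trans h1 _)).
 apply: (le_trans (y := fine (P (bands X (cell_strips F tau))) * (pL ^+ ((N + N).+1 ^ d)%N * pk ^+ K))).
  apply: ler_wpM2r; first by rewrite mulr_ge0// exprn_ge0.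
  exact: osc_all.
 apply: ler_wpM2l; first exact: fineP_ge0.
 apply: ler_wpM2r; first exact: exprn_ge0.
 by apply: ler_wiXn2l => //; exact: cell_count.
apply: le_fineP; [exact: mstrip gX _|exact: measurable_pts gX _ _|].
move=> w; rewrite strip_cat => -[]; rewrite /bands /cell_strips /= !all_map => /allP h2 /allP h3.
apply/allP => x xF; have := h2 x xF; have := h3 (cellof h x).
rewrite /= mem_undup map_f// => /(_ isT).
rewrite lin1 mul1r [lin X _ w]/lin big_cons big_seq1 /= mul1r mulN1r.
exact: two_strips.
Qed.

End oscillation.

(** * Numerical estimates *)

Section estimates.
Context {R : realType}.

Lemma coord_le_enorm d (x : 'rV[R]_d) i : `|x 0 i| <= enorm x.
Proof.
rewrite -sqrtr_sqr /enorm; apply: ler_wsqrtr; rewrite (bigD1 i)//= lerDl.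
by apply: sumr_ge0 => j _; exact: sqr_ge0.
Qed.

Lemma one_sub_ge (x : R) : 0 <= x <= 1 / 2 -> expR (- (2 * x)) <= 1 - x.
Proof.
move=> /andP[x0 x1]; rewrite expRN -[leRHS]invrK lef_pV2 ?posrE ?expR_gt0 ?invr_gt0//; last lra.
have h := expR_ge1Dx (2 * x).
rewrite -div1r ler_pdivrMr; last lra.
apply: (le_trans (y := (1 + 2 * x) * (1 - x))); first nra.
by apply: ler_wpM2r; lra.
Qed.

Lemma ln_large (A : R) : exists2 T0, 1 <= T0 & forall T, T0 <= T -> A <= ln T.
Proof.
exists (Num.max 1 (expR A)); first by rewrite le_max lexx.
move=> T; rewrite ge_max => /andP[T1 TA].
by rewrite -[leLHS]expRK ler_ln// posrE ?expR_gt0//; lra.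
Qed.

Lemma expR_powR (a T : R) : 0 < T -> expR (- (a * ln T)) = T `^ (- a).
Proof. by move=> T0; rewrite /powR gt_eqF// mulNr. Qed.

Lemma expRN_le (z : R) : 0 < z -> expR (- z) <= z^-1.
Proof.
move=> z0; rewrite expRN lef_pV2 ?posrE ?expR_gt0//.
by apply: le_trans (expR_ge1Dx _); rewrite lerDr.
Qed.

End estimates.

Section numeric.
Context {R : realType}.

Lemma pow_half (K : nat) (k : R) : 16 * (K%:R + 1) + 1 <= k ->
 2 * expR (- (k ^+ 2 / (2 * 1))) <= 1 / 2 /\
 1 / 2 <= (1 - 2 * expR (- (k ^+ 2 / (2 * 1)))) ^+ K.
Proof.
move=> kz; have K0 : 0 <= K%:R :> R by [].
set pk := expR _; have pk0 : 0 < pk by exact: expR_gt0.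
have kk : 16 * (K%:R + 1) <= k ^+ 2 by nra.
have k2 : 0 < k ^+ 2 by lra.
have hz : 0 < k ^+ 2 / (2 * 1) by apply: divr_gt0 => //; lra.
have := expRN_le hz; rewrite -/pk invf_div => hp.
have hp2 : pk * k ^+ 2 <= 2 by rewrite -ler_pdivlMr//; lra.
have hp3 : pk * (16 * (K%:R + 1)) <= pk * k ^+ 2 by rewrite ler_pM2l.
have pkle : 4 * pk * (K%:R + 1) <= 1 / 2 by lra.
have pk4 : 2 * pk <= 1 / 2 by nra.
split=> //.
have h1 : expR (- (2 * (2 * pk))) <= 1 - 2 * pk by apply: one_sub_ge; lra.
apply: (le_trans (y := expR (- (2 * (2 * pk))) ^+ K)); last first.
 by apply: lerXn2r; rewrite ?nnegrE ?expR_ge0//; lra.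
by rewrite -expRM_natl; apply: le_trans (expR_ge1Dx _); nra.
Qed.

Lemma eighth (E z y1 y2 : R) : 0 <= E -> 1 / 2 <= z -> E <= y1 -> 1 / 2 <= y2 ->
 E / 8 <= z * (y1 * y2).
Proof.
move=> E0 h1 h2 h3; apply: (le_trans (y := 1 / 2 * (E * (1 / 2)))); first lra.
have h4 : E * (1 / 2) <= y1 * y2 by apply: ler_pM => //; lra.
have h5 : 0 <= E * (1 / 2) by lra.
by apply: ler_pM => //; lra.
Qed.

Lemma ratio_le (x y : R) : 0 <= x -> 0 <= y -> x / (x + 1) * y <= y.
Proof. by move=> x0 y0; apply: ler_piMl => //; rewrite ler_pdivrMr; lra. Qed.

End numeric.

Section numeric.
Context {R : realType}.

Lemma half_sub (y : R) : y <= 4^-1 -> 1 / 2 <= 1 - 2 * y. Proof. lra. Qed.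

Lemma half_two (y : R) : 1 / 2 <= y -> 1 <= 2 * y. Proof. lra. Qed.

(** The side n is (T/2)^(1-e') / (d L) rounded down: the grid of spacing L then has diameter below
    (T/2)^(1-e') and about T^(d - d e') points. *)
Lemma grid_size (d L : nat) (e' : R) : (0 < d)%N -> (0 < L)%N -> 0 < e' < 1 ->
 exists c T0, [/\ 0 < c, 2 <= T0 & forall T, T0 <= T -> exists2 n, (0 < n)%N &
  [/\ d%:R * (L * n)%:R <= (T / 2) `^ (1 - e'), c * T `^ (d%:R - d%:R * e') <= (n ^ d)%:R
  & (n ^ d)%:R <= T `^ d%:R]].
Proof.
move=> d0 L0 /andP[e0 e1].
have dR : 0 < d%:R :> R by rewrite ltr0n.
have LR : 0 < L%:R :> R by rewrite ltr0n.
pose B := d%:R * L%:R : R; have B0 : 0 < B by exact: mulr_gt0.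
have B1 : 1 <= B by rewrite /B -natrM ler1n muln_gt0 d0.
have e10 : 0 < 1 - e' by lra.
have [T1 T11 hT1] := @powR_large R (4 * B) (1 - e') e10.
exists ((4 * B) ^- d), (2 * T1); split.
- by rewrite invr_gt0 exprn_gt0// mulr_gt0.
- lra.
move=> T hT; have T2 : T1 <= T / 2 by lra.
have T0 : 0 < T by lra.
pose rho := (T / 2) `^ (1 - e'); have rhoB : 4 * B <= rho by exact: hT1.
have rho0 : 0 < rho by apply: lt_le_trans rhoB; exact: mulr_gt0.
pose n := Num.truncn (rho / B).
have n1 : n%:R <= rho / B by rewrite truncn_le// divr_ge0// ltW.
have n2 : rho / B < n%:R + 1 by rewrite natr1 truncnS_gt.
have n3 : rho / B / 2 <= n%:R by have : 4 <= rho / B by [rewrite ler_pdivlMr//]; move: (rho / B) n2 => z; lra.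
have rhoT : T `^ (1 - e') / 2 <= rho.
 rewrite /rho powRM; [|exact: ltW|by rewrite invr_ge0].
 rewrite ler_pM2l ?powR_gt0//.
 have hp : (0 : R) < 2^-1 by rewrite invr_gt0.
 have hl : ln (2^-1 : R) < 0 by apply: ln_lt0; lra.
 by rewrite /powR gt_eqF// -[leLHS]lnK ?posrE// ler_expR; nra.
have rho1 : rho <= T.
 apply: (le_trans (y := (T / 2) `^ 1)); first by apply: ler_powR; lra.
 by rewrite powRr1; lra.
exists n.
 rewrite -(ltr0n R); apply: lt_le_trans n3.
 by rewrite divr_gt0// divr_gt0.
split.
- by rewrite natrM mulrA -/B mulrC -ler_pdivlMr.
- have -> : T `^ (d%:R - d%:R * e') = (T `^ (1 - e')) ^+ d.
  by rewrite -powR_mulrn ?powR_ge0// -powRrM; congr (_ `^ _); ring.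
 rewrite mulrC -expr_div_n natrX; apply: lerXn2r; rewrite ?nnegrE//.
  by rewrite divr_ge0 ?powR_ge0// mulr_ge0// ltW.
 apply: le_trans n3; rewrite ler_pdivrMr; last exact: mulr_gt0.
 rewrite (_ : rho / B / 2 * (4 * B) = 2 * rho); last by field; rewrite gt_eqF.
 lra.
- rewrite natrX powR_mulrn; last exact: ltW.
 apply: lerXn2r; rewrite ?nnegrE//; first exact: ltW.
 apply: (le_trans n1); rewrite ler_pdivrMr//; apply: (le_trans rho1).
 by rewrite ler_peMr// ltW.
Qed.

Variables (e m eb q lT l : R).
Hypotheses (he : 0 < e <= 1 / 2) (m0 : 0 < m) (q0 : 0 < q) (lT0 : 0 <= lT) (l0 : 0 < l).
Hypotheses (lE : l ^+ 2 = 2 * m * q * lT) (heb : 0 < eb <= m * e / 8).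
(** The threshold for [Q_exp], in units of sqrt (m - eb). Its numerator lies strictly between the
    level (1 - e) l of local averages and l: [num_factor] keeps a definite gain, and [num_Q] keeps a
    normal tail above a power of T larger than T^(-q). *)
Let a1 := (1 - e / 2) * l / Num.sqrt (m - eb).

Let me0 : 0 < m - eb.
Proof. by case/andP: he => e0 e1; case/andP: heb => _; have := m0; nra. Qed.

Lemma num_a1 : 128 / e * Num.sqrt m <= l -> 64 / e <= a1.
Proof.
case/andP: he => e0 e1 hl; have sm : 0 < Num.sqrt m by rewrite sqrtr_gt0.
have sme : 0 < Num.sqrt (m - eb) by rewrite sqrtr_gt0.
have h1 : Num.sqrt (m - eb) <= Num.sqrt m by apply: ler_wsqrtr; case/andP: heb; lra.
rewrite /a1 ler_pdivlMr//; apply: (le_trans (y := 1 / 2 * l)); last first.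
 by rewrite ler_wpM2r//; [exact: ltW|lra].
apply: (le_trans (y := 64 / e * Num.sqrt m)); last first.
 have : 128 / e * Num.sqrt m = 2 * (64 / e * Num.sqrt m) by field; rewrite gt_eqF.
 by lra.
by rewrite ler_wpM2l// divr_ge0// ltW.
Qed.

(** The shift by 2 and the ratio m / (m - eb) cost factors 1 + e/8 and 1 + e/4, which the factor (1
    - e/2)^2 in a1^2 absorbs. *)
Lemma num_Q : 64 / e <= a1 -> (a1 + 2) ^+ 2 / 2 <= (1 - 3 * e / 8) * q * lT.
Proof.
case/andP: he => e0 e1 ha; have ha' : 64 <= a1 * e by rewrite -ler_pdivrMr.
have a10 : 0 < a1 by apply: lt_le_trans ha; exact: divr_gt0.
have h1 : (a1 + 2) ^+ 2 <= (1 + e / 8) * a1 ^+ 2 by nra.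
have h2 : a1 ^+ 2 = (1 - e / 2) ^+ 2 * (m / (m - eb)) * (2 * q * lT).
 rewrite /a1 expr_div_n exprMn lE sqr_sqrtr; last exact: ltW.
 by field; rewrite gt_eqF.
have h3 : m / (m - eb) <= 1 + e / 4.
 rewrite ler_pdivrMr//; case/andP: heb => _ h.
 have u : 0 <= m * e * (4 - e) by apply: mulr_ge0; [apply: mulr_ge0; exact: ltW|lra].
 apply: (le_trans (y := (1 + e / 4) * (m - m * e / 8))); first lra.
 by apply: ler_wpM2l; lra.
have w0 : 0 <= 2 * q * lT by apply: mulr_ge0 => //; apply: mulr_ge0 => //; exact: ltW.
have h4 : (1 - e / 2) ^+ 2 * (1 + e / 4) * (1 + e / 8) <= 1 - 3 * e / 8.
 have u1 : (1 - e / 2) * (1 + e / 4) <= 1 by nra.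
 have u2 : (1 - e / 2) * (1 + e / 8) <= 1 - 3 * e / 8 by nra.
 have u3 : 0 <= (1 - e / 2) * (1 + e / 8) by nra.
 by nra.
have h5 : (1 + e / 8) * a1 ^+ 2 <= (1 - 3 * e / 8) * (2 * q * lT).
 rewrite h2 mulrA; apply: ler_wpM2r => //; apply: le_trans h4.
 rewrite mulrC ler_wpM2r//; first lra.
 by rewrite ler_wpM2l// sqr_ge0.
lra.
Qed.

Lemma num_factor : e / 4 <= 1 - ((1 - e) * l + 3 * (e / 12 * l)) / Num.sqrt (m - eb) / a1.
Proof.
case/andP: he => e0 e1.
have sme : 0 < Num.sqrt (m - eb) by rewrite sqrtr_gt0.
have -> : ((1 - e) * l + 3 * (e / 12 * l)) / Num.sqrt (m - eb) / a1 = (1 - 3 * e / 4) / (1 - e / 2).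
 by rewrite /a1; field; rewrite !gt_eqF//; lra.
have : (1 - 3 * e / 4) / (1 - e / 2) <= 1 - e / 4 by rewrite ler_pdivrMr; [nra|lra].
lra.
Qed.

End numeric.

Section spectral_domination.
Context {R : realType} {G : setting} {d : nat}.
Variables (mu nu : fin_measure R d).
Hypothesis numu : forall A, measurable A -> (nu A <= mu A)%E.

Lemma qf_kcov_le (s : seq (R * site R G d)) : qf (kcov nu) s s <= qf (kcov mu) s s.
Proof.
rewrite !qf_kcov_Rint.
have bF : bmf (fun l => lin (@cosw R G d) s l ^+ 2 + lin (@sinw R G d) s l ^+ 2).
 under eq_fun do rewrite !expr2.
 by apply: bmfD; apply: bmfM; apply: bmf_lin; [exact: bmf_cosw..|exact: bmf_sinw|exact: bmf_sinw].
rewrite -lee_fin !EFin_Rint//; apply: ge0_le_measure_integral => //.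
 by move=> l; rewrite lee_fin addr_ge0// sqr_ge0.
by apply/measurable_EFinP; exact: bmf_mble bF.
Qed.

End spectral_domination.

Lemma sq_le_abs {R : realType} (a b : R) : 0 <= b -> a ^+ 2 <= b ^+ 2 -> - b <= a <= b.
Proof.
move=> b0 h; rewrite -ler_norml -(ger0_norm b0).
by rewrite -(@ler_pXn2r _ 2) ?nnegrE// !real_normK ?num_real.
Qed.

Lemma sum_inv {R : realType} (I : finType) : (0 < #|I|)%N -> \sum_(i : I) #|I|%:R^-1 = 1 :> R.
Proof.
move=> I0; rewrite sumr_const -[LHS]mulr_natr mulVf// gt_eqF// ltr0n; exact: I0.
Qed.

(** * Averaging measures over translates *)

Section translates.
Context {R : realType} {G : setting} {d : nat}.
Variable mu : fin_measure R d.

Lemma enorm_ge0 (x : 'rV[R]_d) : 0 <= enorm x. Proof. exact: sqrtr_ge0. Qed.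

Lemma enorm_sqr (x : 'rV[R]_d) : enorm x ^+ 2 = edot x x.
Proof.
rewrite sqr_sqrtr; last by apply: sumr_ge0 => i _; exact: sqr_ge0.
by apply: eq_bigr => i _; rewrite expr2.
Qed.

Lemma enormD (x y : 'rV[R]_d) : enorm (x + y) <= enorm x + enorm y.
Proof.
rewrite -(@ler_pXn2r _ 2) ?nnegrE ?addr_ge0 ?enorm_ge0// sqrrD !enorm_sqr.
have -> : edot (x + y) (x + y) = edot x x + edot x y *+ 2 + edot y y.
 rewrite /edot -mulr_natr mulr_suml -!big_split /=; apply: eq_bigr => i _; rewrite !mxE; ring.
by rewrite lerD2r lerD2l lerMn2r /= (le_trans (ler_norm _) (edot_CS x y)).
Qed.

Definition translate (g : site R G d) (v : seq (R * site R G d)) := [seq (q.1, q.2 + g) | q <- v].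

Lemma en_translate g (v : seq (R * site R G d)) : en mu (translate g v) = en mu v.
Proof.
rewrite /en /qf big_map; apply: eq_bigr => p _; rewrite big_map; apply: eq_bigr => q _ /=.
by rewrite kcovDr.
Qed.

Lemma qf_kcov_CS (v w : seq (R * site R G d)) : qf (kcov mu) v w ^+ 2 <= en mu v * en mu w.
Proof. rewrite /en !qf_ip2; apply: ip2_CS; exact: sqi2_gpair. Qed.

(** All translates have the same energy, so by Cauchy-Schwarz every mutual energy is at most
    [en mu v]. *)
Lemma en_average (I : finType) (g : I -> site R G d) v : (0 < #|I|)%N ->
 en mu (lflat (fun i => translate (g i) v) [seq (#|I|%:R^-1, i) | i <- enum I]) <= en mu v.
Proof.
move=> I0; have IR : 0 < #|I|%:R :> R by rewrite ltr0n.
rewrite {1}/en qf_lflat /qf big_map big_enum /=.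
have h i j : qf (kcov mu) (translate (g i) v) (translate (g j) v) <= en mu v.
 have := qf_kcov_CS (translate (g i) v) (translate (g j) v); rewrite !en_translate -expr2.
 by move=> /(sq_le_abs (en_ge0 mu v))/andP[].
apply: (le_trans (y := \sum_(i : I) \sum_(j : I) (#|I|%:R^-1 * #|I|%:R^-1 * en mu v))); last first.
 apply: (le_trans (y := (\sum_(i : I) #|I|%:R^-1) * (\sum_(j : I) #|I|%:R^-1) * en mu v)); last first.
  by rewrite sum_inv// !mul1r.
 rewrite big_distrlr /= mulr_suml; apply: ler_sum => i _.
 by rewrite mulr_suml.
apply: ler_sum => i _; rewrite big_map big_enum /=; apply: ler_sum => j _.
by apply: ler_wpM2l; [rewrite mulr_ge0// invr_ge0|exact: h].
Qed.

Lemma cvx_average (I : finType) (g : I -> site R G d) v (D D' : set (site R G d)) : (0 < #|I|)%N ->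
 cvx D v -> (forall x i, D x -> D' (x + g i)) ->
 cvx D' (lflat (fun i => translate (g i) v) [seq (#|I|%:R^-1, i) | i <- enum I]).
Proof.
move=> I0 [v1 v2] DD; have IR : 0 < #|I|%:R :> R by rewrite ltr0n.
split.
 move=> p /flattenP[s /mapP[q /mapP[i _ ->] ->]] /mapP[p' /mapP[q' qv ->] ->] /=.
 have [h1 h2] := v1 _ qv; split; last exact: DD.
 by rewrite mulr_ge0// invr_ge0.
have -> : \sum_(p <- lflat (fun i => translate (g i) v) [seq (#|I|%:R^-1, i) | i <- enum I]) p.1 =
 lin (fun (_ : site R G d) (_ : unit) => 1) (lflat (fun i => translate (g i) v) [seq (#|I|%:R^-1, i) | i <- enum I]) tt.
 by apply: eq_bigr => p _; rewrite mulr1.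
rewrite lin_lflat /lin big_map big_enum /=.
under eq_bigr do rewrite big_map /=.
rewrite (_ : \sum_(q <- v) q.1 * 1 = 1); last by rewrite -[RHS]v2; apply: eq_bigr => q _; rewrite mulr1.
by rewrite (eq_bigr (fun=> #|I|%:R^-1)); [exact: sum_inv|move=> i _; rewrite mulr1].
Qed.

End translates.

Section averages.
Context {R : realType} {A : eqType} {d} {T : measurableType d} (P : probability T R) (I : finType).
Variables (X : A -> T -> R) (sh : A -> I -> A) (e l b : R) (v : seq (R * A)).
Hypothesis mX : forall a, mble (X a).
Hypotheses (he : 0 < e <= 1 / 2) (l0 : 0 < l) (I0 : (0 < #|I|)%N).
Hypotheses (v0 : forall q, q \in v -> 0 <= q.1) (v1 : \sum_(q <- v) q.1 = 1).
Let low x := [set w | (forall i, 0 <= X (sh x i) w) /\ \sum_i X (sh x i) w <= #|I|%:R * ((1 - e) * l)].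
Hypothesis hb : forall x, fine (P (low x)) <= b.
Let Y w := \sum_(q <- v) q.1 * (#|I|%:R^-1 * \sum_i X (sh q.2 i) w).

Let mlow x : measurable (low x).
Proof.
have -> : low x = pts_event (fun i => X (sh x i)) (enum I) 0 `&`
  [set w | - (#|I|%:R * ((1 - e) * l)) <= - \sum_i X (sh x i) w].
 apply/seteqP; split=> w /=; rewrite lerN2 => -[h1 h2]; split=> //.
  by apply/allP => i _; exact: h1.
 by move=> i; have /allP/(_ i) := h1; rewrite mem_enum; apply.
apply: measurableI.
 rewrite pts_poly; apply: measurable_polyh => i; exact: mX.
by apply: measurable_ge; apply: measurableT_comp => //; exact: measurable_sum.
Qed.

(** Let S be the v-weight of the points whose local mean is at most (1 - e) l. The other points
    alone give Y >= (1 - e) l (1 - S), so Y <= (1 - 2e) l forces S >= e/(1 - e) >= e. As S has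
    expectation at most b, Markov's inequality concludes. *)
Lemma avg_low : fine (P [set w | (forall q, q \in v -> forall i, 0 <= X (sh q.2 i) w) /\
  Y w <= (1 - 2 * e) * l]) <= b / e.
Proof.
case/andP: he => e0 e1; set E := [set w | _].
have IR : 0 < #|I|%:R :> R by rewrite ltr0n.
have mE : measurable E.
 have -> : E = pts_event X [seq sh q.2 i | q <- v, i <- enum I] 0 `&`
   [set w | - ((1 - 2 * e) * l) <= - Y w].
  apply/seteqP; split=> w; rewrite /E /= lerN2 => -[h1 h2]; split=> //.
   by apply/allP => a /allpairsP[[q i] /= [qv _ ->]]; exact: h1.
  move=> q qv i; have /allP := h1; apply; apply/allpairsP; exists (q, i) => /=.
  by rewrite mem_enum.
 apply: measurableI; first by rewrite pts_poly; apply: measurable_polyh => a; exact: mX.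
 apply: measurable_ge; apply: measurableT_comp => //; apply: measurable_sum => q.
 apply: measurable_funM => //; apply: measurable_funM => //; exact: measurable_sum.
rewrite ler_pdivlMr// mulrC -(Rint_indic P mE) -RintZ; last exact: bmf_indic.
have bi q : bmf (fun w => q.1 * \1_(low q.2) w) by move=> *; apply: bmfZ; exact: bmf_indic.
apply: (le_trans (y := \int[P]_w (\sum_(q <- v) q.1 * \1_(low q.2) w))).
 apply: le_Rint; [by apply: bmfZ; exact: bmf_indic|exact: bmf_sum|].
 move=> w; have [Ew|Ew] := pselect (E w); last first.
  rewrite indicE memNset// mulr0 big_seq; apply: sumr_ge0 => q /v0 q0.
  by rewrite mulr_ge0// indicE.
 rewrite indicE mem_set// mulr1; have [h1 h2] := Ew.
 set S := \sum_(q <- v) _.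
 have : (1 - e) * l * (1 - S) <= Y w.
  rewrite -[X in _ * (X - _)]v1 /S -sumrB mulr_sumr /Y !big_seq; apply: ler_sum => q qv.
  rewrite -{1}[q.1]mulr1 -mulrBr mulrCA ler_wpM2l ?v0//.
  have [hl|hl] := pselect (low q.2 w).
   rewrite indicE mem_set// subrr mulr0; apply: mulr_ge0; first by rewrite invr_ge0.
   by apply: sumr_ge0 => i _; exact: h1.
  rewrite indicE memNset// subr0 mulr1 [leRHS]mulrC ler_pdivlMr// mulrC leNgt; apply/negP => h.
  by apply: hl; split; [move=> i; exact: h1|exact: ltW].
 move/le_trans => /(_ _ h2); rewrite mulrAC ler_pM2r// => h3.
 nra.
rewrite Rint_sum//; apply: (le_trans (y := \sum_(q <- v) q.1 * b)); last by rewrite -mulr_suml v1 mul1r.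
rewrite !big_seq; apply: ler_sum => q qv; rewrite RintZ; last exact: bmf_indic.
by rewrite ler_wpM2l ?v0// (_ : \int[P]_w _ = fine (P (low q.2)))//; exact: Rint_indic.
Qed.

End averages.

(** * Deviations of a linear functional given a lower bound on an average *)

Section deviation.
Context {R : realType} {G : setting} {d : nat} {dO : measure_display}
 {Omega : measurableType dO} (P : probability Omega R)
 (X : site R G d -> Omega -> R) (mu : fin_measure R d).
Hypothesis gX : gproc P X (kcov mu).

(** The regression coefficient Q/V of w on v is close to H: Q/k differs from H by at most s0 s1
    because v nearly minimises the energy, and replacing k by V costs at most s0 s1^2. *)
Lemma deviation_coef (k V Q H W C0 s0 s1 : R) : 0 < k -> 0 < s0 -> 0 < s1 <= 1 -> C0 = s0 ^+ 2 ->
 k <= V <= (1 + s1 ^+ 2) * k -> Q ^+ 2 <= W * V -> W <= C0 * k ->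
 (k * H - Q) ^+ 2 <= W * (V - k) ->
 `|Q / V| <= s0 /\ `|Q / V - H| <= 2 * (s0 * s1).
Proof.
move=> k0 s00 /andP[s10 s11] C0E /andP[V1 V2] QW WC HQ.
have V0 : 0 < V by exact: lt_le_trans V1.
have C00 : 0 <= C0 by rewrite C0E sqr_ge0.
have Vk : 0 <= V - k by lra.
have Q1 : Q ^+ 2 <= (s0 * V) ^+ 2.
 apply: (le_trans QW); rewrite exprMn -C0E.
 apply: (le_trans (ler_wpM2r (ltW V0) WC)); rewrite -mulrA; apply: ler_wpM2l => //.
 by rewrite expr2 ler_wpM2r// ltW.
have sV : 0 <= s0 * V by apply: mulr_ge0; exact: ltW.
have := sq_le_abs sV Q1; rewrite -ler_norml => Q2.
have a1 : `|Q / V| <= s0 by rewrite normrM normfV (gtr0_norm V0) ler_pdivrMr.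
split=> //.
have H1 : (k * H - Q) ^+ 2 <= (k * (s0 * s1)) ^+ 2.
 apply: (le_trans HQ); apply: (le_trans (ler_wpM2r Vk WC)).
 rewrite !exprMn -C0E mulrC; have hV : V - k <= s1 ^+ 2 * k by lra.
 apply: (le_trans (ler_wpM2r (mulr_ge0 C00 (ltW k0)) hV)).
 by rewrite le_eqVlt; apply/orP; left; apply/eqP; ring.
have kss : 0 <= k * (s0 * s1) by rewrite !mulr_ge0// ltW.
have := sq_le_abs kss H1; rewrite -ler_norml => H2.
have h3 : `|Q / k - H| <= s0 * s1.
 have -> : Q / k - H = - (k * H - Q) / k by field; rewrite gt_eqF.
 by rewrite normrM normrN normfV (gtr0_norm k0) ler_pdivrMr// [_ * k]mulrC.
have h4 : `|Q / V - Q / k| <= s0 * s1.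
 have -> : Q / V - Q / k = - (Q / V * ((V - k) / k)) by field; rewrite !gt_eqF.
 rewrite normrN normrM; apply: ler_pM => //.
 rewrite ger0_norm; last by rewrite divr_ge0// ltW.
 rewrite ler_pdivrMr//; apply: (le_trans (y := s1 ^+ 2 * k)); first lra.
 by rewrite ler_wpM2r ?(ltW k0)// expr2 ler_piMr// ltW.
have -> : Q / V - H = (Q / V - Q / k) + (Q / k - H) by ring.
by apply: (le_trans (ler_normD _ _)); lra.
Qed.

Lemma deviation_split (a H Y Z x l e s0 e1 : R) : 0 < l -> 0 < s0 -> e1 = e / (4 * s0) ->
 x = a * Y + Z -> `|a| <= s0 -> `|a - H| <= e / 4 -> e < `|x / l - H| -> 0 < e ->
 [\/ Y < (1 - e1) * l, (1 + e1) * l <= Y | e / 4 * l <= Z \/ e / 4 * l <= - Z].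
Proof.
move=> l0 s00 e1E xE as0 aH hx e0.
have [h1|h1] := ltP Y ((1 - e1) * l); first by constructor 1.
have [h2|h2] := leP ((1 + e1) * l) Y; first by constructor 2.
constructor 3.
have hY : `|Y / l - 1| <= e1.
 rewrite ler_norml; apply/andP; split; first by rewrite lerBrDl ler_pdivlMr.
 by rewrite lerBlDl ler_pdivrMr// ltW.
have haY : `|a * (Y / l - 1)| <= e / 4.
 have -> : e / 4 = s0 * e1 by rewrite e1E; field; rewrite gt_eqF.
 by rewrite normrM; apply: ler_pM.
have : e / 4 <= `|Z / l|.
 have E : x / l - H = a * (Y / l - 1) + (a - H) + Z / l by rewrite xE; field; rewrite gt_eqF.
 have := ler_normD (a * (Y / l - 1) + (a - H)) (Z / l); rewrite -E.
 by have := ler_normD (a * (Y / l - 1)) (a - H); lra.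
rewrite normrM normfV (gtr0_norm l0) ler_pdivlMr// => hZ.
by have [z0|z0] := leP 0 Z; [left; rewrite ger0_norm in hZ|right; rewrite ltr0_norm in hZ].
Qed.

(** Write lin X w = a Y + Z, where Y = lin X v, a is near H and Z is uncorrelated with Y. A
    deviation from l H forces one of three events. A low Y on the persistence event has probability
    at most b. A high Y costs (1 + e1)^2 in the exponent. A large |Z| with Y of normal size costs
    e^2/(16 C0) on top of the main exponent, by [joint_tail], once for each sign of Z. *)
Lemma deviation (v w : seq (R * site R G d)) (F : seq (site R G d)) (k l H C0 s0 s1 e e1 c b ep : R) :
 0 < k -> 0 < l -> 0 < e -> 0 < s0 -> 0 < s1 <= 1 -> C0 = s0 ^+ 2 -> e1 = e / (4 * s0) ->
 k <= en mu v <= (1 + s1 ^+ 2) * k -> en mu w <= C0 * k ->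
 (k * H - qf (kcov mu) w v) ^+ 2 <= en mu w * (en mu v - k) ->
 2 * (s0 * s1) <= e / 4 -> s1 ^+ 2 <= e1 -> 2 * ep <= e1 -> 0 <= ep <= 1 / 2 -> c <= e1 ->
 4 * ep + s1 ^+ 2 + c <= e ^+ 2 / (16 * C0) ->
 fine (P (pts_event X F 0 `&` [set t | lin X v t <= (1 - 2 * ep) * l])) <= b ->
 fine (P (pts_event X F 0 `&` [set t | e < `|lin X w t / l - H|])) <=
  b + 3 * expR (- ((1 + c) * (l ^+ 2 / k) / 2)).
Proof.
move=> k0 l0 e0 s00 s1b C0E e1E hV hW hH hs1 hs2 hep /andP[ep0 ep1] hc hc2 hb.
case/andP: (hV) => V1 V2.
set V := en mu v in V1 V2 hV hH; set Q := qf (kcov mu) w v in hH.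
have V0 : 0 < V by exact: lt_le_trans V1.
have Q2 : Q ^+ 2 <= en mu w * V by exact: qf_kcov_CS.
have [a1 a2] := deviation_coef k0 s00 s1b C0E hV Q2 hW hH.
pose a := Q / V; pose z := w ++ scal (- a) v.
have zE t : lin X w t = a * lin X v t + lin X z t by rewrite /z lin_cat lin_scal; ring.
have sy : forall x y : site R G d, kcov mu x y = kcov mu y x by exact: kcovC.
have qvz : qf (kcov mu) v z = 0.
 rewrite /z qf_catr qf_scalr (qfC _ _ sy) -/Q -/(en mu v) -/V /a; field; rewrite gt_eqF//.
have qzz : qf (kcov mu) z z <= C0 * k.
 have -> : qf (kcov mu) z z = en mu w - Q ^+ 2 / V.
  rewrite {1}/z qf_catl qf_scall qvz mulr0 addr0 /z qf_catr qf_scalr -/Q -/(en mu w) /a; field.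
  by rewrite gt_eqF.
 by apply: le_trans hW; rewrite gerBl divr_ge0 ?sqr_ge0// ltW.
have C00 : 0 < C0 by rewrite C0E exprn_gt0.
have C0k : 0 < C0 * k by exact: mulr_gt0.
have mF := measurable_pts gX F 0.
have ml s q : measurable [set t | q <= lin X s t] by apply: measurable_ge; exact: gproc_mlin gX s.
pose z' := scal (-1) z.
have qvz' : qf (kcov mu) v z' = 0 by rewrite /z' qf_scalr qvz mulr0.
have qzz' : qf (kcov mu) z' z' <= C0 * k by rewrite /z' qf_scall qf_scalr !mulN1r opprK.
have lz' t : lin X z' t = - lin X z t by rewrite /z' lin_scal mulN1r.
have yl0 : 0 <= (1 - 2 * ep) * l by apply: mulr_ge0; [lra|exact: ltW].
have zl0 : 0 <= e / 4 * l by apply: mulr_ge0; [lra|exact: ltW].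
have j1 := joint_tail gX sy qvz (lexx V) qzz V0 C0k yl0 zl0.
have j2 := joint_tail gX sy qvz' (lexx V) qzz' V0 C0k yl0 zl0.
have e1p : 0 < e1 by rewrite e1E divr_gt0// mulr_gt0.
have up0 : 0 <= (1 + e1) * l by apply: mulr_ge0; [lra|exact: ltW].
have j3 := gproc_tail gX (lexx V) V0 up0.
set A1 := pts_event X F 0 `&` [set t | lin X v t <= _] in hb.
set A2 := [set t | (1 + e1) * l <= lin X v t] in j3.
set A3 := _ `&` _ in j1; set A4 := _ `&` _ in j2.
have mA1 : measurable A1.
 apply: measurableI => //; have := ml (scal (-1) v) (- ((1 - 2 * ep) * l)).
 by congr measurable; apply/seteqP; split=> t /=; rewrite lin_scal mulN1r lerN2.
have mA2 : measurable A2 by exact: ml.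
have mA3 : measurable A3 by exact: measurableI.
have mA4 : measurable A4 by exact: measurableI.
have z0 : 0 <= l ^+ 2 / k by rewrite divr_ge0 ?sqr_ge0// ltW.
have lV : l ^+ 2 / k / (1 + s1 ^+ 2) <= l ^+ 2 / V.
 rewrite -mulrA; apply: ler_wpM2l; first exact: sqr_ge0.
 by rewrite -invfM lef_pV2 ?posrE//; [rewrite mulrC|rewrite mulr_gt0// ltr_wpDr// sqr_ge0].
have s1p : 0 < 1 + s1 ^+ 2 by rewrite ltr_wpDr// sqr_ge0.
have B2 : expR (- (((1 + e1) * l) ^+ 2 / (2 * V))) <= expR (- ((1 + c) * (l ^+ 2 / k) / 2)).
 rewrite ler_expR lerN2 exprMn.
 have -> : (1 + e1) ^+ 2 * l ^+ 2 / (2 * V) = (1 + e1) ^+ 2 * (l ^+ 2 / V) / 2 by field; rewrite gt_eqF.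
 rewrite ler_pM2r ?invr_gt0//; apply: le_trans (ler_wpM2l (sqr_ge0 _) lV).
 rewrite [X in _ <= X](_ : _ = (1 + e1) ^+ 2 / (1 + s1 ^+ 2) * (l ^+ 2 / k)); last by ring.
 apply: ler_wpM2r => //; rewrite ler_pdivlMr//.
 apply: (le_trans (y := (1 + e1) * (1 + s1 ^+ 2))); first by apply: ler_wpM2r; [exact: ltW|lra].
 by rewrite expr2; apply: ler_wpM2l; lra.
have B3 : expR (- ((((1 - 2 * ep) * l) ^+ 2 / V + (e / 4 * l) ^+ 2 / (C0 * k)) / 2)) <=
  expR (- ((1 + c) * (l ^+ 2 / k) / 2)).
 rewrite ler_expR lerN2 ler_pM2r ?invr_gt0// ![(_ * l) ^+ 2]exprMn.
 have -> : (e / 4) ^+ 2 * l ^+ 2 / (C0 * k) = e ^+ 2 / (16 * C0) * (l ^+ 2 / k).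
  by field; rewrite !gt_eqF.
 apply: (le_trans (y := (1 - 2 * ep) ^+ 2 * (l ^+ 2 / k / (1 + s1 ^+ 2)) + e ^+ 2 / (16 * C0) * (l ^+ 2 / k))); last first.
  by apply: lerD => //; rewrite -[leRHS]mulrA; apply: ler_wpM2l => //; exact: sqr_ge0.
 have h : 1 - 4 * ep - s1 ^+ 2 <= (1 - 2 * ep) ^+ 2 / (1 + s1 ^+ 2).
  by rewrite ler_pdivlMr//; have := sqr_ge0 s1; move: (s1 ^+ 2) => s s_0; nra.
 rewrite [X in _ <= X](_ : _ = ((1 - 2 * ep) ^+ 2 / (1 + s1 ^+ 2) + e ^+ 2 / (16 * C0)) * (l ^+ 2 / k)); last by ring.
 by apply: ler_wpM2r => //; lra.
have mE : measurable (pts_event X F 0 `&` [set t | e < `|lin X w t / l - H|]).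
 apply: measurableI => //.
 have -> : [set t | e < `|lin X w t / l - H|] = ~` [set t | `|lin X w t / l - H| <= e].
  by apply/seteqP; split=> t /=; rewrite ltNge => /negP.
 apply: measurableC; apply: measurable_norm_le; apply: measurable_funB => //.
 by apply: measurable_funM => //; exact: gproc_mlin gX w.
have mA34 : measurable (A3 `|` A4) by exact: measurableU.
have mA234 : measurable (A2 `|` (A3 `|` A4)) by exact: measurableU.
apply: (le_trans (y := fine (P (A1 `|` (A2 `|` (A3 `|` A4)))))).
 apply: le_fineP => //; first exact: measurableU.
 move=> t [Ft et]; have [hY|hY] := leP (lin X v t) ((1 - 2 * ep) * l); first by left.
 right.
 have := deviation_split l0 s00 e1E (zE t) a1 (le_trans a2 hs1) et e0.
 case=> [h|h|[h|h]].
 - exfalso; have : (1 - e1) * l <= (1 - 2 * ep) * l by rewrite ler_pM2r// lerD2l lerN2.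
  by move/(lt_le_trans h)/lt_trans => /(_ _ hY); rewrite ltxx.
 - by left.
 - by right; left; split=> //; exact: ltW.
 - by right; right; split=> /=; [exact: ltW|rewrite lz'].
apply: (le_trans (fineP_setU P mA1 mA234)); apply: lerD => //.
apply: (le_trans (fineP_setU P mA2 mA34)).
have := fineP_setU P mA3 mA4; have := le_trans j1 B3; have := le_trans j2 B3; have := le_trans j3 B2.
by move: (fine _) (fine _) (fine _) (fine _) (expR _) => x1 x2 x3 x4 x5; lra.
Qed.

End deviation.

(** * Bounds on persistence for large T *)

Section asymptotics.
Context {R : realType} {G : setting} {d : nat} {dO : measure_display}
 {Omega : measurableType dO} (P : probability Omega R)
 (f : site R G d -> {RV P >-> R}) (mu mu_ac mu_d mu_sc : fin_measure R d).
Variable alpha : R.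
Hypotheses (hf : is_sgf f) (hmu : is_spectral_measure f mu).
Hypotheses (halpha : 0 <= alpha < d%:R)
 (hdec : is_lebesgue_decomposition mu mu_ac mu_d mu_sc)
 (h2 : mu_ac setT <> 0%E /\ mu_sc setT = 0%E).
Let X (x : site R G d) (w : Omega) : R := f x w.
Let gX : gproc P X (kcov mu). Proof. exact: gproc_field hf hmu. Qed.
Notation m := (fine (mu_ac setT)).

Definition ell (T : R) : R := Num.sqrt (2 * fine (mu_ac setT) * (d%:R - alpha) * ln T).

Let m0 : 0 < m. Proof. exact: ac_mass_gt0 h2. Qed.
Let q0 : 0 < d%:R - alpha. Proof. by case/andP: halpha; rewrite subr_gt0. Qed.
Let d0 : (0 < d)%N.
Proof. by rewrite -(ltr0n R); case/andP: halpha => h; apply: le_lt_trans. Qed.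

Lemma ell_sq T : 1 <= T -> ell T ^+ 2 = 2 * m * (d%:R - alpha) * ln T.
Proof.
move=> T1; rewrite /ell sqr_sqrtr//; apply: mulr_ge0; last exact: ln_ge0.
by apply: mulr_ge0; [rewrite mulr_ge0// ltW|exact: ltW].
Qed.

Lemma ell_ge0 T : 0 <= ell T. Proof. exact: sqrtr_ge0. Qed.

Lemma ell_large A : exists2 T0, 1 <= T0 & forall T, T0 <= T -> A <= ell T.
Proof.
have mq : 0 < 2 * m * (d%:R - alpha) by rewrite !mulr_gt0.
have [T0 T01 h] := ln_large (A ^+ 2 / (2 * m * (d%:R - alpha))).
exists T0 => // T hT; apply: (le_trans (ler_norm A)); rewrite -sqrtr_sqr /ell.
by apply: ler_wsqrtr; rewrite -ler_pdivrMl// mulrC; exact: h.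
Qed.

(** The level (1 + e) l is shared out: (1 + e/2) l for the S1 part at cell corners, e l/4 for
    oscillations, e l/4 for the atoms. About T^d corners, each with tail T^(-(d - alpha + c)), give
    an exponent of order T^(alpha - c). *)
Lemma nolow_asym e : 0 < e < 1 -> exists c C T0, [/\ 0 < c, 0 < C, 1 <= T0 &
 forall T, T0 <= T -> forall F : seq (site R G d), (forall x, x \in F -> site_ball T x) ->
 expR (- (C * T `^ (alpha - c))) / 8 <= fine (P (pts_event X F (- ((1 + e) * ell T))))].
Proof.
move=> /andP[e0 e1]; pose q := d%:R - alpha; have qp : 0 < q := q0.
have me : 0 < m * (e / 4) by rewrite mulr_gt0// divr_gt0.
have [K [u [S1 [M [SE S1C S1p S1v [M0 uM]]]]]] := discrete_split (G := G) hdec h2 d0 me.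
have dR : 0 < d%:R + 1 :> R by rewrite ltr_wpDl.
(* Chosen so that the exponent of Fernique's bound, tau^2 / (48 s2) with tau = e l/4, equals (d + 1)
   log T, which beats the number of cells. *)
pose s2 := e ^+ 2 * m * q / (384 * (d%:R + 1)).
have s20 : 0 < s2.
 rewrite /s2; apply: divr_gt0; last by apply: mulr_gt0; [rewrite ltr0n|exact: dR].
 by apply: mulr_gt0; [apply: mulr_gt0; [exact: exprn_gt0|exact: m0]|exact: qp].
pose s := Num.sqrt s2; have s0 : 0 < s by rewrite sqrtr_gt0.
have [h [h0 hG hs]] := small_osc hf hmu s0.
pose C0 := (2 / h + 4) ^+ d; have C00 : 0 < C0 by rewrite exprn_gt0// addr_gt0// divr_gt0.
have KM0 : 0 <= K%:R * M by rewrite mulr_ge0.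
pose c := e * q / 2; have c0 : 0 < c by rewrite !mulr_gt0.
exists c, (4 * C0).
have [T1 T11 hT1] := ell_large (16 * s / e).
have [T2 T21 hT2] := ell_large (4 * (K%:R * M + 1) / e * (16 * (K%:R + 1) + 1)).
have [T3 T31 hT3] := @powR_large R 4 (q + c) (addr_gt0 qp c0).
exists (Num.max T1 (Num.max T2 (Num.max T3 (2 * C0)))); split=> //.
- by rewrite mulr_gt0.
- by rewrite le_max T11.
move=> T; rewrite !ge_max => /andP[/hT1 l1 /andP[/hT2 l2 /andP[T3T TC]]] F hF.
have T1le : 1 <= T by apply: le_trans T3T.
have T0 : 0 < T by lra.
pose l := ell T; have le0 : 0 <= l := ell_ge0 T.
pose L := (1 + e / 2) * l; pose tau := e / 4 * l; pose k := e * l / (4 * (K%:R * M + 1)).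
pose N := (Num.truncn (T / h)).+1.
have KM1 : 0 < K%:R * M + 1 by lra.
have k0 : 0 <= k by rewrite /k divr_ge0 ?mulr_ge0//; lra.
have L0 : 0 <= L by rewrite /L mulr_ge0//; lra.
have l2E : l ^+ 2 = 2 * m * q * ln T by exact: ell_sq.
have lnT : 0 <= ln T by exact: ln_ge0.
pose pL := expR (- (L ^+ 2 / (2 * (m + m * (e / 4))))).
pose pk := expR (- (k ^+ 2 / (2 * 1))).
pose po := expR (- (tau ^+ 2 / (48 * s ^+ 2))).
have pLT : pL <= T `^ (- (q + c)).
 rewrite -expR_powR// /pL ler_expR lerN2 /L exprMn l2E.
 rewrite (_ : m + m * (e / 4) = m * (1 + e / 4)); last by ring.
 rewrite ler_pdivlMr; last by rewrite !mulr_gt0//; lra.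
 rewrite /c; pose z := m * q * ln T.
 have z0 : 0 <= z by apply: mulr_ge0 => //; apply: mulr_ge0; exact: ltW.
 rewrite (_ : (q + e * q / 2) * ln T * (2 * (m * (1 + e / 4))) = z * (2 * (1 + e / 2) * (1 + e / 4))); last by rewrite /z; field.
 rewrite (_ : (1 + e / 2) ^+ 2 * (2 * m * q * ln T) = z * (2 * (1 + e / 2) ^+ 2)); last by rewrite /z; ring.
 by rewrite ler_wpM2l//; nra.
have poT : po <= T `^ (- (d%:R + 1)).
 rewrite -expR_powR// /po ler_expR lerN2 /tau exprMn l2E sqr_sqrtr; last exact: ltW.
 rewrite le_eqVlt; apply/orP; left; apply/eqP; rewrite /s2.
 by field; rewrite !gt_eqF.
have NT : (N + N).+1%:R <= (2 / h + 4) * T.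
 rewrite -natr1 natrD /N -natr1; have : (Num.truncn (T / h))%:R <= T / h by rewrite truncn_le// divr_ge0// ltW.
 by move=> hh; rewrite mulrDl mulrAC -mulrA; move: (T / h) hh => z; lra.
have Nc : ((N + N).+1 ^ d)%:R <= C0 * T `^ d%:R.
 rewrite natrX powR_mulrn; last exact: ltW.
 rewrite -exprMn; apply: lerXn2r => //; rewrite ?nnegrE// mulr_ge0//; last exact: ltW.
 by rewrite addr_ge0// divr_ge0// ltW.
have Nc0 : 0 <= ((N + N).+1 ^ d)%:R :> R by [].
have Tp a : 0 < T `^ a by exact: powR_gt0.
have osc : 1 / 2 <= 1 - ((N + N).+1 ^ d)%:R * po.
 have : ((N + N).+1 ^ d)%:R * po <= C0 * T `^ d%:R * T `^ (- (d%:R + 1)) by apply: ler_pM => //; exact: expR_ge0.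
 rewrite -mulrA -powRD ?(gt_eqF T0) ?implybT// (_ : d%:R + - (d%:R + 1) = -1); last by ring.
 rewrite powR_inv1; last exact: ltW.
 move=> /le_trans hh.
 have : ((N + N).+1 ^ d)%:R * po <= 1 / 2.
  by apply: hh; rewrite ler_pdivrMr//; lra.
 by lra.
have pL4 : 2 * pL <= 1 / 2.
 have : T `^ (- (q + c)) <= 4^-1 by rewrite powRN lef_pV2 ?posrE//; exact: hT3.
 by lra.
have pL0 : 0 < pL by exact: expR_gt0.
have hL : expR (- (4 * C0 * T `^ (alpha - c))) <= (1 - 2 * pL) ^+ ((N + N).+1 ^ d)%N.
 have h1 : expR (- (2 * (2 * pL))) <= 1 - 2 * pL by apply: one_sub_ge; lra.
 apply: (le_trans (y := expR (- (2 * (2 * pL))) ^+ ((N + N).+1 ^ d)%N)); last first.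
  by apply: lerXn2r; rewrite ?nnegrE ?expR_ge0//; lra.
 rewrite -expRM_natl ler_expR mulrN lerN2.
 have : ((N + N).+1 ^ d)%:R * pL <= C0 * T `^ d%:R * T `^ (- (q + c)) by apply: ler_pM => //; exact: ltW.
 rewrite -mulrA -powRD ?(gt_eqF T0) ?implybT// (_ : d%:R + - (q + c) = alpha - c); last by rewrite /q; ring.
 move: (T `^ _) (((N + N).+1 ^ d)%:R) => y z yz.
 rewrite (_ : z * (2 * (2 * pL)) = 4 * (z * pL)); last by ring.
 by rewrite -mulrA ler_wpM2l.
have pk0 : 0 < pk by exact: expR_gt0.
have kz : 16 * (K%:R + 1) + 1 <= k.
 rewrite /k ler_pdivlMr; last by rewrite mulr_gt0.
 move: l2; set B := 16 * _ + 1; rewrite (_ : 4 * (K%:R * M + 1) / e * B = (B * (4 * (K%:R * M + 1))) / e); last by ring.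
 by rewrite ler_pdivrMr// [ell T * e]mulrC.
have [pk4 hk] := pow_half kz; rewrite -/pk in pk4 hk.
have st : 4 * s <= tau by move: l1; rewrite ler_pdivrMr// /tau -/l; lra.
have hFN x : x \in F -> forall i, `|pos x 0 i| <= N%:R * h.
 move=> /hF xT i; apply: (le_trans (coord_le_enorm (pos x) i)); apply: (le_trans xT).
 by rewrite -ler_pdivrMr//; exact/ltW/truncnS_gt.
have pLp : 0 <= 1 - 2 * pL by lra.
have pkp : 0 <= 1 - 2 * pk by lra.
have := nolow hf hmu h0 hG s0 hs SE S1C S1p S1v uM M0 L0 k0 pLp pkp st hFN.
rewrite -/pL -/pk -/po => hn; apply: (le_trans _ (le_trans hn _)).
 by apply: eighth => //; exact: expR_ge0.
apply: le_fineP; [exact: measurable_pts gX _ _|exact: measurable_pts gX _ _|].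
move=> w /allP hw; apply/allP => x /hw; apply: le_trans.
rewrite lerN2 /tau /L -/l.
have : K%:R * (M * k) <= e / 4 * l.
 have -> : K%:R * (M * k) = (K%:R * M) / (K%:R * M + 1) * (e / 4 * l).
  by rewrite /k; field; rewrite gt_eqF.
 by apply: ratio_le => //; rewrite mulr_ge0// divr_ge0// ltW.
by move: (K%:R * _) => z; lra.
Qed.

Notation el := ell.
Notation J n := {ffun 'I_d -> 'I_n}.
Notation N1 := (normal_prob (0 : R) 1).

Definition gpt (L : nat) n (j : J n) : site R G d := gsite 1 (fun k => L * j k)%N.

(** Numbers the grid in order to apply [ub_grid]; as mu dominates mu_ac, the lower bound on the
    covariance passes to mu, and stationarity allows any base point x. *)
Lemma grid_ineq (L n : nat) (be : site R G d -> site R G d -> R) (e r k a1 : R) (x : site R G d) :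
 (0 < L)%N -> (forall x y, be x y = be y x) -> (forall s, 0 <= qf be s s) ->
 (forall x, be x x <= e) ->
 (forall n (p : 'I_n -> 'I_d -> nat), (forall i j, p i =1 p j -> i = j) ->
  let g i : site R G d := gsite 1 (fun k => L * p i k)%N in
  forall s, (m - e) * qf (fun i j : 'I_n => (i == j)%:R) s s <=
   qf (fun i j => kcov mu_ac (g i) (g j)) s s + qf (fun i j => be (g i) (g j)) s s) ->
 0 < e < m -> 0 <= k -> 2 <= a1 -> (0 < n)%N ->
 fine (P [set w | (forall j : J n, 0 <= X (x + gpt L j) w) /\
         \sum_(j : J n) X (x + gpt L j) w <= (n ^ d)%:R * r]) *
  (1 - (n ^ d)%:R * (2 * expR (- (k ^+ 2 / (2 * e))))) <=
 expR (- (k ^+ 2 * (n ^ d)%:R / (2 * (m - e)))) +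
 expR (- (fine (N1 `[a1 + 1, +oo[%classic) / 2 *
  ((n ^ d)%:R * (1 - (r + 3 * k) / Num.sqrt (m - e) / a1)))).
Proof.
move=> L0 beC be0 bee hbe /andP[e0 em] k0 a12 n0.
pose N := #|{: J n}|; have NE : N = (n ^ d)%N by rewrite /N card_ffun !card_ord.
pose p (i : 'I_N) (k : 'I_d) : nat := (enum_val i : J n) k.
have pinj i j : p i =1 p j -> i = j.
 move=> h; apply: enum_val_inj; apply/ffunP => k'; apply: val_inj; exact: h k'.
pose g (i : 'I_N) : site R G d := gsite 1 (fun k => L * p i k)%N.
have gXg := gproc_reindex gX (fun i => x + g i).
have cE i j : kcov mu (x + g i) (x + g j) = kcov mu (g i) (g j) by rewrite ![x + _]addrC kcovDr.
have le_ac A : measurable A -> (mu_ac A <= mu A)%E.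
 by move=> mA; rewrite (decomposition_sum hdec)// -addeA leeDl// adde_ge0.
have hS s : (m - e) * qf (fun i j : 'I_N => (i == j)%:R) s s <=
  qf (fun i j => kcov mu (x + g i) (x + g j)) s s + qf (fun i j => be (g i) (g j)) s s.
 apply: (le_trans (hbe N p pinj s)); rewrite lerD2r (eq_qf _ _ cE).
 pose t := [seq (c.1, g c.2) | c <- s].
 have tE S : qf (fun i j => S (g i) (g j)) s s = qf S t t.
  by rewrite /qf big_map; apply: eq_bigr => c _; rewrite big_map.
 by rewrite !tE; exact: qf_kcov_le.
have bes s : 0 <= qf (fun i j => be (g i) (g j)) s s.
 rewrite (_ : qf _ s s = qf be [seq (c.1, g c.2) | c <- s] [seq (c.1, g c.2) | c <- s])//.
 by rewrite /qf big_map; apply: eq_bigr => c _; rewrite big_map.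
have me : 0 < m - e by rewrite subr_gt0.
have N0 : (0 < N)%N by rewrite NE expn_gt0 n0.
have := ub_grid r gXg (fun i j => kcovC mu _ _) (fun i j => beC _ _) bes (fun i => bee _) hS me e0 k0 a12 N0.
rewrite -NE; apply: le_trans; rewrite le_eqVlt; apply/orP; left; apply/eqP; congr (fine (P _) * _).
have sE w : \sum_(i < N) X (x + g i) w = \sum_(j : J n) X (x + gpt L j) w.
 by rewrite -(big_enum_val (fun j : J n => X (x + gpt L j) w)); apply: eq_bigl => j.
apply/seteqP; split=> w /=.
 move=> [h1 h3]; split; last by rewrite sE.
 by apply/allP => i _; exact: h1.
move=> [/allP h1]; rewrite sE => h3; split=> // j.
by have := h1 (enum_rank j); rewrite mem_enum => /(_ isT); rewrite /g /p enum_rankK.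
Qed.

(** At least a multiple of T^(d - d e') grid points, each with a normal tail of at least a constant
    times T^(-(1 - 3e/8) q), give the exponent d - d e' - (1 - 3e/8) q = alpha + e q/4; this is the
    origin of c and e'. *)
Lemma grid_bound e : 0 < e <= 1 / 2 -> exists L e' c C T0, [/\ (0 < L)%N, 0 < e' < 1, 0 < c,
 0 < C & 2 <= T0 /\ forall T, T0 <= T -> exists2 n, (0 < n)%N &
  d%:R * (L * n)%:R <= (T / 2) `^ (1 - e') /\
  forall x, fine (P [set w | (forall j : J n, 0 <= X (x + gpt L j) w) /\
         \sum_(j : J n) X (x + gpt L j) w <= (n ^ d)%:R * ((1 - e) * el T)])
   <= 4 * expR (- (C * T `^ (alpha + c)))].
Proof.
move=> /andP[e0 e1]; pose q := d%:R - alpha; have qp : 0 < q := q0.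
have dR : 0 < d%:R :> R by rewrite ltr0n.
have qd : q <= d%:R by rewrite /q; case/andP: halpha => h _; lra.
(* The first bound keeps m - eb close to m. The second makes exp(-k^2/(2 eb)) at most T^(-(d+1)) for
   k = e l/12, so the auxiliary field stays below k on the whole grid with probability at least
   1/2. *)
pose eb := Num.min (m * e / 8) (e ^+ 2 * m * q / (144 * (d%:R + 1))).
have eb0 : 0 < eb.
 rewrite lt_min; apply/andP; split; first by apply: divr_gt0 => //; exact: mulr_gt0.
 apply: divr_gt0; last by apply: mulr_gt0 => //; lra.
 by apply: mulr_gt0 => //; apply: mulr_gt0 => //; exact: exprn_gt0.
have eb1 : eb <= m * e / 8 by rewrite ge_min lexx.
have eb2 : eb <= e ^+ 2 * m * q / (144 * (d%:R + 1)) by rewrite ge_min lexx orbT.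
have ebm : eb < m.
 have := m0; move: m eb1 => y h y0; nra.
have [L [be [L0 beC bep bee hbe]]] := ac_beta (G := G) eb0 (decomposition_ac hdec).
(* Thus d e' = e q/8: thinning the grid uses up only part of the gain 3 e q/8 of the tail. *)
pose e' := e * q / (8 * d%:R).
have e'0 : 0 < e' by apply: divr_gt0; exact: mulr_gt0.
have e'1 : e' < 1.
 rewrite /e' ltr_pdivrMr; last by exact: mulr_gt0.
 by rewrite mul1r; nra.
pose c := e * q / 4; have c0 : 0 < c by apply: divr_gt0 => //; exact: mulr_gt0.
pose npk : R := normal_peak 1; have npk0 : 0 < npk by exact: normal_peak_gt0.
have [cN [T1 [cN0 T12 hN]]] := grid_size d0 L0 (introT andP (conj e'0 e'1)).
have me0 : 0 < m - eb by lra.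
pose Ca := e ^+ 2 / 144 * q * cN; pose Cb := npk / 2 * cN * (e / 4).
have Ca0 : 0 < Ca.
 by apply: mulr_gt0 => //; apply: mulr_gt0 => //; apply: divr_gt0 => //; exact: exprn_gt0.
have Cb0 : 0 < Cb.
 by apply: mulr_gt0; [apply: mulr_gt0 => //; exact: divr_gt0|exact: divr_gt0].
have [T2 T21 hT2] := ell_large (128 / e * Num.sqrt m + 1).
have [T3 T31 hT3] := ln_large (1 : R).
exists L, e', c, (Num.min Ca Cb), (Num.max 4 (Num.max T1 (Num.max T2 T3))); split=> //.
- by rewrite e'0.
- by rewrite lt_min Ca0.
split; first by rewrite le_max; apply/orP; left; lra.
move=> T; rewrite !ge_max => /andP[T4 /andP[/hN[n n0 [n1 n2 n3]] /andP[/hT2 l1 /hT3 lnT]]].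
exists n => //; split=> // x.
have Tp : 0 < T by lra.
have T1le : 1 <= T by lra.
pose l := el T; have lE : l ^+ 2 = 2 * m * q * ln T by exact: ell_sq T1le.
have sm0 : 0 <= 128 / e * Num.sqrt m by apply: mulr_ge0 => //; apply: divr_ge0 => //; exact: ltW.
have l0 : 0 < l by apply: lt_le_trans l1; lra.
have lT0 : 0 <= ln T by lra.
pose k := e / 12 * l; have k0 : 0 <= k by apply: mulr_ge0; [apply: divr_ge0 => //; exact: ltW|exact: ltW].
pose a1 := (1 - e / 2) * l / Num.sqrt (m - eb).
have he : 0 < e <= 1 / 2 by rewrite e0.
have heb : 0 < eb <= m * e / 8 by rewrite eb0.
have a64 : 64 / e <= a1.
 by apply: num_a1 => //; apply: le_trans l1; rewrite lerDl.
have a12 : 2 <= a1 by apply: le_trans a64; rewrite ler_pdivlMr//; lra.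
have hq := num_Q he m0 qp lT0 lE heb a64; rewrite -/a1 in hq.
have hfac := num_factor he m0 l0 heb; rewrite -/a1 -/k in hfac.
have em : 0 < eb < m by rewrite eb0.
have := grid_ineq ((1 - e) * l) x L0 beC bep bee hbe em k0 a12 n0.
set p := fine (P _) => hp.
have p0 : 0 <= p by exact: fineP_ge0.
have Ta b : 0 < T `^ b by exact: powR_gt0.
have Nn0 : 0 <= (n ^ d)%:R :> R by [].
have k2 : k ^+ 2 = e ^+ 2 / 144 * (2 * m * q * ln T) by rewrite /k exprMn lE; field.
have left : 1 / 2 <= 1 - (n ^ d)%:R * (2 * expR (- (k ^+ 2 / (2 * eb)))).
 have h : expR (- (k ^+ 2 / (2 * eb))) <= T `^ (- (d%:R + 1)).
  rewrite -expR_powR// ler_expR lerN2 k2 ler_pdivlMr; last exact: mulr_gt0.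
  have : eb * (144 * (d%:R + 1)) <= e ^+ 2 * m * q.
   by rewrite -ler_pdivlMr//; apply: mulr_gt0 => //; lra.
  move=> /(ler_wpM2r lT0); lra.
 have : (n ^ d)%:R * expR (- (k ^+ 2 / (2 * eb))) <= T `^ d%:R * T `^ (- (d%:R + 1)).
  by apply: ler_pM => //; exact: expR_ge0.
 rewrite -powRD; last by rewrite (gt_eqF Tp) implybT.
 rewrite (_ : d%:R + - (d%:R + 1) = -1); last by ring.
 rewrite powR_inv1; last exact: ltW.
 have : T^-1 <= 4^-1 by rewrite lef_pV2 ?posrE.
 move=> u1 u2; have := le_trans u2 u1; rewrite [_ * (2 * _)]mulrCA; exact: half_sub.
have hp2 : p <= 2 * (p * (1 - (n ^ d)%:R * (2 * expR (- (k ^+ 2 / (2 * eb)))))).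
 by rewrite mulrCA; apply: ler_peMr => //; exact: half_two.
apply: (le_trans hp2); rewrite (_ : 4 = 2 * 2); last by ring.
rewrite -mulrA ler_pM2l//; apply: (le_trans hp).
rewrite [X in _ <= X]mulr_natl mulr2n; apply: lerD; rewrite ler_expR lerN2.
 apply: (le_trans (y := Ca * T `^ (alpha + c))); first by rewrite ler_wpM2r ?ge_min ?lexx//; exact: ltW.
 rewrite ler_pdivlMr; last exact: mulr_gt0.
 have hT : T `^ (alpha + c) <= T `^ (d%:R - d%:R * e').
  apply: ler_powR => //; rewrite /c /e' /q.
  rewrite (_ : d%:R * (e * (d%:R - alpha) / (8 * d%:R)) = e * (d%:R - alpha) / 8); last by field; rewrite gt_eqF.
  by have := qp; rewrite /q; nra.
 have h1 : cN * T `^ (alpha + c) <= (n ^ d)%:R by apply: le_trans n2; rewrite ler_pM2l.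
 rewrite k2 /Ca.
 have h3 : e ^+ 2 / 144 * q * (2 * m) * (cN * T `^ (alpha + c)) <= e ^+ 2 / 144 * q * (2 * m) * ((n ^ d)%:R * ln T).
  apply: ler_wpM2l; first by rewrite !mulr_ge0// ?sqr_ge0 ?ltW//.
  by rewrite -[leLHS]mulr1; apply: ler_pM => //; apply: mulr_ge0; exact: ltW.
 have h4 : e ^+ 2 / 144 * q * cN * T `^ (alpha + c) * (2 * (m - eb)) <= e ^+ 2 / 144 * q * (2 * m) * (cN * T `^ (alpha + c)).
  rewrite (_ : e ^+ 2 / 144 * q * (2 * m) * (cN * T `^ (alpha + c)) = e ^+ 2 / 144 * q * cN * T `^ (alpha + c) * (2 * m)); last by ring.
  apply: ler_wpM2l; last by rewrite ler_pM2l// gerBl ltW.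
  by rewrite mulr_ge0// ltW.
 apply: (le_trans h4); apply: (le_trans h3); rewrite le_eqVlt; apply/orP; left; apply/eqP; ring.
apply: (le_trans (y := Cb * T `^ (alpha + c))); first by rewrite ler_wpM2r ?ge_min ?lexx ?orbT//; exact: ltW.
have hQ : npk * T `^ (- ((1 - 3 * e / 8) * q)) <= fine (N1 `[a1 + 1, +oo[%classic).
 have a10 : 0 <= a1 + 1 by apply: addr_ge0 => //; apply: le_trans a12.
 apply: le_trans (std_tail_ge a10); rewrite -/npk ler_pM2l// -expR_powR// ler_expR lerN2.
 by rewrite (_ : a1 + 1 + 1 = a1 + 2)//; ring.
apply: (le_trans (y := npk * T `^ (- ((1 - 3 * e / 8) * q)) / 2 * (cN * T `^ (d%:R - d%:R * e') * (e / 4)))).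
 rewrite (_ : npk * T `^ (- ((1 - 3 * e / 8) * q)) / 2 * (cN * T `^ (d%:R - d%:R * e') * (e / 4)) =
  Cb * (T `^ (- ((1 - 3 * e / 8) * q)) * T `^ (d%:R - d%:R * e'))); last by rewrite /Cb; field.
 rewrite ler_pM2l// -powRD; last by rewrite (gt_eqF Tp) implybT.
 apply: ler_powR => //; rewrite /c /e' /q le_eqVlt; apply/orP; left; apply/eqP.
 by field; rewrite gt_eqF.
apply: ler_pM.
- by apply: divr_ge0 => //; apply: mulr_ge0; exact: ltW.
- by apply: mulr_ge0; [apply: mulr_ge0; exact: ltW|apply: divr_ge0 => //; exact: ltW].
- by rewrite ler_pM2r.
apply: ler_pM => //; first by apply: mulr_ge0; exact: ltW.
by apply: divr_ge0 => //; exact: ltW.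
Qed.

Hypotheses (h1 : local_dimension G mu alpha)
 (h4 : doubling G mu)
 (h5 : origin_dominance G mu).
Notation kp := (@kapT R G d mu).

Let kp0 T : 0 < T -> 0 < kp T.
Proof. by move=> T0; exact: (kapT_gt0 h1). Qed.

Lemma rate_large A : exists2 T0, 1 <= T0 & forall T, T0 <= T -> A <= el T ^+ 2 / kp T.
Proof.
have K0 := kern0_gt0 hf hmu.
have [T0 T01 h] := ell_large (`|A| * kern mu (0 : site R G d) + 1).
exists T0 => // T hT; have T1 : 1 <= T by lra.
have T0' : 0 < T by lra.
rewrite ler_pdivlMr; last exact: kp0.
have kl : kp T <= kern mu (0 : site R G d) by apply: kapT_le0; lra.
have := h T hT; move: (el T) (kp T) (kp0 T0') kl (ler_norm A) (normr_ge0 A) K0.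
move=> l k k0; move: (kern mu _) => K kK; move: `|A| => a Aa a0 K0 lb.
have aK : 0 <= a * K by apply: mulr_ge0 => //; exact: ltW.
apply: (le_trans (y := a * K)); last by nra.
by apply: (le_trans (y := a * k)); [rewrite ler_pM2r|rewrite ler_wpM2l].
Qed.

Lemma lb_numeric (t : R) : 0 < t <= 1 / 32 ->
 (1 + 2 * t) ^+ 4 * (1 + t) + t ^+ 2 / 4 + t <= 1 + 32 * t.
Proof.
move=> /andP[t0 t1].
have a1 : (1 + 2 * t) ^+ 2 <= 1 + 17 / 4 * t by nra.
have a2 : (1 + 2 * t) ^+ 4 <= 1 + 10 * t.
 rewrite (_ : (1 + 2 * t) ^+ 4 = (1 + 2 * t) ^+ 2 * (1 + 2 * t) ^+ 2); last by ring.
 have : (1 + 2 * t) ^+ 2 * (1 + 2 * t) ^+ 2 <= (1 + 17 / 4 * t) * (1 + 17 / 4 * t).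
  by apply: ler_pM => //; exact: sqr_ge0.
 by nra.
have : (1 + 2 * t) ^+ 4 * (1 + t) <= (1 + 10 * t) * (1 + t) by apply: ler_wpM2r => //; lra.
by nra.
Qed.

(** By [potential], the potential of v at x differs from kap * h(x) >= kap by at most (t/2) kap, and
    (1 + 2t)(1 - t/2) >= 1 + t for t <= 1/2. *)
Lemma pos_lower (t : R) (v : seq (R * site R G d)) (T : R) (F : seq (site R G d)) :
 0 < t <= 1 / 2 -> 1 <= T -> (forall x, x \in F -> site_ball T x) ->
 cvx (site_ball T) v -> kern mu (0 : site R G d) * (en mu v - kp T) <= (t / 2 * kp T) ^+ 2 ->
 forall x, x \in F -> (1 + t) * kp T <= (1 + 2 * t) * qf (kcov mu) [:: (1, x)] v.
Proof.
move=> /andP[t0 t1] T1 hF hv hen x xF; have T0 : 0 < T by lra.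
have k0 := kp0 T0.
have [_ hge /(_ v [:: (1, x)] hv) + _] := potential (sin_int hmu) (site_ball_nonempty (ltW T0)) k0.
rewrite big_seq1 /= mul1r [en mu [:: _]]/en qf1 !mul1r [kcov mu x x]/kcov subrr.
have := hge x (hF x xF); rewrite -/(kapT (G := G) mu T).
move: (equilibrium_potential _ _ _) (qf _ _ _) => hx q hx1 h; have := le_trans h hen.
have tk : 0 <= t / 2 * kp T by rewrite mulr_ge0 ?divr_ge0 ?ltW.
move=> /(sq_le_abs tk)/andP[_ h3].
have h6 : kp T <= kp T * hx by rewrite ler_peMr// ltW.
have h7 : (1 - t / 2) * kp T <= q by lra.
apply: (le_trans (y := (1 + 2 * t) * ((1 - t / 2) * kp T))); last by rewrite ler_wpM2l//; lra.
rewrite mulrA ler_wpM2r//; [exact: ltW|by nra].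
Qed.

Let npk : R := normal_peak 1.
Let npk0 : 0 < npk. Proof. by rewrite normal_peak_gt0. Qed.

(** [lb_shift] with c a multiple of v. The shift is at least (1 + t) l on F, its variance s2 is
    l^2/k up to factors close to 1, and the probability of not going below -(1 + t) l costs only a
    small fraction of the exponent. Constants such as 16 and the normal peak are absorbed as l^2/k
    is large. *)
Lemma shift_lower (t l k V C : R) (v : seq (R * site R G d)) (F : seq (site R G d)) :
 0 < t <= 1 / 32 -> 0 < l -> 0 < k -> en mu v = V -> k <= V <= (1 + t) * k ->
 (forall x, x \in F -> (1 + t) * k <= (1 + 2 * t) * qf (kcov mu) [:: (1, x)] v) ->
 C / 8 <= fine (P (pts_event X F (- ((1 + t) * l)))) ->
 expR (- (t ^+ 2 * (l ^+ 2 / k) / 8)) <= C ->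
 16 <= 3 * t ^+ 2 * (l ^+ 2 / k) / 8 -> 1 <= t ^+ 2 * (l ^+ 2 / k) ->
 (16 / npk) <= t * (l ^+ 2 / k) / 2 ->
 expR (- ((1 + 32 * t) * (l ^+ 2 / k) / 2)) <= fine (P (pts_event X F 0)).
Proof.
move=> /andP[t0 t1] l0 k0 enV /andP[V1 V2] hF hP hC z1 z2 z3.
set z := l ^+ 2 / k in hC z1 z2 z3 *.
have z0 : 0 < z by rewrite divr_gt0// exprn_gt0.
(* The factor 1 + 2t, rather than 1, compensates for the error in the potential of v allowed by
   [hF]. *)
pose ga := (1 + 2 * t) * l / k.
have ga0 : 0 < ga by rewrite divr_gt0// mulr_gt0//; lra.
have V0 : 0 < V by exact: lt_le_trans V1.
pose c := scal ga v.
have qc : qf (kcov mu) c c = ga ^+ 2 * V by rewrite qf_scall qf_scalr -/(en mu v) enV mulrA -expr2.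
pose s2 := ga ^+ 2 * V; have s20 : 0 < s2 by rewrite mulr_gt0// exprn_gt0.
have s2E : s2 = (1 + 2 * t) ^+ 2 * z * (V / k) by rewrite /s2 /ga /z; field; rewrite gt_eqF.
have Vk : 1 <= V / k <= 1 + t by rewrite ler_pdivlMr// ler_pdivrMr// mul1r V1.
have [Vk1 Vk2] := andP Vk.
have s2l : z <= s2.
 rewrite s2E -mulrA; apply: (le_trans (y := z * (V / k))); first by rewrite ler_peMr// ltW.
 by apply: ler_peMl; [rewrite mulr_ge0 ?ltW//; lra|nra].
have s2u : s2 <= (1 + 2 * t) ^+ 2 * (1 + t) * z.
 rewrite s2E (_ : (1 + 2 * t) ^+ 2 * (1 + t) * z = (1 + 2 * t) ^+ 2 * z * (1 + t)); last by ring.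
 by rewrite ler_wpM2l// mulr_ge0 ?sqr_ge0//; exact: ltW.
have qc0 : 0 < qf (kcov mu) c c by rewrite qc.
have l1 : 0 <= (1 + t) * l by rewrite mulr_ge0//; lra.
have hF' : all (fun a => (1 + t) * l <= qf (kcov mu) [:: (1, a)] c) F.
 apply/allP => x xF; rewrite qf_scalr /ga; have := hF x xF; move: (qf _ _ _) => q hq.
 rewrite (_ : (1 + 2 * t) * l / k * q = (1 + 2 * t) * q * (l / k)); last by ring.
 rewrite (_ : (1 + t) * l = (1 + t) * k * (l / k)); last by field; rewrite gt_eqF.
 by rewrite ler_wpM2r// divr_ge0// ltW.
have := lb_shift gX (kcovC mu) t qc0 l1 hF'; rewrite qc -/s2 => h; apply: le_trans h.
have sq0 : 0 < Num.sqrt s2 by rewrite sqrtr_gt0.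
have sqE : Num.sqrt s2 ^+ 2 = s2 by rewrite sqr_sqrtr// ltW.
have t3 : fine (P [set w | t * s2 <= lin X c w]) <= expR (- (t ^+ 2 * s2 / 2)).
 have b0 : 0 <= t * s2 by rewrite mulr_ge0 ?ltW.
 have := gproc_tail gX (lexx (qf (kcov mu) c c)) qc0 b0; rewrite qc -/s2.
 by congr (_ <= expR (- _)); field; rewrite gt_eqF.
have t4 : expR (- (z * t ^+ 2 / 8)) / 16 <=
  fine (P (pts_event X F (- ((1 + t) * l)))) - fine (P [set w | t * s2 <= lin X c w]).
 have : expR (- (t ^+ 2 * s2 / 2)) <= expR (- (z * t ^+ 2 / 8)) / 16.
  have : expR (- (t ^+ 2 * s2 / 2)) <= expR (- (z * t ^+ 2 / 8)) * expR (- (3 * t ^+ 2 * z / 8)).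
   rewrite -expRD ler_expR.
   have : t ^+ 2 * z <= t ^+ 2 * s2 by rewrite ler_wpM2l// sqr_ge0.
   by lra.
  move/le_trans; apply; rewrite ler_pM2l ?expR_gt0//.
  have z1' : 0 < 3 * t ^+ 2 * z / 8 by lra.
  by apply: (le_trans (expRN_le z1')); rewrite lef_pV2 ?posrE//; lra.
 have -> : z * t ^+ 2 / 8 = t ^+ 2 * z / 8 by ring.
 have := hC; move: (expR _) (fine _) (fine _) t3 hP => a b c' h1' h2' h3' h4'; lra.
have t5 : npk * expR (- ((1 + 2 * t) ^+ 2 * s2 / 2)) <= fine (P [set w | (1 + t) * s2 <= lin X c w]).
 have b0 : 0 <= (1 + t) * s2 by rewrite mulr_ge0 ?ltW//; lra.
 have := gproc_tail_ge gX qc0 b0; rewrite qc -/s2 -/npk; apply: le_trans.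
 rewrite ler_pM2l// ler_expR lerN2 ler_pM2r ?invr_gt0//.
 have -> : (1 + t) * s2 / Num.sqrt s2 = (1 + t) * Num.sqrt s2.
  by rewrite -{1}sqE; field; rewrite gt_eqF.
 have ts : 1 <= t * Num.sqrt s2.
  rewrite -(@ler_pXn2r _ 2) ?nnegrE//; last by apply: mulr_ge0; exact: ltW.
  rewrite expr1n exprMn sqE; apply: (le_trans z2).
  by rewrite ler_wpM2l// sqr_ge0.
 rewrite -[in leRHS]sqE -exprMn; apply: lerXn2r; rewrite ?nnegrE; [nra|nra|].
 by move: (Num.sqrt s2) ts => y ts; lra.
apply: (le_trans (y := npk * expR (- ((1 + 2 * t) ^+ 2 * s2 / 2)) * (expR (- (z * t ^+ 2 / 8)) / 16))); last first.
 by apply: ler_pM => //; rewrite ?mulr_ge0 ?divr_ge0 ?expR_ge0// ltW.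
have -> : npk * expR (- ((1 + 2 * t) ^+ 2 * s2 / 2)) * (expR (- (z * t ^+ 2 / 8)) / 16) =
 (npk / 16) * (expR (- ((1 + 2 * t) ^+ 2 * s2 / 2)) * expR (- (z * t ^+ 2 / 8))) by field.
rewrite -expRD.
have z3' : 0 < t * z / 2 by rewrite divr_gt0// mulr_gt0.
have e1 : expR (- (t * z / 2)) <= npk / 16.
 apply: (le_trans (expRN_le z3')); rewrite -[leRHS]invf_div lef_pV2 ?posrE//.
 by rewrite divr_gt0.
apply: (le_trans _ (ler_wpM2r (expR_ge0 _) e1)); rewrite -expRD ler_expR.
have num := lb_numeric (t := t); rewrite t0 t1 in num; have := num isT => num'.
have : (1 + 2 * t) ^+ 2 * s2 <= (1 + 2 * t) ^+ 4 * (1 + t) * z.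
 rewrite (_ : (1 + 2 * t) ^+ 4 * (1 + t) * z = (1 + 2 * t) ^+ 2 * ((1 + 2 * t) ^+ 2 * (1 + t) * z)); last by ring.
 by rewrite ler_wpM2l// sqr_ge0.
have : ((1 + 2 * t) ^+ 4 * (1 + t) + t ^+ 2 / 4 + t) * z <= (1 + 32 * t) * z by rewrite ler_wpM2r// ltW.
by move: ((1 + 2 * t) ^+ 4 * (1 + t)) ((1 + 2 * t) ^+ 2 * s2) => a b; lra.
Qed.

Lemma persistence_lower e : 0 < e < 1 -> exists2 T0, 1 <= T0 & forall T, T0 <= T ->
 forall F : seq (site R G d), (forall x, x \in F -> site_ball T x) ->
 expR (- ((1 + e) * (el T ^+ 2 / kp T) / 2)) <= fine (P (pts_event X F 0)).
Proof.
move=> /andP[e0 e1]; pose t := e / 32.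
have t0 : 0 < t by rewrite /t; lra.
have t1 : t <= 1 / 32 by rewrite /t; lra.
have t01 : 0 < t < 1 by lra.
have [c [C [T1 [c0 C0 T11 hnl]]]] := nolow_asym t01.
have c20 : 0 < c / 2 by rewrite divr_gt0.
have [T2 T21 hT2] := kap_power h1 h4 h5 d0 c20.
have [T3 T31 hT3] := rate_large (Num.max (16 * 8 / (3 * t ^+ 2)) (Num.max (1 / t ^+ 2) (16 / npk * 2 / t))).
have [T4 T41 hT4] := ell_large 1.
have [T5 T51 hT5] := @powR_large R (8 * C / t ^+ 2) (c / 2) c20.
exists (Num.max T1 (Num.max T2 (Num.max T3 (Num.max T4 T5)))); first by rewrite le_max T11.
move=> T; rewrite !ge_max => /andP[/hnl nl /andP[/hT2/andP[kl _] /andP[/hT3 + /andP[T4T /hT5 pT]]]].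
rewrite !ge_max => /andP[z1 /andP[z2 z3]] F hF.
have l1 : 1 <= el T := hT4 _ T4T.
have T1T : 1 <= T by lra.
have T0 : 0 < T by lra.
have k0 := kp0 T0; have K0 := kern0_gt0 hf hmu.
have t20 : 0 < t ^+ 2 by rewrite exprn_gt0.
(* The first bound keeps en(v) <= (1 + t) kap; the second meets the requirement of [pos_lower]. Both
   may depend on T, as v is chosen after T. *)
pose eta := Num.min (t * kp T) ((t / 2 * kp T) ^+ 2 / kern mu (0 : site R G d)).
have eta0 : 0 < eta by rewrite lt_min mulr_gt0//= divr_gt0// exprn_gt0// mulr_gt0// divr_gt0.
have [v hv ev] := @kap_adh R G d mu (site_ball T) eta (site_ball_nonempty (ltW T0)) eta0.
rewrite -/(kapT (G := G) mu T) in ev.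
have kv : kp T <= en mu v by exact: kap_le.
have eta1 : eta <= t * kp T by rewrite ge_min lexx.
have eta2 : eta <= (t / 2 * kp T) ^+ 2 / kern mu (0 : site R G d) by rewrite ge_min lexx orbT.
have hen : kern mu (0 : site R G d) * (en mu v - kp T) <= (t / 2 * kp T) ^+ 2.
 by move: eta2; rewrite ler_pdivlMr// mulrC => /(le_trans _); apply; rewrite ler_pM2l//; lra.
have ht : 0 < t <= 1 / 2 by lra.
have := pos_lower ht T1T hF hv hen => hpl.
have -> : (1 + e) = 1 + 32 * t by rewrite /t; field.
apply: (@shift_lower t (el T) (kp T) (en mu v) (expR (- (C * T `^ (alpha - c)))) v F) => //.
- by rewrite t0.
- lra.
- by rewrite kv/=; lra.
- exact: nl.
- rewrite ler_expR lerN2.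
 have : T `^ (alpha - c / 2) <= el T ^+ 2 / kp T.
  apply: (le_trans kl); rewrite -[leLHS]mul1r; apply: ler_wpM2r; first by rewrite invr_ge0; exact: ltW.
  by rewrite exprn_ege1.
 have -> : alpha - c / 2 = alpha - c + c / 2 by field.
 rewrite powRD ?(gt_eqF T0) ?implybT// => hz.
 have Tp : 0 < T `^ (alpha - c) by exact: powR_gt0.
 have := ler_wpM2l (ltW Tp) pT; move: (T `^ (alpha - c)) (T `^ (c / 2)) Tp hz => y y' y0 hz hy.
 have h7 : y * (8 * C / t ^+ 2) <= el T ^+ 2 / kp T by exact: le_trans hz.
 have := ler_wpM2l (ltW t20) h7.
 rewrite (_ : t ^+ 2 * (y * (8 * C / t ^+ 2)) = 8 * (C * y)); last by field; rewrite gt_eqF.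
 by move: (t ^+ 2 * _) (C * y) => a b; lra.
- by move: z1; rewrite ler_pdivrMr ?mulr_gt0// => h; move: (el T ^+ 2 / kp T) h => z h; lra.
- by move: z2; rewrite ler_pdivrMr// mulrC.
- by move: z3; rewrite ler_pdivrMr//; move: (el T ^+ 2 / kp T) (16 / npk) => z y; lra.
Qed.

Hypothesis h3 : forall e : R, 0 < e ->
 fine (capacity mu (site_ball (G := G) (d := d) (T + T `^ (1 - e)))) /
  fine (capacity mu (site_ball (G := G) (d := d) T)) @[T --> +oo] --> (1 : R).
Notation pot T := (equilibrium_potential mu (site_ball (G := G) (d := d) T)).

(** The capacity grows at most like T^(alpha + c/2), and the logarithm in l^2 as well as the
    constants are absorbed by two factors T^(c/4). *)
Lemma rate_small (A C D c : R) : 0 < A -> 0 < C -> 0 < c -> exists2 T0, 1 <= T0 & forall T, T0 <= T ->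
 A * (el T ^+ 2 / kp T) + D <= C * T `^ (alpha + c).
Proof.
move=> A0 C0 c0; pose q := d%:R - alpha; have qp : 0 < q := q0.
have al0 : 0 <= alpha by case/andP: halpha.
have c20 : 0 < c / 2 by rewrite divr_gt0.
have c40 : 0 < c / 4 by rewrite divr_gt0.
have [T1 T11 hT1] := kap_power h1 h4 h5 d0 c20.
pose C' := 2 * m * q * (4 / c).
have C'0 : 0 < C' by apply: mulr_gt0; [apply: mulr_gt0 => //; exact: mulr_gt0|exact: divr_gt0].
have [T2 T21 hT2] := powR_large ((A * C' + `|D|) / C) c40.
exists (Num.max T1 T2); first by rewrite le_max T11.
move=> T; rewrite ge_max => /andP[T1T /hT2 pT]; have /andP[_ kT] := hT1 _ T1T.
have T1le : 1 <= T by apply: le_trans T1T.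
have T0 : 0 < T by lra.
have Tp a : 0 < T `^ a by exact: powR_gt0.
have lnT : ln T <= 4 / c * T `^ (c / 4).
 have := expR_ge1Dx (c / 4 * ln T); have -> : expR (c / 4 * ln T) = T `^ (c / 4) by rewrite /powR gt_eqF.
 move=> h; rewrite -ler_pdivrMl; last exact: divr_gt0.
 by rewrite invf_div; lra.
have Te a b : T `^ a * T `^ b = T `^ (a + b) by rewrite powRD// (gt_eqF T0) implybT.
pose y := T `^ (alpha + c / 2 + c / 4); have y1 : 1 <= y.
 by rewrite -(powRr0 T); apply: ler_powR => //; rewrite !addr_ge0// ltW.
have z1 : el T ^+ 2 / kp T <= C' * y.
 rewrite (ell_sq T1le); apply: (le_trans (y := 2 * m * q * (4 / c * T `^ (c / 4)) * T `^ (alpha + c / 2))).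
  apply: ler_pM => //.
  - by apply: mulr_ge0; [rewrite !mulr_ge0// ltW|exact: ln_ge0].
  - by rewrite invr_ge0 ltW// kp0.
  - by apply: ler_wpM2l => //; rewrite !mulr_ge0// ltW.
 have -> : y = T `^ (alpha + c / 2) * T `^ (c / 4) by rewrite Te.
 rewrite le_eqVlt; apply/orP; left; apply/eqP; rewrite /C'; ring.
have -> : T `^ (alpha + c) = y * T `^ (c / 4) by rewrite /y Te; congr (_ `^ _); field.
have y0 : 0 < y by lra.
apply: (le_trans (y := (A * C' + `|D|) * y)).
 rewrite mulrDl; apply: lerD; first by rewrite -mulrA ler_pM2l.
 by apply: (le_trans (ler_norm D)); rewrite ler_peMr.
rewrite [leRHS]mulrCA [leRHS]mulrC; apply: ler_wpM2r; first exact: ltW.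
by move: pT; rewrite ler_pdivrMr// [T `^ _ * C]mulrC.
Qed.

(** A near minimiser v on the ball of radius T - rho is spread over a grid of diameter at most rho.
    The result v' lives in B(T) and its energy is still close to kap by [kap_shrink]; its functional
    is a v-average of local grid means, so [grid_bound] and [avg_low] bound the event of a low
    value, and [deviation] concludes. The set F of sites is chosen before w, as a sequence of w will
    be used with the same F. *)
Lemma upper_bound C0 e : 0 < C0 -> 0 < e -> exists c T0, [/\ 0 < c, 1 <= T0 &
 forall T, T0 <= T -> exists2 F : seq (site R G d), (forall x, x \in F -> site_ball T x) &
  forall w, en mu w <= C0 * kp T ->
   fine (P (pts_event X F 0 `&` [set t | e < `|lin X w t / el T - \sum_(p <- w) p.1 * pot T p.2|]))
   <= 4 * expR (- ((1 + c) * (el T ^+ 2 / kp T) / 2))].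
Proof.
move=> C00 e0; pose s0 := Num.sqrt C0; have s00 : 0 < s0 by rewrite sqrtr_gt0.
have C0E : C0 = s0 ^+ 2 by rewrite sqr_sqrtr// ltW.
pose e1 := e / (4 * s0); have e10 : 0 < e1 by apply: divr_gt0 => //; exact: mulr_gt0.
(* The extra cost of a large uncorrelated part in [deviation]; 4 ep, s1^2 and c each take at most a
   quarter of it. *)
pose E := e ^+ 2 / (16 * C0).
have E0 : 0 < E by apply: divr_gt0; [exact: exprn_gt0|exact: mulr_gt0].
pose ep := Num.min (1 / 2) (Num.min (e1 / 2) (E / 16)).
have hdiv (a b : R) : 0 < a -> 0 < b -> 0 < a / b by exact: divr_gt0.
have ep0 : 0 < ep by rewrite !lt_min; apply/and3P; split; apply: hdiv.
have [ep1 ep2 ep3] : [/\ ep <= 1 / 2, ep <= e1 / 2 & ep <= E / 16].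
 by rewrite /ep !ge_min !lexx !orbT.
pose s1 := Num.min 1 (Num.min (e / (8 * s0)) (Num.min e1 (E / 4))).
have s10 : 0 < s1 by rewrite !lt_min; apply/and4P; split=> //; apply: hdiv => //; exact: mulr_gt0.
have [s11 s12 s13 s14] : [/\ s1 <= 1, s1 <= e / (8 * s0), s1 <= e1 & s1 <= E / 4].
 by rewrite /s1 !ge_min !lexx !orbT.
have s1s : s1 ^+ 2 <= s1 by rewrite expr2 ler_piMl// ltW.
pose c := Num.min e1 (E / 4).
have c0 : 0 < c by rewrite lt_min e10; apply: hdiv.
have [c1 c2] : c <= e1 /\ c <= E / 4 by rewrite /c !ge_min !lexx !orbT.
have ep12 : 0 < ep <= 1 / 2 by rewrite ep0.
have [L [e' [cg [Cg [T1 [L0 e'01 cg0 Cg0 [T12 hT1]]]]]]] := grid_bound ep12.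
have s120 : 0 < s1 ^+ 2 / 2 by rewrite divr_gt0// exprn_gt0.
have [T2 T22 hT2] := kap_shrink hmu kp0 h3 e'01 s120.
have A0 : 0 < (1 + c) / 2 by rewrite divr_gt0//; lra.
have [T3 T31 hT3] := rate_small (ln (4 / ep)) A0 Cg0 cg0.
have [T4 T41 hT4] := ell_large 1.
exists c, (Num.max T1 (Num.max T2 (Num.max T3 T4))); split=> //.
 by rewrite le_max; apply/orP; left; lra.
move=> T; rewrite !ge_max => /andP[/hT1[n n0 [hn hg]] /andP[T2T /andP[/hT3 hr /hT4 l1]]].
have [r1 r2] := hT2 _ T2T.
set rho := (T / 2) `^ (1 - e') in hn r1 r2.
have T2' : 2 <= T by apply: le_trans T2T.
have T0 : 0 < T by lra.
have Tr0 : 0 <= T - rho by lra.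
have k0 := kp0 T0; have l0 : 0 < el T by lra.
have eta0 : 0 < s1 ^+ 2 / 2 * kp T by exact: mulr_gt0.
have [v hv ev] := @kap_adh R G d mu (site_ball (T - rho)) _ (site_ball_nonempty Tr0) eta0.
rewrite -/(kapT (G := G) mu (T - rho)) in ev.
pose I : finType := J n.
have I0 : (0 < #|I|)%N by rewrite /I card_ffun !card_ord expn_gt0 n0.
pose g (j : I) : site R G d := gpt L j.
pose v' := lflat (fun j => translate (g j) v) [seq (#|I|%:R^-1, j) | j <- enum I].
have gT x j : site_ball (T - rho) x -> site_ball (G := G) T (x + g j).
 rewrite /site_ball /= posD => hx; apply: (le_trans (enormD _ _)).
 suff h : enorm (pos (g j)) <= rho by apply: (le_trans (lerD hx h)); rewrite subrK.
 apply: le_trans hn; rewrite /g /gpt pos_gsite//.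
 apply: (le_trans (y := Num.sqrt d%:R * (L * n)%:R)).
  apply: enorm_le => // i; rewrite mxE mul1r ger0_norm// ler_nat leq_mul2l.
  by rewrite ltnW ?orbT.
 rewrite ler_wpM2r//; have -> : d%:R = Num.sqrt (d%:R ^+ 2) :> R by rewrite sqrtr_sqr ger0_norm.
 rewrite sqrtr_sqr ger0_norm//; rewrite -[leRHS]ger0_norm// -sqrtr_sqr ler_wsqrtr//.
 by rewrite -natrX ler_nat expnS expn1 leq_pmulr.
have hv' : cvx (site_ball (G := G) T) v' by exact: cvx_average I0 hv gT.
have en' : en mu v' <= en mu v by exact: en_average.
have k1 : kp T <= en mu v' by exact: kap_le.
have hV : kp T <= en mu v' <= (1 + s1 ^+ 2) * kp T by rewrite k1/=; lra.
pose F := [seq p.2 | p <- v'].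
have hF x : x \in F -> site_ball T x by move=> /mapP[p pv ->]; have [_] := hv'.1 p pv.
exists F => // w hw.
have [_ _ hpot _] := potential (sin_int hmu) (site_ball_nonempty (ltW T0)) k0.
have hH := hpot v' w hv'; rewrite -/(kapT (G := G) mu T) in hH.
have Ycov t : lin X v' t = \sum_(q <- v) q.1 * (#|I|%:R^-1 * \sum_(i : I) X (q.2 + g i) t).
 rewrite /v' lin_lflat /lin big_map big_enum /=.
 under eq_bigr do rewrite big_map mulr_sumr.
 rewrite exchange_big /=; apply: eq_bigr => q _; rewrite !mulr_sumr; apply: eq_bigr => i _.
 by rewrite mulrCA.
have hb : fine (P (pts_event X F 0 `&` [set t | lin X v' t <= (1 - 2 * ep) * el T])) <=
  4 * expR (- (Cg * T `^ (alpha + cg))) / ep.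
 have mX x : mble (X x) by exact: gproc_measurable gX x.
 have hlow x : fine (P [set t | (forall i : I, 0 <= X (x + g i) t) /\
   \sum_i X (x + g i) t <= #|I|%:R * ((1 - ep) * el T)]) <= 4 * expR (- (Cg * T `^ (alpha + cg))).
  by have := hg x; rewrite {1}/I card_ffun !card_ord.
 have := avg_low (sh := fun x i => x + g i) mX ep12 l0 I0 (fun q qv => (hv.1 q qv).1) hv.2 hlow.
 apply: le_trans; rewrite le_eqVlt; apply/orP; left; apply/eqP; congr (fine (P _)).
 apply/seteqP; split=> t /=; rewrite Ycov => -[h6 h7]; split=> //.
  move=> q qv i; have /allP := h6; apply; apply/mapP; exists (#|I|%:R^-1 * q.1, q.2 + g i) => //.
  apply/flattenP; exists (scal #|I|%:R^-1 (translate (g i) v)).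
   by rewrite -map_comp; apply/mapP; exists i => //; rewrite mem_enum.
  by rewrite /scal /translate -map_comp; apply/mapP; exists q.
 apply/allP => x /mapP[p /flattenP[s]]; rewrite -map_comp => /mapP[i _ ->].
 rewrite /scal /translate /= -map_comp => /mapP[q qv ->] ->; exact: h6.
have s1b : 0 < s1 <= 1 by rewrite s10.
have hs1 : 2 * (s0 * s1) <= e / 4.
 move: s12; rewrite ler_pdivlMr; last exact: mulr_gt0.
 by rewrite (_ : s1 * (8 * s0) = 8 * (s0 * s1)); [move: (s0 * s1) => y; lra|ring].
have hs2 : s1 ^+ 2 <= e1 by exact: le_trans s13.
have hep : 2 * ep <= e1 by rewrite mulrC -ler_pdivlMr.
have ep12' : 0 <= ep <= 1 / 2 by rewrite ltW.
have hc2 : 4 * ep + s1 ^+ 2 + c <= e ^+ 2 / (16 * C0) by rewrite -/E; lra.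
have hdev := deviation gX k0 l0 e0 s00 s1b C0E erefl hV hw hH hs1 hs2 hep ep12' c1 hc2 hb.
apply: (le_trans hdev); set x := expR (- (_ / 2)).
suff hx : 4 * expR (- (Cg * T `^ (alpha + cg))) / ep <= x.
 by rewrite [leRHS](_ : 4 * x = x + 3 * x) ?lerD2r//; ring.
have -> : 4 * expR (- (Cg * T `^ (alpha + cg))) / ep = expR (ln (4 / ep) - Cg * T `^ (alpha + cg)).
 by rewrite expRD lnK ?posrE ?divr_gt0//; ring.
rewrite /x ler_expR; have -> : (1 + c) * (el T ^+ 2 / kp T) / 2 = (1 + c) / 2 * (el T ^+ 2 / kp T) by ring.
by rewrite lerBlDr addrC -lerBlDr opprK addrC.
Qed.

End asymptotics.

Lemma close_two (R : realType) (x y z r : R) :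
 0 <= x - z -> x - z < r -> 0 <= y - z -> y - z < r -> `|x - y| < r.
Proof. by move=> a1 a2 b1 b2; rewrite ltr_norml; apply/andP; split; lra. Qed.

(** * Continuous functions and closed sets of R^d *)

Section borel.
Context {R : realType} {d : nat}.

Lemma measurable_floors_set L (B : set 'rV[int]_d) : measurable (floors L @^-1` B : set 'rV[R]_d).
Proof.
apply: measurable_countable => k.
have -> : (floors L @^-1` [set k] : set 'rV[R]_d) =
  \bigcap_(i : 'I_d) ((fun x : 'rV[R]_d => x 0 i) @^-1` ((fun t : R => L%:R * t) @^-1` [set t | Num.floor t = k 0 i])).
 apply/seteqP; split=> [x /= <- i _|x h]; first by rewrite /= mxE.
 by apply/rowP => i; rewrite mxE; exact: h i I.
apply: fin_bigcap_measurable => // i _.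
rewrite -[X in measurable X]setTI; apply: measurable_coord => //.
have mM : mble (fun t : R => L%:R * t) by exact: measurable_funM.
rewrite -[X in measurable X]setTI; apply: mM => //; exact: measurable_floor_set.
Qed.

Definition fcorner L (k : 'rV[int]_d) : 'rV[R]_d := \row_i ((k 0 i)%:~R / L%:R).

Lemma fcorner_close L (x : 'rV[R]_d) i : (0 < L)%N ->
 0 <= x 0 i - fcorner L (floors L x) 0 i < L%:R^-1.
Proof.
move=> L0; have LR : 0 < L%:R :> R by rewrite ltr0n.
rewrite !mxE; have := floor_le_tmp (L%:R * x 0 i); have := floorD1_gt (L%:R * x 0 i).
rewrite intrD; move: (Num.floor _)%:~R => z h1 h2.
have -> : x 0 i - z / L%:R = (L%:R * x 0 i - z) / L%:R by field; rewrite gt_eqF.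
by rewrite divr_ge0 ?subr_ge0 ?(ltW LR)//= ltr_pdivrMr// mulVf ?gt_eqF// ltrBlDl.
Qed.

Lemma cvg_rowP (u : nat -> 'rV[R]_d) (x : 'rV[R]_d) :
 (forall e : R, 0 < e -> \forall n \near \oo, forall i, `|x 0 i - u n 0 i| < e) ->
 u n @[n --> \oo] --> x.
Proof.
move=> h; apply/cvg_ballP => e e0; have := h e e0; apply: filterS => n hn.
by split=> // i j; rewrite (ord1 i) /ball /=; exact: hn.
Qed.

Lemma inv_small (e : R) : 0 < e -> \forall n \near \oo, n.+1%:R^-1 < e.
Proof.
move=> e0; exists (Num.truncn e^-1) => // n /= hn.
rewrite -[e]invrK ltf_pV2 ?posrE ?invr_gt0//; apply: (lt_le_trans (truncnS_gt _)).
by rewrite ler_nat ltnS.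
Qed.

(** A continuous g is the limit of its values at the corners of grids of mesh 1/(n+1), and these are
    functions of the measurable floors. *)
Lemma continuous_measurable (g : 'rV[R]_d -> R) : continuous g -> mble g.
Proof.
move=> cg; apply: (@measurable_fun_cvg _ _ _ setT (fun n x => g (fcorner n.+1 (floors n.+1 x)))).
 move=> n _ Y mY; rewrite setTI.
 exact: (measurable_floors_set n.+1 [set k | Y (g (fcorner n.+1 k))]).
move=> x _; apply: continuous_cvg; first exact: cg.
apply: cvg_rowP => e e0; have := inv_small e0; apply: filterS => n hn i.
have /andP[h1 h2] := fcorner_close x i (ltn0Sn n).
by rewrite ger0_norm//; exact: lt_trans hn.
Qed.

(** A closed set is the intersection over n of the unions of grid cells of mesh 1/(n+1) that meet
    it. *)
Lemma closed_measurable (D : set 'rV[R]_d) : closed D -> measurable D.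
Proof.
move=> cD; pose B n := [set k | exists2 y, D y & floors n.+1 y = k].
have -> : D = \bigcap_n (floors n.+1 @^-1` B n).
 apply/seteqP; split=> [x Dx n _|x hx]; first by exists x.
 apply: cD => V /nbhs_ballP[e /= e0 he].
 have [n _ /(_ n (leqnn n)) hn] := inv_small e0.
 have [y Dy yx] := hx n I; exists y; split=> //; apply: he; split=> // i j.
 have /andP[a1 a2] := fcorner_close x j (ltn0Sn n); have /andP[b1 b2] := fcorner_close y j (ltn0Sn n).
 rewrite (ord1 i) /ball /=; apply: lt_trans hn.
 by move: b1 b2; rewrite yx => b1 b2; exact: close_two a1 a2 b1 b2.
apply: bigcapT_measurable => n; exact: measurable_floors_set.
Qed.

Lemma continuous_bounded_box M (g : 'rV[R]_d -> R) : continuous g ->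
 exists2 C, 0 <= C & forall x, @rbox R M d x -> `|g x| <= C.
Proof.
move=> cg.
pose r : R := M%:R.
have cK : compact [set v : 'rV[R]_d | forall i, v ord0 i \in `[(- r), r]].
 apply: (@rV_compact _ _ (fun=> `[(- r), r]%classic)).
 by move=> _; apply: segment_compact.
have /compact_bounded[C [_ hC]] : compact (g @` [set v : 'rV[R]_d | forall i, v ord0 i \in `[(- r), r]]).
 by apply: continuous_compact => //; exact: continuous_subspaceT.
exists (`|C| + 1); first by rewrite addr_ge0.
move=> x hx; apply: (hC (`|C| + 1)); last first.
 by exists x => // i; rewrite in_itv; exact: hx.
by rewrite (le_lt_trans (ler_norm C))// ltrDl.
Qed.

End borel.

(** * Volumes of cubes *)

Section cubes.
Context {R : realType}.

Definition cube n (a : 'rV[R]_n) (r : R) : set 'rV[R]_n := [set x | forall i, a 0 i <= x 0 i < a 0 i + r].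

Lemma measurable_cube n (a : 'rV[R]_n) r : measurable (cube a r).
Proof.
have -> : cube a r = \bigcap_(i : 'I_n) ((fun x : 'rV[R]_n => x 0 i) @^-1` `[a 0 i, a 0 i + r[%classic).
 by apply/seteqP; split=> [x h i _|x h i]; [rewrite /= in_itv; exact: h|have := h i I; rewrite /= in_itv].
apply: fin_bigcap_measurable => // i _.
by rewrite -[X in measurable X]setTI; apply: measurable_coord => //; exact: measurable_itv.
Qed.

Lemma lebesgue_cube n (a : 'rV[R]_n) r : 0 <= r -> lebesgue_rV R n (cube a r) = (r ^+ n)%:E.
Proof.
move=> r0; elim: n a => [|n IH] a.
 rewrite /= diracE mem_set ?expr0//.
 by move=> -[].
pose a' : 'rV[R]_n := \row_i a 0 (lift ord0 i).
pose B := @rV_cons R n @^-1` (cube a r).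
have mc : mble (@rV_cons R n) by exact: measurable_rV_cons.
have mB : measurable B by have := mc measurableT _ (measurable_cube a r); rewrite setTI.
have -> : lebesgue_rV R n.+1 (cube a r) = (\int[lebesgue_rV R n]_y lebesgue_measure (xsection B y))%E by [].
have mI : measurable `[a 0 ord0, a 0 ord0 + r[%classic by exact: measurable_itv.
have lI : (@lebesgue_measure R `[a 0%R ord0, (a 0%R ord0 + r)%R[%classic = r%:E)%E.
 rewrite lebesgue_measure_itv /= lte_fin ltrDl; case: ltP => [_|r0'].
  by rewrite -EFinB addrAC subrr add0r.
 by congr EFin; apply/le_anti; rewrite r0 r0'.
transitivity (\int[lebesgue_rV R n]_y (r%:E * (\1_(cube a' r) y)%:E))%E.
 apply: eq_integral => y _; have [hy|hy] := pselect (cube a' r y).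
  rewrite indicE mem_set// mule1 -lI; congr (lebesgue_measure _).
  apply/seteqP; split=> t; rewrite /xsection /B /= inE in_itv/=.
   by move=> h; have := h ord0; rewrite /rV_cons mxE unlift_none.
  move=> ht i; rewrite /rV_cons mxE; case: unliftP => [j ->|->] //=.
  by have := hy j; rewrite mxE.
 rewrite indicE memNset// mule0 (_ : xsection B y = set0) ?measure0//.
 apply/seteqP; split=> t //; rewrite /xsection /B /= inE => h; apply: hy => j.
 by have := h (lift ord0 j); rewrite /rV_cons mxE liftK /= mxE.
rewrite ge0_integralZl//; last first.
 by apply/measurable_EFinP; exact: measurable_indic (measurable_cube a' r).
rewrite integral_indic ?setIT//; last exact: measurable_cube.
by rewrite IH -EFinM exprS.
Qed.

End cubes.

(** * Riemann sums on a box *)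

Section box_quadrature.
Context {R : realType} {d : nat}.
Notation leb := (lebesgue_rV R d).

Lemma Rint_restr (nu : {measure set 'rV[R]_d -> \bar R}) (Q : set 'rV[R]_d) (mQ : measurable Q)
  (fQ : (nu Q < +oo)%E) (F : 'rV[R]_d -> R) :
 (forall x, ~ Q x -> F x = 0) -> \int[nu]_x F x = \int[mfrestr mQ fQ]_x F x.
Proof.
move=> F0; congr fine.
have e (m : {measure set 'rV[R]_d -> \bar R}) :
  (\int[m]_x (F x)%:E = \int[m]_(x in Q) (F x)%:E)%E.
 rewrite [RHS]integral_mkcond; apply: eq_integral => x _; rewrite patchE.
 by case: ifPn => // /negP h; rewrite F0// => q; apply: h; rewrite inE.
rewrite (e nu) (e (mfrestr mQ fQ)); apply: eq_measure_integral => A mA AQ.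
by rewrite /= /mfrestr /mrestr setIidl.
Qed.

Notation J n := {ffun 'I_d -> 'I_n}.
Variables (B S : R) (rho : 'rV[R]_d -> R).
Hypotheses (B0 : 0 < B) (S0 : 0 <= S) (mrho : mble rho).
Hypothesis rhoS : forall x, `|rho x| <= S.
Let a : 'rV[R]_d := const_mx (- B).
Hypothesis rho0 : forall x, ~ cube a (2 * B) x -> rho x = 0.

Let Q := cube a (2 * B).
Let B20 : 0 <= 2 * B. Proof. by rewrite mulr_ge0// ltW. Qed.
Let mQ : measurable Q := measurable_cube a (2 * B).
Let fQ : (leb Q < +oo)%E.
Proof. by rewrite lebesgue_cube// ltry. Qed.
Let nu := mfrestr mQ fQ.

Let mesh (n : nat) : R := 2 * B / n%:R.
Let knot n (j : J n) : 'rV[R]_d := a + @gs R Euclidean d (mesh n) n j.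
Let patch n (j : J n) := cube (knot j) (mesh n).

Let mesh0 n : (0 < n)%N -> 0 < mesh n.
Proof. by move=> n0; rewrite /mesh divr_gt0 ?mulr_gt0// ltr0n. Qed.
Let knotE n (j : J n) i : knot j 0 i = - B + mesh n * (j i)%:R.
Proof. by rewrite /knot !mxE. Qed.

Let patch_ex n x : (0 < n)%N -> Q x -> exists j : J n, patch j x.
Proof.
move=> n0 Qx; have m0 := mesh0 n0.
have h i : exists k : 'I_n, mesh n * k%:R <= x 0 i + B < mesh n * k%:R + mesh n.
 have := Qx i; rewrite mxE => /andP[h1 h2].
 pose y : R := (x 0 i + B) / mesh n.
 have y0 : 0 <= y by rewrite divr_ge0 ?(ltW m0)// addrC -lerBlDl sub0r.
 have /andP[k1 k2] := truncn_itv y0.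
 have kn : (Num.truncn y < n)%N.
  rewrite -(ltr_nat R); apply: (le_lt_trans k1); rewrite ltr_pdivrMr//.
  have -> : n%:R * mesh n = 2 * B by rewrite /mesh mulrC divfK// pnatr_eq0 -lt0n.
  by move: h2; move: (x 0 i : R) => z; lra.
 exists (Ordinal kn) => /=; rewrite mulrC -ler_pdivlMr// k1/=.
 by rewrite -[X in _ < _ + X]mul1r -mulrDl natr1 -ltr_pdivrMr.
exists [ffun i => xchoose (h i)] => i; rewrite knotE ffunE.
by have := xchooseP (h i); move: (mesh n * _) => z /andP[h1 h2]; apply/andP; split; lra.
Qed.

Let patch_uniq n x (j j' : J n) : (0 < n)%N -> patch j x -> patch j' x -> j = j'.
Proof.
move=> n0 h h'; have m0 := mesh0 n0; apply/ffunP => i; apply/val_inj/eqP.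
have := h i; have := h' i; rewrite !knotE => /andP[a1 a2] /andP[b1 b2].
have l (p q : nat) : - B + mesh n * p%:R <= x 0 i -> x 0 i < - B + mesh n * q%:R + mesh n -> (p <= q)%N.
 move=> u v; rewrite -ltnS -(ltr_nat R) -(ltr_pM2l m0) -natr1 mulrDr mulr1.
 by move: u v; move: (mesh n * p%:R) (mesh n * q%:R) => y z; lra.
by rewrite /= eqn_leq (l _ _ a1 b2) (l _ _ b1 a2).
Qed.

Let weight n (j : J n) : R := \int[nu]_x (\1_(patch j) x * rho x).

Let bmf_rho : bmf rho. Proof. by split=> //; exists S. Qed.

Let bmf_patch n (j : J n) : bmf (fun x => \1_(patch j) x * rho x).
Proof. by apply: bmfM => //; apply: bmf_indic; exact: measurable_cube. Qed.

Let weight_le n (j : J n) : (0 < n)%N -> `|weight j| <= S * (2 * B) ^+ d / n%:R ^+ d.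
Proof.
move=> n0; have m0 := mesh0 n0; have mc := measurable_cube (knot j) (mesh n).
have h : S * fine (nu (patch j)) <= S * (2 * B) ^+ d / n%:R ^+ d.
 rewrite -mulrA -expr_div_n; apply: ler_wpM2l => //.
 have -> : (2 * B / n%:R) ^+ d = fine (leb (patch j)) by rewrite lebesgue_cube// ltW.
 apply: fine_le; [exact: fin_num_measure|by rewrite lebesgue_cube ?(ltW m0)|].
 by apply: le_measure; rewrite ?inE//; apply: measurableI.
apply: le_trans h; rewrite -Rint_indic// -RintZ; last exact: bmf_indic.
have hle x : `|\1_(patch j) x * rho x| <= S * \1_(patch j) x.
 by rewrite normrM ger0_norm// mulrC; exact: ler_wpM2r.
rewrite ler_norml; apply/andP; split.
 rewrite -mulN1r -RintZ; last by apply: bmfZ; exact: bmf_indic.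
 apply: le_Rint => //; first by apply: bmfZ; apply: bmfZ; exact: bmf_indic.
 by move=> x; have := hle x; rewrite ler_norml mulN1r => /andP[].
apply: le_Rint => //; first by apply: bmfZ; exact: bmf_indic.
by move=> x; have := hle x; rewrite ler_norml => /andP[].
Qed.

(** The weights are the integrals of rho over the cells, so they depend neither on g nor on any
    regularity of rho, which jumps at the boundary of D; continuity of g suffices, by dominated
    convergence. *)
Lemma box_quadrature : exists w : forall n, J n -> R,
 (forall n j, (0 < n)%N -> `|w n j| <= S * (2 * B) ^+ d / n%:R ^+ d) /\
 forall g : 'rV[R]_d -> R, continuous g ->
  \sum_(j : J n.+1) w n.+1 j * g (const_mx (- B) + @gs R Euclidean d (2 * B / n.+1%:R) n.+1 j) @[n --> \oo]
   --> \int[leb]_x (g x * rho x).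
Proof.
exists (fun n j => weight j); split=> [n j|g cg]; first exact: weight_le.
rewrite (@Rint_restr _ Q mQ fQ) => [|x hx]; last by rewrite rho0 ?mulr0.
pose step n x := \sum_(j : J n.+1) g (knot j) * (\1_(patch j) x * rho x).
rewrite (_ : (fun n => _) = (fun n => \int[nu]_x step n x)); last first.
 apply/funext => n; rewrite Rint_sum => [|j]; last exact: bmfZ.
 by apply: eq_bigr => j _; rewrite RintZ// mulrC.
have stepE n x (j : J n.+1) : patch j x -> step n x = g (knot j) * rho x.
 move=> hj; rewrite /step (bigD1 j)//= big1 ?addr0 => [|j' jj'].
  by rewrite indicE mem_set// mul1r.
 rewrite indicE memNset ?mul0r ?mulr0// => hj'.
 by move/eqP: jj'; apply; exact: patch_uniq hj' hj.
have step0 n x : ~ Q x -> step n x = 0.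
 by move=> hx; rewrite /step big1// => j _; rewrite rho0// !mulr0.
have BM : B <= (Num.truncn B).+1%:R by exact/ltW/truncnS_gt.
have [C C0 hC] := continuous_bounded_box (Num.truncn B).+1 cg.
apply: (Rint_bounded_cvg (M := C * S)) => [n|n x|x].
- by have [] : bmf (step n) by apply: bmf_sum => j; exact: bmfZ.
- have [hx|hx] := pselect (Q x); last by rewrite step0// normr0 mulr_ge0.
 have [j hj] := patch_ex (ltn0Sn n) hx.
 rewrite (stepE _ _ _ hj) normrM; apply: ler_pM => //; apply: hC => i.
 have m0 := mesh0 (ltn0Sn n).
 have h1 : 0 <= mesh n.+1 * (j i)%:R by rewrite mulr_ge0// ltW.
 have h2 : mesh n.+1 * (j i)%:R <= 2 * B.
  rewrite /mesh mulrAC ler_pdivrMr ?ltr0n//; apply: ler_wpM2l => //.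
  by rewrite ler_nat ltnW.
 rewrite knotE; move: BM h1 h2; move: (mesh _ * _) (_.+1%:R) => y z *.
 by apply/andP; split; lra.
- have [hx|hx] := pselect (Q x); last first.
  rewrite rho0// mulr0 (_ : (fun n => _) = fun=> 0); first exact: cvg_cst.
  by apply/funext => n; exact: step0.
 pose J' n : J n.+1 := projT1 (cid (patch_ex (ltn0Sn n) hx)).
 have hJ n : patch (J' n) x by rewrite /J'; case: cid.
 rewrite (_ : (fun n => _) = (fun n => g (knot (J' n)) * rho x)); last first.
  by apply/funext => n; exact: stepE.
 apply: cvgMl; apply: (continuous_cvg _ (cg x)).
 apply: cvg_rowP => e e0.
 have e' : 0 < e / (2 * B) by rewrite divr_gt0// mulr_gt0.
 have := inv_small e'; apply: filterS => n hn i.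
 have /andP[h1 h2] := hJ n i.
 rewrite ger0_norm ?subr_ge0//.
 apply: (lt_trans (y := mesh n.+1)); first by rewrite ltrBlDl.
 by move: hn; rewrite ltr_pdivlMr ?mulr_gt0// mulrC.
Qed.

End box_quadrature.

(** * Rescaled test densities *)

Section rescaled.
Context {R : realType} {d : nat}.
Variables (xi : 'rV[R]_d -> R) (D : set 'rV[R]_d).

Lemma compact_in_box : compact D ->
 exists2 M : nat, (0 < M)%N & forall x, D x -> forall i, `|x 0 i| < M%:R.
Proof.
move=> /compact_bounded[r [_ hr]]; exists (Num.truncn (`|r| + 1)).+1 => // x Dx i.
apply: le_lt_trans (truncnS_gt _); apply: (le_trans (y := `|x|)).
 have /mapP[j Hj ->] : `|x ord0 i| \in [seq `|x v.1 v.2| | v : 'I_1 * 'I_d].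
  by apply/mapP; exists (ord0, i) => //=; rewrite mem_enum.
 by rewrite [leRHS]/Num.norm /= mx_normrE; apply/bigmax_geP; right => /=; exists j.
by apply: hr => //; rewrite (le_lt_trans (ler_norm r))// ltrDl.
Qed.

Lemma rescaled_bounds : is_test xi D -> exists M S, [/\ (0 < M)%N, 0 <= S &
 forall T, 0 < T -> [/\ mble (rescaled_density xi D T),
  forall x, `|rescaled_density xi D T x| <= S / T ^+ d &
  forall x, rescaled_density xi D T x <> 0 -> forall i, `|x 0 i| < M%:R * T]].
Proof.
move=> [cxi _ [cD _ _]]; have [M M0 hM] := compact_in_box cD.
have [S S0 hS] := continuous_bounded_box M cxi.
have mD : measurable D.
 apply: closed_measurable; apply: compact_closed => //; exact: norm_hausdorff.
exists M, S; split=> // T T0; split.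
- have ms : mble (fun x : 'rV[R]_d => T^-1 *: x).
  apply: measurable_fun_rV => i; under eq_fun do rewrite mxE.
  by apply: measurable_funM => //; exact: measurable_coord.
 rewrite /rescaled_density; apply: measurable_funM; last first.
  by apply: measurableT_comp => //; exact: measurable_indic.
 apply: measurable_funM => //; apply: measurableT_comp => //.
 exact: continuous_measurable.
- move=> x; rewrite /rescaled_density indicE.
 have Td : 0 < T ^- d by rewrite invr_gt0 exprn_gt0.
 have [Dx|Dx] := pselect (D (T^-1 *: x)); last first.
  by rewrite memNset// mulr0 normr0 divr_ge0// exprn_ge0// ltW.
 rewrite mem_set// mulr1 normrM (gtr0_norm Td) mulrC.
 apply: ler_wpM2r; first exact: ltW.
 by apply: hS => i; rewrite -ler_norml; exact/ltW/hM.
- move=> x; rewrite /rescaled_density indicE.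
 have [Dx|Dx] := pselect (D (T^-1 *: x)); last by rewrite memNset// mulr0.
 move=> _ i; have := hM _ Dx i; rewrite mxE normrM gtr0_norm ?invr_gt0//.
 by rewrite mulrC ltr_pdivrMr.
Qed.

Notation J n := {ffun 'I_d -> 'I_n}.

Lemma lattice_sum (N : nat) (F : 'rV[int]_d -> R) :
 (forall x, F x <> 0 -> forall i, - N%:Z <= x 0 i < N%:Z) ->
 \sum_(x \in [set: 'rV[int]_d]) F x =
 \sum_(j : J (N + N)) F (const_mx (- N%:Z) + @gs R Lattice d 1 _ j).
Proof.
move=> hF; pose s (j : J (N + N)) : 'rV[int]_d := const_mx (- N%:Z) + @gs R Lattice d 1 _ j.
have sE j i : s j 0 i = - N%:Z + (j i : nat)%:Z by rewrite /s !mxE.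
have si : injective s.
 move=> j j' jj'; apply/ffunP => i; apply/val_inj => /=.
 by have := sE j i; rewrite jj' sE => /addrI[].
rewrite -(@fsbig_widen _ _ _ _ [set` [seq s j | j <- enum {: J (N + N)}]])//.
 rewrite -fsbig_seq; last by rewrite map_inj_uniq// enum_uniq.
 by rewrite big_map big_enum.
move=> x /= [_ hx]; apply: contrapT => /hF h; apply: hx.
have k i : (`|(x 0%R i + N%:Z)%R| < N + N)%N.
 have := h i; move: (x 0 i) => y; lia.
apply/mapP; exists [ffun i => Ordinal (k i)]; first by rewrite mem_enum.
apply/rowP => i; rewrite sE ffunE /=.
by have := h i; move: (x 0 i) => y; lia.
Qed.

End rescaled.

Lemma int_bounds (R : realType) (N : nat) (y : int) :
 - N%:R < y%:~R :> R -> y%:~R < N%:R :> R -> - N%:Z <= y < N%:Z.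
Proof. by rewrite !pmulrn -mulrNz !ltr_int; lia. Qed.

(** * Riemann sums for the pairing, with controlled variance *)

Section quadrature.
Context {R : realType} {G : setting} {d : nat}.
Variable mu : fin_measure R d.
Variable alpha : R.
Hypotheses (h1 : local_dimension G mu alpha)
 (h4 : doubling G mu)
 (h5 : origin_dominance G mu).
Notation J n := {ffun 'I_d -> 'I_n}.
Variables (xi : 'rV[R]_d -> R) (D : set 'rV[R]_d).
Hypothesis hxi : is_test xi D.

(** The bound A is uniform in T since the height S/T^d of the density compensates for the volume (2
    M T)^d of the box. The 2 added to 2M covers the rounding of the box to integers on the lattice,
    where the sum is exact and the sequence constant. *)
Lemma weighted_grid : exists2 A, 0 <= A & forall T, 1 <= T -> forall de0, 0 < de0 ->
 exists de n x0 (w : forall k, J (n k) -> R),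
 (forall k, [/\ 0 < de k, G = Lattice -> de k = 1, G = Euclidean -> de k <= de0,
  (0 < n k)%N & T <= de k * (n k)%:R]) /\
 (forall k j, `|w k j| <= A / (n k)%:R ^+ d) /\
 forall g : site R G d -> R, continuous_field g ->
  \sum_(j : J (n k)) w k j * g (x0 + gs (de k) j) @[k --> \oo] -->
  pairing g (rescaled_density xi D T).
Proof.
have [M [S [M0 S0 hS]]] := rescaled_bounds hxi.
have MR : 1 <= M%:R :> R by rewrite ler1n.
have A0 : 0 <= S * (2 * M%:R + 2) ^+ d.
 by apply: mulr_ge0 => //; apply: exprn_ge0; lra.
exists (S * (2 * M%:R + 2) ^+ d) => // T T1 de0 de00.
have T0 : 0 < T by lra.
have [mr rS r0] := hS T T0.
have Td : T ^+ d != 0 by rewrite expf_neq0// gt_eqF.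
case: G => /=.
- pose B := M%:R * T; have B0 : 0 < B by rewrite mulr_gt0// ltr0n.
 have SS : 0 <= S / T ^+ d by rewrite divr_ge0// exprn_ge0// ltW.
 have [x hx|w [w1 w2]] := @box_quadrature R d B (S / T ^+ d) _ B0 SS mr rS.
  apply: contrapT => /r0 h; apply: hx => i; rewrite mxE.
  by have := h i; rewrite ltr_norml => /andP[/ltW -> h']/=; rewrite mulr2n mulrDl !mul1r addKr.
 (* An offset of the index that makes the mesh at most [de0] from the first term on. *)
 pose k0 := Num.truncn (2 * B / de0).
 exists (fun k => 2 * B / (k + k0).+1%:R), (fun k => (k + k0).+1), (const_mx (- B)).
 exists (fun k j => w (k + k0).+1 j); split; [|split].
 + move=> k; have kR : 0 < (k + k0).+1%:R :> R by rewrite ltr0n.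
  split=> //; first by rewrite divr_gt0// mulr_gt0.
   move=> _; rewrite ler_pdivrMr// [leRHS]mulrC -ler_pdivrMr//.
   apply/ltW/(lt_le_trans (y := k0.+1%:R)); first exact: truncnS_gt.
   rewrite ler_nat ltnS; exact: leq_addl.
  by rewrite divfK ?gt_eqF// /B; nra.
 + move=> k j; apply: (le_trans (w1 _ j _)) => //.
  apply: ler_wpM2r; first by rewrite invr_ge0 exprn_ge0.
  rewrite /B mulrA exprMn mulrA mulrAC -(mulrA S) [X in S * X * _]mulrC mulrA mulfK//.
  by apply: ler_wpM2l => //; apply: lerXn2r; rewrite ?nnegrE; lra.
 + move=> g /w2; rewrite -(cvg_shiftn k0); apply: cvg_trans; apply: near_eq_cvg.
  by near=> k.
- pose N := (Num.truncn (M%:R * T)).+1.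
 have N1 : M%:R * T < N%:R by exact: truncnS_gt.
 have N2 : N%:R <= M%:R * T + 1.
  by rewrite -natr1 lerD2r truncn_le mulr_ge0// ltW.
 pose x0 : 'rV[int]_d := const_mx (- N%:Z).
 exists (fun=> 1), (fun=> (N + N)%N), x0.
 exists (fun k j => rescaled_density xi D T (map_mx intr (x0 + @gs R Lattice d 1 _ j))); split; [|split].
 + by move=> k; split=> //; rewrite mul1r natrD; nra.
 + move=> _ j; apply: (le_trans (rS _)); rewrite -mulrA; apply: ler_wpM2l => //.
  rewrite -[leLHS]mul1r ler_pdivrMr ?exprn_gt0// mulrAC ler_pdivlMr; last first.
   by rewrite exprn_gt0// natrD; nra.
  by rewrite mul1r -exprMn; apply: lerXn2r; rewrite ?nnegrE ?natrD; nra.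
 + move=> g _; rewrite (@lattice_sum _ _ N) => [|x hx i].
   rewrite (_ : (fun k : nat => _) = fun=> \sum_(j : J (N + N)) g (x0 + @gs R Lattice d 1 _ j) *
    rescaled_density xi D T (map_mx intr (x0 + @gs R Lattice d 1 _ j))); first exact: cvg_cst.
   by apply/funext => k; apply: eq_bigr => j _; rewrite mulrC.
  have h : rescaled_density xi D T (map_mx intr x) <> 0.
   by move=> h; apply: hx; rewrite h mulr0.
  have := r0 _ h i; rewrite mxE ltr_norml => /andP[a1 a2].
  have [b1 b2] : - N%:R < (x 0 i)%:~R :> R /\ (x 0 i)%:~R < N%:R :> R by split; lra.
  exact: int_bounds b1 b2.
Unshelve. all: by end_near.
Qed.

Notation kp := (@kapT R G d mu).

(** The sieve bounds the variance by C A^2 times the spectral mass of the ball of radius 1/T, which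
    is at most a multiple of kap. *)
Lemma quadrature : exists2 C0, 0 < C0 & forall T, 1 <= T -> exists s : nat -> seq (R * site R G d),
 (forall k, en mu (s k) <= C0 * kp T) /\
 forall g : site R G d -> R, continuous_field g ->
  \sum_(p <- s k) p.1 * g p.2 @[k --> \oo] --> pairing g (rescaled_density xi D T).
Proof.
have [A A0 hA] := weighted_grid.
have [C C0 hC] := sieve_mub h4 h5 (mub_gt0 h1).
have [C' C'0 hC'] := kap_lower_mub h4.
have CA : 0 <= C * A ^+ 2 by rewrite mulr_ge0 ?(ltW C0)// sqr_ge0.
exists (C * A ^+ 2 * C' + 1).
 by rewrite ltr_wpDl// mulr_ge0// ltW.
move=> T T1; have T0 : 0 < T by exact: lt_le_trans T1.
have [de0 de00 hde] := hC T T0.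
have [de [n [x0 [w [w1 [w2 w3]]]]]] := hA T T1 de0 de00.
exists (fun k => [seq (w k j, x0 + gs (de k) j) | j <- enum {: J (n k)}]); split.
- move=> k; have [k1 k2 k3 k4 k5] := w1 k.
 apply: (le_trans (hde _ k1 k2 k3 _ k4 k5 _ A x0 (w2 k))).
 apply: (le_trans (ler_wpM2l CA (hC' T T0))).
 by rewrite mulrA ler_wpM2r ?lerDl//; exact/ltW/(kapT_gt0 h1).
- move=> g /w3; rewrite (_ : (fun k => \sum_(p <- _) _) =
  (fun k => \sum_(j : J (n k)) w k j * g (x0 + gs (de k) j)))//.
 by apply/funext => k; rewrite big_map big_enum.
Qed.

End quadrature.

(** * Continuity of the equilibrium potential *)

Section continuity.
Context {R : realType} {d : nat}.
Variable mu : fin_measure R d.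

Lemma kern_continuous_at0 (e : R) : 0 < e -> exists2 b : R, 0 < b &
 forall y : site R Euclidean d, (forall i, `|y 0 i| < b) -> kern mu (0 : site R Euclidean d) - kern mu y < e.
Proof.
move=> e0; apply: contrapT => hn.
have hy (n : nat) : exists y : site R Euclidean d, (forall i, `|y 0 i| < n.+1%:R^-1) /\
  e <= kern mu (0 : site R Euclidean d) - kern mu y.
 apply: contrapT => hy; apply: hn; exists n.+1%:R^-1; first by rewrite invr_gt0.
 move=> y yn; rewrite ltNge; apply/negP => h; apply: hy; by exists y.
pose u n := projT1 (cid (hy n)).
have u1 n i : `|u n 0 i| < n.+1%:R^-1 by rewrite /u; case: cid => y [].
have u2 n : e <= kern mu (0 : site R Euclidean d) - kern mu (u n) by rewrite /u; case: cid => y [].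
have ue l : edot l (u n) @[n --> \oo] --> (0 : R).
 apply/cvgrPdist_lt => r r0.
 have r' : 0 < r / (\sum_i `|l 0 i| + 1) by rewrite divr_gt0// ltr_wpDl// sumr_ge0.
 have := inv_small r'; apply: filterS => n hn'.
 rewrite sub0r normrN; apply: (le_lt_trans (ler_norm_sum _ _ _)).
 apply: (@le_lt_trans _ _ ((\sum_i `|l 0 i|) * n.+1%:R^-1)).
  by rewrite mulr_suml; apply: ler_sum => i _; rewrite normrM ler_wpM2l// ltW.
 rewrite ltr_pdivlMr in hn'; last by rewrite ltr_wpDl// sumr_ge0.
 apply: le_lt_trans hn'; rewrite mulrC ler_wpM2l ?invr_ge0//.
 by rewrite lerDl.
have : kern mu (u n) @[n --> \oo] --> kern mu (0 : site R Euclidean d).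
 apply: (Rint_bounded_cvg (M := 1)) => [n|n l|l].
 - exact: (bmf_mble (bmf_cosw (u n : site R Euclidean d))).
 - by rewrite /cosw; exact: cos_max.
 - rewrite /cosw; apply: continuous_cvg; first exact: continuous_cos.
  rewrite [phase 0 l](_ : _ = 2 * pi * 0); last by rewrite phase0 mulr0.
  by apply: cvgMr; exact: ue.
move=> /cvgrPdist_lt /(_ e e0) [n _ /(_ n (leqnn n))].
by rewrite ltNge => /negP; apply; apply: (le_trans (u2 n)); exact: ler_norm.
Qed.

Lemma en_diff (G : setting) (x y : site R G d) :
 en mu [:: (1, x); (- 1, y)] = 2 * (kern mu (0 : site R G d) - kern mu (x - y)).
Proof. by rewrite /en /qf !big_cons !big_nil /= (kcovC mu y x) /kcov !subrr; ring. Qed.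

(** The evaluation bound is applied to the difference of two point masses, whose energy is 2 (K(0) -
    K(x - y)). *)
Lemma cm_continuous (G : setting) (h : site R G d -> R) (k : R) : 0 < k ->
 (forall w, (\sum_(q <- w) q.1 * h q.2) ^+ 2 <= en mu w / k) -> continuous_field h.
Proof.
move=> k0; case: G h => // h hh; rewrite /continuous_field => x.
apply/(cvgrPdist_lt (F := nbhs (x : 'rV[R]_d))) => e e0.
have [b b0 hb] := kern_continuous_at0 (e := e ^+ 2 * k / 2) ltac:(by rewrite divr_gt0// mulr_gt0// exprn_gt0).
apply/nbhs_ballP; exists b => //= y [_ xy].
have := hh [:: (1, x); (- 1, y)]; rewrite !big_cons big_nil /= addr0 mul1r mulN1r.
have := hb (x - y : 'rV[R]_d) => /(_ _)/wrap[i|hk].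
 by rewrite !mxE; exact: xy.
rewrite en_diff.
move=> hle; rewrite -(ltr_pXn2r (n := 2))// ?nnegrE ?(ltW e0)// real_normK ?num_real//.
apply: (le_lt_trans hle); rewrite ltr_pdivrMr//; move: hk.
by move: (e ^+ 2 * k) => z; lra.
Qed.

End continuity.

(** The condition |q| <= |x| keeps the rational approximations inside the ball in [dense_sites]. *)
Lemma rat_near (R : realType) (x e : R) : 0 < e ->
 exists q : rat, `|ratr q| <= `|x| /\ `|x - ratr q| < e.
Proof.
move=> e0; have [x0|x0|->] := ltgtP x 0.
- have h : x < Num.min 0 (x + e) by rewrite lt_min x0 ltrDl.
 have [q] := rat_in_itvoo h; rewrite in_itv/= lt_min => /andP[a /andP[b c]]; exists q.
 by rewrite !ltr0_norm ?subr_lt0//; split; lra.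
- have h : Num.max 0 (x - e) < x by rewrite gt_max x0 gtrBl.
 have [q] := rat_in_itvoo h; rewrite in_itv/= gt_max => /andP[/andP[b c] a]; exists q.
 by rewrite !gtr0_norm ?subr_gt0//; split; lra.
- by exists 0; rewrite rmorph0 subrr normr0.
Qed.

(** * Persistence as a countable intersection *)

Section persistence.
Context {R : realType} {G : setting} {d : nat}.

Lemma dense_sites (T : R) : 0 <= T -> exists a : nat -> site R G d,
 (forall n, site_ball T (a n)) /\
 forall g : site R G d -> R, continuous_field g -> (forall n, 0 <= g (a n)) ->
  forall x, site_ball T x -> 0 <= g x.
Proof.
move=> T0; have b0 : site_ball T (0 : site R G d).
 by rewrite /site_ball /= pos0 /enorm big1 ?sqrtr0// => i _; rewrite mxE expr0n.
suff [C [emb hE]] : exists (C : countType) (emb : C -> site R G d),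
  forall g : site R G d -> R, continuous_field g -> forall x, site_ball T x -> g x < 0 ->
  exists2 c, site_ball T (emb c) & g (emb c) < 0.
 pose a n := if unpickle n is Some c then
  if `[< site_ball T (emb c) >] then emb c else 0 else 0.
 exists a; split=> [n|g cg ha x xT].
  by rewrite /a; case: unpickle => // c; case: ifPn => // /asboolP.
 rewrite leNgt; apply/negP => /(hE g cg x xT)[c cT]; apply/negP; rewrite -leNgt.
 by have := ha (pickle c); rewrite /a pickleK asboolT.
clear b0; case: G => /=; last first.
 by exists 'rV[int]_d, id => g _ x xT gx; exists x.
exists 'rV[rat]_d, (map_mx ratr) => g cg x xT gx.
have /cvgrPdist_lt /(_ (- g x)) := cg x; rewrite oppr_gt0 => /(_ gx) /nbhs_ballP[e /= e0 he].
have hq i := rat_near (x 0 i) e0.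
pose q : 'rV[rat]_d := \row_i projT1 (cid (hq i)).
have q1 i : `|ratr (q 0 i)| <= `|x 0 i| by rewrite mxE; case: cid => r [].
have q2 i : `|x 0 i - ratr (q 0 i)| < e by rewrite mxE; case: cid => r [].
exists q.
 apply: le_trans xT; rewrite /enorm /=; apply: ler_wsqrtr; apply: ler_sum => i _.
 by rewrite mxE -(real_normK (num_real (ratr _))) -(real_normK (num_real (x 0 i))) lerXn2r// nnegrE.
have : ball x e (map_mx ratr q) by split=> // i j; rewrite (ord1 i) /ball /= mxE; exact: q2.
by move=> /he /=; rewrite ltr_norml => /andP[h _]; move: h; rewrite -opprB ltrN2; lra.
Qed.

Context {dO : measure_display} {Omega : measurableType dO} (P : probability Omega R)
 (f : site R G d -> {RV P >-> R}).
Hypothesis hf : is_sgf f.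
Let X (x : site R G d) (w : Omega) : R := f x w.

Lemma measurable_pts_field F c : measurable (pts_event X F c).
Proof.
elim: F => [|x F IH]; first by rewrite (_ : pts_event X [::] c = setT) //; apply/seteqP.
rewrite (_ : pts_event X (x :: F) c = [set w | c <= X x w] `&` pts_event X F c).
 by apply: measurableI => //; apply: measurable_ge; exact: measurable_funP.
by apply/seteqP; split=> w; rewrite /pts_event /= => /andP.
Qed.

(** By path continuity persistence is the decreasing limit of persistence on finite sets of sites,
    so a bound uniform over finite sets passes to it. *)
Lemma persistence_ge (T b : R) : 0 <= T ->
 (forall F : seq (site R G d), (forall x, x \in F -> site_ball T x) -> b <= fine (P (pts_event X F 0))) ->
 measurable (persistence f T) /\ b <= fine (P (persistence f T)).
Proof.
move=> T0 hb; have [a [a1 a2]] := dense_sites T0.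
pose E n := pts_event X [seq a i | i <- iota 0 n] 0.
have PE : persistence f T = \bigcap_n E n.
 apply/seteqP; split=> [w hw n _|w hw].
  by apply/allP => x /mapP[i _ ->]; exact: hw.
 apply: a2; first exact: sgf_continuous hf w.
 move=> n; have /allP := hw n.+1 I; apply; apply/mapP; exists n => //.
 by rewrite mem_iota add0n ltnSn.
have mE n : measurable (E n) by exact: measurable_pts_field.
have mP : measurable (\bigcap_n E n) by exact: bigcapT_measurable.
rewrite PE; split=> //.
have nE : nonincreasing_seq E.
 move=> n m nm; apply/subsetPset => w /allP hw; apply/allP => x /mapP[i hi ->].
 apply: hw; apply/mapP; exists i => //; move: hi; rewrite !mem_iota /= !add0n => h.
 exact: leq_trans nm.
have := @nonincreasing_cvg_mu _ _ _ P E _ mE mP nE => /(_ _)/wrap[|cE].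
 by rewrite ltey_eq fin_num_measure.
have cf : fine (P (E n)) @[n --> \oo] --> fine (P (\bigcap_n E n)).
 by apply: fine_cvg; rewrite fineK// fin_num_measure.
apply: (ler_cvg_to (cvg_cst b) cf); apply: nearW => n /=; apply: hb.
by move=> x /mapP[i _ ->].
Qed.

(** Carries a bound for the Riemann sums over to their limit: the event for the limit lies in the
    liminf of the approximating events. *)
Lemma fineP_liminf (B : nat -> set Omega) (b : R) : (forall k, measurable (B k)) ->
 (forall k, fine (P (B k)) <= b) ->
 measurable (\bigcup_n \bigcap_(k in [set k | (n <= k)%N]) B k) /\
 fine (P (\bigcup_n \bigcap_(k in [set k | (n <= k)%N]) B k)) <= b.
Proof.
move=> mB hB; pose E n := \bigcap_(k in [set k | (n <= k)%N]) B k.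
have mE n : measurable (E n) by apply: bigcap_measurable => //; exists n => /=.
have mU : measurable (\bigcup_n E n) by exact: bigcupT_measurable.
split=> //.
have nE : nondecreasing_seq E.
 by move=> n m nm; apply/subsetPset => w hw k /= mk; apply: hw; exact: leq_trans mk.
have cE := @nondecreasing_cvg_mu _ _ _ P E mE mU nE.
have cf : fine (P (E n)) @[n --> \oo] --> fine (P (\bigcup_n E n)).
 by apply: fine_cvg; rewrite fineK// fin_num_measure.
apply: (ler_cvg_to cf (cvg_cst b)); apply: nearW => n /=; apply: le_trans (hB n).
by apply: le_fineP => // w; apply; exact: leqnn.
Qed.

End persistence.

(** * Conditional deviations of the field from the potential *)

Theorem theorem2 (R : realType) (G : setting) (d : nat) (alpha : R)
  (dO : measure_display) (Omega : measurableType dO) (P : probability Omega R)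
  (f : site R G d -> {RV P >-> R})
  (mu mu_ac mu_d mu_sc : {finite_measure set 'rV[R]_d -> \bar R})
  (halpha : 0 <= alpha < d%:R)
  (hf : is_sgf f)
  (hmu : is_spectral_measure f mu)
  (hdec : is_lebesgue_decomposition mu mu_ac mu_d mu_sc)
  (h1 : (lne (mu (freq_ball G 0 r)) * ((ln r)^-1)%:E)%E @[r --> 0^'+]
      --> alpha%:E)
  (h2 : mu_ac setT <> 0%E /\ mu_sc setT = 0%E)
  (h3 : forall e : R, 0 < e ->
   fine (capacity mu (site_ball (G := G) (d := d) (T + T `^ (1 - e)))) /
    fine (capacity mu (site_ball (G := G) (d := d) T)) @[T --> +oo]
     --> (1 : R))
  (h4 : exists2 c : R, 0 < c & forall r : R, 0 < r ->
   (mu (freq_ball G 0 (2 * r)) <= c%:E * mu (freq_ball G 0 r))%E)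
  (h5 : exists2 c : R, 0 < c & forall r : R, 0 < r ->
   (ereal_sup [set mu (freq_ball G u r) | u in [set: 'rV[R]_d]] <=
     c%:E * mu (freq_ball G 0 r))%E)
  (xi : 'rV[R]_d -> R) (D : set 'rV[R]_d) (hxi : is_test xi D) :
 let m := fine (mu_ac setT) in
 let h T := equilibrium_potential mu (site_ball (G := G) (d := d) T) in
 cond_cvg0_in_prob P (persistence f) (fun T w =>
  pairing (fun x => f x w) (rescaled_density xi D T) /
    Num.sqrt (2 * m * (d%:R - alpha) * ln T) -
   pairing (h T) (rescaled_density xi D T)).
Proof.
move=> m h e e0.
have [C0 C00 hQ] := quadrature h1 h4 h5 hxi.
have e20 : 0 < e / 2 by rewrite divr_gt0.
have [c [T1 [c0 T11 hU]]] := upper_bound hf hmu halpha hdec h2 h1 h4 h5 h3 C00 e20.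
(* The joint event decays with exponent factor 1 + c and persistence at worst with 1 + c'; c' <= c/2
   leaves a gap of at least c/2. *)
pose c' := Num.min (c / 2) (1 / 2).
have c'b : 0 < c' < 1.
 by apply/andP; split; [rewrite lt_min; apply/andP; split|rewrite gt_min]; lra.
have c'c : c' <= c / 2 by rewrite ge_min lexx.
have [T2 T21 hL] := persistence_lower hf hmu halpha hdec h2 h1 h4 h5 c'b.
apply/cvgrPdist_le => r r0.
(* The ratio of probabilities is at most 4 exp(- c z/4) <= 16/(c z), which is at most r as soon as z
   = l^2/k reaches 16/(c r). *)
have [T3 T31 hz] := rate_large hf hmu halpha h2 h1 (16 / (c * r)).
have := nbhs_pinfty_ge (num_real (Num.max T1 (Num.max T2 T3))).
apply: filterS => T; rewrite !ge_max => /andP[/hU{hU}[F FT hF] /andP[T2T /hz{hz} zT]].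
have T1' : 1 <= T by exact: le_trans T2T.
have T0 : 0 < T by exact: lt_le_trans T1'.
have {}hL := hL T T2T; have [s [s1 s2]] := hQ T T1'.
have k0 : 0 < kapT (G := G) mu T by exact: (kapT_gt0 h1).
(* The Riemann sums converge for continuous functions, so the potential must be known to be
   continuous, like the paths of f. *)
have hc : continuous_field (h T).
 have [_ _ _ hw] := potential (sin_int hmu) (site_ball_nonempty (ltW T0)) k0.
 exact: (cm_continuous k0 hw).
set z := ell mu_ac alpha T ^+ 2 / kapT mu T in hF hL zT.
have [mA hA] := persistence_ge hf (ltW T0) hL.
pose X (x : site R G d) (w : Omega) : R := f x w.
pose el := ell mu_ac alpha T.
pose Z w := `|pairing (fun x => f x w) (rescaled_density xi D T) / el - pairing (h T) (rescaled_density xi D T)|.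
pose Zk k w := `|lin X (s k) w / el - \sum_(p <- s k) p.1 * h T p.2|.
have mZk k : measurable_fun setT (Zk k).
 apply: measurableT_comp => //; apply: measurable_funB => //; apply: measurable_funM => //.
 by apply: measurable_lin => x; exact: measurable_funP.
have ZkZ w : Zk k w @[k --> \oo] --> Z w.
 apply: cvg_norm; apply: cvgB; last exact: s2.
 by apply: cvgMl; apply: s2; exact: sgf_continuous hf w.
have mZ : measurable_fun setT Z by apply: (measurable_fun_cvg mZk) => w _; exact: ZkZ.
(* A path that persists and has Z > e satisfies Zk > e/2 for all large k, hence lies in the liminf
   of these events; the halved threshold makes room for the limit. *)
pose B k := pts_event X F 0 `&` [set w | e / 2 < Zk k w].
have mB k : measurable (B k).
 apply: measurableI; first exact: measurable_pts_field.
 exact: measurable_gt.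
have [mU hB] := fineP_liminf mB (fun k => hF _ (s1 k)).
rewrite sub0r normrN ger0_norm; last by rewrite divr_ge0// fineP_ge0.
rewrite /cond_prob ler_pdivrMr; last exact: lt_le_trans (expR_gt0 _) hA.
have hle : fine (P ([set w | e < Z w] `&` persistence f T)) <= 4 * expR (- ((1 + c) * z / 2)).
 apply: le_trans hB; apply: le_fineP => //.
  by apply: measurableI => //; exact: measurable_gt.
 move=> w [/= ew pw].
 have e2 : e / 2 < Z w by lra.
 have [n _ hn] := cvgr_gt _ (ZkZ w) _ e2.
 exists n => // k nk; split; last exact: hn.
 by apply/allP => x /FT; exact: pw.
apply: (le_trans hle).
apply: (@le_trans _ _ (r * expR (- ((1 + c') * z / 2)))); last by rewrite ler_wpM2l// ltW.
have cr : 0 < c * r by rewrite mulr_gt0.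
have z0 : 0 < z by apply: lt_le_trans zT; rewrite divr_gt0.
rewrite (_ : - ((1 + c) * z / 2) = - ((c - c') * z / 2) - (1 + c') * z / 2); last by ring.
rewrite expRD mulrA ler_wpM2r ?expR_ge0//.
have cz : c * z / 4 <= (c - c') * z / 2 by nra.
apply: (@le_trans _ _ (4 * expR (- (c * z / 4)))); first by rewrite ler_wpM2l// ler_expR lerN2.
have cz0 : 0 < c * z / 4 by apply: divr_gt0 => //; exact: mulr_gt0.
apply: (@le_trans _ _ (4 * (c * z / 4)^-1)).
 by rewrite ler_wpM2l// expRN_le.
rewrite ler_pdivrMr//.
by move: zT; rewrite ler_pdivrMr//; lra.
Qed.
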